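(* There exist constants $c>0$ and $X_0$ such that for all $X\ge X_0$, \[\max_{X/2<x\leq 5X^{3/2}(\log X)^2}\left|\frac{P(x^2)}{\sqrt x}\right| \ \ge\ c\,(\log X)^{1/4}\,(\log_2 X)^{\frac34(2^{1/3}-1)}\,(\log_3 X)^{-3/8}.\]
   Context: $r(n)$ is the number of ways of writing $n$ as a sum of two squares, i.e. the number of pairs $(a,b)\in\mathbb{Z}^2$ with $a^2+b^2=n$, and \[P(x)=\sum_{1\le n\leq x}r(n)-\pi x .\] Here $\log_2 X=\log\log X$ and $\log_3 X=\log\log\log X$. The maximum is over real $x$ and is understood as a supremum. *)

(* Defs.v *)
From HB Require Import structures.
From mathcomp Require Import all_boot all_order all_algebra.
From mathcomp Require Import finmap.
From mathcomp Require Import all_classical all_reals all_analysis.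
Set Implicit Arguments.
Unset Strict Implicit.
Unset Printing Implicit Defensive.
Import Order.TTheory GRing.Theory Num.Theory.
Local Open Scope classical_set_scope.
Local Open Scope ring_scope.

(* [fset_set] sends an infinite set to the empty one; this never happens here,
   since a ^+ 2 + b ^+ 2 = n forces |a|, |b| <= n. *)
Definition r2 (n : nat) : nat :=
  #|` fset_set [set p : int * int | (p.1 ^+ 2 + p.2 ^+ 2 = n%:Z)%R] |%fset.

(* The sum starts at n = 1, so the lattice point (0, 0) is not counted;
   [Num.truncn x] is the floor of x for x >= 0 and is 0 for x < 0. *)
Definition circle_error (R : realType) (x : R) : R :=
  \sum_(1 <= n < (Num.truncn x).+1) (r2 n)%:R - pi * x.

(* Main.v *)
Require Import Defs.
From HB Require Import structures.
From mathcomp Require Import all_boot all_order all_algebra.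
From mathcomp Require Import finmap.
From mathcomp Require Import all_classical all_reals all_analysis.
From mathcomp Require Import measurable_realfun.
From mathcomp Require Import ring lra zify.
Set Implicit Arguments.
Unset Strict Implicit.
Unset Printing Implicit Defensive.
Import Order.TTheory GRing.Theory Num.Theory.
Import numFieldNormedType.Exports.
Local Open Scope classical_set_scope.
Local Open Scope ring_scope.

(* A resonance argument. For a finite set M of positive integers let R(x) be the
   nonnegative product of the 1 + cos(2 pi sqrt(m) x), m in M, let V be its primitive
   with V(0) = 0, and g(x) = phi(x) V(x) / x with phi a Gaussian cut-off. If
   |P(x^2)| <= S sqrt x on (X/2, X^(3/2)], then summation by parts bounds the
   difference between the sum of g(|v|) over nonzero lattice points v and the integral
   of 2 pi x g(x) by about S D, where D measures the density of the frequencies of R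
   near 0. On the other hand V(x)/x is a combination of functions sinc(2 pi th x), and
   sinc(2 pi th |v|) is an average of the characters cos(2 pi v.w) over the projections
   w of the points of a sphere of radius th. Poisson summation for Gaussians then turns
   that difference into a sum of nonnegative terms over the dual lattice, and keeping
   the points of norm sqrt m, m in M, gives at least c D sum_{m in M} r(m) m^(-3/4).
   Hence S >= c sum_{m in M} r(m) m^(-3/4), as long as 2^|M| is a small power of X.

   For M take (log X)/20 integers a p, with p a large prime 1 mod 4 and a a product of j
   distinct primes 1 mod 4, so that r(a p) >= 2^j. By Mertens' theorem modulo 4 there
   are enough of them up to N ~ log X (log_2 X) j! / s^j with s = (log_3 X)/2 - O(1).
   The resulting bound contains (2^(4/3) s)^j / j!, and j is chosen as the mode of this
   Poisson weight, where by Stirling's formula it is about exp(mu) / sqrt(mu) with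
   mu = 2^(1/3) log_3 X - O(1); this yields the powers of log_2 X and log_3 X. *)

(** * Calculus on segments *)

(** The density D is never evaluated, which would require control of small signed sums of square
    roots. The upper bound works with the frequencies of M without m0, for any m0 in M, because 1 +
    cos <= 2; the lower bound works, for each m, with those of M without m. Choosing m0 to minimise
    this density lets one D serve both sides. The match rests on the sphere. Its uniform measure
    projects to a positive measure on the disc of radius th whose density blows up like (th -
    |w|)^(-1/2) at the rim. Hence the dual terms are nonnegative and, smoothed at scale p, have size
    |k|^(-3/2) (p + th - |k|)^(-1/2) for k just inside the rim, with the exponent 1/2 that the
    weight sqrt x produces in the summation by parts. The obstacle is the range x <= X/2, where
    nothing is assumed. The cut-off must vanish to high order at 0, and so is a signed combination
    of five Gaussians, exp(-p^2 x^2) and narrower ones of parameter at least q. Only the first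
    enters the main term; the others cost about q^(-1/2) up to a small power of X, while D >=
    p^(-1/2) and p is smaller than q by a power of X. *)

Section derivative_rules.
Context {R : realType}.
Implicit Types (f g : R -> R) (x a b : R).

#[export] Instance dpow n f x a : is_derive x (1 : R) f a ->
  is_derive x (1 : R) (fun y => f y ^+ n) (n%:R * f x ^+ n.-1 * a).
Proof.
move=> fa; have -> : (fun y => f y ^+ n) = f ^+ n; last exact: is_deriveX.
by apply/funext => y; rewrite exprfctE.
Qed.

Lemma dinv f x a : f x != 0 -> is_derive x (1 : R) f a ->
  is_derive x (1 : R) (fun y => (f y)^-1) (- (f x) ^- 2 * a).
Proof. by move=> fx fa; exact: is_deriveV. Qed.

Lemma dsqrt f x a : 0 < f x -> is_derive x (1 : R) f a ->
  is_derive x (1 : R) (fun y => Num.sqrt (f y)) ((2 * Num.sqrt (f x))^-1 * a).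
Proof.
move=> fx fa; apply: (@is_derive1_comp _ (@Num.sqrt R)).
exact: is_derive1_sqrt.
Qed.

Lemma dln f x a : 0 < f x -> is_derive x (1 : R) f a ->
  is_derive x (1 : R) (fun y => ln (f y)) ((f x)^-1 * a).
Proof.
move=> fx fa; apply: (@is_derive1_comp _ (@ln R)).
exact: is_derive1_ln.
Qed.
End derivative_rules.

Section integral_rules.
Context {R : realType}.
Implicit Types (f g F : R -> R) (x a b : R).
Notation mu := (@lebesgue_measure R).

Lemma derivable_continuous F : (forall x, derivable F x 1) -> continuous F.
Proof. by move=> dF x; exact/differentiable_continuous/derivable1_diffP. Qed.

Lemma derivable_continuous_at F x : derivable F x 1 -> {for x, continuous F}.
Proof. by move=> dF; exact/differentiable_continuous/derivable1_diffP. Qed.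

Lemma derive_continuous_at F d x : is_derive x (1 : R) F d -> {for x, continuous F}.
Proof.
by move=> dF; apply/differentiable_continuous/derivable1_diffP; exact: ex_derive.
Qed.

Lemma cont_itv_integrable f a b : {in `[a, b], continuous f} ->
  mu.-integrable `[a, b] (EFin \o f).
Proof.
move=> cf; apply: continuous_compact_integrable; first exact: segment_compact.
by apply: continuous_in_subspaceT => x /set_mem /cf.
Qed.

Lemma Rint_FTC F f a b : a <= b ->
  (forall x, x \in `[a, b] -> is_derive x (1 : R) F (f x)) ->
  {in `[a, b], continuous f} ->
  \int[mu]_(x in `[a, b]) f x = F b - F a.
Proof.
rewrite le_eqVlt => /predU1P[-> _ _|ab dF cf].
  by rewrite subrr set_itv1 Rintegral_set1.
have cF x : x \in `[a, b] -> {for x, continuous F} by move=> /dF/derive_continuous_at.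
rewrite /Rintegral (@continuous_FTC2 _ f F)//.
- by apply: continuous_in_subspaceT => x /set_mem /cf.
- split.
  + by move=> x xab; apply: (@ex_derive _ _ _ _ _ _ (f x)); exact: dF (subset_itv_oo_cc xab).
  + by apply: cvg_at_right_filter; apply: cF; rewrite in_itv/= lexx ltW.
  + by apply: cvg_at_left_filter; apply: cF; rewrite in_itv/= lexx ltW.
- move=> x xab; rewrite derive1E.
  exact: (@derive_val _ _ _ _ _ _ _ (dF x (subset_itv_oo_cc xab))).
Qed.

Lemma Rint_cst c a b : a <= b -> \int[mu]_(x in `[a, b]) c = c * (b - a).
Proof.
move=> ab; rewrite mulrBr; apply: (@Rint_FTC (fun x => c * x) (fun=> c)) => // x _.
- by apply: is_derive_eq; rewrite /GRing.scale/= mulr1.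
- exact: cst_continuous.
Qed.

Lemma le_Rint f g a b : mu.-integrable `[a, b] (EFin \o f) ->
  mu.-integrable `[a, b] (EFin \o g) ->
  (forall x, x \in `[a, b] -> f x <= g x) ->
  \int[mu]_(x in `[a, b]) f x <= \int[mu]_(x in `[a, b]) g x.
Proof. by move=> intf intg fg; apply: le_Rintegral => // x /= /fg. Qed.

Lemma Rint_add f g a b : mu.-integrable `[a, b] (EFin \o f) ->
  mu.-integrable `[a, b] (EFin \o g) ->
  \int[mu]_(x in `[a, b]) (f x + g x) =
  \int[mu]_(x in `[a, b]) f x + \int[mu]_(x in `[a, b]) g x.
Proof. by move=> intf intg; rewrite RintegralD. Qed.

Lemma Rint_scale c f a b : mu.-integrable `[a, b] (EFin \o f) ->
  \int[mu]_(x in `[a, b]) (c * f x) = c * \int[mu]_(x in `[a, b]) f x.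
Proof. by move=> intf; rewrite RintegralZl. Qed.

Lemma derive_ge0_le F f a b : a <= b ->
  (forall x, x \in `[a, b] -> is_derive x (1 : R) F (f x)) ->
  (forall x, x \in `[a, b] -> 0 <= f x) -> F a <= F b.
Proof.
move=> ab dF f0.
have dF' x : x \in `]a, b[ -> is_derive x (1 : R) F (f x).
  by move=> xab; apply: dF; exact: subset_itv_oo_cc.
have cF : {within `[a, b], continuous F}.
  by apply: continuous_in_subspaceT => x /set_mem xab; exact: derive_continuous_at (dF _ xab).
have [c cab E] := MVT_segment ab dF' cF.
by rewrite -subr_ge0 E mulr_ge0 ?subr_ge0 ?f0.
Qed.
End integral_rules.

(** * Averages over the sphere *)
Section sphere_average.
Context (R : realType).
Notation RT := (measurableTypeR R).
Implicit Types (F G : RT * RT -> R) (a b h : R -> R).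
Notation mu := (@lebesgue_measure R).
Notation mu2 := (mu \x mu)%E.

(** Archimedes' coordinates: in terms of the height [z] and the longitude [t] the uniform measure of
    the unit sphere is a multiple of Lebesgue measure. The upper half [0 <= z] is enough, since only
    projections to the plane matter. *)
Definition avg_dom : set (RT * RT) := `[0, 1] `*` `[- pi, pi].

Lemma measurable_avg_dom : measurable avg_dom.
Proof. exact: measurableX. Qed.

Definition avg F := (2 * pi)^-1 * \int[mu2]_(u in avg_dom) F u.

(** A class stable under sums, products and composition with continuous functions, so that
    integrability is settled once for all integrands. *)
Definition avg_ok F := measurable_fun setT F /\
  exists M : R, forall u, avg_dom u -> `|F u| <= M.

Lemma bounded_on_itv h (x y : R) : continuous h ->
  exists M : R, forall t, x <= t <= y -> `|h t| <= M.
Proof.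
move=> ch.
have [M [_ HM]] : bounded_set (h @` `[x, y]).
  apply: compact_bounded; apply: continuous_compact; last exact: segment_compact.
  exact: continuous_subspaceT.
exists (`|M| + 1) => t xty.
by apply: (HM (`|M| + 1)); [rewrite ltr_pwDr// ler_norm|exists t].
Qed.

Lemma avg_ok_fst h : continuous h -> avg_ok (fun u => h u.1).
Proof.
move=> ch; split.
  apply: measurableT_comp; first exact: continuous_measurable_fun.
  exact: measurable_fst.
have [M HM] := bounded_on_itv 0 1 ch.
by exists M => -[z t] [/= + _]; rewrite in_itv/= => /HM.
Qed.

Lemma avg_ok_snd h : continuous h -> avg_ok (fun u => h u.2).
Proof.
move=> ch; split.
  apply: measurableT_comp; first exact: continuous_measurable_fun.
  exact: measurable_snd.
have [M HM] := bounded_on_itv (- pi) pi ch.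
by exists M => -[z t] [/= _]; rewrite in_itv/= => /HM.
Qed.

Lemma avg_ok_comp h F : continuous h -> avg_ok F -> avg_ok (fun u => h (F u)).
Proof.
move=> ch [mF [M HM]]; split.
  by apply: measurableT_comp => //; exact: continuous_measurable_fun.
have [M' HM'] := bounded_on_itv (- M) M ch.
by exists M' => u /HM; rewrite ler_norml => /HM'.
Qed.

Lemma avg_ok_cst c : avg_ok (fun=> c).
Proof. by split; [exact: measurable_cst|exists `|c|]. Qed.

Lemma avg_okD F G : avg_ok F -> avg_ok G -> avg_ok (fun u => F u + G u).
Proof.
move=> [mF [M HM]] [mG [N HN]]; split; first exact: measurable_funD.
by exists (M + N) => u Du; rewrite (le_trans (ler_normD _ _))// lerD ?HM ?HN.
Qed.

Lemma avg_okM F G : avg_ok F -> avg_ok G -> avg_ok (fun u => F u * G u).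
Proof.
move=> [mF [M HM]] [mG [N HN]]; split; first exact: measurable_funM.
by exists (M * N) => u Du; rewrite normrM ler_pM ?HM ?HN.
Qed.

Lemma avg_ok_sum (I : Type) (s : seq I) (f : I -> RT * RT -> R) :
  (forall i, avg_ok (f i)) -> avg_ok (fun u => \sum_(i <- s) f i u).
Proof.
move=> fok; elim: s => [|i s IH].
  by under eq_fun do rewrite big_nil; exact: avg_ok_cst.
by under eq_fun do rewrite big_cons; exact: avg_okD.
Qed.

Lemma avg_ok_integrable F : avg_ok F -> mu2.-integrable avg_dom (EFin \o F).
Proof.
move=> [mF [M HM]]; apply: measurable_bounded_integrable.
- exact: measurable_avg_dom.
- rewrite [ltLHS](_ : _ = (mu [set` `[0%R, 1%R]%R] * mu [set` `[- pi, pi]%R])%E);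
    last exact: product_measure1E.
  rewrite !lebesgue_measure_itv/=.
  by case: ifPn => _; case: ifPn => _; rewrite ?mule0 ?mul0e// -!EFinB -EFinM ltry.
- exact: measurable_funTS.
- exists M; split; first by rewrite num_real.
  by move=> N MN u Du; apply: (le_trans (HM _ Du)); exact: ltW.
Qed.

Lemma avgD F G : avg_ok F -> avg_ok G ->
  avg (fun u => F u + G u) = avg F + avg G.
Proof.
move=> okF okG; rewrite /avg RintegralD ?mulrDr//.
- exact: measurable_avg_dom.
- exact: avg_ok_integrable.
- exact: avg_ok_integrable.
Qed.

Lemma avgZ c F : avg_ok F -> avg (fun u => c * F u) = c * avg F.
Proof.
move=> okF; rewrite /avg mulrCA; congr (_ * _).
apply: RintegralZl; [exact: measurable_avg_dom|exact: avg_ok_integrable].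
Qed.

Lemma avg_le F G : avg_ok F -> avg_ok G ->
  (forall u, avg_dom u -> F u <= G u) -> avg F <= avg G.
Proof.
move=> okF okG FG; rewrite /avg ler_wpM2l ?invr_ge0 ?mulr_ge0 ?pi_ge0//.
apply: le_Rintegral => //; [exact: measurable_avg_dom|exact: avg_ok_integrable..].
Qed.

Lemma avg_sum (I : Type) (s : seq I) (f : I -> RT * RT -> R) :
  (forall i, avg_ok (f i)) ->
  avg (fun u => \sum_(i <- s) f i u) = \sum_(i <- s) avg (f i).
Proof.
move=> fok; elim: s => [|i s IH].
  under eq_fun do rewrite big_nil.
  by rewrite big_nil /avg Rintegral_cst ?mul0r ?mulr0//; exact: measurable_avg_dom.
under eq_fun do rewrite big_cons.
by rewrite avgD ?big_cons ?IH//; exact: avg_ok_sum.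
Qed.

Lemma avg_prod a b : continuous a -> continuous b ->
  avg (fun u => a u.1 * b u.2) =
  (\int[mu]_(z in `[0, 1]) a z) * ((2 * pi)^-1 * \int[mu]_(t in `[- pi, pi]) b t).
Proof.
move=> ca cb; rewrite /avg mulrCA; congr (_ * _).
have okab : avg_ok (fun u => a u.1 * b u.2).
  by apply: avg_okM; [exact: avg_ok_fst|exact: avg_ok_snd].
have ia : mu.-integrable `[0, 1] (EFin \o a).
  apply: continuous_compact_integrable; first exact: segment_compact.
  exact: continuous_subspaceT.
have ib : mu.-integrable `[- pi, pi] (EFin \o b).
  apply: continuous_compact_integrable; first exact: segment_compact.
  exact: continuous_subspaceT.
rewrite /Rintegral integral_mkcond.
have iab := avg_ok_integrable okab.
(* Extension by zero, so that Fubini's theorem applies on the whole plane. *)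
pose f : RT * RT -> \bar R := (fun u => (a u.1 * b u.2)%:E) \_ avg_dom.
have fi : mu2.-integrable setT f.
  by apply/(integrable_mkcond _ measurable_avg_dom).
have <- : (\int[mu]_x fubini_F mu f x = \int[mu2]_x f x)%E.
  exact: integral12_prod_meas1.
rewrite -[RHS]/(fine _ * fine _).
rewrite -fineM; [|exact: integrable_fin_num..].
congr fine.
rewrite -[X in _ = (_ * X)%E]fineK; last exact: integrable_fin_num.
rewrite -integralZr//.
rewrite [RHS]integral_mkcond; apply: eq_integral => z _.
rewrite /fubini_F !patchE/=; case: ifPn => z01; last first.
  rewrite (eq_integral (cst 0%E)) ?integral0// => t _.
  rewrite /f patchE ifF//; apply/negP => /set_mem[/= z01' _].
  by move/negP: z01; apply; exact/mem_set.
rewrite fineK; last exact: integrable_fin_num.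
rewrite -integralZl//.
rewrite [RHS]integral_mkcond; apply: eq_integral => t _.
rewrite /f !patchE/= /avg_dom.
have -> : ((z, t) \in `[0, 1]%classic `*` `[- pi, pi]%classic) = (t \in `[- pi, pi]%classic).
  apply/idP/idP => [/set_mem[_ ?]|/set_mem ?]; apply/mem_set => //.
  by split => //; exact: set_mem.
by case: ifP => _; rewrite ?EFinM.
Qed.
End sphere_average.

(** * Moments of the sphere and the function sinc *)

Section moments.
Context {R : realType}.
Notation mu := (@lebesgue_measure R).
Implicit Types (x y z t : R).

(** A Wallis recursion: [z (1 - z^2)^(j+1)] vanishes at 0 and at 1, so its derivative has integral
    zero. *)
Lemma z_moment j : (2 * j.+1 + 1)%:R * \int[mu]_(z in `[0, 1]) (1 - z ^+ 2) ^+ j.+1 =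
  (2 * j.+1)%:R * \int[mu]_(z in `[0, 1]) (1 - z ^+ 2) ^+ j :> R.
Proof.
have cW i : continuous (fun z : R => (1 - z ^+ 2) ^+ i).
  by apply: derivable_continuous => z; exact: ex_derive.
have iW i : mu.-integrable `[0, 1] (EFin \o (fun z : R => (1 - z ^+ 2) ^+ i)).
  by apply: cont_itv_integrable => z _; exact: cW.
have d z : is_derive z (1 : R) (fun y => y * (1 - y ^+ 2) ^+ j.+1)
    ((2 * j.+1 + 1)%:R * (1 - z ^+ 2) ^+ j.+1 + (- (2 * j.+1)%:R) * (1 - z ^+ 2) ^+ j).
  apply: is_derive_eq; rewrite /GRing.scale/= !(exprS (1 - z ^+ 2) j).
  move: ((1 - z ^+ 2) ^+ j) => W; rewrite natrD natrM -(natr1 j); ring.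
have := @Rint_FTC R _ _ 0 1 ler01 (fun z _ => d z).
rewrite expr1n subrr expr0n mul1r mul0r subrr Rint_add; last 2 first.
- by apply: cont_itv_integrable => z _; apply: derivable_continuous_at; exact: ex_derive.
- by apply: cont_itv_integrable => z _; apply: derivable_continuous_at; exact: ex_derive.
rewrite !Rint_scale// mulNr => /(_ _)/eqP; rewrite subr_eq0 => H; apply/eqP/H.
by move=> z _; apply: derivable_continuous_at; exact: ex_derive.
Qed.

(** With [f = a cos + b sin] one has [f^2 + f'^2 = a^2 + b^2] and [f'' = - f]; integrating the
    derivative of the periodic function [f^(n+1) f'] over a period gives the recursion. *)
Lemma psi_moment (a b : R) n :
  n.+2%:R * \int[mu]_(t in `[- pi, pi]) (a * cos t + b * sin t) ^+ n.+2 =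
  n.+1%:R * (a ^+ 2 + b ^+ 2) * \int[mu]_(t in `[- pi, pi]) (a * cos t + b * sin t) ^+ n.
Proof.
pose f t := a * cos t + b * sin t.
have cf i : continuous (fun t : R => f t ^+ i).
  by apply: derivable_continuous => z; exact: ex_derive.
have intf i : mu.-integrable `[- pi, pi] (EFin \o (fun t : R => f t ^+ i)).
  by apply: cont_itv_integrable => z _; exact: cf.
have d t : is_derive t (1 : R) (fun y => f y ^+ n.+1 * (- a * sin y + b * cos y))
    (n.+1%:R * (a ^+ 2 + b ^+ 2) * f t ^+ n + (- n.+2%:R) * f t ^+ n.+2).
  apply: is_derive_eq; rewrite /GRing.scale/= /f.
  rewrite !(exprS _ n.+1) !(exprS _ n) -(natr1 n.+1).
  move: ((a * cos t + b * sin t) ^+ n) => F.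
  have E : a ^+ 2 + b ^+ 2 = (a * cos t + b * sin t) ^+ 2 + (- a * sin t + b * cos t) ^+ 2.
    have := cos2Dsin2 t; move: (cos t) (sin t) => c s cs.
    transitivity ((a ^+ 2 + b ^+ 2) * (c ^+ 2 + s ^+ 2)); first by rewrite cs mulr1.
    ring.
  rewrite E; ring.
have npi : - pi <= pi :> R by have := @pi_ge0 R; lra.
have := @Rint_FTC R _ _ (- pi) pi npi (fun z _ => d z).
rewrite /f !cosN !sinN !cospi !sinpi oppr0 !mulr0 !addr0 subrr -/f.
rewrite -/(f) Rint_add; last 2 first.
- by apply: cont_itv_integrable => z _; apply: derivable_continuous_at; exact: ex_derive.
- by apply: cont_itv_integrable => z _; apply: derivable_continuous_at; exact: ex_derive.
rewrite !Rint_scale// mulNr => /(_ _)/eqP; rewrite subr_eq0 => H; apply/esym/eqP/H.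
by move=> z _; apply: derivable_continuous_at; exact: ex_derive.
Qed.

(** In the product of the two recursions the factor [2 j + 2] cancels. The denominator that remains
    turns [(2 j)!] into [(2 j + 1)!], that is, the series of the cosine into that of [sinc]. *)
Lemma sphere_moment (a b : R) j :
  avg (fun u => (Num.sqrt (1 - u.1 ^+ 2) * (a * cos u.2 + b * sin u.2)) ^+ j.*2) =
  (a ^+ 2 + b ^+ 2) ^+ j / (2 * j + 1)%:R.
Proof.
have -> : avg (fun u => (Num.sqrt (1 - u.1 ^+ 2) * (a * cos u.2 + b * sin u.2)) ^+ j.*2)
   = avg (fun u => (fun z => (1 - z ^+ 2) ^+ j) u.1 *
                   (fun t => (a * cos t + b * sin t) ^+ j.*2) u.2).
  congr (_ * _); apply: eq_Rintegral => -[z t] /set_mem[/= + _].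
  rewrite in_itv/= => /andP[z0 z1].
  rewrite exprMn -mul2n exprM sqr_sqrtr// subr_ge0 -(expr1n _ 2).
  by rewrite lerXn2r ?nnegrE.
have ca : continuous (fun z : R => (1 - z ^+ 2) ^+ j).
  by apply: derivable_continuous => z; exact: ex_derive.
have cb : continuous (fun t : R => (a * cos t + b * sin t) ^+ j.*2).
  by apply: derivable_continuous => z; exact: ex_derive.
rewrite (avg_prod ca cb) {ca cb}.
elim: j => [|j IH].
  under eq_Rintegral do rewrite expr0.
  under [X in _ * (_ * X) = _]eq_Rintegral do rewrite expr0.
  have pi0 := @pi_gt0 R.
  rewrite !Rint_cst//; last by lra.
  by rewrite expr0; field; lra.
have j1 : (2 * j.+1 + 1)%:R != 0 :> R by rewrite pnatr_eq0 addn1.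
have j2 : j.+1.*2%:R != 0 :> R by rewrite pnatr_eq0 doubleS.
apply: (mulfI j1); apply: (mulfI j2).
transitivity (((2 * j.+1 + 1)%:R * \int[mu]_(z in `[0, 1]) (1 - z ^+ 2) ^+ j.+1) * ((2 * pi)^-1 *
   (j.*2.+2%:R * \int[mu]_(t in `[- pi, pi]) (a * cos t + b * sin t) ^+ j.*2.+2))).
  by rewrite doubleS; ring.
rewrite z_moment psi_moment.
transitivity ((2 * j.+1)%:R * j.*2.+1%:R * (a ^+ 2 + b ^+ 2) * ((a ^+ 2 + b ^+ 2) ^+ j / (2 * j + 1)%:R)).
  rewrite -IH; ring.
have -> : (2 * j + 1)%:R = j.*2.+1%:R :> R by rewrite addn1 mul2n.
have j3 : j.*2.+1%:R != 0 :> R by rewrite pnatr_eq0.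
rewrite (exprS (a ^+ 2 + b ^+ 2) j); rewrite -(mul2n j.+1) in j2 *.
move: ((a ^+ 2 + b ^+ 2) ^+ j) ((2 * j.+1)%:R : R) (j.*2.+1%:R : R) ((2 * j.+1 + 1)%:R : R) j1 j3.
by move=> W p q r r0 q0; field; rewrite r0 q0.
Qed.

Definition sinc y : R := if y == 0 then 1 else sin y / y.

Definition cosT n y : R := \sum_(0 <= j < n) (-1) ^+ j * y ^+ j.*2 / (j.*2)`!%:R.

(** The cosine series with all signs positive: its tails dominate those of [cosT] uniformly on
    bounded sets. *)
Definition coshT n y : R := \sum_(0 <= j < n) y ^+ j.*2 / (j.*2)`!%:R.

Lemma coshT_cvg y : cvgn (coshT ^~ y).
Proof.
apply: nondecreasing_is_cvgn.
  apply/nondecreasing_seqP => n; rewrite /coshT big_nat_recr//= lerDl.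
  by rewrite divr_ge0// -mul2n exprM exprn_ge0// sqr_ge0.
exists (limn (series (exp_coeff `|y|))) => _ [n _ <-].
apply: le_trans (_ : series (exp_coeff `|y|) n.*2 <= _).
  rewrite /series/= /coshT; elim: n => [|n IH]; first by rewrite !big_geq.
  rewrite big_nat_recr//= doubleS !big_nat_recr//= -addrA lerD//.
  rewrite /exp_coeff/= -{1}(mul2n n) exprM -normrX ler_wpDr//.
  by rewrite -(mul2n n) exprM ger0_norm// exprn_ge0// sqr_ge0.
apply: nondecreasing_cvgn_le => //.
  by apply/nondecreasing_seqP => m; rewrite /series/= big_nat_recr//= lerDl exp_coeff_ge0.
exact: is_cvg_series_exp_coeff.
Qed.

Lemma cos_taylor n y Y : `|y| <= Y ->
  `|cos y - cosT n y| <= limn (coshT ^~ Y) - coshT n Y.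
Proof.
move=> yY.
have Y0 : 0 <= Y by exact: le_trans yY.
have E : cosT ^~ y = series (cos_coeff' y).
  by apply/funext => m; rewrite /cosT /series/=; apply: eq_bigr => i _.
have H N : (n <= N)%N -> `|cosT N y - cosT n y| <= limn (coshT ^~ Y) - coshT n Y.
  move=> nN; apply: le_trans (_ : coshT N Y - coshT n Y <= _); last first.
    rewrite lerD2r; apply: nondecreasing_cvgn_le; last exact: coshT_cvg.
    apply/nondecreasing_seqP => m; rewrite /coshT big_nat_recr//= lerDl.
    by rewrite divr_ge0// exprn_ge0.
  rewrite /cosT /coshT !(@big_cat_nat _ _ _ n 0 N)//= addrAC subrr add0r addrAC subrr add0r.
  apply: (le_trans (ler_norm_sum _ _ _)); apply: ler_sum => i _.
  rewrite !normrM normfV normr_nat normrX normrN1 expr1n mul1r.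
  by rewrite ler_wpM2r// normrX lerXn2r ?nnegrE.
have : (fun N => `|cosT N y - cosT n y|) @ \oo --> `|cos y - cosT n y|.
  apply: cvg_norm; apply: cvgB; last exact: cvg_cst.
  by rewrite E; exact: cvg_cos_coeff'.
move=> /cvg_lim <- //; apply: limr_le.
  apply/cvg_ex; exists (`|cos y - cosT n y|).
  apply: cvg_norm; apply: cvgB; last exact: cvg_cst.
  by rewrite E; exact: cvg_cos_coeff'.
by exists n => // N /= nN; exact: H.
Qed.

Lemma sinc_cvg y :
  (fun n => \sum_(0 <= j < n) (-1) ^+ j * y ^+ j.*2 / (j.*2)`!%:R / (2 * j + 1)%:R)
    @ \oo --> sinc y.
Proof.
rewrite /sinc; have [->|y0] := eqVneq y 0.
  rewrite -(cvg_shiftn 1); apply: cvg_near_cst; near=> n.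
  rewrite /= addn1 big_nat_recl//= expr0 mul1r !divr1 big1 ?addr0// => i _.
  by rewrite doubleS expr0n mulr0 !mul0r.
have -> : (fun n => \sum_(0 <= j < n) (-1) ^+ j * y ^+ j.*2 / (j.*2)`!%:R / (2 * j + 1)%:R)
   = (fun n => series (sin_coeff' y) n / y).
  apply/funext => n; rewrite /series/= mulr_suml; apply: eq_bigr => i _.
  rewrite /sin_coeff' -exprnP factS natrM addn1 mul2n exprS.
  move: ((-1) ^+ i) (y ^+ i.*2) => s t; field.
  rewrite y0 pnatr_eq0 -lt0n fact_gt0/= lt0r_neq0//.
by apply: cvgM; [exact: cvg_sin_coeff'|exact: cvg_cst].
Unshelve. all: by end_near.
Qed.

Lemma sqrt_cont : continuous (fun z : R => Num.sqrt (1 - z ^+ 2)).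
Proof.
move=> z; apply: continuous_comp; last exact: sqrt_continuous.
by apply: derivable_continuous_at; exact: ex_derive.
Qed.

Definition sph1 (th : R) (u : measurableTypeR R * measurableTypeR R) : R :=
  th * (Num.sqrt (1 - u.1 ^+ 2) * cos u.2).
Definition sph2 (th : R) (u : measurableTypeR R * measurableTypeR R) : R :=
  th * (Num.sqrt (1 - u.1 ^+ 2) * sin u.2).

Lemma sph1_ok th : avg_ok (sph1 th).
Proof.
apply: avg_okM; first exact: avg_ok_cst.
apply: avg_okM; first exact: (avg_ok_fst sqrt_cont).
exact: (avg_ok_snd (@continuous_cos R)).
Qed.

Lemma sph2_ok th : avg_ok (sph2 th).
Proof.
apply: avg_okM; first exact: avg_ok_cst.
apply: avg_okM; first exact: (avg_ok_fst sqrt_cont).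
exact: (avg_ok_snd (@continuous_sin R)).
Qed.

Lemma sqrt_z_le1 z : Num.sqrt (1 - z ^+ 2) <= 1.
Proof. by rewrite -[leRHS]sqrtr1 ler_wsqrtr// lerBlDr lerDl sqr_ge0. Qed.

Lemma avg_cst c : avg (fun=> c) = c :> R.
Proof.
have pi0 := @pi_gt0 R.
have -> : (fun=> c) = (fun u : measurableTypeR R * measurableTypeR R =>
    (fun=> c) u.1 * (fun=> 1) u.2) by apply/funext => u; rewrite mulr1.
rewrite (@avg_prod R (fun=> c) (fun=> 1)); [|exact: cst_continuous..].
by rewrite !Rint_cst//; [field; lra|lra].
Qed.

Lemma avg_dist F G e : avg_ok F -> avg_ok G ->
  (forall u, avg_dom u -> `|F u - G u| <= e) -> `|avg F - avg G| <= e :> R.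
Proof.
move=> okF okG FG; rewrite ler_norml lerBlDr lerBrDr -(avg_cst e).
rewrite -[X in X <= _ <= _]addrC -mulN1r -avgZ; last exact: avg_ok_cst.
rewrite -avgD//; last exact/avg_okM/avg_ok_cst/avg_ok_cst.
rewrite -avgD//; last exact: avg_ok_cst.
apply/andP; split; apply: avg_le => //.
- by apply: avg_okD => //; apply: avg_okM; exact: avg_ok_cst.
- by move=> u /FG; rewrite ler_norml => /andP[]; lra.
- by apply: avg_okD => //; exact: avg_ok_cst.
- by move=> u /FG; rewrite ler_norml => /andP[]; lra.
Qed.

(** Both sides are limits of the same partial sums: the Taylor polynomials of the cosine converge
    uniformly on the sphere, and [sphere_moment] identifies their averages with the partial sums of
    [sinc]. *)
Lemma avg_cos_sinc (a b : R) :
  avg (fun u => cos (a * sph1 1 u + b * sph2 1 u)) = sinc (Num.sqrt (a ^+ 2 + b ^+ 2)).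
Proof.
pose F u := a * sph1 1 u + b * sph2 1 u.
have okF : avg_ok F.
  by apply: avg_okD; apply: avg_okM; [exact: avg_ok_cst|exact: sph1_ok|exact: avg_ok_cst|exact: sph2_ok].
have okc h : continuous h -> avg_ok (fun u => h (F u)) by move=> ch; exact: avg_ok_comp.
pose Y := `|a| + `|b|.
have FY u : `|F u| <= Y.
  rewrite /F /Y (le_trans (ler_normD _ _))// !normrM normr1 !mul1r.
  have ? := sqrt_z_le1 u.1; have ? := sqrtr_ge0 (1 - u.1 ^+ 2).
  by rewrite lerD// ler_piMr// mulr_ile1// ?sin_max ?cos_max// ger0_norm.
have cT n : continuous (cosT n).
  elim: n => [|n IHn].
    have -> : cosT 0 = (fun=> 0) by apply/funext => y; rewrite /cosT big_geq.
    exact: cst_continuous.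
  have -> : cosT n.+1 = (fun y => cosT n y + (-1) ^+ n * y ^+ n.*2 / (n.*2)`!%:R).
    by apply/funext => y; rewrite /cosT big_nat_recr.
  move=> y; apply: cvgD; first exact: IHn.
  by apply: (@derivable_continuous_at R (fun y => (-1) ^+ n * y ^+ n.*2 / (n.*2)`!%:R)).
have avgT n : avg (fun u => cosT n (F u)) = \sum_(0 <= j < n) (-1) ^+ j *
   (Num.sqrt (a ^+ 2 + b ^+ 2)) ^+ j.*2 / (j.*2)`!%:R / (2 * j + 1)%:R.
  rewrite /cosT avg_sum; last first.
    move=> i; apply: (okc (fun y => (-1) ^+ i * y ^+ i.*2 / (i.*2)`!%:R)).
    by apply: derivable_continuous => y; exact: ex_derive.
  apply: eq_bigr => i _.
  under eq_fun do rewrite mulrAC.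
  rewrite avgZ; last first.
    by apply: (okc (fun y => y ^+ i.*2)); apply: derivable_continuous => y; exact: ex_derive.
  have -> : (fun u => F u ^+ i.*2) = (fun u => (Num.sqrt (1 - u.1 ^+ 2) * (a * cos u.2 + b * sin u.2)) ^+ i.*2).
    by apply/funext => u; congr (_ ^+ _); rewrite /F /sph1 /sph2; ring.
  have -> : Num.sqrt (a ^+ 2 + b ^+ 2) ^+ i.*2 = (a ^+ 2 + b ^+ 2) ^+ i.
    by rewrite -mul2n exprM sqr_sqrtr// addr_ge0// sqr_ge0.
  by rewrite sphere_moment mulrA [X in X / _]mulrAC.
apply: (@cvg_unique _ _ ((fun n => avg (fun u => cosT n (F u))) @ \oo)) => //; last first.
  have -> : (fun n => avg (fun u => cosT n (F u))) = _ := funext avgT.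
  exact: sinc_cvg.
apply/cvgrPdist_le => e e0.
have : coshT ^~ Y @ \oo --> limn (coshT ^~ Y) by exact: coshT_cvg.
move=> /cvgrPdist_le/(_ e e0); apply: filterS => n Hn.
have Hu u : `|cos (F u) - cosT n (F u)| <= e.
  by apply: le_trans (cos_taylor n (FY u)) _; apply: le_trans Hn; exact: ler_norm.
by apply: avg_dist => [||u _]; [exact/okc/continuous_cos|exact/okc/cT|exact: Hu].
Qed.
End moments.

(** * The theta identity *)
(** The integers of absolute value at most [n], ordered so that induction on [n] peels off the pair
    [n], [- n]. *)
Fixpoint zs (n : nat) : seq int :=
  if n is m.+1 then n%:Z :: - n%:Z :: zs m else [:: 0].

Lemma mem_zs n z : (z \in zs n) = (`|z| <= n%:Z).
Proof.
elim: n => [|n IH] /=; first by rewrite inE normr_le0.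
rewrite !inE IH; lia.
Qed.

Lemma uniq_zs n : uniq (zs n).
Proof.
elim: n => [//|n IH] /=; rewrite IH !inE !mem_zs; lia.
Qed.

(** * Finite Fourier analysis modulo an odd number *)

Section zsums.
Context {R : realType}.
Implicit Types (f g : int -> R) (x w a : R).

Lemma sum_zs_telescope (S : int -> R) n :
  \sum_(k <- zs n) (S (k + 1) - S k) = S (n.+1%:Z) - S (- n%:Z).
Proof.
elim: n => [|n IH] /=; first by rewrite big_seq1 add0r oppr0.
rewrite !big_cons IH.
have -> : (- n.+1%:Z) + 1 = - n%:Z by lia.
have -> : n.+1%:Z + 1 = n.+2%:Z by lia.
ring.
Qed.

Lemma sum_zs_iota f m :
  \sum_(k <- zs m) f k = \sum_(0 <= l < (2 * m).+1) f (l%:Z - m%:Z).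
Proof.
rewrite -(big_map (fun l : nat => l%:Z - m%:Z) xpredT f).
apply: perm_big; apply: uniq_perm; first exact: uniq_zs.
  rewrite map_inj_uniq ?iota_uniq// => i j /eqP; rewrite (inj_eq (addIr _)).
  by move=> /eqP[].
move=> z; rewrite mem_zs; apply/idP/mapP => [zm|[l + ->]].
  exists (absz (z + m%:Z)); last by lia.
  by rewrite mem_index_iota; lia.
by rewrite mem_index_iota; lia.
Qed.

Lemma sum_zs_multiple f m n : (0 < n)%N ->
  (forall j, m%:Z < `|n%:Z * j| -> f (n%:Z * j) = 0) ->
  \sum_(k <- zs m | (n %| `|k|)%N) f k = \sum_(j <- zs m) f (n%:Z * j).
Proof.
move=> n0 f0.
rewrite [RHS](bigID (fun j => `|n%:Z * j| <= m%:Z))/= [X in _ = _ + X]big1 ?addr0; last first.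
  by move=> j; rewrite -ltNge => /f0.
rewrite -big_filter -[RHS]big_filter -(big_map (fun j : int => n%:Z * j) xpredT f).
apply: perm_big; apply: uniq_perm; first exact/filter_uniq/uniq_zs.
  rewrite map_inj_uniq ?filter_uniq ?uniq_zs// => i j; apply: mulfI; lia.
move=> z; rewrite mem_filter mem_zs; apply/idP/mapP.
  move=> /andP[/dvdnP[q qE] zm].
  exists (sgz z * q%:Z); last by rewrite {1}(intEsg z) qE PoszM; ring.
  by rewrite mem_filter mem_zs; nia.
move=> [j + ->]; rewrite mem_filter mem_zs => /andP[-> _].
by rewrite abszM dvdn_mulr.
Qed.

(** The binomial expansion of [(e^(ix) + e^(-ix))^N] in real form; the induction step is Pascal's
    rule. *)
Lemma pow2cos (x : R) N :
  (2 * cos x) ^+ N = \sum_(0 <= l < N.+1) 'C(N, l)%:R * cos ((N%:R - 2 * l%:R) * x).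
Proof.
elim: N => [|N IH].
  by rewrite big_nat1 bin0 mul1r mulr0 subrr mul0r cos0 expr0.
rewrite exprS IH mulr_sumr.
have E l : 2 * cos x * ('C(N, l)%:R * cos ((N%:R - 2 * l%:R) * x)) =
   'C(N, l)%:R * cos ((N.+1%:R - 2 * l%:R) * x) +
   'C(N, l)%:R * cos ((N.+1%:R - 2 * l.+1%:R) * x).
  have -> : (N.+1%:R - 2 * l%:R) * x = (N%:R - 2 * l%:R) * x + x by rewrite -natr1; ring.
  have -> : (N.+1%:R - 2 * l.+1%:R) * x = (N%:R - 2 * l%:R) * x - x by rewrite -natr1 -(natr1 l); ring.
  rewrite cosD cosB; ring.
under eq_bigr do rewrite E.
rewrite big_split/= [RHS]big_nat_recl// bin0.
rewrite [X in X + _ = _]big_nat_recl// bin0 -addrA; congr (_ + _).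
rewrite [X in _ = X]big_nat_recr//=.
rewrite (_ : \sum_(0 <= i < N) _ = \sum_(0 <= i < N) ('C(N, i.+1)%:R * cos ((N.+1%:R - 2 * i.+1%:R) * x)))//.
rewrite [X in _ + X = _]big_nat_recr//= addrA -big_split/= binn.
congr (_ + _); last by rewrite binn.
by apply: eq_bigr => i _; rewrite -mulrDl -natrD binS.
Qed.

Lemma cos2pi_int (y : R) (z : int) : cos (y + 2 * pi * z%:~R) = cos y.
Proof.
have H n (t : R) : cos (t + 2 * pi * n%:R) = cos t.
  elim: n t => [|n IHn] t; first by rewrite mulr0 addr0.
  by rewrite -(natr1 n) mulrDr mulr1 addrA mulr_natl cosD2pi -mulr_natl IHn.
case: z => n; first exact: H.
rewrite NegzE mulrNz mulrN -[in RHS](subrK (2 * pi * n.+1%:R) y).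
by rewrite H.
Qed.

Lemma sin2pi_int (y : R) (z : int) : sin (y + 2 * pi * z%:~R) = sin y.
Proof.
have H n (t : R) : sin (t + 2 * pi * n%:R) = sin t.
  elim: n t => [|n IHn] t; first by rewrite mulr0 addr0.
  by rewrite -(natr1 n) mulrDr mulr1 addrA mulr_natl sinD2pi -mulr_natl IHn.
case: z => n; first exact: H.
rewrite NegzE mulrNz mulrN -[in RHS](subrK (2 * pi * n.+1%:R) y).
by rewrite H.
Qed.

Lemma sin_pi_frac_neq0 (d : int) n : (0 < n)%N -> ~~ (n %| `|d|)%N ->
  sin (pi * d%:~R / n%:R) != 0 :> R.
Proof.
move=> n0 nd.
have npos : 0 < n%:R :> R by rewrite ltr0n.
have pi0 := @pi_gt0 R.
pose r := (d %% n%:Z)%Z.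
have r_gt0 : 0 < r.
  rewrite lt_neqAle modz_ge0 ?eqz_nat -?lt0n// andbT eq_sym.
  by apply: contra nd => /eqP/dvdz_mod0P.
have r_lt : r < n%:Z by rewrite ltz_pmod.
have E : pi * d%:~R / n%:R = pi * r%:~R / n%:R + pi * (d %/ n%:Z)%Z%:~R :> R.
  rewrite {1}(divz_eq d n%:Z) -/r rmorphD rmorphM/=; field.
  by rewrite gt_eqF.
have s0 : 0 < sin (pi * r%:~R / n%:R) :> R.
  apply: sin_gt0_pi; rewrite divr_gt0 ?mulr_gt0 ?ltr0z//=.
  by rewrite -mulrA gtr_pMr// ltr_pdivrMr// mul1r -[ltRHS]/(n%:Z%:~R) ltr_int.
have sg z y : sin y != 0 -> sin (y + pi * z%:~R) != 0 :> R.
  move=> sy.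
  have sN m t : sin t != 0 -> sin (t + pi * m%:R) != 0 :> R.
    elim: m t => [|m IHm] t st; first by rewrite mulr0 addr0.
    by rewrite -natr1 mulrDr mulr1 addrA sinDpi oppr_eq0 IHm.
  case: z => m; first exact: sN.
  rewrite NegzE mulrNz mulrN; apply/eqP => s00.
  have sN' m' t : sin t = 0 -> sin (t + pi * m'%:R) = 0 :> R.
    elim: m' t => [|m' IHm] t st; first by rewrite mulr0 addr0.
    by rewrite -natr1 mulrDr mulr1 addrA sinDpi IHm// oppr0.
  by move/eqP: sy; apply; rewrite -(subrK (pi * m.+1%:R) y) sN'.
by rewrite E; apply: sg; rewrite gt_eqF.
Qed.

Lemma cos_orthogonality (d : int) N w :
  \sum_(k <- zs N) cos (2 * d%:~R * (pi * (k%:~R - w) / (2 * N).+1%:R)) =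
  if ((2 * N).+1 %| `|d|)%N then (2 * N).+1%:R * cos (2 * pi * d%:~R * w / (2 * N).+1%:R)
  else 0.
Proof.
set n := (2 * N).+1.
have n0 : n%:R != 0 :> R by rewrite pnatr_eq0.
case: ifPn => nd.
  have [q dE] : exists q : int, d = n%:Z * q.
    have : (n%:Z %| d)%Z by rewrite /dvdz.
    by move=> /dvdzP[q ->]; exists q; rewrite mulrC.
  have H k : cos (2 * d%:~R * (pi * (k%:~R - w) / n%:R)) = cos (2 * pi * d%:~R * w / n%:R).
    rewrite -[RHS]cosN -[RHS](cos2pi_int _ (q * k)); congr cos.
    by rewrite dE !rmorphM/=; field.
  under eq_bigr do rewrite H.
  have Hs (c : R) (s : seq int) : \sum_(i <- s) c = (size s)%:R * c.
    by elim: s => [|y s IHs]; rewrite ?big_nil ?mul0r// big_cons IHs -(natr1 (size s)); ring.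
  rewrite Hs.
  have -> // : size (zs N) = n.
  by rewrite /n; elim: (N) => [//|m IHm] /=; rewrite IHm; lia.
have s0 := @sin_pi_frac_neq0 d n isT nd.
have s2 : 2 * sin (pi * d%:~R / n%:R) != 0 :> R by rewrite mulf_neq0.
(* Multiplication by [2 sin (pi d / n)] turns each cosine into a difference of sines at neighbouring
   half-integers; the arguments at the two ends of the telescoped sum differ by [2 pi d]. *)
apply: (mulfI s2); rewrite mulr0 mulr_sumr.
pose S (k : int) := sin (2 * d%:~R * (pi * (k%:~R - w - 2^-1) / n%:R)) : R.
transitivity (\sum_(k <- zs N) (S (k + 1) - S k)).
  apply: eq_bigr => k _; rewrite /S.
  set y := 2 * d%:~R * (pi * (k%:~R - w) / n%:R).
  set z := pi * d%:~R / n%:R.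
  have -> : 2 * d%:~R * (pi * ((k + 1)%:~R - w - 2^-1) / n%:R) = y + z.
    by rewrite /y /z rmorphD/=; field.
  have -> : 2 * d%:~R * (pi * (k%:~R - w - 2^-1) / n%:R) = y - z.
    by rewrite /y /z; field.
  rewrite sinD sinB; ring.
rewrite sum_zs_telescope /S.
apply/eqP; rewrite subr_eq0; apply/eqP.
rewrite -[RHS](sin2pi_int _ d); congr sin.
have nE : n%:R = 2 * N%:R + 1 :> R by rewrite /n -addn1 natrD natrM.
rewrite rmorphN/= -[N.+1%:~R]/(N.+1%:R) -[N%:~R]/(N%:R : R) -(natr1 N).
by rewrite nE in n0 *; field.
Qed.

(** After expansion of the powers, summation over the grid kills every frequency not divisible by
    [2 N + 1]. The surviving binomial coefficients are the discrete counterpart of the Gaussian on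
    the dual side. *)
Lemma polya_identity N m w :
  \sum_(k <- zs N) (2 * cos (pi * (k%:~R - w) / (2 * N).+1%:R)) ^+ (2 * m) =
  (2 * N).+1%:R * \sum_(j <- zs m) 'C(2 * m, m + (2 * N).+1 * `|j|)%:R * cos (2 * pi * j%:~R * w).
Proof.
set n := (2 * N).+1.
have n0 : n%:R != 0 :> R by rewrite pnatr_eq0.
pose x (k : int) := pi * (k%:~R - w) / n%:R.
have E k : (2 * cos (x k)) ^+ (2 * m) = \sum_(i <- zs m) 'C(2 * m, m + `|i|)%:R * cos (2 * i%:~R * x k).
  rewrite pow2cos sum_zs_iota big_nat_cond [RHS]big_nat_cond.
  apply: eq_bigr => l /andP[/andP[_ lm] _].
  congr (_%:R * _).
    case: (leqP m l) => ml.
      by congr 'C(_, _); lia.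
    by rewrite -bin_sub; [congr 'C(_, _); lia|lia].
  rewrite -cosN; congr cos.
  by rewrite rmorphB/= natrM -[l%:~R]/(l%:R : R) -[m%:~R]/(m%:R : R); ring.
under eq_bigr do rewrite E.
rewrite exchange_big/=.
under eq_bigr do rewrite -mulr_sumr cos_orthogonality -/n.
transitivity (\sum_(i <- zs m | (n %| `|i|)%N) n%:R * ('C(2 * m, m + `|i|)%:R * cos (2 * pi * i%:~R * w / n%:R))).
  rewrite [RHS]big_mkcond/=; apply: eq_bigr => i _; case: ifP => _; last by rewrite mulr0.
  by rewrite mulrCA.
rewrite -mulr_sumr; congr (_ * _).
rewrite (@sum_zs_multiple (fun i => 'C(2 * m, m + `|i|)%:R * cos (2 * pi * i%:~R * w / n%:R)))//.
  apply: eq_bigr => j _; congr (_%:R * cos _); first by rewrite abszM.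
  by rewrite rmorphM/= -[n%:~R]/(n%:R : R); field.
move=> j jm; rewrite bin_small ?mul0r//; lia.
Qed.
End zsums.

(** * Dominated convergence for series *)

Section tannery.
Context {R : realType}.
Implicit Types (v : nat -> R) (C z : R).

Lemma geo_tail z K M : 0 <= z < 1 -> \sum_(K <= i < M) z ^+ i <= z ^+ K / (1 - z).
Proof.
move=> /andP[z0 z1]; have z1' : 0 < 1 - z by rewrite subr_gt0.
rewrite ler_pdivlMr//.
have [MK|KM] := leqP M K; first by rewrite big_geq// mul0r exprn_ge0.
have -> : (\sum_(K <= i < M) z ^+ i) * (1 - z) = z ^+ K - z ^+ M.
  rewrite -(opprB (z ^+ M)) -(telescope_sumr (fun i => z ^+ i) (ltnW KM)) -sumrN mulr_suml.
  by apply: eq_bigr => i _; rewrite exprS; ring.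
by rewrite gerBl exprn_ge0.
Qed.

Lemma abs_sum_tail v C z K M : 0 <= z < 1 -> 0 <= C -> (forall i, `|v i| <= C * z ^+ i) ->
  `|\sum_(K <= i < M) v i| <= C * z ^+ K / (1 - z).
Proof.
move=> z01 C0 vC; apply: (le_trans (ler_norm_sum _ _ _)).
apply: (@le_trans _ _ (C * \sum_(K <= i < M) z ^+ i)).
  by rewrite mulr_sumr; apply: ler_sum => i _; exact: vC.
by rewrite -mulrA ler_wpM2l// geo_tail.
Qed.

Lemma dom_series_cvg v C z : 0 <= z < 1 -> 0 <= C -> (forall i, `|v i| <= C * z ^+ i) ->
  cvgn (series v).
Proof.
move=> z01 C0 vC; apply: normed_cvg.
apply: (@series_le_cvg _ _ (fun i => C * z ^+ i)) => //.
- by move=> i /=.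
- by move=> i; rewrite mulr_ge0// exprn_ge0//; case/andP: z01.
- by apply: (@is_cvg_geometric_series R C z); rewrite ger0_norm; case/andP: z01.
Qed.

Lemma dom_series_tail v C z K : 0 <= z < 1 -> 0 <= C -> (forall i, `|v i| <= C * z ^+ i) ->
  `|limn (series v) - series v K| <= C * z ^+ K / (1 - z).
Proof.
move=> z01 C0 vC.
have cv := dom_series_cvg z01 C0 vC.
have cvD : (fun N => `|series v N - series v K|) @ \oo --> `|limn (series v) - series v K|.
  by apply: cvg_norm; apply: cvgB; [exact: cv|exact: cvg_cst].
rewrite -(cvg_lim _ cvD)//; apply: limr_le; first by apply/cvg_ex; eexists; exact: cvD.
exists K => // N /= KN.
by rewrite sub_series_geq//; exact: abs_sum_tail.
Qed.

(** Tannery's theorem with a moving upper limit: cut at a fixed [K] beyond which the geometric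
    majorant is at most [e / 3], and let [N] grow in the finitely many terms left. *)
Lemma tannery (u : nat -> nat -> R) v (M : nat -> nat) C z : 0 <= z < 1 -> 0 <= C ->
  (forall i, (u^~ i) @ \oo --> v i) ->
  (\forall N \near \oo, forall i, `|u N i| <= C * z ^+ i) ->
  (forall K, \forall N \near \oo, (K <= M N)%N) ->
  (forall i, `|v i| <= C * z ^+ i) /\
  (fun N => \sum_(0 <= i < M N) u N i) @ \oo --> limn (series v).
Proof.
move=> z01 C0 uv uC MK.
have vC i : `|v i| <= C * z ^+ i.
  have h : (fun N => `|u N i|) @ \oo --> `|v i| by apply: cvg_norm; exact: uv.
  rewrite -(cvg_lim _ h)//; apply: limr_le; first by apply/cvg_ex; eexists; exact: h.
  by apply: filterS uC => N; exact.
split=> //.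
apply/cvgrPdist_le => e e0.
have z1 : 0 < 1 - z by rewrite subr_gt0; case/andP: z01.
have e3 : 0 < e / 3 by rewrite divr_gt0.
have [K HK] : exists K, C * z ^+ K / (1 - z) <= e / 3.
  have : (fun K => C / (1 - z) * z ^+ K) @ \oo --> (0 : R).
    by apply: (@cvg_geometric R); rewrite ger0_norm; case/andP: z01.
  move=> /cvgrPdist_le/(_ _ e3)[K _ /(_ K (leqnn K))].
  rewrite sub0r normrN => h; exists K; apply: le_trans h.
  by rewrite mulrAC; exact: ler_norm.
have cS : (fun N => \sum_(0 <= i < K) u N i) @ \oo --> \sum_(0 <= i < K) v i.
  elim: (K) => [|k IH]; first by under eq_fun do rewrite big_geq//; rewrite big_geq//; exact: cvg_cst.
  by under eq_fun do rewrite big_nat_recr//=; rewrite big_nat_recr//=; apply: cvgD.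
move/cvgrPdist_le : cS => /(_ _ e3) cS.
near=> N.
have NM : (K <= M N)%N by near: N; exact: MK.
have uN : forall i, `|u N i| <= C * z ^+ i by near: N.
rewrite (@big_cat_nat _ _ _ K 0 (M N))//=.
have -> : limn (series v) - (\sum_(0 <= i < K) u N i + \sum_(K <= i < M N) u N i) =
  (limn (series v) - series v K) + ((\sum_(0 <= i < K) v i - \sum_(0 <= i < K) u N i)
   - \sum_(K <= i < M N) u N i).
  by rewrite /series/=; ring.
have h1 := dom_series_tail K z01 C0 vC.
have h2 := abs_sum_tail K (M N) z01 C0 uN.
have h3 : `|\sum_(0 <= i < K) v i - \sum_(0 <= i < K) u N i| <= e / 3 by near: N.
apply: (le_trans (ler_normD _ _)); have := ler_normB (\sum_(0 <= i < K) v i - \sum_(0 <= i < K) u N i) (\sum_(K <= i < M N) u N i).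
lra.
Unshelve. all: by end_near.
Qed.

(** Pairing the terms at [i] and [- i] turns a symmetric two-sided sum into a series over [nat]. *)
Definition fold (f : int -> R) (i : nat) : R :=
  if i is j.+1 then f i%:Z + f (- i%:Z) else f 0.

Lemma sum_zs_fold (f : int -> R) n :
  \sum_(k <- zs n) f k = \sum_(0 <= i < n.+1) fold f i.
Proof.
elim: n => [|n IH]; first by rewrite big_seq1 big_nat1.
have -> : \sum_(0 <= i < n.+2) fold f i = \sum_(0 <= i < n.+1) fold f i + fold f n.+1.
  by rewrite big_nat_recr.
have -> : \sum_(k <- zs n.+1) f k = f n.+1%:Z + (f (- n.+1%:Z) + \sum_(k <- zs n) f k).
  by rewrite big_cons big_cons.
rewrite IH [fold f n.+1]/=; ring.
Qed.

Lemma fold_bound (f : int -> R) C z : 0 <= z -> (forall k, `|f k| <= C * z ^+ `|k|%N) ->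
  forall i, `|fold f i| <= 2 * C * z ^+ i.
Proof.
move=> z0 fC [|i] /=.
  have := fC 0; rewrite absz0 expr0 !mulr1; have := normr_ge0 (f 0); lra.
apply: (le_trans (ler_normD _ _)); have := fC i.+1; have := fC (- i.+1%:Z).
by rewrite abszN /=; lra.
Qed.

Definition tsum (f : int -> R) : R := limn (series (fold f)).

Lemma tannery_zs (u : nat -> int -> R) (v : int -> R) (M : nat -> nat) C z :
  0 <= z < 1 -> 0 <= C ->
  (forall k, (u^~ k) @ \oo --> v k) ->
  (\forall N \near \oo, forall k, `|u N k| <= C * z ^+ `|k|%N) ->
  (forall K, \forall N \near \oo, (K <= M N)%N) ->
  (fun N => \sum_(k <- zs (M N)) u N k) @ \oo --> tsum v.
Proof.
move=> z01 C0 uv uC MK.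
under eq_fun do rewrite sum_zs_fold.
apply: (@tannery (fun N => fold (u N)) (fold v) (fun N => (M N).+1) (2 * C) z _ _ _ _ _).2 => //.
- by rewrite mulr_ge0.
- by move=> [|i] /=; [exact: uv|apply: cvgD; exact: uv].
- apply: filterS uC => N uN; apply: fold_bound => //; by case/andP: z01.
- by move=> K; apply: filterS (MK K) => N /leqW.
Qed.

Lemma tsum_tail (f : int -> R) C z n : 0 <= z < 1 -> 0 <= C ->
  (forall k, `|f k| <= C * z ^+ `|k|%N) ->
  `|tsum f - \sum_(k <- zs n) f k| <= 2 * C * z ^+ n.+1 / (1 - z).
Proof.
move=> z01 C0 fC; rewrite sum_zs_fold.
apply: (@dom_series_tail (fold f) (2 * C) z n.+1) => //; first by rewrite mulr_ge0.
by apply: fold_bound => //; case/andP: z01.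
Qed.
End tannery.

(** * Elementary bounds for sine, cosine and powers *)

Section elementary_bounds.
Context {R : realType}.
Implicit Types (x s : R).

(** The start of a chain in which each bound is the previous one integrated from 0: [sin x <= x],
    then [cos x >= 1 - x^2 / 2], then [sin x >= x - x^3 / 6]. *)
Lemma sin_le x : 0 <= x -> sin x <= x.
Proof.
move=> x0; rewrite -subr_ge0 -(_ : 0 - sin 0 = 0); last by rewrite sin0 subr0.
apply: (@derive_ge0_le R (fun y => y - sin y) (fun y => 1 - cos y)) => //.
Qed.

Lemma cos_ge x : 0 <= x -> 1 - x ^+ 2 / 2 <= cos x.
Proof.
move=> x0; rewrite -subr_ge0 -(_ : cos 0 - (1 - 0 ^+ 2 / 2) = 0); last by rewrite cos0; ring.
apply: (@derive_ge0_le R (fun y => cos y - (1 - y ^+ 2 / 2)) (fun y => y - sin y)) => //.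
- by move=> y _; apply: is_derive_eq; rewrite /GRing.scale/=; field.
- by move=> y; rewrite in_itv/= => /andP[y0 _]; rewrite subr_ge0 sin_le.
Qed.

Lemma sin_ge x : 0 <= x -> x - x ^+ 3 / 6 <= sin x.
Proof.
move=> x0; rewrite -subr_ge0 -(_ : sin 0 - (0 - 0 ^+ 3 / 6) = 0); last by rewrite sin0; ring.
apply: (@derive_ge0_le R (fun y => sin y - (y - y ^+ 3 / 6)) (fun y => cos y - (1 - y ^+ 2 / 2))) => //.
- by move=> y _; apply: is_derive_eq; rewrite /GRing.scale/=; field.
- by move=> y; rewrite in_itv/= => /andP[y0 _]; rewrite subr_ge0 cos_ge.
Qed.

Lemma sin_dist x : `|sin x - x| <= `|x| ^+ 3 / 6.
Proof.
have H (y : R) : 0 <= y -> `|sin y - y| <= y ^+ 3 / 6.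
  move=> y0; have := sin_le y0; have := sin_ge y0; rewrite ler_norml => ? ?.
  have : 0 <= y ^+ 3 by rewrite exprn_ge0.
  lra.
have [x0|x0] := leP 0 x; first by rewrite (ger0_norm x0) H.
rewrite (ltr0_norm x0)//.
have x0' : 0 <= - x by lra.
have -> : sin x - x = - (sin (- x) - - x) by rewrite sinN; ring.
by rewrite normrN; exact: H.
Qed.

(** The cubic minorant is at least [x / 6] as long as [x^2 <= 5]. The value 11/5 lies below the
    square root of 5 and leaves room for the crude bound [pi <= 4] wherever this is applied. *)
Lemma sin_sqr_ge x : `|x| <= 11 / 5 -> x ^+ 2 / 36 <= sin x ^+ 2.
Proof.
have H (y : R) : 0 <= y <= 11 / 5 -> y ^+ 2 / 36 <= sin y ^+ 2.
  move=> /andP[y0 y2].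
  have h : y / 6 <= sin y by apply: le_trans (sin_ge y0); nra.
  have -> : y ^+ 2 / 36 = (y / 6) ^+ 2 by field.
  by rewrite lerXn2r ?nnegrE//; [lra|apply: le_trans h; lra].
have [x0|x0] := leP 0 x; first by rewrite (ger0_norm x0) => x2; rewrite H ?x0.
rewrite (ltr0_norm x0) => x2; rewrite -sqrrN -[leRHS]sqrrN -sinN H//; lra.
Qed.

Lemma pow1B_le s m : 0 <= s <= 1 -> (1 - s) ^+ m <= expR (- (m%:R * s)).
Proof.
move=> /andP[s0 s1]; rewrite -mulrN expRM_natl lerXn2r ?nnegrE ?expR_ge0//; first lra.
by have := expR_ge1Dx (- s).
Qed.

Lemma pow1B_ge s m : 0 <= s < 1 -> expR (- (m%:R * (s / (1 - s)))) <= (1 - s) ^+ m.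
Proof.
move=> /andP[s0 s1]; have s1' : 0 < 1 - s by lra.
rewrite -mulrN expRM_natl lerXn2r ?nnegrE ?expR_ge0//; first lra.
rewrite expRN -[leRHS]invrK lef_pV2 ?posrE ?expR_gt0 ?invr_gt0//.
apply: le_trans (expR_ge1Dx _).
by rewrite [leLHS](_ : _ = 1 + s / (1 - s))//; field; lra.
Qed.
End elementary_bounds.

(** * Central binomial coefficients *)

Section binomial_ratio.
Context {R : realType}.

(* Polya's route to the theta identity: [bratio m (n * j)] tends to
   [expR (- a ^+ 2 * j ^+ 2)] when [m] is about [(n / a) ^+ 2], and for such [m] the
   binomial expansion of [(2 cos x) ^+ (2 m)], averaged over [n] equally spaced
   points, is a finite theta identity. *)
Definition bratio (m r : nat) : R := 'C(2 * m, m + r)%:R / 'C(2 * m, m)%:R.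

Lemma bratio0 m : bratio m 0 = 1.
Proof. by rewrite /bratio addn0 divff// pnatr_eq0 -lt0n bin_gt0; lia. Qed.

Lemma bratioS m r : (r <= m)%N ->
  bratio m r.+1 = bratio m r * ((m%:R - r%:R) / (m + r.+1)%:R).
Proof.
move=> rm; rewrite /bratio.
have H : (m + r.+1)%:R * 'C(2 * m, m + r.+1)%:R = (m%:R - r%:R) * 'C(2 * m, m + r)%:R :> R.
  rewrite -natrM addnS mul_bin_left natrM; congr (_ * _).
  by rewrite -natrB//; congr _%:R; lia.
have h0 : (m + r.+1)%:R != 0 :> R by rewrite pnatr_eq0; lia.
have h1 : 'C(2 * m, m)%:R != 0 :> R by rewrite pnatr_eq0 -lt0n bin_gt0; lia.
apply: (mulfI h0); rewrite mulrA H.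
move: h0 h1; move: (m + r.+1)%:R ('C(2 * m, m)%:R) => u v u0 v0.
by field; rewrite u0 v0.
Qed.

Lemma bratio_ge0 m r : 0 <= bratio m r.
Proof. by rewrite /bratio divr_ge0. Qed.

(** Each quotient of neighbours is [1 - (2 i + 1) / (m + i + 1)], and the odd numbers below [2 r]
    add up to [r^2]. The denominator is frozen at [m + r] so that the exponents add; [bratio_ge]
    does the same with [m - r]. *)
Lemma bratio_le m r : (r <= m)%N -> (0 < m)%N ->
  bratio m r <= expR (- (r%:R ^+ 2 / (m + r)%:R)).
Proof.
move=> rm m0.
have H i : (i <= r)%N -> bratio m i <= expR (- (i%:R ^+ 2 / (m + r)%:R)).
  elim: i => [_|i IH ir]; first by rewrite bratio0 expr0n mul0r oppr0 expR0.
  rewrite bratioS; last by lia.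
  have mr0 : 0 < (m + r)%:R :> R by rewrite ltr0n; lia.
  have mi0 : 0 < (m + i.+1)%:R :> R by rewrite ltr0n; lia.
  have -> : - (i.+1%:R ^+ 2 / (m + r)%:R) = - (i%:R ^+ 2 / (m + r)%:R) - (2 * i + 1)%:R / (m + r)%:R :> R.
    by rewrite [(2 * i + 1)%:R]natrD natrM -(natr1 i); field; lra.
  rewrite expRD ler_pM ?bratio_ge0 ?(IH (ltnW ir)) ?divr_ge0 ?subr_ge0 ?ler_nat//; first lia.
  apply: le_trans (expR_ge1Dx _).
  have -> : (m%:R - i%:R) / (m + i.+1)%:R = 1 - (2 * i + 1)%:R / (m + i.+1)%:R :> R.
    rewrite -[in X in _ = X - _](divff (lt0r_neq0 mi0)) -mulrBl; congr (_ / _).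
    by rewrite (natrD _ m) (natrD _ (2 * i)%N) natrM -(natr1 i); ring.
  rewrite lerD2l lerN2 ler_wpM2l// lef_pV2 ?posrE// ler_nat; lia.
exact: H.
Qed.

Lemma bratio_ge m r : (r < m)%N ->
  expR (- (r%:R ^+ 2 / (m%:R - r%:R))) <= bratio m r.
Proof.
move=> rm.
have mr0 : 0 < m%:R - r%:R :> R by rewrite subr_gt0 ltr_nat.
have H i : (i <= r)%N -> expR (- (i%:R ^+ 2 / (m%:R - r%:R))) <= bratio m i.
  elim: i => [_|i IH ir]; first by rewrite bratio0 expr0n mul0r oppr0 expR0.
  rewrite bratioS; last by lia.
  have mi0 : 0 < (m + i.+1)%:R :> R by rewrite ltr0n; lia.
  have mi1 : 0 < m%:R - i%:R :> R by rewrite subr_gt0 ltr_nat; lia.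
  have -> : - (i.+1%:R ^+ 2 / (m%:R - r%:R)) = - (i%:R ^+ 2 / (m%:R - r%:R)) - (2 * i + 1)%:R / (m%:R - r%:R) :> R.
    by rewrite [(2 * i + 1)%:R]natrD natrM -(natr1 i); field; lra.
  rewrite expRD ler_pM ?expR_ge0 ?(IH (ltnW ir))//.
  rewrite expRN -[leRHS]invrK lef_pV2 ?posrE ?expR_gt0 ?invr_gt0 ?divr_gt0//.
  apply: le_trans (expR_ge1Dx _).
  have -> : ((m%:R - i%:R) / (m + i.+1)%:R)^-1 = 1 + (2 * i + 1)%:R / (m%:R - i%:R) :> R.
    have -> : (m + i.+1)%:R = m%:R + i%:R + 1 :> R by rewrite natrD -(natr1 i); ring.
    rewrite natrD natrM; field; rewrite gt_eqF//= gt_eqF//.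
  rewrite lerD2l ler_wpM2l// lef_pV2 ?posrE// lerD2l lerN2 ler_nat; lia.
exact: H.
Qed.

(** The square of a normalised central binomial coefficient. It decreases, hence converges; the
    value [2 / pi] of the limit comes out of the theta identity itself, in [cbin2_lim]. *)
Definition cbin2 (m : nat) : R := 'C(2 * m, m)%:R ^+ 2 * (2 * m + 1)%:R / 16 ^+ m.

Lemma cbin2_noninc : {homo cbin2 : m n / (m <= n)%N >-> n <= m}.
Proof.
apply/nonincreasing_seqP => m; rewrite /cbin2.
have H : m.+1%:R * 'C(2 * m.+1, m.+1)%:R = 2 * (2 * m + 1)%:R * 'C(2 * m, m)%:R :> R.
  have e1 : (m.+1 * 'C(2 * m.+1, m.+1) = 2 * m.+1 * 'C(2 * m + 1, m))%N.
    by rewrite -mul_bin_diag; congr (_ * 'C(_, _))%N; lia.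
  have e2 : (m.+1 * 'C(2 * m + 1, m) = (2 * m + 1) * 'C(2 * m, m))%N.
    have := mul_bin_down (2 * m).+1 m; rewrite addn1 => ->; congr (_ * _)%N; lia.
  apply/eqP; rewrite -!natrM eqr_nat; apply/eqP; nia.
have m0 : 0 < m.+1%:R :> R by [].
have -> : 'C(2 * m.+1, m.+1)%:R = 2 * (2 * m + 1)%:R / m.+1%:R * 'C(2 * m, m)%:R :> R.
  by apply: (mulfI (lt0r_neq0 m0)); rewrite H; field.
rewrite (exprS 16) invfM mulrA ler_wpM2r ?invr_ge0 ?exprn_ge0//.
set c := 'C(2 * m, m)%:R.
have -> : (2 * m.+1 + 1)%:R = 2 * m%:R + 3 :> R by rewrite natrD natrM -(natr1 m); ring.
have -> : (2 * m + 1)%:R = 2 * m%:R + 1 :> R by rewrite natrD natrM.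
have mg : 0 <= m%:R :> R by [].
rewrite -(natr1 m) in m0 *; move: (m%:R) mg m0 => x x0 x1.
rewrite ler_pdivrMr//.
have -> : (2 * (2 * x + 1) / (x + 1) * c) ^+ 2 * (2 * x + 3) =
  c ^+ 2 * (2 * x + 1) * (4 * (2 * x + 1) * (2 * x + 3) / (x + 1) ^+ 2) by field; lra.
rewrite ler_wpM2l ?mulr_ge0 ?sqr_ge0//; first lra.
rewrite ler_pdivrMr ?exprn_gt0//; nra.
Qed.

Lemma cbin2_cvg : exists V : R, 0 <= V /\ cbin2 @ \oo --> V.
Proof.
have c0 m : 0 <= cbin2 m by rewrite /cbin2 divr_ge0 ?mulr_ge0 ?sqr_ge0// exprn_ge0.
have h : has_lbound (range cbin2) by exists 0 => _ [m _ <-].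
exists (inf (range cbin2)); split.
  apply: lb_le_inf; first by exists (cbin2 0), 0.
  by move=> _ [m _ <-].
exact: nonincreasing_cvgn cbin2_noninc h.
Qed.
End binomial_ratio.

(** * Passage to the limit in the finite identity *)

Section theta.
Context {R : realType}.
Variable (a : R).
Hypothesis (a0 : 0 < a).
Implicit Types (w : R) (N : nat).

Definition rn N : R := (2 * N).+1%:R.
Definition mm (a : R) N : nat := Num.truncn ((rn N / a) ^+ 2).

Lemma rn_gt0 N : 0 < rn N. Proof. by rewrite /rn ltr0n. Qed.

Lemma rnV_cvg : (fun N => (rn N)^-1) @ \oo --> (0 : R).
Proof.
apply: (@squeeze_cvgr _ _ _ _ (fun=> 0) (@harmonic R)); last 2 first.
- exact: cvg_cst.
- exact: cvg_harmonic.
apply: nearW => N; rewrite invr_ge0 ltW ?rn_gt0//= /harmonic/=.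
by rewrite lef_pV2 ?posrE ?rn_gt0// /rn ler_nat; lia.
Qed.

Lemma mm_le N : (mm a N)%:R <= (rn N / a) ^+ 2.
Proof. by have /andP[] := truncn_itv (sqr_ge0 (rn N / a)). Qed.

Lemma mm_gt N : (rn N / a) ^+ 2 < (mm a N)%:R + 1.
Proof. by have /andP[_] := truncn_itv (sqr_ge0 (rn N / a)); rewrite natr1. Qed.

Lemma mm_cvg : (fun N => (mm a N)%:R / rn N ^+ 2) @ \oo --> a ^- 2.
Proof.
apply: (@squeeze_cvgr _ _ _ _ (fun N => a ^- 2 - (rn N)^-1 * (rn N)^-1) (fun=> a ^- 2)); last 2 first.
- have : (fun N => a ^- 2 - (rn N)^-1 * (rn N)^-1) @ \oo --> a ^- 2 - 0 * 0.
    by apply: cvgB; [exact: cvg_cst|apply: cvgM; exact: rnV_cvg].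
  by rewrite mulr0 subr0.
- exact: cvg_cst.
apply: nearW => N; have r0 := rn_gt0 N.
rewrite ler_pdivlMr ?exprn_gt0// ler_pdivrMr ?exprn_gt0//.
have := mm_le N; have := mm_gt N.
have -> : (rn N / a) ^+ 2 = a ^- 2 * rn N ^+ 2 by rewrite exprMn exprVn mulrC.
have -> : (a ^- 2 - (rn N)^-1 * (rn N)^-1) * rn N ^+ 2 = a ^- 2 * rn N ^+ 2 - 1.
  by field; rewrite gt_eqF// gt_eqF.
lra.
Qed.

Lemma mm_cvgy K : \forall N \near \oo, (K <= mm a N)%N.
Proof.
exists (Num.truncn (K.+1%:R * a ^+ 2)).+1 => // N /= KN.
have h1 : K.+1%:R * a ^+ 2 < N%:R.
  apply: lt_le_trans (_ : (Num.truncn (K.+1%:R * a ^+ 2)).+1%:R <= _); last by rewrite ler_nat.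
  by have /andP[] := truncn_itv (mulr_ge0 (ler0n R K.+1) (sqr_ge0 a)).
have h2 : N%:R <= rn N ^+ 2.
  rewrite /rn -natrX ler_nat; nia.
rewrite -ltnS -(ltr_nat R) -natr1; have := mm_gt N.
apply: lt_trans; rewrite exprMn exprVn ltr_pdivlMr ?exprn_gt0//.
apply: le_lt_trans (lt_le_trans h1 h2).
by rewrite ler_wpM2r ?sqr_ge0// ler_nat.
Qed.

Lemma rn_sin_cvg c : (fun N => rn N * sin (c / rn N)) @ \oo --> c.
Proof.
apply/cvgrPdist_le => e e0.
have : (fun N => `|c| ^+ 3 / 6 * (rn N)^-1) @ \oo --> (0 : R).
  by rewrite -(mulr0 (`|c| ^+ 3 / 6)); apply: cvgM; [exact: cvg_cst|exact: rnV_cvg].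
move=> /cvgrPdist_le/(_ _ e0); apply: filterS => N.
rewrite sub0r normrN ger0_norm; last first.
  by rewrite mulr_ge0 ?invr_ge0 ?(ltW (rn_gt0 N))// divr_ge0 ?exprn_ge0.
apply: le_trans; have r0 := rn_gt0 N.
have r1 : 1 <= rn N by rewrite /rn ler1n.
have -> : c - rn N * sin (c / rn N) = - (rn N * (sin (c / rn N) - c / rn N)).
  by field; lra.
rewrite normrN normrM (gtr0_norm r0).
apply: (@le_trans _ _ (rn N * (`|c / rn N| ^+ 3 / 6))).
  by apply: ler_wpM2l; [exact: ltW|exact: sin_dist].
rewrite normrM normfV (gtr0_norm r0).
have -> : rn N * ((`|c| / rn N) ^+ 3 / 6) = `|c| ^+ 3 / 6 * (rn N ^+ 2)^-1 by field; lra.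
rewrite ler_wpM2l ?divr_ge0 ?exprn_ge0// lef_pV2 ?posrE ?exprn_gt0//.
by rewrite ler_eXnr.
Qed.

Lemma cos_pow_cvg c : (fun N => cos (c / rn N) ^+ (2 * mm a N)) @ \oo --> expR (- (c ^+ 2 / a ^+ 2)).
Proof.
pose s N := sin (c / rn N) ^+ 2.
have sE N : cos (c / rn N) ^+ (2 * mm a N) = (1 - s N) ^+ mm a N.
  by rewrite exprM /s -[in RHS](cos2Dsin2 (c / rn N)); congr (_ ^+ _); ring.
under eq_fun do rewrite sE.
have ms : (fun N => (mm a N)%:R * s N) @ \oo --> c ^+ 2 / a ^+ 2.
  have -> : (fun N => (mm a N)%:R * s N) =
     (fun N => (rn N * sin (c / rn N)) * (rn N * sin (c / rn N)) * ((mm a N)%:R / rn N ^+ 2)).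
    by apply/funext => N; rewrite /s; have := rn_gt0 N => r0; field; lra.
  by apply: cvgM; [apply: cvgM; exact: rn_sin_cvg|exact: mm_cvg].
have s0 : s @ \oo --> (0 : R).
  have -> : s = (fun N => (rn N * sin (c / rn N)) * (rn N)^-1 * ((rn N * sin (c / rn N)) * (rn N)^-1)).
    by apply/funext => N; rewrite /s; have := rn_gt0 N => r0; field; lra.
  have -> : (0 : R) = (c * 0) * (c * 0) by ring.
  by apply: cvgM; apply: cvgM; [exact: rn_sin_cvg|exact: rnV_cvg|exact: rn_sin_cvg|exact: rnV_cvg].
have s1 : \forall N \near \oo, s N < 1.
  move/cvgrPdist_lt : s0 => /(_ _ ltr01); apply: filterS => N.
  by rewrite sub0r normrN; apply: le_lt_trans; exact: ler_norm.
have s_ge0 N : 0 <= s N by exact: sqr_ge0.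
have cE (f : nat -> R) l : f @ \oo --> l -> (fun N => expR (- f N)) @ \oo --> expR (- l).
  move=> fl; apply: continuous_cvg; first exact: continuous_expR.
  exact: cvgN.
apply: (@squeeze_cvgr _ _ _ _ (fun N => expR (- ((mm a N)%:R * (s N / (1 - s N)))))
    (fun N => expR (- ((mm a N)%:R * s N)))); last 2 first.
- apply: cE; under eq_fun do rewrite mulrA.
  have : (fun N => (mm a N)%:R * s N / (1 - s N)) @ \oo --> c ^+ 2 / a ^+ 2 * (1 - 0)^-1.
    apply: cvgM => //; apply: cvgV; first by rewrite subr0 oner_neq0.
    by apply: cvgB => //; exact: cvg_cst.
  by rewrite subr0 invr1 mulr1.
- exact: cE.
by apply: filterS s1 => N sN; rewrite pow1B_ge ?s_ge0//= pow1B_le// s_ge0/= ltW.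
Qed.

Lemma bratio_cvg (J : nat) :
  (fun N => bratio (mm a N) ((2 * N).+1 * J) : R) @ \oo --> expR (- (a ^+ 2 * J%:R ^+ 2)).
Proof.
pose r N : R := ((2 * N).+1 * J)%:R.
have rE N : r N = rn N * J%:R by rewrite /r natrM.
have Jr : (fun N => J%:R * (rn N)^-1) @ \oo --> (0 : R).
  by rewrite -(mulr0 (J%:R : R)); apply: cvgM; [exact: cvg_cst|exact: rnV_cvg].
have aV : a ^- 2 != 0 by rewrite invr_neq0// expf_neq0// gt_eqF.
have cp : (fun N => r N ^+ 2 / ((mm a N)%:R + r N)) @ \oo --> a ^+ 2 * J%:R ^+ 2.
  have -> : (fun N => r N ^+ 2 / ((mm a N)%:R + r N)) =
      (fun N => J%:R ^+ 2 * ((mm a N)%:R / rn N ^+ 2 + J%:R * (rn N)^-1)^-1).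
    apply/funext => N; have r0 := rn_gt0 N.
    rewrite -[J%:R ^+ 2 * _]/(J%:R ^+ 2 / _).
    have -> : (mm a N)%:R / rn N ^+ 2 + J%:R / rn N = ((mm a N)%:R + r N) / rn N ^+ 2.
      by rewrite rE; field; lra.
    by rewrite invf_div rE; ring.
  rewrite mulrC; apply: cvgM; first exact: cvg_cst.
  rewrite -[X in _ --> X]invrK; apply: cvgV => //.
  by rewrite -[X in _ --> X]addr0; apply: cvgD; [exact: mm_cvg|].
have cm0 : (fun N => (mm a N)%:R / rn N ^+ 2 - J%:R * (rn N)^-1) @ \oo --> a ^- 2.
  by rewrite -[X in _ --> X]subr0; apply: cvgB; [exact: mm_cvg|].
have cm : (fun N => r N ^+ 2 / ((mm a N)%:R - r N)) @ \oo --> a ^+ 2 * J%:R ^+ 2.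
  have -> : (fun N => r N ^+ 2 / ((mm a N)%:R - r N)) =
      (fun N => J%:R ^+ 2 * ((mm a N)%:R / rn N ^+ 2 - J%:R * (rn N)^-1)^-1).
    apply/funext => N; have r0 := rn_gt0 N.
    have -> : (mm a N)%:R / rn N ^+ 2 - J%:R * (rn N)^-1 = ((mm a N)%:R - r N) / rn N ^+ 2.
      by rewrite rE; field; lra.
    by rewrite invf_div rE; ring.
  rewrite mulrC; apply: cvgM; first exact: cvg_cst.
  by rewrite -[X in _ --> X]invrK; apply: cvgV.
have lt : \forall N \near \oo, ((2 * N).+1 * J < mm a N)%N.
  have a2 : 0 < a ^- 2 by rewrite invr_gt0 exprn_gt0.
  move/cvgrPdist_lt : (cm0) => /(_ _ a2); apply: filterS => N; have r0 := rn_gt0 N.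
  rewrite ltr_distlC subrr => /andP[+ _].
  have -> : (mm a N)%:R / rn N ^+ 2 - J%:R * (rn N)^-1 = ((mm a N)%:R - r N) / rn N ^+ 2.
    by rewrite rE; field; lra.
  by rewrite pmulr_lgt0 ?invr_gt0 ?exprn_gt0// subr_gt0 /r ltr_nat.
have cE (f : nat -> R) l : f @ \oo --> l -> (fun N => expR (- f N)) @ \oo --> expR (- l).
  move=> fl; apply: continuous_cvg; first exact: continuous_expR.
  exact: cvgN.
apply: (@squeeze_cvgr _ _ _ _ (fun N => expR (- (r N ^+ 2 / ((mm a N)%:R - r N))))
    (fun N => expR (- (r N ^+ 2 / ((mm a N)%:R + r N))))); [|exact: cE..].
apply: filterS lt => N lt; rewrite /r bratio_ge//= -natrD bratio_le//; first exact: ltnW.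
by lia.
Qed.

Definition thA_term w (k : int) : R := expR (- ((pi * (k%:~R - w)) ^+ 2 / a ^+ 2)).
Definition thB_term w (j : int) : R := expR (- (a ^+ 2 * j%:~R ^+ 2)) * cos (2 * pi * j%:~R * w).

Lemma sqr_natr_absz (j : int) : (`|j|%N%:R : R) ^+ 2 = j%:~R ^+ 2.
Proof. by rewrite natr_absz intr_norm -normrX ger0_norm// sqr_ge0. Qed.

Lemma expR_nat_sq (c : R) (j : int) : 0 <= c -> expR (- (c * j%:~R ^+ 2)) <= expR (- c) ^+ `|j|%N.
Proof.
move=> c0; rewrite -expRM_natl ler_expR mulrN lerN2 mulrC -sqr_natr_absz ler_wpM2l//.
by rewrite -natrX ler_nat; case: `|j|%N => // n; nia.
Qed.

(** When the binomial coefficient does not vanish, [m + r <= 2 m <= 2 (n / a)^2], so the bound of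
    [bratio_le] no longer depends on [N]. *)
Lemma thB_dom N (j : int) w :
  `|bratio (mm a N) ((2 * N).+1 * `|j|) * cos (2 * pi * j%:~R * w)|
    <= expR (- (a ^+ 2 / 2)) ^+ `|j|%N.
Proof.
rewrite normrM ger0_norm ?bratio_ge0//.
apply: (@le_trans _ _ (bratio (mm a N) ((2 * N).+1 * `|j|))).
  by rewrite ler_piMr ?bratio_ge0// cos_max.
have [->|j0] := eqVneq j 0; first by rewrite absz0 muln0 bratio0 expr0.
have [rm|mr] := leqP ((2 * N).+1 * `|j|) (mm a N); last first.
  by rewrite /bratio bin_small ?mul0r ?exprn_ge0 ?expR_ge0//; lia.
have m0 : (0 < mm a N)%N by apply: leq_trans rm; lia.
apply: le_trans (bratio_le rm m0) _.
apply: le_trans (_ : expR (- (a ^+ 2 / 2 * j%:~R ^+ 2)) <= _); last first.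
  by apply: expR_nat_sq; rewrite divr_ge0// sqr_ge0.
rewrite ler_expR lerN2 -sqr_natr_absz.
set J := `|j|%N.
have M0 : 0 < (mm a N + (2 * N).+1 * J)%:R :> R by rewrite ltr0n; lia.
rewrite ler_pdivlMr// natrM.
have h : (mm a N + (2 * N).+1 * J)%:R <= 2 * (rn N / a) ^+ 2.
  apply: (@le_trans _ _ (2 * (mm a N)%:R)); last by rewrite ler_wpM2l// mm_le.
  by rewrite -natrM ler_nat; move: rm; rewrite -/J; lia.
apply: (@le_trans _ _ (a ^+ 2 / 2 * J%:R ^+ 2 * (2 * (rn N / a) ^+ 2))).
  by rewrite ler_wpM2l// mulr_ge0 ?sqr_ge0// divr_ge0// sqr_ge0.
by rewrite -/(rn N) le_eqVlt; apply/orP; left; apply/eqP; field; rewrite gt_eqF.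
Qed.

Lemma thA_dom w : exists C z, [/\ 0 <= z < 1, 0 <= C &
  \forall N \near \oo, forall k : int, (`|k| <= N)%N ->
  `|cos (pi * (k%:~R - w) / rn N) ^+ (2 * mm a N)| <= C * z ^+ `|k|%N].
Proof.
(* 72 = 36 * 2: the 36 of [sin_sqr_ge], and a factor 2 for truncating [(rn N / a)^2] to an
   integer. *)
pose c := pi ^+ 2 / (72 * a ^+ 2).
have pi0 := @pi_gt0 R.
have c0 : 0 < c by rewrite divr_gt0 ?exprn_gt0// mulr_gt0// exprn_gt0.
exists (expR (c * w ^+ 2)), (expR (- (c / 2))); split; [|exact: expR_ge0|].
  by rewrite expR_ge0/= -expR0 ltr_expR oppr_lt0 divr_gt0.
exists (Num.truncn (10 * `|w|) + (Num.truncn (2 * a ^+ 2))).+1 => // N /= HN k kN.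
have hw : 10 * `|w| <= N%:R.
  have /andP[_] := truncn_itv (mulr_ge0 (ler0n R 10) (normr_ge0 w)).
  by move=> /ltW /le_trans; apply; rewrite ler_nat; apply: leq_trans HN; rewrite ltnS ?leq_addr ?leq_addl.
have ha : 2 * a ^+ 2 <= N%:R.
  have /andP[_] := truncn_itv (mulr_ge0 (ler0n R 2) (sqr_ge0 a)).
  by move=> /ltW /le_trans; apply; rewrite ler_nat; apply: leq_trans HN; rewrite ltnS ?leq_addr ?leq_addl.
have r0 := rn_gt0 N.
have rE : rn N = 2 * N%:R + 1 by rewrite /rn -natr1 natrM.
have N0 : 1 <= N%:R :> R by rewrite ler1n; lia.
set y := pi * (k%:~R - w) / rn N.
have y2 : `|y| <= 11 / 5.
  rewrite /y normrM normfV (gtr0_norm r0) ler_pdivrMr// normrM (gtr0_norm pi0).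
  have kw : `|k%:~R - w| <= N%:R + `|w|.
    apply: (le_trans (ler_normB _ _)); rewrite lerD2r -intr_norm.
    by rewrite -[leRHS]/(N%:Z%:~R) ler_int; lia.
  have pi4 : pi <= 4 :> R by have := @pihalf_lt2 R; lra.
  apply: (@le_trans _ _ (4 * (N%:R + `|w|))); first by apply: ler_pM => //; exact: ltW.
  rewrite rE; lra.
rewrite ger0_norm; last by rewrite mulnC exprM sqr_ge0.
have -> : cos y ^+ (2 * mm a N) = (1 - sin y ^+ 2) ^+ mm a N.
  by rewrite exprM -[in RHS](cos2Dsin2 y); congr (_ ^+ _); ring.
have s01 : 0 <= sin y ^+ 2 <= 1.
  by rewrite sqr_ge0 -(cos2Dsin2 y) lerDr sqr_ge0.
apply: le_trans (pow1B_le _ s01) _.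
apply: (@le_trans _ _ (expR (c * w ^+ 2) * expR (- (c / 2 * k%:~R ^+ 2)))); last first.
  by rewrite ler_wpM2l ?expR_ge0// expR_nat_sq// divr_ge0// ltW.
rewrite -expRD ler_expR.
have s36 := sin_sqr_ge y2.
have mg : (rn N / a) ^+ 2 / 2 <= (mm a N)%:R.
  have := mm_gt N; suff : 2 <= (rn N / a) ^+ 2 by lra.
  rewrite exprMn exprVn ler_pdivlMr ?exprn_gt0// rE; nra.
have : (rn N / a) ^+ 2 / 2 * (y ^+ 2 / 36) <= (mm a N)%:R * sin y ^+ 2.
  by apply: ler_pM => //; rewrite divr_ge0// sqr_ge0.
have -> : (rn N / a) ^+ 2 / 2 * (y ^+ 2 / 36) = c * (k%:~R - w) ^+ 2.
  by rewrite /y /c; field; rewrite !gt_eqF.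
have : c * ((k%:~R - w) ^+ 2 - (k%:~R ^+ 2 / 2 - w ^+ 2)) >= 0.
  apply: mulr_ge0; first exact: ltW.
  by move: (k%:~R : R) => x; have := sqr_ge0 (x - 2 * w); nra.
lra.
Qed.

Lemma thA_cvg w : (fun N => \sum_(k <- zs N) cos (pi * (k%:~R - w) / rn N) ^+ (2 * mm a N)) @ \oo
   --> tsum (thA_term w).
Proof.
have [C [z [z01 C0 dom]]] := thA_dom w.
pose u N (k : int) := if (`|k| <= N)%N then cos (pi * (k%:~R - w) / rn N) ^+ (2 * mm a N) else 0.
have -> : (fun N => \sum_(k <- zs N) cos (pi * (k%:~R - w) / rn N) ^+ (2 * mm a N)) =
  (fun N => \sum_(k <- zs N) u N k).
  apply/funext => N; apply: eq_big_seq => k; rewrite mem_zs => kN; rewrite /u ifT//; lia.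
apply: (@tannery_zs R u (thA_term w) id C z) => //.
- move=> k; have := @cos_pow_cvg (pi * (k%:~R - w)); apply: cvg_trans.
  apply: near_eq_cvg; exists (`|k|%N) => // N /= kN; by rewrite /u kN.
- apply: filterS dom => N dom k; rewrite /u; case: ifP => kN; first exact: dom.
  by rewrite normr0 mulr_ge0// exprn_ge0//; case/andP: z01.
- by move=> K; exists K.
Qed.

Lemma thB_cvg w : (fun N => \sum_(j <- zs (mm a N)) bratio (mm a N) ((2 * N).+1 * `|j|) * cos (2 * pi * j%:~R * w)) @ \oo
   --> tsum (thB_term w).
Proof.
apply: (@tannery_zs R (fun N j => bratio (mm a N) ((2 * N).+1 * `|j|) * cos (2 * pi * j%:~R * w))
  (thB_term w) (mm a) 1 (expR (- (a ^+ 2 / 2)))) => //.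
- by rewrite expR_ge0/= -expR0 ltr_expR oppr_lt0 divr_gt0// exprn_gt0.
- move=> j; apply: cvgM; last exact: cvg_cst.
  by rewrite -sqr_natr_absz; exact: bratio_cvg.
- by apply: nearW => N j; rewrite mul1r; exact: thB_dom.
- exact: mm_cvgy.
Qed.

(** Polya's identity divided by [4^m], in the limit. The constant is still expressed through the
    limit [V] of [cbin2]. *)
Lemma theta_raw w (V : R) : 0 <= V -> cbin2 @ \oo --> V ->
  tsum (thA_term w) = Num.sqrt (V * a ^+ 2 / 2) * tsum (thB_term w).
Proof.
move=> V0 cV.
pose kap N : R := rn N * 'C(2 * mm a N, mm a N)%:R / 4 ^+ mm a N.
have kap0 N : 0 <= kap N by rewrite divr_ge0 ?exprn_ge0// mulr_ge0// ltW ?rn_gt0.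
have E N : \sum_(k <- zs N) cos (pi * (k%:~R - w) / rn N) ^+ (2 * mm a N) =
   kap N * \sum_(j <- zs (mm a N)) bratio (mm a N) ((2 * N).+1 * `|j|) * cos (2 * pi * j%:~R * w).
  have p4 : 4 ^+ mm a N != 0 :> R by rewrite expf_neq0.
  apply: (mulfI p4); rewrite [LHS]mulr_sumr.
  transitivity (\sum_(k <- zs N) (2 * cos (pi * (k%:~R - w) / (2 * N).+1%:R)) ^+ (2 * mm a N)).
    have e4 : (2 : R) ^+ 2 = 4 by rewrite -natrX.
    by apply: eq_bigr => k _; rewrite exprMn (exprM 2 2) e4.
  rewrite polya_identity -/(rn N) mulrA /kap mulrCA divff// mulr1 -mulrA; congr (_ * _).
  rewrite mulr_sumr; apply: eq_bigr => j _; rewrite mulrA; congr (_ * _).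
  by rewrite /bratio mulrCA divff ?mulr1// pnatr_eq0 -lt0n bin_gt0; lia.
have ck : kap @ \oo --> Num.sqrt (V * a ^+ 2 / 2).
  have -> : kap = (fun N => Num.sqrt (cbin2 (mm a N) * (2 * ((mm a N)%:R / rn N ^+ 2) + (rn N)^-1 * (rn N)^-1)^-1)).
    apply/funext => N; rewrite -[LHS]ger0_norm// -sqrtr_sqr; congr Num.sqrt.
    have r0 := rn_gt0 N.
    have -> : 2 * ((mm a N)%:R / rn N ^+ 2) + (rn N)^-1 * (rn N)^-1 = (2 * mm a N + 1)%:R / rn N ^+ 2.
      by rewrite natrD natrM; field; lra.
    rewrite /kap /cbin2 invf_div.
    have -> : (16 : R) ^+ mm a N = 4 ^+ mm a N ^+ 2
      by rewrite -exprM mulnC exprM; congr (_ ^+ _); rewrite -natrX.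
    have p4 : 4 ^+ mm a N != 0 :> R by rewrite expf_neq0.
    have m1 : (2 * mm a N + 1)%:R != 0 :> R by rewrite pnatr_eq0 addn1.
    move: p4 m1; move: (4 ^+ mm a N) ((2 * mm a N + 1)%:R : R) => x y x0 y0.
    by field; rewrite x0 y0.
  apply: continuous_cvg; first exact: sqrt_continuous.
  rewrite -mulrA; apply: cvgM.
    apply: cvg_comp cV => A [K _ HK]; have [N0 _ HN0] := mm_cvgy K.
    by exists N0 => // N /= NN0; apply: HK; exact: HN0.
  have -> : a ^+ 2 / 2 = (2 * a ^- 2 + 0 * 0)^-1.
    by rewrite mulr0 addr0 invfM invrK mulrC.
  apply: cvgV; first by rewrite mulr0 addr0 mulf_neq0// invr_neq0// expf_neq0// gt_eqF.
  apply: cvgD; first by apply: cvgM; [exact: cvg_cst|exact: mm_cvg].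
  by apply: cvgM; exact: rnV_cvg.
have cA := @thA_cvg w; rewrite (funext E) in cA.
apply: (cvg_unique _ cA) => //; exact: (cvgM ck (@thB_cvg w)).
Qed.

Lemma tsum_ge (f : int -> R) C z n : 0 <= z < 1 -> 0 <= C ->
  (forall k, `|f k| <= C * z ^+ `|k|%N) -> (forall k, 0 <= f k) ->
  \sum_(k <- zs n) f k <= tsum f.
Proof.
move=> z01 C0 fC f0; rewrite sum_zs_fold.
apply: nondecreasing_cvgn_le; last first.
  apply: (@dom_series_cvg _ (fold f) (2 * C) z) => //; first by rewrite mulr_ge0.
  by apply: fold_bound => //; case/andP: z01.
apply/nondecreasing_seqP => m; rewrite /series/= big_nat_recr//= lerDl.
by case: m => [|m] /=; rewrite ?addr_ge0.
Qed.

Lemma thA_term_dom W w k : `|w| <= W ->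
  `|thA_term w k| <= expR (pi ^+ 2 / a ^+ 2 * W ^+ 2) * expR (- (pi ^+ 2 / a ^+ 2 / 2)) ^+ `|k|%N.
Proof.
move=> wW; rewrite ger0_norm ?expR_ge0// /thA_term.
set c := pi ^+ 2 / a ^+ 2.
have c0 : 0 <= c by rewrite divr_ge0// sqr_ge0.
apply: (@le_trans _ _ (expR (c * W ^+ 2) * expR (- (c / 2 * k%:~R ^+ 2)))); last first.
  by rewrite ler_wpM2l ?expR_ge0// expR_nat_sq// divr_ge0.
rewrite -expRD ler_expR.
have -> : (pi * (k%:~R - w)) ^+ 2 / a ^+ 2 = c * (k%:~R - w) ^+ 2 by rewrite /c exprMn mulrAC.
have w2 : w ^+ 2 <= W ^+ 2.
  by rewrite -(real_normK (num_real w)) lerXn2r ?nnegrE// (le_trans _ wW).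
have : c * ((k%:~R - w) ^+ 2 + W ^+ 2 - k%:~R ^+ 2 / 2) >= 0.
  apply: mulr_ge0 => //.
  by move: (k%:~R : R) => x; have := sqr_ge0 (x - 2 * w); nra.
lra.
Qed.

Lemma thB_term_dom w k :
  `|thB_term w k| <= 1 * expR (- a ^+ 2) ^+ `|k|%N.
Proof.
rewrite mul1r /thB_term normrM (ger0_norm (expR_ge0 _)).
apply: le_trans (expR_nat_sq _ _); last exact: sqr_ge0.
by rewrite ler_piMr ?expR_ge0// cos_max.
Qed.

Lemma expR_lt1 (c : R) : 0 < c -> 0 <= expR (- c) < 1.
Proof. by move=> c0; rewrite expR_ge0/= -expR0 ltr_expR oppr_lt0. Qed.
End theta.

(** * The constant of the theta identity, and uniformity *)

Section theta_identity.
Context {R : realType}.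

(** At [w = 0] the parameters [1] and [pi] exchange the two theta series. Applying the identity
    twice returns the first series multiplied by [pi V / 2], which must therefore be 1. *)
Lemma cbin2_lim (V : R) : 0 <= V -> cbin2 @ \oo --> V -> Num.sqrt (V / 2) = (Num.sqrt pi)^-1.
Proof.
move=> V0 cV; have pi0 := @pi_gt0 R.
have p10 : 0 < 1 :> R by [].
pose A := tsum (thA_term (1 : R) 0).
pose B := tsum (thB_term (1 : R) 0).
have Api : tsum (thA_term (pi : R) 0) = B.
  congr tsum; apply/funext => k; rewrite /thA_term /thB_term mulr0 cos0 mulr1 subr0.
  by congr (expR (- _)); field; lra.
have Bpi : tsum (thB_term (pi : R) 0) = A.
  congr tsum; apply/funext => k; rewrite /thA_term /thB_term mulr0 cos0 mulr1 subr0.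
  by congr (expR (- _)); field; lra.
have H1 := theta_raw p10 0 V0 cV.
have H2 := theta_raw pi0 0 V0 cV.
rewrite -/A -/B expr1n mulr1 in H1.
rewrite Api Bpi in H2.
have A0 : 0 < A.
  apply: lt_le_trans (_ : \sum_(k <- zs 0) thA_term (1 : R) 0 k <= _).
    by rewrite /= big_seq1 expR_gt0.
  apply: tsum_ge (@expR_lt1 R (pi ^+ 2 / 1 ^+ 2 / 2) _) (expR_ge0 (pi ^+ 2 / 1 ^+ 2 * 0 ^+ 2)) _ _.
  - by rewrite !divr_gt0// exprn_gt0.
  - by move=> k; apply: thA_term_dom => //; rewrite normr0.
  - by move=> k; exact: expR_ge0.
have V2 : 0 <= V / 2 by rewrite divr_ge0.
have e : Num.sqrt (V * pi ^+ 2 / 2) = Num.sqrt (V / 2) * pi.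
  have -> : V * pi ^+ 2 / 2 = V / 2 * pi ^+ 2 by ring.
  by rewrite sqrtrM// sqrtr_sqr gtr0_norm.
rewrite e {e} in H2; set s := Num.sqrt (V / 2) in H1 H2 *.
have s0 : 0 <= s := sqrtr_ge0 _.
have ss : s ^+ 2 * pi = 1.
  apply: (mulIf (lt0r_neq0 A0)); rewrite mul1r {2}H1 H2; ring.
rewrite -[RHS]sqrtrV; last exact: ltW.
have -> : pi^-1 = s ^+ 2 by apply: (mulIf (lt0r_neq0 pi0)); rewrite mulVf ?ss// lt0r_neq0.
by rewrite sqrtr_sqr ger0_norm.
Qed.

Theorem theta_identity (a w : R) : 0 < a ->
  tsum (thB_term a w) = Num.sqrt pi / a * tsum (thA_term a w).
Proof.
move=> a0; have [V [V0 cV]] := @cbin2_cvg R.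
have spi : Num.sqrt pi != 0 :> R by rewrite gt_eqF// sqrtr_gt0 pi_gt0.
rewrite (theta_raw a0 w V0 cV).
have -> : V * a ^+ 2 / 2 = V / 2 * a ^+ 2 by ring.
rewrite sqrtrM ?divr_ge0// sqrtr_sqr gtr0_norm// (cbin2_lim V0 cV).
by field; rewrite spi gt_eqF.
Qed.

(** Finite sums, uniformly for bounded [w]: in this form the identity can be averaged over the
    sphere without exchanging an integral and a series. *)
Theorem theta_uniform (a W e : R) : 0 < a -> 0 < e -> \forall n \near \oo,
  forall w, `|w| <= W ->
  `|\sum_(j <- zs n) thB_term a w j - Num.sqrt pi / a * \sum_(k <- zs n) thA_term a w k| <= e.
Proof.
move=> a0 e0; have pi0 := @pi_gt0 R.
set z1 := expR (- a ^+ 2).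
set z2 := expR (- (pi ^+ 2 / a ^+ 2 / 2)).
set C2 := expR (pi ^+ 2 / a ^+ 2 * W ^+ 2).
have z1l : 0 <= z1 < 1 by apply: expR_lt1; rewrite exprn_gt0.
have z2l : 0 <= z2 < 1 by apply: expR_lt1; rewrite !divr_gt0// exprn_gt0.
set c := Num.sqrt pi / a.
have c0 : 0 <= c by rewrite divr_ge0 ?sqrtr_ge0// ltW.
have t1 : (fun n => 2 * 1 / (1 - z1) * z1 ^+ n) @ \oo --> (0 : R).
  by apply: (@cvg_geometric R); rewrite ger0_norm; case/andP: z1l.
have t2 : (fun n => c * (2 * C2) / (1 - z2) * z2 ^+ n) @ \oo --> (0 : R).
  by apply: (@cvg_geometric R); rewrite ger0_norm; case/andP: z2l.
have e2 : 0 < e / 2 by rewrite divr_gt0.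
move/cvgrPdist_le : t1 => /(_ _ e2) t1.
move/cvgrPdist_le : t2 => /(_ _ e2) t2.
near=> n => w wW.
have h1 : `|0 - 2 * 1 / (1 - z1) * z1 ^+ n| <= e / 2 by near: n.
have h2 : `|0 - c * (2 * C2) / (1 - z2) * z2 ^+ n| <= e / 2 by near: n.
move: h1 h2; rewrite !sub0r !normrN => /(le_trans (ler_norm _)) h1 /(le_trans (ler_norm _)) h2.
have d1 := tsum_tail n z1l ler01 (@thB_term_dom R a a0 w).
have d2 := tsum_tail n z2l (expR_ge0 _) (fun k => thA_term_dom a0 k wW).
rewrite -/z1 in d1; rewrite -/z2 -/C2 in d2.
have := theta_identity w a0; rewrite -/c => E.
have -> : \sum_(j <- zs n) thB_term a w j - c * \sum_(k <- zs n) thA_term a w k =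
  - (tsum (thB_term a w) - \sum_(j <- zs n) thB_term a w j) +
  c * (tsum (thA_term a w) - \sum_(k <- zs n) thA_term a w k) by rewrite E; ring.
apply: (le_trans (ler_normD _ _)); rewrite normrN normrM (ger0_norm c0).
have d2' := ler_wpM2l c0 d2.
have z1p : 0 < 1 - z1 by rewrite subr_gt0; case/andP: z1l.
have z2p : 0 < 1 - z2 by rewrite subr_gt0; case/andP: z2l.
have zS (z : R) : 0 <= z < 1 -> z ^+ n.+1 <= z ^+ n.
  by move=> /andP[z0 z1']; rewrite exprS ler_piMl ?exprn_ge0// ltW.
have g1 : 2 * 1 * z1 ^+ n.+1 / (1 - z1) <= 2 * 1 / (1 - z1) * z1 ^+ n.
  by rewrite mulrAC ler_wpM2l ?zS// divr_ge0// ltW.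
have g2 : c * (2 * C2 * z2 ^+ n.+1 / (1 - z2)) <= c * (2 * C2) / (1 - z2) * z2 ^+ n.
  have -> : c * (2 * C2 * z2 ^+ n.+1 / (1 - z2)) = c * (2 * C2) / (1 - z2) * z2 ^+ n.+1 by ring.
  by rewrite ler_wpM2l ?zS// divr_ge0 ?(ltW z2p)// mulr_ge0// mulr_ge0// expR_ge0.
lra.
Unshelve. all: by end_near.
Qed.
End theta_identity.

(** * Poisson summation for spherical averages *)
Section sphere_kernel.
Context {R : realType}.
Notation RT := (measurableTypeR R).
Implicit Types (p th w : R) (k v : int * int).

Definition vnrm v : R := Num.sqrt (v.1%:~R ^+ 2 + v.2%:~R ^+ 2).

Definition zs2 n : seq (int * int) := [seq (i, j) | i <- zs n, j <- zs n].

Definition gdist th k (u : RT * RT) : R :=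
  (k.1%:~R - sph1 th u) ^+ 2 + (k.2%:~R - sph2 th u) ^+ 2.

(* [ek p th k] is the term at [k] of the series that Poisson summation associates
   with [\sum_v expR (- p ^+ 2 * |v| ^+ 2) * sinc (2 * pi * th * |v|)], [v] in Z^2:
   [sinc (2 * pi * th * |v|)] averages [cos (2 * pi * (v.w))] over the projections [w]
   to the plane of the points of the sphere of radius [th]. *)
Definition ek p th k : R := pi / p ^+ 2 *
  avg (fun u => expR (- (pi ^+ 2 / p ^+ 2 * gdist th k u))).

Lemma gdist_ok th k : avg_ok (gdist th k).
Proof.
have H c F : avg_ok F -> avg_ok (fun u => (c - F u) ^+ 2).
  move=> okF; apply: (avg_ok_comp (h := fun y => (c - y) ^+ 2)) => //.
  by apply: derivable_continuous => y; exact: ex_derive.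
by apply: avg_okD; apply: H; [exact: sph1_ok|exact: sph2_ok].
Qed.

Lemma expN_ok (c : R) F : avg_ok F -> avg_ok (fun u => expR (- (c * F u))).
Proof.
move=> okF; apply: (avg_ok_comp (h := fun y => expR (- (c * y)))) => //.
by apply: derivable_continuous => y; exact: ex_derive.
Qed.

Lemma avg_ge0 F : (forall u, 0 <= F u) -> 0 <= avg F :> R.
Proof.
move=> F0; rewrite /avg mulr_ge0 ?invr_ge0 ?mulr_ge0 ?pi_ge0//.
exact: Rintegral_ge0.
Qed.

Lemma ek_ge0 p th k : 0 <= ek p th k.
Proof.
rewrite /ek mulr_ge0 ?divr_ge0 ?pi_ge0 ?sqr_ge0//.
by apply: avg_ge0 => u; exact: expR_ge0.
Qed.

Lemma sph1_le th u : `|sph1 th u| <= `|th|.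
Proof.
rewrite /sph1 normrM ler_piMr// normrM mulr_ile1//.
  by rewrite ger0_norm ?sqrtr_ge0// sqrt_z_le1.
exact: cos_max.
Qed.

Lemma sph2_le th u : `|sph2 th u| <= `|th|.
Proof.
rewrite /sph2 normrM ler_piMr// normrM mulr_ile1//.
  by rewrite ger0_norm ?sqrtr_ge0// sqrt_z_le1.
exact: sin_max.
Qed.

Lemma sum_zs2 n (f : int * int -> R) :
  \sum_(v <- zs2 n) f v = \sum_(i <- zs n) \sum_(j <- zs n) f (i, j).
Proof. exact: big_allpairs. Qed.

Lemma sqrt_scale (c : R) v : 0 <= c ->
  Num.sqrt ((c * v.1%:~R) ^+ 2 + (c * v.2%:~R) ^+ 2) = c * vnrm v.
Proof.
move=> c0; rewrite !exprMn -mulrDr sqrtrM ?sqr_ge0// sqrtr_sqr ger0_norm//.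
Qed.

Lemma avg_cos2 th v : 0 <= th ->
  avg (fun u => cos (2 * pi * v.1%:~R * sph1 th u) * cos (2 * pi * v.2%:~R * sph2 th u))
  = sinc (2 * pi * th * vnrm v).
Proof.
move=> th0.
have pi0 := @pi_ge0 R.
have c0 : 0 <= 2 * pi * th by rewrite mulr_ge0// mulr_ge0.
pose a : R := 2 * pi * th * v.1%:~R.
pose b : R := 2 * pi * th * v.2%:~R.
pose F (s : R) (u : RT * RT) := a * sph1 1 u + (s * b) * sph2 1 u.
have okF s : avg_ok (F s).
  by apply: avg_okD; apply: avg_okM; [exact: avg_ok_cst|exact: sph1_ok|exact: avg_ok_cst|exact: sph2_ok].
have okc s : avg_ok (fun u => cos (F s u)) by apply: avg_ok_comp => //; exact: continuous_cos.
have -> : (fun u => cos (2 * pi * v.1%:~R * sph1 th u) * cos (2 * pi * v.2%:~R * sph2 th u)) =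
  (fun u => 2^-1 * (cos (F 1 u) + cos (F (-1) u))).
  apply/funext => u; rewrite /F mul1r mulN1r mulNr cosD cosB.
  have -> : 2 * pi * v.1%:~R * sph1 th u = a * sph1 1 u by rewrite /a /sph1; ring.
  have -> : 2 * pi * v.2%:~R * sph2 th u = b * sph2 1 u by rewrite /b /sph2; ring.
  by field.
rewrite avgZ; last exact: avg_okD.
rewrite avgD// /F !avg_cos_sinc mul1r mulN1r sqrrN -(sqrt_scale v c0) -/a -/b.
by field.
Qed.

(** Two one-dimensional theta identities, taken at the two coordinates of a point of the projected
    sphere, are multiplied and averaged. *)
Lemma avg_poisson p th (e : R) : 0 < p -> 0 <= th -> 0 < e -> \forall n \near \oo,
  `|\sum_(v <- zs2 n) expR (- (p ^+ 2 * (vnrm v) ^+ 2)) * sinc (2 * pi * th * vnrm v)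
    - \sum_(k <- zs2 n) ek p th k| <= e.
Proof.
move=> p0 th0 e0.
pose A n w := \sum_(j <- zs n) thB_term p w j.
pose E n w := Num.sqrt pi / p * \sum_(k <- zs n) thA_term p w k.
pose B := tsum (thB_term p 0).
have z01 : 0 <= expR (- p ^+ 2) < 1 by apply: expR_lt1; rewrite exprn_gt0.
have AB n w : `|A n w| <= B.
  apply: (@le_trans _ _ (\sum_(j <- zs n) thB_term p 0 j)).
    apply: (le_trans (ler_norm_sum _ _ _)); apply: ler_sum => j _.
    rewrite /thB_term normrM (ger0_norm (expR_ge0 _)) mulr0 cos0 mulr1.
    by rewrite ler_piMr ?expR_ge0// cos_max.
  apply: (tsum_ge n z01 ler01); first exact: thB_term_dom.
  by move=> j; rewrite /thB_term mulr0 cos0 mulr1 expR_ge0.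
have B0 : 0 <= B by apply: le_trans (AB 0%N 0).
(* With [d] this quotient, [d <= 1] and [d (2 B + d) <= e]; the left side is the error of a product
   of two factors bounded by [B], each known up to [d]. *)
have e'0 : 0 < e / (2 * B + 1 + e) by apply: divr_gt0 => //; lra.
have := theta_uniform th p0 e'0; apply: filterS => n Hn.
have {}Hn w : `|w| <= th -> `|A n w - E n w| <= e / (2 * B + 1 + e) by exact: Hn.
have D1 : 0 < 2 * B + 1 + e by lra.
have AE w w' : `|w| <= th -> `|w'| <= th -> `|A n w * A n w' - E n w * E n w'| <= e.
  move=> wth w'th; set d := e / (2 * B + 1 + e) in Hn e'0.
  have d1 : d <= 1 by rewrite /d ler_pdivrMr// mul1r; lra.
  have -> : A n w * A n w' - E n w * E n w' =
     (A n w - E n w) * A n w' + (A n w - (A n w - E n w)) * (A n w' - E n w') by ring.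
  apply: (@le_trans _ _ (d * B + (B + d) * d)).
    apply: (le_trans (ler_normD _ _)); rewrite !normrM lerD//; apply: ler_pM => //; try exact: Hn.
    by apply: (le_trans (ler_normB _ _)); rewrite lerD ?AB ?Hn.
  have -> : e = d * (2 * B + 1 + e) by rewrite /d divfK// gt_eqF.
  have -> : d * B + (B + d) * d = d * (2 * B + d) by ring.
  by apply: ler_wpM2l; [exact: ltW|lra].
have okA j (s : R -> RT * RT -> R) : avg_ok (s th) -> avg_ok (fun u => thB_term p (s th u) j).
  move=> oks; apply: (avg_ok_comp (h := fun y => thB_term p y j)) => //.
  by apply: derivable_continuous => y; exact: ex_derive.
have okE (k : int) (s : R -> RT * RT -> R) : avg_ok (s th) -> avg_ok (fun u => thA_term p (s th u) k).
  move=> oks; apply: (avg_ok_comp (h := fun y => thA_term p y k)) => //.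
  by apply: derivable_continuous => y; exact: ex_derive.
have ok1 := sph1_ok th; have ok2 := sph2_ok th.
have avgA : avg (fun u => A n (sph1 th u) * A n (sph2 th u)) =
  \sum_(v <- zs2 n) expR (- (p ^+ 2 * (vnrm v) ^+ 2)) * sinc (2 * pi * th * vnrm v).
  have -> : (fun u => A n (sph1 th u) * A n (sph2 th u)) =
    (fun u => \sum_(v <- zs2 n) thB_term p (sph1 th u) v.1 * thB_term p (sph2 th u) v.2).
    by apply/funext => u; rewrite sum_zs2 /A mulr_suml; apply: eq_bigr => i _; rewrite mulr_sumr.
  rewrite avg_sum; last by move=> v; apply: avg_okM; exact: okA.
  apply: eq_bigr => v _; rewrite -avg_cos2//.
  have -> : expR (- (p ^+ 2 * vnrm v ^+ 2)) = expR (- (p ^+ 2 * v.1%:~R ^+ 2)) * expR (- (p ^+ 2 * v.2%:~R ^+ 2)).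
    by rewrite -expRD /vnrm sqr_sqrtr ?addr_ge0 ?sqr_ge0//; congr expR; ring.
  rewrite -avgZ; last first.
    apply: avg_okM; [apply: (avg_ok_comp (h := fun y => cos (2 * pi * v.1%:~R * y)))|
       apply: (avg_ok_comp (h := fun y => cos (2 * pi * v.2%:~R * y)))] => //;
    by apply: derivable_continuous => y; exact: ex_derive.
  by congr avg; apply/funext => u; rewrite /thB_term; ring.
have avgE : avg (fun u => E n (sph1 th u) * E n (sph2 th u)) = \sum_(k <- zs2 n) ek p th k.
  have -> : (fun u => E n (sph1 th u) * E n (sph2 th u)) =
    (fun u => pi / p ^+ 2 * \sum_(k <- zs2 n) thA_term p (sph1 th u) k.1 * thA_term p (sph2 th u) k.2).
    apply/funext => u; rewrite sum_zs2 /E.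
    have -> : pi / p ^+ 2 = (Num.sqrt pi / p) * (Num.sqrt pi / p) :> R.
      by rewrite mulrACA -expr2 sqr_sqrtr ?pi_ge0// -invfM.
    rewrite mulrACA; congr (_ * _).
    by rewrite mulr_suml; apply: eq_bigr => i _; rewrite mulr_sumr.
  rewrite avgZ; last by apply: avg_ok_sum => k; apply: avg_okM; exact: okE.
  rewrite avg_sum; last by move=> k; apply: avg_okM; exact: okE.
  rewrite mulr_sumr; apply: eq_bigr => k _; rewrite /ek; congr (_ * avg _).
  apply/funext => u; rewrite /thA_term -expRD; congr expR.
  by rewrite /gdist; field; rewrite gt_eqF.
rewrite -avgA -avgE; apply: avg_dist.
- apply: avg_okM; apply: avg_ok_sum => j; exact: okA.
- apply: avg_okM; apply: avg_okM; rewrite ?/cst; try exact: avg_ok_cst; apply: avg_ok_sum => j; exact: okE.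
- move=> u _; apply: AE.
    by apply: le_trans (sph1_le th u) _; rewrite ger0_norm.
  by apply: le_trans (sph2_le th u) _; rewrite ger0_norm.
Qed.
End sphere_kernel.

(** * Size of the kernel *)
Section kernel_lower_bound.
Context {R : realType}.
Notation RT := (measurableTypeR R).
Notation mu := (@lebesgue_measure R).
Notation mu2 := (mu \x mu)%E.
Implicit Types (p th w : R) (k v : int * int).

Lemma avg_ge_rect F (z1 z2 t1 t2 m : R) : avg_ok F -> (forall u, 0 <= F u) ->
  0 <= m -> 0 <= z1 -> z1 <= z2 -> z2 <= 1 -> - pi <= t1 -> t1 <= t2 -> t2 <= pi ->
  (forall z t, z1 <= z <= z2 -> t1 <= t <= t2 -> m <= F (z, t)) ->
  m * ((z2 - z1) * (t2 - t1)) / (2 * pi) <= avg F.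
Proof.
move=> okF F0 m0 z10 z12 z21 t1p t12 t2p mF.
have pi0 := @pi_gt0 R.
rewrite /avg mulrC ler_wpM2l ?invr_ge0 ?mulr_ge0 ?(ltW pi0)//.
pose rect : set (RT * RT) := `[z1, z2] `*` `[t1, t2].
have mrect : measurable rect by exact: measurableX.
have sub : rect `<=` @avg_dom R.
  move=> [z t] [/=]; rewrite !in_itv/= => /andP[? ?] /andP[? ?].
  by split; rewrite /= in_itv/=; apply/andP; split; lra.
have iF := avg_ok_integrable okF.
have E : (mu2 rect = ((z2 - z1) * (t2 - t1))%:E)%E.
  rewrite [LHS](_ : _ = (mu [set` `[z1, z2]%R] * mu [set` `[t1, t2]%R])%E);
    last exact: product_measure1E.
  have H (x y : R) : x <= y -> mu [set` `[x, y]%R] = (y - x)%:E.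
    rewrite lebesgue_measure_itv/= lte_fin; case: ltP => // yx xy.
    by have -> : y = x; [apply/le_anti/andP|rewrite subrr].
  by rewrite !H// EFinM.
have -> : m * ((z2 - z1) * (t2 - t1)) = \int[mu2]_(u in rect) m.
  by rewrite Rintegral_cst//; congr (_ * _); exact: (esym (congr1 fine E)).
apply: (@le_trans _ _ (\int[mu2]_(u in rect) F u)).
  apply: le_Rintegral => //.
  - by have := avg_ok_integrable (avg_ok_cst m); apply: integrableS => //; exact: measurable_avg_dom.
  - by apply: integrableS iF => //; exact: measurable_avg_dom.
  - by move=> [z t] [/=]; rewrite !in_itv/=; exact: mF.
rewrite /Rintegral fine_le//.
- by apply: integrable_fin_num => //; apply: integrableS iF => //; exact: measurable_avg_dom.
- by apply: integrable_fin_num => //; exact: measurable_avg_dom.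
- apply: ge0_subset_integral => //; first exact: measurable_avg_dom.
  + by apply/measurable_EFinP; apply: measurable_funTS; case: okF.
  + by move=> u _; rewrite lee_fin.
Qed.

Lemma polar_angle (x y l : R) : 0 < l -> x ^+ 2 + y ^+ 2 = l ^+ 2 ->
  exists t, [/\ - pi <= t <= pi, x = l * cos t & y = l * sin t].
Proof.
move=> l0 xy.
have ll : (x / l) ^+ 2 + (y / l) ^+ 2 = 1.
  have -> : (x / l) ^+ 2 + (y / l) ^+ 2 = (x ^+ 2 + y ^+ 2) / l ^+ 2 by field; lra.
  by rewrite xy divff// expf_neq0// gt_eqF.
have x1 : -1 <= x / l <= 1.
  by have := sqr_ge0 (y / l) => h; apply/andP; split; nra.
have ac := acosK x1; have a0 := acos_ge0 x1; have api := acos_lepi x1.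
have sn : sin (acos (x / l)) ^+ 2 = (y / l) ^+ 2.
  by have := cos2Dsin2 (acos (x / l)); rewrite ac; lra.
have xE : x = l * cos (acos (x / l)) by rewrite ac mulrCA divff ?mulr1// gt_eqF.
have sg0 : 0 <= sin (acos (x / l)) by apply: sin_ge0_pi; rewrite a0 api.
have pi0 := @pi_ge0 R.
have [y0|y0] := leP 0 y.
  exists (acos (x / l)); split => //; first by apply/andP; split => //; lra.
  have yl : 0 <= y / l by rewrite divr_ge0// ltW.
  have -> : sin (acos (x / l)) = y / l.
    by apply/eqP; rewrite -(eqrXn2 (n := 2))//; apply/eqP.
  by rewrite mulrCA divff ?mulr1// gt_eqF.
exists (- acos (x / l)); rewrite cosN sinN; split => //; first by apply/andP; split; lra.
have yl : 0 <= - (y / l) by rewrite -mulNr divr_ge0 ?(ltW l0)//; lra.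
have -> : sin (acos (x / l)) = - (y / l).
  by apply/eqP; rewrite -(eqrXn2 (n := 2))// sqrrN; apply/eqP.
by rewrite opprK mulrCA divff ?mulr1// gt_eqF.
Qed.

Lemma gdist_polar th k (z t t0 l : R) : k.1%:~R = l * cos t0 -> k.2%:~R = l * sin t0 ->
  gdist th k (z, t) = (th * Num.sqrt (1 - z ^+ 2) - l) ^+ 2 +
     2 * (th * Num.sqrt (1 - z ^+ 2)) * l * (1 - cos (t - t0)).
Proof.
move=> k1 k2; rewrite /gdist k1 k2 /sph1 /sph2/= cosB.
set r := Num.sqrt _.
have c1 := cos2Dsin2 t; have c0 := cos2Dsin2 t0.
transitivity (l ^+ 2 * (cos t0 ^+ 2 + sin t0 ^+ 2) + (th * r) ^+ 2 * (cos t ^+ 2 + sin t ^+ 2)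
  - 2 * l * (th * r) * (cos t * cos t0 + sin t * sin t0)); first by ring.
rewrite c1 c0; ring.
Qed.

Lemma cos_ge_abs (x : R) : 1 - x ^+ 2 / 2 <= cos x.
Proof.
have [x0|x0] := leP 0 x; first exact: cos_ge.
by rewrite -cosN -sqrrN cos_ge// oppr_ge0 ltW.
Qed.

Lemma arc_near (t0 d : R) : - pi <= t0 <= pi -> 0 <= d <= 1 ->
  exists t1, [/\ - pi <= t1, t1 + d <= pi & forall t, t1 <= t <= t1 + d -> (t - t0) ^+ 2 <= d ^+ 2].
Proof.
move=> /andP[tl tr] /andP[d0 d1]; have pi2 := @pi_ge2 R.
have [h|h] := leP t0 0.
  exists t0; split; [lra|lra|move=> t /andP[? ?]].
  by rewrite lerXn2r ?nnegrE ?subr_ge0// lerBlDl.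
exists (t0 - d); split; [lra|lra|move=> t /andP[? ?]].
rewrite -sqrrN opprB lerXn2r ?nnegrE ?subr_ge0//; lra.
Qed.

(** [z1] and [z2] are the heights at which the parallel of the sphere of radius [th] has radius [l]
    and [l - p]. Here [z2^2 - z1^2] is of order [p / l], and [z1 + z2] is at most of order
    [sqrt ((p + th - l) / l)]. *)
Lemma shell_width (p l th z1 z2 : R) : 0 < p <= 1 -> 1 <= l -> 0 <= th - l <= 1 ->
  0 <= z1 -> 0 <= z2 ->
  z1 ^+ 2 = 1 - (l / th) ^+ 2 -> z2 ^+ 2 = 1 - ((l - p) / th) ^+ 2 ->
  p / (16 * Num.sqrt l * Num.sqrt (p + (th - l))) <= z2 - z1.
Proof.
move=> /andP[p0 p1] l1 /andP[om0 om1] z10 z20 z1s z2s.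
have l0 : 0 < l by exact: lt_le_trans l1.
have th0 : 0 < th by apply: lt_le_trans l0 _; rewrite -subr_ge0.
have po : 0 < p + (th - l) by rewrite ltr_wpDr.
have sl0 : 0 < Num.sqrt l by rewrite sqrtr_gt0.
have so0 : 0 < Num.sqrt (p + (th - l)) by rewrite sqrtr_gt0.
have sl2 : Num.sqrt l ^+ 2 = l by rewrite sqr_sqrtr// ltW.
have so2 : Num.sqrt (p + (th - l)) ^+ 2 = p + (th - l) by rewrite sqr_sqrtr// ltW.
move: (Num.sqrt l) (Num.sqrt (p + (th - l))) sl0 so0 sl2 so2 => sl so sl0 so0 sl2 so2.
have zd : (z2 - z1) * (z2 + z1) = p * (2 * l - p) / th ^+ 2.
  have -> : (z2 - z1) * (z2 + z1) = z2 ^+ 2 - z1 ^+ 2 by ring.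
  by rewrite z1s z2s; field; rewrite gt_eqF.
have zd0 : 0 < p * (2 * l - p) / th ^+ 2.
  by rewrite divr_gt0 ?exprn_gt0// mulr_gt0//; clear -p1 l1; lra.
have z12 : z1 < z2.
  rewrite -subr_gt0 -(pmulr_lgt0 _ (_ : 0 < z2 + z1)) ?zd//.
  by rewrite lt_def addr_ge0// andbT; apply: contraTneq zd0 => h; rewrite -zd h mulr0 ltxx.
have z2pos : 0 < z2 by apply: le_lt_trans z12.
have z2b : z2 * sl <= 2 * so.
  rewrite -(@ler_pXn2r _ 2)// ?nnegrE ?mulr_ge0 ?(ltW sl0) ?(ltW so0)//.
  rewrite !exprMn sl2 so2 z2s.
  have -> : (1 - ((l - p) / th) ^+ 2) * l = (p + (th - l)) * (th + l - p) * l / th ^+ 2.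
    by field; rewrite gt_eqF.
  rewrite ler_pdivrMr ?exprn_gt0//.
  have h : (th + l - p) * l <= 4 * th ^+ 2 by clear -p0 l1 om0; nra.
  by have := ler_wpM2l (ltW po) h; clear; lra.
have zge : p / (4 * l) / (2 * z2) <= z2 - z1.
  have zs : 0 < z2 + z1 by rewrite ltr_wpDr.
  have -> : z2 - z1 = p * (2 * l - p) / th ^+ 2 / (z2 + z1) by rewrite -zd mulfK// gt_eqF.
  apply: ler_pM.
  - by rewrite divr_ge0 ?(ltW p0) ?mulr_ge0 ?(ltW l0).
  - by rewrite invr_ge0 mulr_ge0.
  - rewrite -mulrA ler_wpM2l ?(ltW p0)// ler_pdivlMr ?exprn_gt0// mulrC ler_pdivrMr ?mulr_gt0//.
    clear -p0 p1 l1 om0 om1; nra.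
  - by rewrite lef_pV2 ?posrE ?mulr_gt0//; clear -z12; lra.
apply: le_trans zge.
have -> : p / (4 * l) / (2 * z2) = p / (8 * sl * (z2 * sl)).
  by rewrite -{1}sl2; field; rewrite !gt_eqF.
rewrite ler_wpM2l ?(ltW p0)// lef_pV2 ?posrE ?mulr_gt0//.
by have := ler_wpM2l (ltW sl0) z2b; clear; lra.
Qed.

Lemma gdist_shell (p l r c d : R) : 0 < l -> 0 <= r -> l - p <= r <= l -> 0 <= p ->
  0 <= 1 - c <= (p / l) ^+ 2 / 2 -> (r - l) ^+ 2 + 2 * r * l * (1 - c) <= 2 * p ^+ 2.
Proof.
move=> l0 r0 /andP[lr rl] p0 /andP[c0 c1].
have a1 : (r - l) ^+ 2 <= p ^+ 2.
  by rewrite -sqrrN opprB lerXn2r ?nnegrE ?subr_ge0//; clear -lr; lra.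
have a3 : 2 * r * l * (1 - c) <= 2 * l * l * ((p / l) ^+ 2 / 2).
  apply: ler_pM; rewrite ?mulr_ge0 ?(ltW l0)//.
  by rewrite ler_wpM2r ?(ltW l0)// ler_wpM2l.
have a4 : 2 * l * l * ((p / l) ^+ 2 / 2) = p ^+ 2 by field; rewrite gt_eqF.
by move: a3; rewrite a4; clear -a1; lra.
Qed.

Lemma shell_range (th l z zl : R) : 0 < th -> 0 <= l -> zl ^+ 2 = 1 - (l / th) ^+ 2 ->
  (zl ^+ 2 <= z ^+ 2 -> th * Num.sqrt (1 - z ^+ 2) <= l) *
  (z ^+ 2 <= zl ^+ 2 -> l <= th * Num.sqrt (1 - z ^+ 2)).
Proof.
move=> th0 l0 zls.
have E : l = th * Num.sqrt ((l / th) ^+ 2).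
  by rewrite sqrtr_sqr ger0_norm ?divr_ge0 ?(ltW th0)// mulrC divfK// gt_eqF.
by split => h; rewrite [in X in is_true X]E ler_wpM2l ?(ltW th0)// ler_wsqrtr//; lra.
Qed.

(** Where the parallel has radius between [l - p] and [l] and the longitude is within [p / l] of
    that of [k], the squared distance to [k] is at most [2 p^2]. In the coordinates of [avg_dom]
    this region contains a rectangle whose sides are given by [shell_width] and by [p / l]. *)
Lemma ek_lower p (l om : R) k : 0 < p <= 1 -> 1 <= l -> vnrm k = l -> 0 <= om <= 1 ->
  expR (- (2 * pi ^+ 2)) / 32 / (l * Num.sqrt l * Num.sqrt (p + om)) <= ek p (l + om) k.
Proof.
move=> p01 l1 kl om01.
have /andP[p0 p1] := p01; have /andP[om0 om1] := om01.
have l0 : 0 < l by exact: lt_le_trans l1.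
have [th thE] : exists th, th = l + om by eexists.
have omE : om = th - l by rewrite thE; ring.
rewrite -thE; rewrite {}omE in om01 om0 *.
have th0 : 0 < th by apply: lt_le_trans l0 _; rewrite -subr_ge0.
have pi0 := @pi_gt0 R.
have kk : (k.1%:~R : R) ^+ 2 + (k.2%:~R : R) ^+ 2 = l ^+ 2.
  by rewrite -kl /vnrm sqr_sqrtr// addr_ge0// sqr_ge0.
have [t0 [t0b k1 k2]] := polar_angle l0 kk.
have lp : 0 <= l - p by rewrite subr_ge0 (le_trans p1).
have lt1 : (l - p) / th <= l / th by rewrite ler_wpM2r ?invr_ge0 ?(ltW th0)// gerBl ltW.
have lt0 : 0 <= (l - p) / th by rewrite divr_ge0// ltW.
have lt1' : ((l - p) / th) ^+ 2 <= (l / th) ^+ 2 by rewrite lerXn2r ?nnegrE// (le_trans lt0).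
have e1 : 0 <= 1 - (l / th) ^+ 2.
  rewrite subr_ge0 expr_le1 ?(le_trans lt0)// ler_pdivrMr// mul1r -subr_ge0//.
have e2 : 0 <= 1 - ((l - p) / th) ^+ 2 by apply: le_trans e1 _; rewrite lerD2l lerN2.
have [z1 [z10 z1s]] : exists z1 : R, 0 <= z1 /\ z1 ^+ 2 = 1 - (l / th) ^+ 2.
  by exists (Num.sqrt (1 - (l / th) ^+ 2)); rewrite sqrtr_ge0 sqr_sqrtr.
have [z2 [z20 z2s]] : exists z2 : R, 0 <= z2 /\ z2 ^+ 2 = 1 - ((l - p) / th) ^+ 2.
  by exists (Num.sqrt (1 - ((l - p) / th) ^+ 2)); rewrite sqrtr_ge0 sqr_sqrtr.
have z12 : z1 <= z2 by rewrite -(@ler_pXn2r _ 2)// ?nnegrE// z1s z2s lerD2l lerN2.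
have z21 : z2 <= 1 by rewrite -(@ler_pXn2r _ 2)// ?nnegrE// z2s expr1n gerBl sqr_ge0.
have pl01 : 0 <= p / l <= 1.
  by rewrite divr_ge0 ?(ltW p0) ?(ltW l0)//= ler_pdivrMr// mul1r (le_trans p1).
have [t1 [t1p t2p tt]] := arc_near t0b pl01.
have okF : avg_ok (fun u => expR (- (pi ^+ 2 / p ^+ 2 * gdist th k u))).
  by apply: expN_ok; exact: gdist_ok.
have Fm z t : z1 <= z <= z2 -> t1 <= t <= t1 + p / l ->
    expR (- (2 * pi ^+ 2)) <= expR (- (pi ^+ 2 / p ^+ 2 * gdist th k (z, t))).
  move=> /andP[zl zr] /tt ht; rewrite ler_expR lerN2.
  have z0 := le_trans z10 zl.
  have zs1 : z1 ^+ 2 <= z ^+ 2 by rewrite lerXn2r ?nnegrE.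
  have zs2 : z ^+ 2 <= z2 ^+ 2 by rewrite lerXn2r ?nnegrE.
  have rl := (shell_range z th0 (ltW l0) z1s).1 zs1.
  have lr := (shell_range z th0 lp z2s).2 zs2.
  have g : gdist th k (z, t) <= 2 * p ^+ 2.
    rewrite (gdist_polar th z t k1 k2); apply: gdist_shell => //.
    - by rewrite mulr_ge0 ?sqrtr_ge0// ltW.
    - by rewrite lr.
    - exact: ltW.
    - rewrite subr_ge0 cos_le1/=; have := cos_ge_abs (t - t0); clear -ht; lra.
  apply: (@le_trans _ _ (pi ^+ 2 / p ^+ 2 * (2 * p ^+ 2))).
    by rewrite ler_wpM2l// divr_ge0// sqr_ge0.
  by rewrite mulrCA divfK// expf_neq0// gt_eqF.
have t12 : t1 <= t1 + p / l by rewrite lerDl; case/andP: pl01.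
have := avg_ge_rect okF (fun u => expR_ge0 _) (expR_ge0 (- (2 * pi ^+ 2))) z10 z12 z21 t1p t12 t2p Fm.
have -> : t1 + p / l - t1 = p / l by ring.
have := shell_width p01 l1 om01 z10 z20 z1s z2s.
have so0 : 0 < Num.sqrt (p + (th - l)) by rewrite sqrtr_gt0 ltr_wpDr.
have sl0 : 0 < Num.sqrt l by rewrite sqrtr_gt0.
have e0 : 0 <= expR (- (2 * pi ^+ 2)) :> R by exact: expR_ge0.
rewrite /ek; set A := avg _; clearbody A.
move: (expR (- (2 * pi ^+ 2))) (Num.sqrt l) (Num.sqrt (p + (th - l))) e0 sl0 so0 => e sl so e0 sl0 so0 zz H.
apply: (@le_trans _ _ (pi / p ^+ 2 * (e * (p / (16 * sl * so) * (p / l)) / (2 * pi)))).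
  have -> : pi / p ^+ 2 * (e * (p / (16 * sl * so) * (p / l)) / (2 * pi)) =
      e / 32 / (l * sl * so); last by [].
  by move: (pi : R) pi0 => P P0; field; rewrite !gt_eqF.
rewrite ler_wpM2l ?divr_ge0 ?sqr_ge0 ?(ltW pi0)//.
apply: le_trans H.
rewrite ler_wpM2r ?invr_ge0 ?mulr_ge0 ?(ltW pi0)// ler_wpM2l//.
by rewrite ler_wpM2r//; case/andP: pl01.
Qed.
End kernel_lower_bound.

(** * Upper bounds for the kernel away from the origin *)

Section kernel_upper_bound.
Context {R : realType}.
Notation RT := (measurableTypeR R).
Notation mu := (@lebesgue_measure R).
Implicit Types (p q th w : R) (k v : int * int).

Lemma expN_le_inv (y : R) : 0 <= y -> expR (- y) <= 1 / (1 + y).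
Proof.
move=> y0; rewrite expRN div1r lef_pV2 ?posrE ?expR_gt0//; [exact: expR_ge1Dx|lra].
Qed.

Lemma expN_le_inv2 (y : R) : 0 <= y -> expR (- y) <= 4 / (1 + y) ^+ 2.
Proof.
move=> y0; have -> : - y = - (y / 2) + - (y / 2) by field.
rewrite expRD.
have h : expR (- (y / 2)) <= 2 / (1 + y).
  apply: (le_trans (expN_le_inv _)); first lra.
  by rewrite ler_pdivrMr; [rewrite mulrAC ler_pdivlMr; lra|lra].
have -> : 4 / (1 + y) ^+ 2 = (2 / (1 + y)) * (2 / (1 + y)) by field; lra.
by apply: ler_pM => //; exact: expR_ge0.
Qed.

Lemma cauchy_cont (c y0 : R) : 0 < c -> continuous (fun y : R => 1 / (1 + (y - y0) ^+ 2 / c)).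
Proof.
move=> c0; apply: derivable_continuous => y.
have h : 1 + (y - y0) ^+ 2 / c != 0 by rewrite gt_eqF// ltr_wpDr// divr_ge0 ?sqr_ge0// ltW.
have H := @dinv R (fun y => 1 + (y - y0) ^+ 2 / c) y _ h _.
have E : is_derive y (1 : R) (fun y => 1 + (y - y0) ^+ 2 / c) (2 * (y - y0) / c).
  by apply: is_derive_eq; rewrite /GRing.scale/=; ring.
have {}H := H _ E.
exact: ex_derive.
Qed.

(** In the upper bounds Gaussians are replaced by Cauchy kernels, whose primitive is the
    arctangent. *)
Lemma cauchy_integral (c y0 a b : R) : 0 < c -> a <= b ->
  \int[mu]_(y in `[a, b]) (1 / (1 + (y - y0) ^+ 2 / c)) <= pi * Num.sqrt c.
Proof.
move=> c0 ab; have s0 : 0 < Num.sqrt c by rewrite sqrtr_gt0.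
have ss : Num.sqrt c ^+ 2 = c by rewrite sqr_sqrtr// ltW.
have D (y : R) : y \in `[a, b] -> is_derive y (1 : R) (fun y => Num.sqrt c * atan ((y - y0) / Num.sqrt c))
    (1 / (1 + (y - y0) ^+ 2 / c)).
  move=> _; apply: is_derive_eq; rewrite /GRing.scale/=.
  have := sqr_ge0 (y - y0) => h.
  rewrite -[in RHS]ss; field; rewrite ss; apply/andP; split; first by rewrite gt_eqF//; lra.
  by rewrite gt_eqF//; lra.
rewrite (Rint_FTC ab D); last by move=> y _; exact: cauchy_cont.
rewrite -mulrBr mulrC ler_wpM2r ?(ltW s0)//.
have := atan_ltpi2 ((b - y0) / Num.sqrt c); have := atan_gtNpi2 ((a - y0) / Num.sqrt c); lra.
Qed.

Lemma cos_quad_ge (x : R) : `|x| <= pi -> x ^+ 2 / 72 <= 1 - cos x.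
Proof.
move=> xp; have p2 : pi <= 4 :> R by have [/andP[_]] := @pihalf_02_cos_pihalf R; lra.
have -> : 1 - cos x = 2 * sin (x / 2) ^+ 2.
  have E : x = x / 2 + x / 2 by field.
  by rewrite {1}E cosD -expr2 -expr2; have := cos2Dsin2 (x / 2); lra.
have h : `|x / 2| <= 11 / 5 by rewrite normrM (@ger0_norm _ 2^-1)//; lra.
by have := sin_sqr_ge h; rewrite exprMn; lra.
Qed.

(** [t - t0] lies between [- 2 pi] and [2 pi], so one of three translates brings it to [[- pi, pi]],
    where [1 - cos y >= y^2 / 72]. The scale [(20 q)^2] rounds up [72 * 16 / 3 * q^2]. *)
Lemma cos_major (q t t0 : R) : 0 < q -> - pi <= t <= pi -> - pi <= t0 <= pi ->
  expR (- (3 * (1 - cos (t - t0)) / (16 * q ^+ 2))) <=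
  1 / (1 + (t - (t0 - 2 * pi)) ^+ 2 / (20 * q) ^+ 2) + 1 / (1 + (t - t0) ^+ 2 / (20 * q) ^+ 2)
   + 1 / (1 + (t - (t0 + 2 * pi)) ^+ 2 / (20 * q) ^+ 2).
Proof.
move=> q0 /andP[tl tr] /andP[t0l t0r].
have g (y : R) : 0 <= 1 / (1 + y ^+ 2 / (20 * q) ^+ 2).
  by rewrite divr_ge0// addr_ge0// divr_ge0// sqr_ge0.
have H (y : R) : `|y| <= pi -> cos y = cos (t - t0) ->
    expR (- (3 * (1 - cos (t - t0)) / (16 * q ^+ 2))) <= 1 / (1 + y ^+ 2 / (20 * q) ^+ 2).
  move=> yp <-; have cy := cos_quad_ge yp.
  apply: le_trans (expN_le_inv _); last by rewrite divr_ge0// sqr_ge0.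
  rewrite ler_expR lerN2.
  have -> : y ^+ 2 / (20 * q) ^+ 2 = y ^+ 2 * (1 / 25) / (16 * q ^+ 2) by field; lra.
  by rewrite ler_wpM2r ?invr_ge0 ?mulr_ge0 ?sqr_ge0//; have := sqr_ge0 y; lra.
have g1 := g (t - (t0 - 2 * pi)); have g2 := g (t - t0); have g3 := g (t - (t0 + 2 * pi)).
have [h|h] := leP (t - t0) (- pi).
  apply: (@le_trans _ _ (1 / (1 + (t - (t0 - 2 * pi)) ^+ 2 / (20 * q) ^+ 2))); last lra.
  apply: H; first by rewrite ler_norml; apply/andP; split; lra.
  have -> : t - (t0 - 2 * pi) = (t - t0) + pi *+ 2 by ring.
  by rewrite cosD2pi.
have [h'|h'] := leP (t - t0) pi.
  apply: (@le_trans _ _ (1 / (1 + (t - t0) ^+ 2 / (20 * q) ^+ 2))); last lra.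
  by apply: H => //; rewrite ler_norml; apply/andP; split; lra.
apply: (@le_trans _ _ (1 / (1 + (t - (t0 + 2 * pi)) ^+ 2 / (20 * q) ^+ 2))); last lra.
apply: H; first by rewrite ler_norml; apply/andP; split; lra.
have -> : t - t0 = (t - (t0 + 2 * pi)) + pi *+ 2 by ring.
by rewrite cosD2pi.
Qed.

Lemma quartic_major (q x y : R) : 0 < q -> x ^+ 2 / 4 <= `|y| ->
  expR (- (3 / 2 * y ^+ 2 / q ^+ 2)) <= 3 * (1 / (1 + x ^+ 2 / q)).
Proof.
move=> q0 xy.
have y2 : (x ^+ 2 / 4) ^+ 2 <= y ^+ 2.
  by rewrite -(real_normK (num_real y)) lerXn2r ?nnegrE// divr_ge0 ?sqr_ge0.
set s := x ^+ 2 / q.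
have s0 : 0 <= s by rewrite divr_ge0 ?sqr_ge0// ltW.
apply: (@le_trans _ _ (expR (- (3 * s ^+ 2 / 32)))).
  rewrite ler_expR lerN2.
  have -> : 3 * s ^+ 2 / 32 = 3 / 2 * (x ^+ 2 / 4) ^+ 2 / q ^+ 2 by rewrite /s; field; lra.
  by rewrite ler_wpM2r ?invr_ge0 ?sqr_ge0// ler_wpM2l.
apply: (le_trans (expN_le_inv _)); first by have := sqr_ge0 s; lra.
rewrite ler_pdivrMr; last by have := sqr_ge0 s; lra.
rewrite mulrA mulr1 mulrAC ler_pdivlMr; last lra.
nra.
Qed.

(** Near the rim the radius of a parallel varies quadratically with its height. A Gaussian of width
    [q] in the radius thus becomes, in [quartic_major], a bump of width [sqrt q] in the height. *)
Lemma radial_major (th l z : R) : 0 < th -> 0 <= z <= 1 -> 1 <= l -> l < 2 * th ->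
  (z - Num.sqrt (1 - (l / th) ^+ 2)) ^+ 2 / 4 <= `|th * Num.sqrt (1 - z ^+ 2) - l|.
Proof.
move=> th0 /andP[z0' z1] l1 lth; set z0 := Num.sqrt _.
set r := Num.sqrt (1 - z ^+ 2).
have zz : z ^+ 2 <= 1 by nra.
have r0 : 0 <= r := sqrtr_ge0 _.
have rs : r ^+ 2 = 1 - z ^+ 2 by rewrite sqr_sqrtr//; lra.
have r1 : r <= 1 by have := sqr_ge0 z => h; nra.
have [lt|lt] := leP l th.
  have q1 : (l / th) ^+ 2 <= 1.
    by rewrite expr_le1// ?divr_ge0 ?(ltW th0)//; [rewrite ler_pdivrMr ?mul1r|lra].
  have z00 : 0 <= z0 := sqrtr_ge0 _.
  have zs : z0 ^+ 2 = 1 - (l / th) ^+ 2 by rewrite sqr_sqrtr//; lra.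
  have E : (th * r - l) * (th * r + l) = th ^+ 2 * (z0 ^+ 2 - z ^+ 2).
    rewrite zs; have -> : (th * r - l) * (th * r + l) = th ^+ 2 * r ^+ 2 - l ^+ 2 by ring.
    by rewrite rs; field; lra.
  have E' : `|th * r - l| * (th * r + l) = th ^+ 2 * (`|z - z0| * (z + z0)).
    have n1 : `|th * r + l| = th * r + l by rewrite ger0_norm// addr_ge0 ?mulr_ge0 ?(ltW th0)//; lra.
    rewrite -{1}n1 -normrM E normrM ger0_norm ?sqr_ge0//; congr (_ * _).
    have -> : z0 ^+ 2 - z ^+ 2 = - (z - z0) * (z + z0) by ring.
    by rewrite normrM normrN (@ger0_norm _ (z + z0))// addr_ge0.
  have s1 : (z - z0) ^+ 2 <= `|z - z0| * (z + z0).
    rewrite -(real_normK (num_real (z - z0))) expr2 ler_wpM2l//.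
    by rewrite ler_norml; apply/andP; split; lra.
  have tl : 0 < th * r + l by rewrite ltr_wpDl ?mulr_ge0 ?(ltW th0)//; lra.
  have tl2 : th * r + l <= 2 * th by nra.
  have n0 := normr_ge0 (th * r - l).
  have := sqr_ge0 (z - z0) => h2.
  have h3 : th ^+ 2 * (z - z0) ^+ 2 <= `|th * r - l| * (2 * th).
    apply: (le_trans (ler_wpM2l (sqr_ge0 th) s1)).
    by rewrite -E' ler_wpM2l.
  have h4 : th * (z - z0) ^+ 2 <= `|th * r - l| * 2.
    by rewrite -(ler_pM2l th0); nra.
  nra.
(* Beyond the rim the square root of a negative number is 0, so [z0] is the height of the equator,
   the part of the sphere closest to [k]. *)
have zE : z0 = 0.
  rewrite /z0 ler0_sqrtr// subr_le0 -[leLHS](expr1n _ 2) lerXn2r ?nnegrE//.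
    by rewrite divr_ge0 ?(ltW th0)//; lra.
  by rewrite ler_pdivlMr// mul1r ltW.
rewrite zE subr0.
have : th * r <= th * (1 - z ^+ 2 / 2).
  rewrite ler_wpM2l ?(ltW th0)//.
  by rewrite -(@ler_pXn2r _ 2)// ?nnegrE; [rewrite rs; nra|lra].
have := sqr_ge0 z => h h'.
rewrite ler0_norm; last nra.
nra.
Qed.

(** If [r >= l / 2] the angular term has a coefficient at least 1; otherwise half of the radial term
    is at least 1/8 and pays for the angular one. *)
Lemma gdist_split (l r c : R) : 1 <= l -> 0 <= r -> -1 <= c <= 1 ->
  (r - l) ^+ 2 / 2 + (1 - c) / 16 <= (r - l) ^+ 2 + 2 * r * l * (1 - c).
Proof.
move=> l1 r0 /andP[c1 c2].
have [h|h] := leP (l / 2) r.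
  have : 1 <= 2 * r * l by nra.
  have := sqr_ge0 (r - l) => ? ?; nra.
have : 1 / 4 <= (r - l) ^+ 2 by nra.
have : 0 <= 2 * r * l * (1 - c) by rewrite !mulr_ge0//; lra.
lra.
Qed.

(** The majorant is a product of a function of [z] of width [sqrt q] and a function of [t] of width
    [q], so its average factors. The exponent has 3 in place of [pi^2] to keep something for the
    decay in [k]. *)
Lemma avg_tail_upper (q th : R) k : 0 < q <= 1 -> 0 <= th -> 1 <= vnrm k :> R ->
  avg (fun u => expR (- (3 / q ^+ 2 * gdist th k u))) <= 90 * pi * q * Num.sqrt q.
Proof.
move=> /andP[q0 q1] th0 l1.
set l := vnrm k in l1 *.
have l0 : 0 < l by lra.
have pi0 := @pi_gt0 R; have pi2 := @pi_ge2 R.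
have sq0 : 0 < Num.sqrt q by rewrite sqrtr_gt0.
have sqs : Num.sqrt q ^+ 2 = q by rewrite sqr_sqrtr// ltW.
have sq1 : q <= Num.sqrt q by nra.
have kk : (k.1%:~R : R) ^+ 2 + (k.2%:~R : R) ^+ 2 = l ^+ 2.
  by rewrite -/l /l /vnrm sqr_sqrtr// addr_ge0// sqr_ge0.
have [t0 [t0b k1 k2]] := polar_angle l0 kk.
have pp : - pi <= pi :> R by lra.
have sq14 (y : R) : 1 / 2 <= y -> 1 / 4 <= y ^+ 2 by move=> ?; nra.
have okF : avg_ok (fun u => expR (- (3 / q ^+ 2 * gdist th k u))).
  by apply: expN_ok; exact: gdist_ok.
have r01 (z : R) : 0 <= z <= 1 -> 0 <= Num.sqrt (1 - z ^+ 2) <= 1.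
  by move=> z01; rewrite sqrtr_ge0 sqrt_z_le1.
have [lt|lt] := leP (2 * th) l.
  apply: (@le_trans _ _ (avg (fun=> 2 * q ^+ 2))).
    apply: avg_le => // [|[z t] [/=]]; first exact: avg_ok_cst.
    rewrite !in_itv/= => /r01/andP[r0 r1] _.
    rewrite (gdist_polar th z t k1 k2); set r := Num.sqrt _ in r0 r1 *.
    have c1 := cos_le1 (t - t0).
    have d' : th * r <= l / 2 by have := ler_wpM2l th0 r1; lra.
    have d : 1 / 4 <= (th * r - l) ^+ 2 by rewrite -sqrrN opprB; apply: sq14; lra.
    have e : 0 <= 2 * (th * r) * l * (1 - cos (t - t0)).
      by rewrite !mulr_ge0// ?(ltW l0)//; lra.
    have q20 : 0 < q ^+ 2 by rewrite exprn_gt0.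
    apply: (le_trans (expN_le_inv _)); first by rewrite mulr_ge0// ?divr_ge0 ?(ltW q20)//; lra.
    set D := (th * r - l) ^+ 2 + _.
    have DD : 1 / 4 <= D by apply: (le_trans d); rewrite lerDl.
    rewrite ler_pdivrMr; last by rewrite ltr_wpDr// mulr_ge0// ?divr_ge0 ?(ltW q20)//; lra.
    have -> : 2 * q ^+ 2 * (1 + 3 / q ^+ 2 * D) = 2 * q ^+ 2 + 6 * D by field; lra.
    lra.
  rewrite avg_cst.
  have h1 := ler_wpM2l (ltW q0) sq1.
  have h2 := ler_wpM2r (mulr_ge0 (ltW q0) (ltW sq0)) pi2.
  have h3 := mulr_ge0 (ltW q0) (ltW sq0).
  rewrite -!mulrA; lra.
have th1 : 0 < th by lra.
pose z0 := Num.sqrt (1 - (l / th) ^+ 2).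
pose a z : R := 3 * (1 / (1 + (z - z0) ^+ 2 / q)).
pose b t : R := 1 / (1 + (t - (t0 - 2 * pi)) ^+ 2 / (20 * q) ^+ 2) + 1 / (1 + (t - t0) ^+ 2 / (20 * q) ^+ 2)
   + 1 / (1 + (t - (t0 + 2 * pi)) ^+ 2 / (20 * q) ^+ 2).
have qq : 0 < (20 * q) ^+ 2 by rewrite exprn_gt0//; lra.
have sqq : Num.sqrt ((20 * q) ^+ 2) = 20 * q by rewrite sqrtr_sqr ger0_norm//; lra.
have cc (y : R) := @cauchy_cont _ y qq.
have ca : continuous a.
  by move=> z; apply: cvgM; [exact: cvg_cst|exact: cauchy_cont].
have cb : continuous b.
  by move=> t; apply: cvgD; [apply: cvgD|]; exact: cc.
apply: (@le_trans _ _ (avg (fun u => a u.1 * b u.2))).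
  apply: avg_le => //.
    by apply: avg_okM; [apply: avg_ok_fst|apply: avg_ok_snd].
  move=> [z t] [/=]; rewrite !in_itv/= => z01 tb.
  have /andP[r0 r1] := r01 _ z01.
  rewrite (gdist_polar th z t k1 k2).
  have h1 := radial_major th1 z01 l1 lt.
  set r := Num.sqrt (1 - z ^+ 2) in r0 r1 h1 *.
  have cb1 : -1 <= cos (t - t0) <= 1 by rewrite cos_geN1 cos_le1.
  have h2 := gdist_split l1 (mulr_ge0 th0 r0) cb1.
  apply: (@le_trans _ _ (expR (- (3 / 2 * (th * r - l) ^+ 2 / q ^+ 2)) *
      expR (- (3 * (1 - cos (t - t0)) / (16 * q ^+ 2))))).
    rewrite -expRD ler_expR.
    have -> : - (3 / 2 * (th * r - l) ^+ 2 / q ^+ 2) + - (3 * (1 - cos (t - t0)) / (16 * q ^+ 2)) =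
      - (3 / q ^+ 2 * ((th * r - l) ^+ 2 / 2 + (1 - cos (t - t0)) / 16)) by field; lra.
    by rewrite lerN2 ler_wpM2l// divr_ge0// sqr_ge0.
  apply: ler_pM; rewrite ?expR_ge0//; first exact: quartic_major.
  exact: cos_major.
have ci (f : R -> R) (x y : R) : continuous f -> mu.-integrable `[x, y] (EFin \o f).
  by move=> cf; apply: cont_itv_integrable => ? _; exact: cf.
rewrite avg_prod//.
have Ia : 0 <= \int[mu]_(z in `[0, 1]) a z <= 3 * (pi * Num.sqrt q).
  rewrite /a (@Rint_scale R); last by apply: ci; exact: cauchy_cont.
  rewrite ler_wpM2l ?cauchy_integral// mulr_ge0//.
  apply: Rintegral_ge0 => z _; rewrite divr_ge0// addr_ge0// divr_ge0 ?sqr_ge0//; lra.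
have Ib : \int[mu]_(t in `[- pi, pi]) b t <= 60 * pi * q.
  rewrite /b Rint_add; [|apply: ci; move=> ?; apply: cvgD; exact: cc|apply: ci; exact: cc].
  rewrite Rint_add; [|apply: ci; exact: cc..].
  have K y := @cauchy_integral _ y _ _ qq pp; rewrite sqq in K.
  have := K (t0 - 2 * pi); have := K t0; have := K (t0 + 2 * pi).
  clear ci cc Ia; lra.
have /andP[Ia0 Ia1] := Ia; clear ci cc Ia.
apply: (@le_trans _ _ (3 * (pi * Num.sqrt q) * ((2 * pi)^-1 * (60 * pi * q)))).
  apply: (@le_trans _ _ ((\int[mu]_(z in `[0, 1]) a z) * ((2 * pi)^-1 * (60 * pi * q)))).
    by rewrite ler_wpM2l// ler_wpM2l// invr_ge0 mulr_ge0 ?(ltW pi0).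
  by rewrite ler_wpM2r// !mulr_ge0 ?invr_ge0 ?mulr_ge0 ?(ltW pi0) ?(ltW q0).
rewrite le_eqVlt; apply/orP; left; apply/eqP.
have K (P s : R) : 0 < P -> 3 * (P * s) * ((2 * P)^-1 * (60 * P * q)) = 90 * P * q * s.
  by move=> ?; field; rewrite !gt_eqF.
exact: K.
Qed.

(** Peetre's inequality [1 + |k|^2 <= 2 (1 + |w|^2) (1 + |k - w|^2)] with [|w| <= th]: closeness to
    the sphere is traded for decay in [k]. *)
Lemma peetre_sph th k u : 0 <= th -> avg_dom u ->
  (1 + (k.1%:~R : R) ^+ 2) * (1 + k.2%:~R ^+ 2) <= 4 * (1 + th ^+ 2) ^+ 2 * (1 + gdist th k u) ^+ 2.
Proof.
case: u => z t th0 [/=]; rewrite !in_itv/= => /andP[z0 z1] _.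
have rs : Num.sqrt (1 - z ^+ 2) ^+ 2 = 1 - z ^+ 2 by rewrite sqr_sqrtr//; nra.
have w2 : sph1 th (z, t) ^+ 2 + sph2 th (z, t) ^+ 2 <= th ^+ 2.
  rewrite /sph1 /sph2/=.
  have -> : (th * (Num.sqrt (1 - z ^+ 2) * cos t)) ^+ 2 + (th * (Num.sqrt (1 - z ^+ 2) * sin t)) ^+ 2
     = th ^+ 2 * Num.sqrt (1 - z ^+ 2) ^+ 2 * (cos t ^+ 2 + sin t ^+ 2) by ring.
  rewrite cos2Dsin2 mulr1 rs; have := sqr_ge0 (th * z); nra.
rewrite /gdist; set x := k.1%:~R; set y := k.2%:~R.
set a := sph1 _ _ in w2 *; set b := sph2 _ _ in w2 *.
set D := (x - a) ^+ 2 + (y - b) ^+ 2.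
have D0 : 0 <= D by rewrite addr_ge0// sqr_ge0.
have T0 := sqr_ge0 th.
have kD : x ^+ 2 + y ^+ 2 <= 2 * D + 2 * th ^+ 2.
  have := sqr_ge0 (x - 2 * a); have := sqr_ge0 (y - 2 * b); rewrite /D; nra.
have h : 1 + x ^+ 2 + y ^+ 2 <= 2 * (1 + th ^+ 2) * (1 + D) by nra.
have x0 := sqr_ge0 x; have y0 := sqr_ge0 y.
apply: (@le_trans _ _ ((1 + x ^+ 2 + y ^+ 2) ^+ 2)); first nra.
have -> : 4 * (1 + th ^+ 2) ^+ 2 * (1 + D) ^+ 2 = (2 * (1 + th ^+ 2) * (1 + D)) ^+ 2 by ring.
by rewrite lerXn2r ?nnegrE//; [lra|rewrite !mulr_ge0//; lra].
Qed.

Lemma vnrm_ge1 k : k != 0 -> 1 <= vnrm k :> R.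
Proof.
case: k => a b ab; rewrite /vnrm/= -[leLHS]sqrtr1 ler_wsqrtr//.
rewrite -!rmorphXn -rmorphD/= ler1z.
have : ~~ ((a == 0) && (b == 0)) by [].
rewrite negb_and => /orP[h|h].
  by nia.
by nia.
Qed.

(** As [q^2 + 3 <= pi^2], the Gaussian is at most [exp (- D) exp (- 3 D / q^2)]: the second factor
    gives the size in [q], the first, by [peetre_sph], a summable decay in [k]. *)
Lemma ek_upper (q th : R) k : 0 < q <= 1 -> 0 <= th -> k != 0 ->
  ek q th k <= 10 ^+ 5 * (1 + th ^+ 2) ^+ 2 / ((1 + k.1%:~R ^+ 2) * (1 + k.2%:~R ^+ 2)) / Num.sqrt q.
Proof.
move=> /andP[q0 q1] th0 /vnrm_ge1 k1.
have pi0 := @pi_gt0 R; have pi2 := @pi_ge2 R.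
have pi4 : pi <= 4 :> R by have [/andP[_]] := @pihalf_02_cos_pihalf R; lra.
set K := (1 + _) * (1 + _).
have K0 : 0 < K by rewrite mulr_gt0// ltr_wpDr// sqr_ge0.
set A := 16 * (1 + th ^+ 2) ^+ 2 / K.
have A0 : 0 <= A by rewrite divr_ge0 ?(ltW K0)// mulr_ge0// sqr_ge0.
have sq0 : 0 < Num.sqrt q by rewrite sqrtr_gt0.
have sqs : Num.sqrt q ^+ 2 = q by rewrite sqr_sqrtr// ltW.
have q20 : 0 < q ^+ 2 by rewrite exprn_gt0.
have ok3 : avg_ok (fun u => expR (- (3 / q ^+ 2 * gdist th k u))).
  by apply: expN_ok; exact: gdist_ok.
have pq : q ^+ 2 + 3 <= pi ^+ 2.
  by have : q ^+ 2 <= 1; [rewrite expr_le1// ltW|nra].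
have H : avg (fun u => expR (- (pi ^+ 2 / q ^+ 2 * gdist th k u))) <= A * (90 * pi * q * Num.sqrt q).
  apply: (@le_trans _ _ (avg (fun u => A * expR (- (3 / q ^+ 2 * gdist th k u))))); last first.
    by rewrite avgZ// ler_wpM2l// avg_tail_upper// q0.
  apply: avg_le => [||u Du].
  - by apply: expN_ok; exact: gdist_ok.
  - by apply: avg_okM => //; exact: avg_ok_cst.
  set D := gdist th k u.
  have D0 : 0 <= D by rewrite addr_ge0// sqr_ge0.
  have P := peetre_sph k th0 Du; rewrite -/D -/K in P.
  apply: (@le_trans _ _ (expR (- D) * expR (- (3 / q ^+ 2 * D)))).
    rewrite -expRD ler_expR -opprD lerN2.
    have -> : D + 3 / q ^+ 2 * D = D * ((q ^+ 2 + 3) / q ^+ 2) by field; lra.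
    by rewrite [leRHS]mulrC ler_wpM2l// ler_wpM2r ?invr_ge0 ?(ltW q20)////; exact: pq.
  rewrite ler_wpM2r ?expR_ge0//.
  apply: (le_trans (expN_le_inv2 D0)).
  rewrite /A ler_pdivlMr// mulrAC ler_pdivrMr ?exprn_gt0//; last lra.
  lra.
rewrite /ek.
apply: (@le_trans _ _ (pi / q ^+ 2 * (A * (90 * pi * q * Num.sqrt q)))).
  by rewrite ler_wpM2l// divr_ge0 ?(ltW q20)// ltW.
have -> : pi / q ^+ 2 * (A * (90 * pi * q * Num.sqrt q)) = 90 * pi ^+ 2 * A / Num.sqrt q.
  move: (pi : R) (A : R) => P B; rewrite -{1 2}sqs; field; rewrite gt_eqF//.
rewrite ler_wpM2r ?invr_ge0 ?(ltW sq0)//.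
have -> : 10 ^+ 5 * (1 + th ^+ 2) ^+ 2 / K = 6250 * A by rewrite /A; field; lra.
by rewrite ler_wpM2r//; nra.
Qed.

(** The subtracted term makes the induction telescope. *)
Lemma sum_zs_cauchy n : \sum_(j <- zs n) 1 / (1 + (j%:~R : R) ^+ 2) <= 5 - 4 / n.+1%:R.
Proof.
elim: n => [|n IH]; first by rewrite /= big_seq1 mulr0z expr0n/= addr0 !divr1; lra.
rewrite [zs _]/= !big_cons mulrNz sqrrN.
have -> : (n.+1%:Z)%:~R = n.+1%:R :> R by [].
have E : n.+2%:R = n.+1%:R + 1 :> R by rewrite [LHS]mulrSr.
have n1 : 1 <= n.+1%:R :> R by rewrite ler1n.
rewrite E; move: IH; set x : R := n.+1%:R in n1 *; set s := \sum_(_ <- _) _ => IH.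
have h : 2 * (1 / (1 + x ^+ 2)) <= 4 / x - 4 / (x + 1).
  have -> : 4 / x - 4 / (x + 1) = 4 / (x * (x + 1)) by field; lra.
  rewrite mulrA mulr1 ler_pdivlMr; last nra.
  rewrite mulrAC ler_pdivrMr; nra.
move: (1 / (1 + x ^+ 2)) (4 / x) (4 / (x + 1)) s h IH => a b c s' h IH; lra.
Qed.

Lemma ek_upper_sum (q th : R) n : 0 < q <= 1 -> 0 <= th ->
  \sum_(k <- zs2 n | k != 0) ek q th k <= 25 * 10 ^+ 5 * (1 + th ^+ 2) ^+ 2 / Num.sqrt q.
Proof.
move=> q01 th0; have /andP[q0 _] := q01.
have sq0 : 0 < Num.sqrt q by rewrite sqrtr_gt0.
set C := 10 ^+ 5 * (1 + th ^+ 2) ^+ 2 / Num.sqrt q.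
have C0 : 0 <= C by rewrite divr_ge0 ?(ltW sq0)// mulr_ge0 ?sqr_ge0.
have pos (x : R) : 0 < 1 + x ^+ 2 by rewrite ltr_wpDr ?sqr_ge0.
pose f (j : int) : R := 1 / (1 + j%:~R ^+ 2).
have f0 j : 0 <= f j by rewrite divr_ge0// ltW.
apply: (@le_trans _ _ (\sum_(k <- zs2 n) C * (f k.1 * f k.2))).
  rewrite big_mkcond/= ler_sum// => k _; case: ifP => [k0|_]; last by rewrite mulr_ge0// mulr_ge0.
  apply: (le_trans (ek_upper q01 th0 _)); first by rewrite k0.
  rewrite le_eqVlt; apply/orP; left; apply/eqP; rewrite /C /f.
  have := pos k.1%:~R; have := pos k.2%:~R => h1 h2.
  by field; rewrite !gt_eqF.
rewrite -mulr_sumr sum_zs2 /=.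
have -> : \sum_(i <- zs n) \sum_(j <- zs n) f i * f j = (\sum_(i <- zs n) f i) ^+ 2.
  by rewrite expr2 mulr_suml; apply: eq_bigr => i _; rewrite mulr_sumr.
have s0 : 0 <= \sum_(i <- zs n) f i by apply: sumr_ge0.
have s5 : \sum_(i <- zs n) f i <= 5.
  by apply: (le_trans (sum_zs_cauchy n)); rewrite gerBl divr_ge0.
have -> : 25 * 10 ^+ 5 * (1 + th ^+ 2) ^+ 2 / Num.sqrt q = C * 25 by rewrite /C; ring.
rewrite ler_wpM2l//; nra.
Qed.
End kernel_upper_bound.

(** * The zero frequency *)
Section radial_integral.
Context {R : realType}.
Notation RT := (measurableTypeR R).
Notation mu := (@lebesgue_measure R).
Implicit Types (p th b T z : R).

Lemma cont_derivable_itv (f : R -> R) (a b : R) : (forall x, derivable f x 1) ->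
  mu.-integrable `[a, b] (EFin \o f).
Proof.
by move=> df; apply: cont_itv_integrable => x _; exact: (derivable_continuous df).
Qed.

Definition gsin p b T z : R := \int[mu]_(r in `[0, T]) (expR (- (p ^+ 2 * r ^+ 2)) * sin (b * r * z)).

Lemma gsin_derive0 p b T z : 0 <= T ->
  is_derive z (1 : R) (gsin p b T)
    (\int[mu]_(r in `[0, T]) (expR (- (p ^+ 2 * r ^+ 2)) * (b * r * cos (b * r * z)))).
Proof.
move=> T0.
pose f (z r : R) := expR (- (p ^+ 2 * r ^+ 2)) * sin (b * r * z).
have d1 (x y : R) : is_derive x (1 : R) (f ^~ y) (expR (- (p ^+ 2 * y ^+ 2)) * (b * y * cos (b * y * x))).
  by rewrite /f; apply: is_derive_eq; rewrite /GRing.scale/=; ring.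
have mB : measurable (`[0, T] : set RT) by [].
have Iz : `]z - 1, z + 1[%classic z by rewrite /= in_itv/=; apply/andP; split; lra.
have intf (x : R) : `]z - 1, z + 1[%classic x -> mu.-integrable `[0, T] (EFin \o f x).
  move=> _; suff H : mu.-integrable `[0, T] (EFin \o (fun r => expR (- (p ^+ 2 * r ^+ 2)) * sin (b * r * x))) by [].
  by clear; apply: cont_derivable_itv => y; exact: ex_derive.
have df (x y : R) : `]z - 1, z + 1[%classic x -> `[0, T]%classic y -> derivable (f ^~ y) x 1.
  by move=> _ _; exact: (@ex_derive _ _ _ _ _ _ _ (d1 x y)).
pose G (y : R) := `|b| * T.
have G0 y : 0 <= G y by rewrite /G mulr_ge0.
have iG : mu.-integrable `[0, T] (EFin \o G).
  by apply: cont_derivable_itv => y; exact: ex_derive.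
have GE (x y : R) : partial1of2 f x y = expR (- (p ^+ 2 * y ^+ 2)) * (b * y * cos (b * y * x)).
  by rewrite partial1of2E; exact: (@derive_val _ _ _ _ _ _ _ (d1 x y)).
have Gub (x y : R) : `]z - 1, z + 1[%classic x -> `[0, T]%classic y -> `|partial1of2 f x y| <= G y.
  move=> _; rewrite /= in_itv/= => /andP[y0 yT]; rewrite GE /G normrM -[leRHS]mul1r.
  apply: ler_pM => //.
    by rewrite ger0_norm ?expR_ge0// -expR0 ler_expR oppr_le0 mulr_ge0// sqr_ge0.
  rewrite 2!normrM -mulrA ler_wpM2l// -[leRHS]mulr1 ger0_norm// ler_pM// ler_norml.
  by rewrite cos_geN1 cos_le1.
have H1 := derivable_under_integral mB Iz intf df G0 iG Gub.
have H2 := differentiation_under_integral mB Iz intf df G0 iG Gub.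
apply: DeriveDef; first exact: H1.
rewrite -derive1E H2; apply: eq_Rintegral => y _; exact: GE.
Qed.

(* Dawson's differential equation for the sine transform of a Gaussian. *)
Lemma gsin_derive p b T z : p != 0 -> 0 <= T ->
  is_derive z (1 : R) (gsin p b T)
    (b / (2 * p ^+ 2) * (1 - expR (- (p ^+ 2 * T ^+ 2)) * cos (b * T * z))
      - b ^+ 2 * z / (2 * p ^+ 2) * gsin p b T z).
Proof.
move=> p0 T0; have := gsin_derive0 p b z T0.
set I := \int[mu]_(r in _) _.
suff -> : I = b / (2 * p ^+ 2) * (1 - expR (- (p ^+ 2 * T ^+ 2)) * cos (b * T * z))
      - b ^+ 2 * z / (2 * p ^+ 2) * gsin p b T z by [].
pose F (r : R) := - (b / (2 * p ^+ 2)) * (expR (- (p ^+ 2 * r ^+ 2)) * cos (b * r * z)).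
pose f1 (r : R) := expR (- (p ^+ 2 * r ^+ 2)) * (b * r * cos (b * r * z)).
pose f2 (r : R) := b ^+ 2 * z / (2 * p ^+ 2) * (expR (- (p ^+ 2 * r ^+ 2)) * sin (b * r * z)).
have D1 x : derivable f1 x 1 by exact: ex_derive.
have D2 x : derivable f2 x 1 by exact: ex_derive.
have H : \int[mu]_(r in `[0, T]) (f1 r + f2 r) = F T - F 0.
  apply: Rint_FTC => //.
    move=> x _; rewrite /F /f1 /f2; apply: is_derive_eq; rewrite /GRing.scale/=; field.
    by rewrite p0.
  by move=> x _; apply: derivable_continuous => y; exact: derivableD.
rewrite Rint_add in H; [|exact: cont_derivable_itv..].
have E2 : \int[mu]_(r in `[0, T]) f2 r = b ^+ 2 * z / (2 * p ^+ 2) * gsin p b T z.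
  by rewrite /f2 Rint_scale//; apply: cont_derivable_itv => x; exact: ex_derive.
rewrite E2 in H; rewrite -/I in H.
have -> : I = F T - F 0 - b ^+ 2 * z / (2 * p ^+ 2) * gsin p b T z by rewrite -H addrK.
rewrite /F expr0n/= !mulr0 mul0r oppr0 expR0 cos0; ring.
Qed.

(** The linear equation of [gsin_derive] solved by an integrating factor. The variable of the
    equation becomes the height on the sphere, which is why the dual term at the origin appears. *)
Lemma gsin_formula p th T : 0 < p -> 0 <= T ->
  gsin p (2 * pi * th) T 1 = \int[mu]_(z in `[0, 1])
    (expR (- (pi ^+ 2 / p ^+ 2 * th ^+ 2 * (1 - z ^+ 2))) *
      (pi * th / p ^+ 2 * (1 - expR (- (p ^+ 2 * T ^+ 2)) * cos (2 * pi * th * T * z)))).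
Proof.
move=> p0 T0; set b := 2 * pi * th; set A := pi ^+ 2 / p ^+ 2 * th ^+ 2.
have pn : p != 0 by rewrite gt_eqF.
have D z := gsin_derive b z pn T0.
have D' (z : R) : z \in `[0, 1] -> is_derive z (1 : R) (fun z => expR (- (A * (1 - z ^+ 2))) * gsin p b T z)
    (expR (- (A * (1 - z ^+ 2))) *
      (pi * th / p ^+ 2 * (1 - expR (- (p ^+ 2 * T ^+ 2)) * cos (b * T * z)))).
  move=> _; have Dz := D z; apply: is_derive_eq; rewrite /GRing.scale/=.
  by rewrite /A /b; move: (pi : R) (expR _) (expR _) (cos _) (gsin _ _ _ _) => P e1 e2 c g; field.
rewrite (Rint_FTC ler01 D').
  have -> : gsin p b T 0 = 0.
    rewrite /gsin; under eq_Rintegral do rewrite mulr0 sin0 mulr0.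
    by rewrite Rint_cst// mul0r.
  by rewrite mulr0 subr0 expr1n subrr mulr0 oppr0 expR0 mul1r.
by move=> z _; apply: derivable_continuous => y; exact: ex_derive.
Qed.

Lemma ek0 p th : ek p th 0 =
  pi / p ^+ 2 * \int[mu]_(z in `[0, 1]) expR (- (pi ^+ 2 / p ^+ 2 * th ^+ 2 * (1 - z ^+ 2))).
Proof.
rewrite /ek; congr (_ * _).
set a := fun z => expR (- (pi ^+ 2 / p ^+ 2 * th ^+ 2 * (1 - z ^+ 2))).
have ca : continuous a by apply: derivable_continuous => y; exact: ex_derive.
have pi0 := @pi_gt0 R.
have E : avg (fun u : RT * RT => a u.1 * 1) = \int[mu]_(z in `[0, 1]) a z.
  rewrite (@avg_prod _ a (fun=> 1)) ?Rint_cst//; last 2 first.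
  - by rewrite (le_trans _ (ltW pi0))// oppr_le0 ltW.
  - by move=> y; exact: cvg_cst.
  by rewrite opprK mul1r -mulr2n -(mulr_natl pi) mulVf ?mulr1// mulf_neq0// gt_eqF.
rewrite -{}E.
have okF : avg_ok (fun u : RT * RT => a u.1 * 1).
  by apply: avg_okM; [exact: avg_ok_fst|exact: avg_ok_cst].
have okG : avg_ok (fun u => expR (- (pi ^+ 2 / p ^+ 2 * gdist th 0 u))).
  by apply: expN_ok; exact: gdist_ok.
have H u : avg_dom u -> expR (- (pi ^+ 2 / p ^+ 2 * gdist th 0 u)) = a u.1 * 1.
  case: u => z t [/=]; rewrite !in_itv/= => /andP[z0 z1] _; rewrite mulr1 /a.
  congr (expR (- _)); rewrite -[RHS]mulrA; congr (_ * _); rewrite /gdist.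
  have -> : ((0 : int * int).1%:~R : R) = 0 by [].
  rewrite /sph1 /sph2/= !sub0r !sqrrN.
  have rs : Num.sqrt (1 - z ^+ 2) ^+ 2 = 1 - z ^+ 2.
    by rewrite sqr_sqrtr// subr_ge0 expr_le1.
  rewrite -[in RHS]rs; have c := cos2Dsin2 t; set r := Num.sqrt (1 - z ^+ 2); clearbody r.
  by rewrite -[RHS]mulr1 -c; ring.
by apply/le_anti/andP; split; apply: avg_le => // u /H ->.
Qed.

(** In polar coordinates: the dual term at the origin is the integral of the summand over the plane.
    After [gsin_formula] the two differ only by the boundary term at [T]. Radius 0 is treated apart
    because of a division by [th]. *)
Lemma radial_ek0 p th T : 0 < p -> 0 <= th -> 0 <= T ->
  `|\int[mu]_(r in `[0, T]) (2 * pi * r * expR (- (p ^+ 2 * r ^+ 2)) * sinc (2 * pi * th * r))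
     - ek p th 0| <= pi / p ^+ 2 * expR (- (p ^+ 2 * T ^+ 2)).
Proof.
move=> p0 th0 T0; have pi0 := @pi_gt0 R.
have pn : p != 0 by rewrite gt_eqF.
have ip : 0 <= pi / p ^+ 2 by rewrite divr_ge0 ?sqr_ge0// ltW.
set e := expR (- (p ^+ 2 * T ^+ 2)); have e0 : 0 <= e by exact: expR_ge0.
have [th00|thn] := eqVneq th 0.
  rewrite th00 ek0.
  under eq_Rintegral do rewrite mulr0 mul0r /sinc eqxx mulr1.
  under [X in _ - _ * X]eq_Rintegral do rewrite expr0n/= mulr0 mul0r oppr0 expR0.
  rewrite Rint_cst// mul1r subr0 mulr1.
  have D (x : R) : x \in `[0, T] -> is_derive x (1 : R) (fun r => - (pi / p ^+ 2) * expR (- (p ^+ 2 * r ^+ 2)))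
      (2 * pi * x * expR (- (p ^+ 2 * x ^+ 2))).
    by move=> _; apply: is_derive_eq; rewrite /GRing.scale/=; move: (pi : R) => P; field.
  rewrite (Rint_FTC T0 D); last by move=> x _; apply: derivable_continuous => y; exact: ex_derive.
  rewrite expr0n/= mulr0 oppr0 expR0 mulr1 -/e.
  have -> : - (pi / p ^+ 2) * e - - (pi / p ^+ 2) - pi / p ^+ 2 = - (pi / p ^+ 2 * e) by ring.
  by rewrite normrN ger0_norm// mulr_ge0.
have thp : 0 < th by rewrite lt_def thn.
have -> : \int[mu]_(r in `[0, T]) (2 * pi * r * expR (- (p ^+ 2 * r ^+ 2)) * sinc (2 * pi * th * r))
   = th^-1 * gsin p (2 * pi * th) T 1.
  rewrite /gsin -Rint_scale; last by apply: cont_derivable_itv => x; exact: ex_derive.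
  apply: eq_Rintegral => r _; rewrite mulr1 /sinc; case: eqVneq => [h|h].
    have -> : r = 0.
      by move/eqP: h; rewrite mulf_eq0 gt_eqF ?mulr_gt0//= => /eqP.
    by rewrite !mulr0 !mul0r sin0 !mulr0.
  move: h; rewrite !mulf_eq0 !negb_or => /andP[/andP[/andP[_ P0] _] r0].
  by move: (pi : R) P0 (expR _) (sin _) => P P0 E S; field; rewrite r0 thn P0.
rewrite gsin_formula// ek0.
set A := pi ^+ 2 / p ^+ 2 * th ^+ 2.
have A0 : 0 <= A by rewrite mulr_ge0 ?sqr_ge0// divr_ge0 ?sqr_ge0.
pose a (z : R) := expR (- (A * (1 - z ^+ 2))).
pose g (z : R) := a z * (pi * th / p ^+ 2 * (1 - e * cos (2 * pi * th * T * z))).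
have ia : mu.-integrable `[0, 1] (EFin \o a) by apply: cont_derivable_itv => x; exact: ex_derive.
have ig : mu.-integrable `[0, 1] (EFin \o g) by apply: cont_derivable_itv => x; exact: ex_derive.
have ika c : mu.-integrable `[0, 1] (EFin \o (fun z => c * a z)).
  by apply: cont_derivable_itv => x; exact: ex_derive.
set D := \int[mu]_(z in `[0, 1]) a z.
set K := pi * th / p ^+ 2.
have K0 : 0 <= K by rewrite divr_ge0 ?sqr_ge0// mulr_ge0// ltW.
have D1 : D <= 1.
  have -> : 1 = \int[mu]_(z in `[0, 1]) (1 : R) by rewrite Rint_cst// mul1r subr0.
  apply: le_Rint => //; first by apply: cont_derivable_itv => x; exact: ex_derive.
  move=> z; rewrite in_itv/= => /andP[z0 z1].
  by rewrite /a -[leRHS]expR0 ler_expR oppr_le0 mulr_ge0// subr_ge0 expr_le1.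
have U : \int[mu]_(z in `[0, 1]) g z <= K * (1 + e) * D.
  rewrite -Rint_scale//; apply: le_Rint => // z _; rewrite /g mulrC ler_wpM2r ?expR_ge0//.
  rewrite ler_wpM2l// lerD2l.
  have h : 0 <= e * (1 + cos (2 * pi * th * T * z)) by rewrite mulr_ge0// addrC -lerBlDr sub0r cos_geN1.
  by clear -h; lra.
have L : K * (1 - e) * D <= \int[mu]_(z in `[0, 1]) g z.
  rewrite -Rint_scale//; apply: le_Rint => // z _; rewrite /g [leRHS]mulrC ler_wpM2r ?expR_ge0//.
  by rewrite ler_wpM2l// lerD2l lerN2 -[leRHS]mulr1 ler_wpM2l// cos_le1.
rewrite -/g; move: (\int[mu]_(z in _) g z) U L => I U L.
have D0 : 0 <= D by apply: Rintegral_ge0 => z _; exact: expR_ge0.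
have tK : th^-1 * K = pi / p ^+ 2 by rewrite /K -mulrA mulrCA mulKf.
have eD : K * e * D <= K * e by rewrite -[leRHS]mulr1 ler_wpM2l// mulr_ge0.
have -> : th^-1 * I - pi / p ^+ 2 * D = th^-1 * (I - K * D) by rewrite -tK; ring.
rewrite -tK -[leRHS]mulrA normrM ger0_norm ?invr_ge0// ler_wpM2l ?invr_ge0// ler_norml.
by move: U L eD; clear; move=> *; apply/andP; split; lra.
Qed.
End radial_integral.

(** * The resonator *)
Section frequency_sums.
Context {R : realType}.
Notation mu := (@lebesgue_measure R).
Implicit Types (ls : seq R) (f g : R -> R).

(* The coefficients of [\prod_(l <- ls) (1 + cos (2 * pi * l * x))], a cosine
   polynomial, paired with a function of the frequency. *)
Fixpoint fsum ls f : R :=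
  if ls is l :: ls' then fsum ls' (fun w => f w + (f (w + l) + f (w - l)) / 2) else f 0.

Lemma eq_fsum ls f g : f =1 g -> fsum ls f = fsum ls g.
Proof. by move=> /funext ->. Qed.

Lemma fsumD ls f g : fsum ls (fun w => f w + g w) = fsum ls f + fsum ls g.
Proof.
elim: ls f g => //= l ls IH f g; rewrite -IH; apply: eq_fsum => w; ring.
Qed.

Lemma fsumZ ls (c : R) f : fsum ls (fun w => c * f w) = c * fsum ls f.
Proof. elim: ls f => //= l ls IH f; rewrite -IH; apply: eq_fsum => w; ring. Qed.

Lemma fsumN ls f : fsum ls (fun w => - f w) = - fsum ls f.
Proof. by rewrite -mulN1r -fsumZ; apply: eq_fsum => w; rewrite mulN1r. Qed.

Lemma fsum_cst ls (c : R) : fsum ls (fun=> c) = 2 ^+ size ls * c.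
Proof.
elim: ls c => [|l ls IH] c /=; first by rewrite mul1r.
by rewrite IH exprS; field.
Qed.

Lemma fsum_sum (I : Type) (s : seq I) (P : pred I) ls (f : I -> R -> R) :
  fsum ls (fun w => \sum_(i <- s | P i) f i w) = \sum_(i <- s | P i) fsum ls (f i).
Proof.
elim: s => [|i s IH].
  by under eq_fsum do rewrite big_nil; rewrite big_nil fsum_cst mulr0.
rewrite big_cons -IH; case: ifP => Pi.
  by under eq_fsum do rewrite big_cons Pi; rewrite fsumD.
by apply: eq_fsum => w; rewrite big_cons Pi.
Qed.

(** The frequencies are signed sums of distinct entries of [ls], so only this interval matters. It
    is needed for bounds that grow with the frequency, such as [ek_upper_sum]. *)
Lemma fsum_le_supp ls f g : all (>= 0) ls ->
  (forall w, `|w| <= \sum_(l <- ls) l -> f w <= g w) -> fsum ls f <= fsum ls g.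
Proof.
elim: ls f g => [|l ls IH] f g /= => [_ fg|/andP[l0 ls0] fg].
  by apply: fg; rewrite normr0 big_nil.
apply: IH => // w; rewrite ler_norml => /andP[wl wr].
have H y : `|y| <= \sum_(j <- ls) j + l -> f y <= g y by move=> h; apply: fg; rewrite big_cons addrC.
by rewrite lerD ?ler_pM2r ?lerD//; apply: H; rewrite ler_norml; apply/andP; split; lra.
Qed.

Lemma fsum_le ls f g : (forall w, f w <= g w) -> fsum ls f <= fsum ls g.
Proof.
elim: ls f g => [|l ls IH] f g fg /=; first exact: fg.
by apply: IH => w; rewrite lerD// ler_pM2r// lerD.
Qed.

Lemma fsum_ge0 ls f : (forall w, 0 <= f w) -> 0 <= fsum ls f.
Proof. by move=> f0; rewrite -(mulr0 (2 ^+ size ls)) -fsum_cst fsum_le. Qed.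

Lemma fsum_norm ls f : `|fsum ls f| <= fsum ls (fun w => `|f w|).
Proof.
rewrite ler_norml -fsumN; apply/andP; split; apply: fsum_le => w; last exact: ler_norm.
by rewrite lerNl -normrN ler_norm.
Qed.

Lemma fsum_sym ls f : fsum ls (fun w => f (- w)) = fsum ls f.
Proof.
elim: ls f => [|l ls IH] f /=; first by rewrite oppr0.
rewrite -[RHS]IH; apply: eq_fsum => w; congr (_ + _ / _).
by rewrite addrC; congr (f _ + f _); ring.
Qed.

Lemma fsum_middle ls1 l ls2 f : fsum (ls1 ++ l :: ls2) f = fsum (l :: ls1 ++ ls2) f.
Proof.
elim: ls1 f => [//|a ls1 IH] f.
rewrite [LHS]IH /=; apply: eq_fsum => w.
have -> : w - l - a = w - a - l by ring.
have -> : w - l + a = w + a - l by ring.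
have -> : w + l - a = w - a + l by ring.
have -> : w + l + a = w + a + l by ring.
ring.
Qed.

Lemma fsum_perm ls ls' f : perm_eq ls ls' -> fsum ls f = fsum ls' f.
Proof.
elim: ls ls' f => [|l ls IH] ls' f; first by move=> /perm_size/esym/size0nil ->.
move=> p; have : l \in ls' by rewrite -(perm_mem p) mem_head.
move=> lls'; case/splitPr: lls' p => s1 s2 p.
rewrite fsum_middle /=; apply: IH.
by rewrite -(perm_cons l) (perm_trans p)// perm_catC cat_cons perm_cons perm_catC.
Qed.

Lemma fsum_derive ls (f : R -> R -> R) (f' : R -> R) (x : R) :
  (forall w, is_derive x (1 : R) (f w) (f' w)) ->
  is_derive x (1 : R) (fun y => fsum ls (f ^~ y)) (fsum ls f').
Proof.
elim: ls f f' => [|l ls IH] f f' df /=; first exact: df.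
apply: (IH (fun w y => f w y + (f (w + l) y + f (w - l) y) / 2)) => w.
have d0 := df w; have d1 := df (w + l); have d2 := df (w - l).
by apply: is_derive_eq; rewrite /GRing.scale/=; ring.
Qed.

Lemma fsum_integrable ls (f : R -> R -> R) (a b : R) :
  (forall w, mu.-integrable `[a, b] (EFin \o f w)) ->
  mu.-integrable `[a, b] (EFin \o (fun x => fsum ls (f ^~ x))) /\
  \int[mu]_(x in `[a, b]) fsum ls (f ^~ x) = fsum ls (fun w => \int[mu]_(x in `[a, b]) f w x).
Proof.
elim: ls f => [|l ls IH] f intf /=; first by split=> //; exact: intf.
have mI : measurable (`[a, b] : set (measurableTypeR R)) by [].
have iD (g h : R -> R) : mu.-integrable `[a, b] (EFin \o g) -> mu.-integrable `[a, b] (EFin \o h) ->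
    mu.-integrable `[a, b] (EFin \o (fun x => g x + h x)).
  by move=> ig ih; have := integrableD mI ig ih.
have iZ (g : R -> R) : mu.-integrable `[a, b] (EFin \o g) ->
    mu.-integrable `[a, b] (EFin \o (fun x => 2^-1 * g x)).
  by move=> ig; have := integrableZl mI 2^-1 ig.
have i2 w := iD _ _ (intf (w + l)) (intf (w - l)).
have i3 w := iZ _ (i2 w).
have E x : fsum ls (fun w => f w x + (f (w + l) x + f (w - l) x) / 2) =
   fsum ls (fun w => f w x + 2^-1 * (f (w + l) x + f (w - l) x)).
  by apply: eq_fsum => w; rewrite (mulrC _ 2^-1).
have [H1 H2] := IH (fun w x => f w x + 2^-1 * (f (w + l) x + f (w - l) x))
   (fun w => iD _ _ (intf w) (i3 w)).
have -> : (fun x => fsum ls (fun w => f w x + (f (w + l) x + f (w - l) x) / 2)) =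
    (fun x => fsum ls (fun w => f w x + 2^-1 * (f (w + l) x + f (w - l) x))) by apply/funext.
split => //; rewrite H2; apply: eq_fsum => w.
by rewrite Rint_add// Rint_scale// Rint_add// (mulrC _ 2^-1).
Qed.
End frequency_sums.

(** * The nonnegative product and its primitive *)

Section resonator.
Context {R : realType}.
Implicit Types (ls : seq R) (w x : R).

Definition reson ls x : R := fsum ls (fun w => cos (2 * pi * w * x)).

Definition sin_prim w x : R := if w == 0 then x else sin (2 * pi * w * x) / (2 * pi * w).

Definition reson_prim ls x : R := fsum ls (sin_prim ^~ x).

Lemma reson_cons l ls x : reson (l :: ls) x = reson ls x * (1 + cos (2 * pi * l * x)).
Proof.
rewrite /reson /= [RHS]mulrC -[RHS]fsumZ; apply: eq_fsum => w.
have -> : 2 * pi * (w + l) * x = 2 * pi * w * x + 2 * pi * l * x by ring.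
have -> : 2 * pi * (w - l) * x = 2 * pi * w * x - 2 * pi * l * x by ring.
by rewrite cosD cosB; field.
Qed.

Lemma reson_bound ls x : 0 <= reson ls x <= 2 ^+ size ls.
Proof.
elim: ls => [|l ls /andP[h0 h1]]; first by rewrite /reson/= mulr0 mul0r cos0 ler01 lexx.
have c0 := cos_geN1 (2 * pi * l * x); have c1 := cos_le1 (2 * pi * l * x).
rewrite reson_cons /= exprS; apply/andP; split; first by rewrite mulr_ge0//; clear -c0; lra.
by rewrite mulrC ler_pM//; clear -c0 c1; lra.
Qed.

Lemma sin_prim_derive w x : is_derive x (1 : R) (sin_prim w) (cos (2 * pi * w * x)).
Proof.
rewrite /sin_prim; case: eqVneq => [->|w0].
  by rewrite mulr0 mul0r cos0; exact: is_derive_id.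
have pi0 : pi != 0 :> R by rewrite gt_eqF// pi_gt0.
apply: is_derive_eq; rewrite /GRing.scale/=; move: (pi : R) pi0 => P P0; field.
by rewrite w0 P0.
Qed.

Lemma reson_prim_derive ls x : is_derive x (1 : R) (reson_prim ls) (reson ls x).
Proof. by apply: fsum_derive => w; exact: sin_prim_derive. Qed.

Lemma reson_prim0 ls : reson_prim ls 0 = 0.
Proof.
rewrite /reson_prim -[RHS](mulr0 (2 ^+ size ls)) -fsum_cst; apply: eq_fsum => w.
by rewrite /sin_prim; case: eqP => // _; rewrite mulr0 sin0 mul0r.
Qed.

Lemma reson_prim_ge0 ls x : 0 <= x -> 0 <= reson_prim ls x.
Proof.
move=> x0; rewrite -(reson_prim0 ls); apply: (@derive_ge0_le R _ (reson ls)) => //.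
  by move=> y _; exact: reson_prim_derive.
by move=> y _; case/andP: (reson_bound ls y).
Qed.

Lemma reson_prim_le ls x : 0 <= x -> reson_prim ls x <= 2 ^+ size ls * x.
Proof.
move=> x0; rewrite -subr_ge0.
have -> : 0 = 2 ^+ size ls * 0 - reson_prim ls 0 by rewrite reson_prim0 mulr0 subr0.
apply: (@derive_ge0_le R (fun y => 2 ^+ size ls * y - reson_prim ls y) (fun y => 2 ^+ size ls - reson ls y)) => //.
  move=> y _; have d := reson_prim_derive ls y.
  by apply: is_derive_eq; rewrite /GRing.scale/=; ring.
by move=> y _; rewrite subr_ge0; case/andP: (reson_bound ls y).
Qed.

(** Since [1 + cos <= 2], any one frequency can be discarded at the cost of a factor 2. This brings
    the upper bound to the same set of frequencies as the lower bound. *)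
Lemma reson_prim_cons_le l ls x : 0 <= x -> reson_prim (l :: ls) x <= 2 * reson_prim ls x.
Proof.
move=> x0; rewrite -subr_ge0.
have -> : 0 = 2 * reson_prim ls 0 - reson_prim (l :: ls) 0 by rewrite !reson_prim0 mulr0 subr0.
apply: (@derive_ge0_le R (fun y => 2 * reson_prim ls y - reson_prim (l :: ls) y)
  (fun y => 2 * reson ls y - reson (l :: ls) y)) => //.
  move=> y _; have d := reson_prim_derive ls y; have d' := reson_prim_derive (l :: ls) y.
  by apply: is_derive_eq; rewrite /GRing.scale/=; ring.
move=> y _; rewrite reson_cons.
have /andP[h _] := reson_bound ls y; have c1 := cos_le1 (2 * pi * l * y).
have := mulr_ge0 h (_ : 0 <= 1 - cos (2 * pi * l * y)); rewrite subr_ge0 => /(_ c1); clear; lra.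
Qed.

Lemma sin_prim_sinc w x : x * sinc (2 * pi * `|w| * x) = sin_prim w x.
Proof.
have pi0 : pi != 0 :> R by rewrite gt_eqF// pi_gt0.
rewrite /sin_prim; have [->|w0] := eqVneq w 0.
  by rewrite normr0 mulr0 mul0r /sinc eqxx mulr1.
have n0 : `|w| != 0 by rewrite normr_eq0.
rewrite /sinc; case: eqVneq => [|h].
  move/eqP; rewrite !mulf_eq0 (negbTE n0) (negbTE pi0) pnatr_eq0/= => /eqP ->.
  by rewrite !mulr0 sin0 !mul0r.
move: h; rewrite !mulf_eq0 !negb_or => /andP[_ x0].
have [wp|wn] := leP 0 w.
  by rewrite ger0_norm//; move: (pi : R) pi0 (sin _) => P pi0 S; field; rewrite x0 w0 pi0.
rewrite ltr0_norm//.
have -> : 2 * pi * - w * x = - (2 * pi * w * x) by ring.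
by rewrite sinN; move: (pi : R) pi0 (sin _) => P pi0 S; field; rewrite x0 w0 pi0.
Qed.

Lemma sinc_bound (y : R) : `|sinc y| <= 1.
Proof.
have H (x : R) : 0 <= x -> `|sin x| <= x.
  move=> x0; rewrite ler_norml sin_le// andbT.
  have [x1|x1] := leP x 1; last by have := sin_geN1 x; clear -x1; lra.
  have := sin_ge x0; have : x ^+ 3 <= x by rewrite exprS ler_piMr// expr_le1.
  clear -x0; lra.
rewrite /sinc; case: eqP => [_|/eqP n0]; first by rewrite normr1.
rewrite normf_div ler_pdivrMr ?normr_gt0// mul1r.
have [y0|y0] := leP 0 y; first by rewrite (ger0_norm y0) H.
by rewrite (ltr0_norm y0) -[y in sin y]opprK sinN normrN H// oppr_ge0 ltW.
Qed.

Lemma sin_prim_bound w x : 0 <= x -> `|sin_prim w x| <= 2 * x / (1 + `|w| * x).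
Proof.
move=> x0; have pi2 := @pi_ge2 R.
have wx0 : 0 <= `|w| * x by rewrite mulr_ge0.
have d0 : 0 < 1 + `|w| * x by rewrite ltr_wpDr.
rewrite ler_pdivlMr//.
have [wx|wx] := leP (`|w| * x) 1.
  rewrite -sin_prim_sinc normrM (ger0_norm x0) mulrC.
  have -> : 2 * x = 2 * (x * 1) by rewrite mulr1.
  apply: ler_pM; rewrite ?(ltW d0) ?mulr_ge0//; first by clear -wx; lra.
  by rewrite ler_wpM2l// sinc_bound.
have w0 : w != 0 by apply: contraTneq wx => ->; rewrite normr0 mul0r -leNgt.
have wp : 0 < `|w| by rewrite normr_gt0.
rewrite /sin_prim (negbTE w0) normf_div normrM (@ger0_norm _ (2 * pi)) ?mulr_ge0//; last first.
  by clear -pi2; lra.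
have s1 : `|sin (2 * pi * w * x)| <= 1 by rewrite ler_norml sin_geN1 sin_le1.
have P0 : 0 < 2 * pi * `|w| by rewrite mulr_gt0//; clear -pi2; lra.
rewrite mulrAC ler_pdivrMr//.
apply: (@le_trans _ _ (1 * (2 * (`|w| * x)))).
  by apply: ler_pM => //; [exact: ltW|clear -wx; lra].
have : 0 <= (pi - 1) * (`|w| * x) by rewrite mulr_ge0//; clear -pi2; lra.
move: (pi : R) (`|w|) wx0 => P W; clear; nra.
Qed.
End resonator.

(** * Summation by parts against the circle error *)
Section abel_summation.
Context {R : realType}.

(** The sign of the derivative is required only inside the interval: at the points [sqrt m] the
    counting function jumps. *)
Lemma derive_oo_ge0_le (F f : R -> R) (a b : R) : a <= b ->
  (forall x, x \in `[a, b] -> is_derive x (1 : R) F (f x)) ->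
  (forall x, a < x < b -> 0 <= f x) -> F a <= F b.
Proof.
rewrite le_eqVlt => /predU1P[->//|ab] dF f0.
have dF' x : x \in `]a, b[ -> is_derive x (1 : R) F (f x).
  by move=> xab; apply: dF; exact: subset_itv_oo_cc.
have cF : {within `[a, b], continuous F}.
  by apply: continuous_in_subspaceT => x /set_mem xab; exact: derive_continuous_at (dF _ xab).
have [c] := MVT ab dF' cF; rewrite in_itv/= => cab E.
by rewrite -subr_ge0 E mulr_ge0 ?f0// subr_ge0 ltW.
Qed.

(** Summation by parts through primitives. Between neighbouring points [sqrt m] the counting
    function is constant and [(N m - pi x^2) g + U] has derivative [(N m - pi x^2) g']; added to
    [Psi] with either sign it gives a nondecreasing function. *)
Lemma abel_sqrt (r : nat -> R) (N : nat -> R) (g g' U Psi Psi' : R -> R) K : (0 < K)%N ->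
  (forall m, N m = \sum_(1 <= i < m.+1) r i) ->
  (forall x, x \in `[1, Num.sqrt K%:R] -> is_derive x (1 : R) g (g' x)) ->
  (forall x, x \in `[1, Num.sqrt K%:R] -> is_derive x (1 : R) U (2 * pi * x * g x)) ->
  (forall x, x \in `[1, Num.sqrt K%:R] -> is_derive x (1 : R) Psi (Psi' x)) ->
  (forall m x, (0 < m < K)%N -> Num.sqrt m%:R < x < Num.sqrt m.+1%:R ->
     `|N m - pi * x ^+ 2| * `|g' x| <= Psi' x) ->
  `|\sum_(1 <= m < K.+1) r m * g (Num.sqrt m%:R) - (N K - pi * K%:R) * g (Num.sqrt K%:R)
     - pi * g 1 - (U (Num.sqrt K%:R) - U 1)| <= Psi (Num.sqrt K%:R) - Psi 1.
Proof.
move=> + NE dg dU dP H; elim: K H dg dU dP => [//|K IH] H dg dU dP _.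
have [->|K0] := posnP K.
  rewrite big_nat1 NE big_nat1 sqrtr1 !subrr.
  have -> : r 1%N * g 1 - (r 1%N - pi * 1) * g 1 - pi * g 1 - 0 = 0 by ring.
  by rewrite normr0.
set a : R := Num.sqrt K%:R; set b : R := Num.sqrt K.+1%:R.
have a1 : 1 <= a by rewrite -sqrtr1 ler_wsqrtr// ler1n.
have ab : a <= b by rewrite ler_wsqrtr// ler_nat.
have sub x : x \in `[1, a] -> x \in `[1, b].
  by rewrite !in_itv/= => /andP[-> xa]; rewrite (le_trans xa).
have sub' x : x \in `[a, b] -> x \in `[1, b].
  by rewrite !in_itv/= => /andP[xa ->]; rewrite (le_trans a1).
have H' m x : (0 < m < K)%N -> Num.sqrt m%:R < x < Num.sqrt m.+1%:R ->
    `|N m - pi * x ^+ 2| * `|g' x| <= Psi' x.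
  by move=> /andP[m0 mK]; apply: H; rewrite m0 ltnW.
have {}IH := IH H'
  (fun x xa => dg x (sub x xa)) (fun x xa => dU x (sub x xa)) (fun x xa => dP x (sub x xa)) K0.
have dF s x : x \in `[a, b] -> is_derive x (1 : R)
    (fun x => Psi x + s * ((N K - pi * x ^+ 2) * g x + U x))
    (Psi' x + s * ((N K - pi * x ^+ 2) * g' x)).
  move=> /sub' xab; have d1 := dg _ xab; have d2 := dU _ xab; have d3 := dP _ xab.
  by apply: is_derive_eq; rewrite /GRing.scale/=; ring.
have {}H (x : R) : a < x < b -> `|(N K - pi * x ^+ 2) * g' x| <= Psi' x.
  by move=> xab; rewrite normrM; apply: H => //; rewrite K0/=.
have h1 := derive_oo_ge0_le ab (dF 1); have h2 := derive_oo_ge0_le ab (dF (- 1)).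
have {}h1 : Psi a + 1 * ((N K - pi * a ^+ 2) * g a + U a) <= Psi b + 1 * ((N K - pi * b ^+ 2) * g b + U b).
  by apply: h1 => x /H; rewrite ler_norml => /andP[+ _]; clear; lra.
have {}h2 : Psi a + - 1 * ((N K - pi * a ^+ 2) * g a + U a) <= Psi b + - 1 * ((N K - pi * b ^+ 2) * g b + U b).
  by apply: h2 => x /H; rewrite ler_norml => /andP[_]; clear; lra.
have a2 : a ^+ 2 = K%:R by rewrite sqr_sqrtr// ler0n.
have b2 : b ^+ 2 = K%:R + 1 by rewrite sqr_sqrtr ?ler0n// natr1.
have NS : N K.+1 = N K + r K.+1 by rewrite !NE big_nat_recr.
rewrite big_nat_recr//= -/b NS -natr1; move: IH h1 h2; rewrite -/a a2 b2.
set s := \sum_(_ <= _ < _) _ => IH h1 h2.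
move: IH; rewrite !ler_norml => /andP[i1 i2].
move: (N K) (r K.+1) (g a) (g b) (U a) (U b) (Psi a) (Psi b) (K%:R : R) (pi : R) s (g 1) (U 1) (Psi 1) h1 h2 i1 i2.
by clear; move=> *; apply/andP; split; nra.
Qed.
End abel_summation.

(** * The cut-off and the test function *)

Section damping.
Context {R : realType}.
Implicit Types (p q x : R) (ls : seq R).

Definition gauss p x : R := expR (- (p ^+ 2 * x ^+ 2)).

(* With [X] the lower end of the range, [q ^-1] is larger than [X]: the factor
   [(1 - gauss q x) ^+ 4] vanishes to order 8 at 0 and makes the range [x <= X], where
   nothing is assumed on the circle error, negligible. *)
Definition damp p q x : R := gauss p x * (1 - gauss q x) ^+ 4.

Definition damp' p q x : R := - (2 * p ^+ 2 * x) * damp p q x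
  + 8 * q ^+ 2 * x * gauss q x * (1 - gauss q x) ^+ 3 * gauss p x.

Lemma gauss_ge0 p x : 0 <= gauss p x. Proof. exact: expR_ge0. Qed.

Lemma gauss_le1 p x : gauss p x <= 1.
Proof. by rewrite -[leRHS]expR0 ler_expR oppr_le0 mulr_ge0// sqr_ge0. Qed.

Lemma one_minus_gauss q x : 0 <= 1 - gauss q x <= 1.
Proof. by rewrite subr_ge0 gauss_le1 gerBl gauss_ge0. Qed.

Lemma one_minus_gauss_le q x : 1 - gauss q x <= (q * x) ^+ 2.
Proof. by rewrite exprMn; have := expR_ge1Dx (- (q ^+ 2 * x ^+ 2)); rewrite /gauss; clear; lra. Qed.

Lemma sqr_gauss_le p x : (p * x) ^+ 2 * gauss p x <= 1.
Proof.
rewrite /gauss -exprMn; set y := _ ^+ 2; have y0 : 0 <= y by exact: sqr_ge0.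
have := expN_le_inv y0; rewrite ler_pdivlMr; last by clear -y0; lra.
have := expR_ge0 (- y); clear -y0; nra.
Qed.

Lemma gauss_derive p x : is_derive x (1 : R) (gauss p) (- (2 * p ^+ 2 * x) * gauss p x).
Proof. by rewrite /gauss; apply: is_derive_eq; rewrite /GRing.scale/=; ring. Qed.

Lemma damp_derive p q x : is_derive x (1 : R) (damp p q) (damp' p q x).
Proof.
have d1 := gauss_derive p x; have d2 := gauss_derive q x.
by rewrite /damp' /damp; apply: is_derive_eq; rewrite /GRing.scale/=; ring.
Qed.

Lemma damp_ge0 p q x : 0 <= damp p q x.
Proof. by rewrite mulr_ge0 ?gauss_ge0// exprn_ge0//; case/andP: (one_minus_gauss q x). Qed.

Lemma damp_le p q x : damp p q x <= gauss p x.
Proof.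
rewrite ler_piMr ?gauss_ge0// exprn_ile1//; by case/andP: (one_minus_gauss q x).
Qed.

Lemma damp_le_pow p q x : damp p q x <= gauss p x * (q * x) ^+ 8.
Proof.
rewrite ler_wpM2l ?gauss_ge0// (_ : 8 = 2 * 4)%N// exprM lerXn2r ?nnegrE ?sqr_ge0 ?one_minus_gauss_le//.
by case/andP: (one_minus_gauss q x).
Qed.

Lemma damp'_le p q x : 0 < x -> `|damp' p q x| <= gauss p x * (2 * p ^+ 2 * x + 8 / x).
Proof.
move=> x0; have /andP[h0 h1] := one_minus_gauss q x.
have e0 := gauss_ge0 p x; have e1 := gauss_ge0 q x.
apply: (le_trans (ler_normD _ _)); rewrite mulrDr; apply: lerD.
  have k : 0 <= 2 * p ^+ 2 * x by apply: mulr_ge0; [apply: mulr_ge0; [by []|exact: sqr_ge0]|exact: ltW].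
  by rewrite normrM normrN (ger0_norm k) (ger0_norm (damp_ge0 _ _ _)) mulrC ler_wpM2r ?damp_le.
rewrite ger0_norm; last exact: (mulr_ge0 (mulr_ge0 (mulr_ge0 (mulr_ge0 (mulr_ge0 (ler0n _ 8) (sqr_ge0 q)) (ltW x0)) e1) (exprn_ge0 3 h0)) e0).
rewrite mulrC ler_wpM2l// ler_pdivlMr//.
have -> : 8 * q ^+ 2 * x * gauss q x * (1 - gauss q x) ^+ 3 * x =
   8 * ((q * x) ^+ 2 * gauss q x) * (1 - gauss q x) ^+ 3 by ring.
rewrite -[leRHS]mulr1 -[X in _ <= X * _]mulr1; apply: ler_pM.
- exact: (mulr_ge0 (ler0n _ 8) (mulr_ge0 (sqr_ge0 _) e1)).
- by rewrite exprn_ge0.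
- by rewrite ler_wpM2l// sqr_gauss_le.
- by rewrite exprn_ile1.
Qed.

Lemma damp'_le_pow p q x : 0 < x -> `|damp' p q x| <= 10 * q ^+ 8 * x ^+ 7.
Proof.
move=> x0; have /andP[h0 h1] := one_minus_gauss q x.
have e0 := gauss_ge0 p x; have e1 := gauss_ge0 q x.
apply: (le_trans (ler_normD _ _)).
have -> : 10 * q ^+ 8 * x ^+ 7 = 2 * q ^+ 8 * x ^+ 7 + 8 * q ^+ 8 * x ^+ 7 by ring.
have q8 : 0 <= q ^+ 8 by rewrite (_ : 8 = 2 * 4)%N// exprM exprn_ge0 ?sqr_ge0.
apply: lerD.
  have k : 0 <= 2 * p ^+ 2 * x by apply: mulr_ge0; [apply: mulr_ge0; [by []|exact: sqr_ge0]|exact: ltW].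
  rewrite normrM normrN (ger0_norm k) (ger0_norm (damp_ge0 _ _ _)).
  apply: (@le_trans _ _ (2 * p ^+ 2 * x * (gauss p x * (q * x) ^+ 8))).
    by rewrite ler_wpM2l ?damp_le_pow.
  have -> : 2 * p ^+ 2 * x * (gauss p x * (q * x) ^+ 8) =
     2 * q ^+ 8 * x ^+ 7 * ((p * x) ^+ 2 * gauss p x) by ring.
  by rewrite ler_piMr ?sqr_gauss_le// mulr_ge0 ?exprn_ge0 ?(ltW x0)// mulr_ge0.
rewrite ger0_norm; last exact: (mulr_ge0 (mulr_ge0 (mulr_ge0 (mulr_ge0 (mulr_ge0 (ler0n _ 8) (sqr_ge0 q)) (ltW x0)) e1) (exprn_ge0 3 h0)) e0).
have -> : 8 * q ^+ 8 * x ^+ 7 = 8 * q ^+ 2 * x * 1 * (((q * x) ^+ 2) ^+ 3) * 1 by ring.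
have k0 : 0 <= 8 * q ^+ 2 * x := mulr_ge0 (mulr_ge0 (ler0n _ 8) (sqr_ge0 q)) (ltW x0).
apply: ler_pM; rewrite ?gauss_le1//; first exact: (mulr_ge0 (mulr_ge0 k0 e1) (exprn_ge0 3 h0)).
apply: ler_pM; [exact: (mulr_ge0 k0 e1)|exact: (exprn_ge0 3 h0)|by rewrite ler_wpM2l// gauss_le1|].
by rewrite lerXn2r ?nnegrE ?sqr_ge0// one_minus_gauss_le.
Qed.

Definition resg p q ls x : R := damp p q x * reson_prim ls x / x.

Definition resg' p q ls x : R :=
  damp' p q x * reson_prim ls x / x + damp p q x * reson ls x / x - damp p q x * reson_prim ls x / x ^+ 2.

Lemma resg_derive p q ls x : 0 < x -> is_derive x (1 : R) (resg p q ls) (resg' p q ls x).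
Proof.
move=> x0; have d1 := damp_derive p q x; have d2 := reson_prim_derive ls x.
have d3 : is_derive x (1 : R) (fun y => y^-1) (- x ^- 2 * 1).
  by apply: dinv; rewrite gt_eqF.
by rewrite /resg /resg'; apply: is_derive_eq; rewrite /GRing.scale/=; field; rewrite gt_eqF.
Qed.

Lemma resg_ge0 p q ls x : 0 <= x -> 0 <= resg p q ls x.
Proof. by move=> x0; rewrite divr_ge0// mulr_ge0 ?damp_ge0 ?reson_prim_ge0. Qed.

Lemma resg_le p q ls x : 0 < x -> resg p q ls x <= 2 ^+ size ls * damp p q x.
Proof.
move=> x0; rewrite /resg ler_pdivrMr// -[leRHS]mulrA [leRHS]mulrCA ler_wpM2l ?damp_ge0//.
exact/reson_prim_le/ltW.
Qed.

Lemma resg'_le p q ls x : 0 < x ->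
  `|resg' p q ls x| <= gauss p x * (reson ls x / x + (2 * (p * x) ^+ 2 + 9) * reson_prim ls x / x ^+ 2).
Proof.
move=> x0; have /andP[r0 _] := reson_bound ls x; have v0 := reson_prim_ge0 ls (ltW x0).
have e0 := gauss_ge0 p x; have ix : 0 <= x^-1 by rewrite invr_ge0 ltW.
have D := damp_le p q x; have D0 := damp_ge0 p q x.
apply: (le_trans (ler_normB _ _)).
have h1 : `|damp' p q x * reson_prim ls x / x| <= gauss p x * (2 * p ^+ 2 * x + 8 / x) * reson_prim ls x / x.
  by rewrite 2!normrM (ger0_norm v0) (ger0_norm ix) ler_wpM2r// ler_wpM2r// damp'_le.
have h2 : `|damp p q x * reson ls x / x| <= gauss p x * reson ls x / x.
  by rewrite (ger0_norm (mulr_ge0 (mulr_ge0 D0 r0) ix)) ler_wpM2r// ler_wpM2r.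
have h3 : `|damp p q x * reson_prim ls x / x ^+ 2| <= gauss p x * reson_prim ls x / x ^+ 2.
  have ix2 : 0 <= x ^- 2 by rewrite invr_ge0 sqr_ge0.
  by rewrite (ger0_norm (mulr_ge0 (mulr_ge0 D0 v0) ix2)) ler_wpM2r// ler_wpM2r.
apply: (le_trans (lerD (le_trans (ler_normD _ _) (lerD h1 h2)) h3)).
rewrite le_eqVlt; apply/orP; left; apply/eqP; field; by rewrite gt_eqF.
Qed.

(** Meant for [x <= X / 2]: multiplied by the trivial bound [9 x^2] for the circle error it stays
    small thanks to the factor [q^8]. *)
Lemma resg'_le_pow p q ls x : 0 < x ->
  `|resg' p q ls x| <= 12 * 2 ^+ size ls * q ^+ 8 * x ^+ 7.
Proof.
move=> x0; have /andP[r0 r1] := reson_bound ls x; have v0 := reson_prim_ge0 ls (ltW x0).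
have v1 := reson_prim_le ls (ltW x0).
have ix : 0 <= x^-1 by rewrite invr_ge0 ltW.
have D0 := damp_ge0 p q x.
have D : damp p q x <= (q * x) ^+ 8.
  by apply: (le_trans (damp_le_pow p q x)); rewrite ler_piMl ?gauss_le1// (_ : 8 = 2 * 4)%N// exprM exprn_ge0 ?sqr_ge0.
move: (2 ^+ size ls) r1 v1 => n r1 v1; have n0 := le_trans r0 r1.
apply: (le_trans (ler_normB _ _)).
have vx : reson_prim ls x / x <= n by rewrite ler_pdivrMr.
have h1 : `|damp' p q x * reson_prim ls x / x| <= 10 * q ^+ 8 * x ^+ 7 * n.
  rewrite -mulrA normrM (@ger0_norm _ (reson_prim ls x / x)) ?mulr_ge0//.
  by apply: ler_pM; rewrite ?mulr_ge0// damp'_le_pow.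
have h2 : `|damp p q x * reson ls x / x| <= (q * x) ^+ 8 * n / x.
  by rewrite (ger0_norm (mulr_ge0 (mulr_ge0 D0 r0) ix)) ler_wpM2r// ler_pM.
have h3 : `|damp p q x * reson_prim ls x / x ^+ 2| <= (q * x) ^+ 8 * n / x.
  have -> : damp p q x * reson_prim ls x / x ^+ 2 = damp p q x * (reson_prim ls x / x) / x.
    by field; rewrite gt_eqF.
  have vx0 := mulr_ge0 v0 ix.
  by rewrite (ger0_norm (mulr_ge0 (mulr_ge0 D0 vx0) ix)) ler_wpM2r// ler_pM.
apply: (le_trans (lerD (le_trans (ler_normD _ _) (lerD h1 h2)) h3)).
rewrite le_eqVlt; apply/orP; left; apply/eqP; field; by rewrite gt_eqF.
Qed.
End damping.

(** * A majorant for the remainder of the summation by parts *)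

Section remainder_majorant.
Context {R : realType}.
Implicit Types (p q x S A : R) (ls rest : seq R).

(* Both sides of the resonance inequality are compared with this quantity: a
   frequency at distance [w] from [|k|] contributes about
   [|k| `^ (- 3 / 2) / Num.sqrt (p + |w|)] to the kernel [ek p _ k]. *)
Definition density p rest : R := fsum rest (fun w => 1 / Num.sqrt (p + `|w|)).

(** It increases from 0 to [pi / sqrt r], which is how [1 / sqrt (p + |w|)] enters the upper
    bound. *)
Definition atank (r x : R) : R := 2 * atan (Num.sqrt (r * x)) / Num.sqrt r.

Lemma atank_derive (r x : R) : 0 < r -> 0 < x ->
  is_derive x (1 : R) (atank r) (1 / (Num.sqrt x * (1 + r * x))).
Proof.
move=> r0 x0; have rx0 : 0 < r * x by rewrite mulr_gt0.
have d1 : is_derive x (1 : R) (fun y => Num.sqrt (r * y)) ((2 * Num.sqrt (r * x))^-1 * r).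
  apply: dsqrt => //; by apply: is_derive_eq; rewrite /GRing.scale/=; ring.
have sx : 0 < Num.sqrt x by rewrite sqrtr_gt0.
have sr : 0 < Num.sqrt r by rewrite sqrtr_gt0.
have sr2 : Num.sqrt r ^+ 2 = r by rewrite sqr_sqrtr// ltW.
have sx2 : Num.sqrt x ^+ 2 = x by rewrite sqr_sqrtr// ltW.
have E : Num.sqrt (r * x) = Num.sqrt r * Num.sqrt x by rewrite sqrtrM// ltW.
rewrite /atank; apply: is_derive_eq; rewrite /GRing.scale/= E.
move: (Num.sqrt r) (Num.sqrt x) sx sr sr2 sx2 => a b b0 a0 <- <-.
rewrite -exprMn; have h : 1 + (a * b) ^+ 2 != 0 by rewrite gt_eqF// ltr_wpDr// sqr_ge0.
by move: (1 + _) h => d h; field; rewrite h !gt_eqF.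
Qed.

Lemma atank_bound (r x : R) : 0 < r -> 0 <= atank r x <= 4 / Num.sqrt r.
Proof.
move=> r0; have sr : 0 < Num.sqrt r by rewrite sqrtr_gt0.
have a0 : 0 <= atan (Num.sqrt (r * x)).
  by rewrite -atan0 le_atan// sqrtr_ge0.
have a1 : 2 * atan (Num.sqrt (r * x)) <= 4.
  have := atan_ltpi2 (Num.sqrt (r * x)); have := pihalf_lt2 R; clear; lra.
rewrite /atank divr_ge0 ?mulr_ge0 ?(ltW sr)//=.
by rewrite ler_wpM2r// invr_ge0 ltW.
Qed.

(* [maj] is an explicit primitive of an upper bound for
   [S * Num.sqrt x * `|resg' x| + A / x], see [maj_ge]. *)
Definition maj S p ls rest A x : R :=
  S * (gauss p x * reson_prim ls x / Num.sqrt x + 320 * fsum rest (fun w => atank (p + `|w|) x))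
  + A * ln x.

Definition maj' S p ls rest A x : R :=
  S * ((gauss p x * reson ls x - 2 * p ^+ 2 * x * gauss p x * reson_prim ls x) / Num.sqrt x
     - gauss p x * reson_prim ls x / (2 * x * Num.sqrt x)
     + 320 * fsum rest (fun w => 1 / (Num.sqrt x * (1 + (p + `|w|) * x))))
  + A / x.

Lemma maj_derive S p ls rest A x : 0 < p -> 0 < x ->
  is_derive x (1 : R) (maj S p ls rest A) (maj' S p ls rest A x).
Proof.
move=> p0 x0.
have d1 := gauss_derive p x; have d2 := reson_prim_derive ls x.
have sx : 0 < Num.sqrt x by rewrite sqrtr_gt0.
have sx2 : Num.sqrt x ^+ 2 = x by rewrite sqr_sqrtr// ltW.
have d3 : is_derive x (1 : R) (fun y => Num.sqrt y) ((2 * Num.sqrt x)^-1 * 1) by apply: dsqrt.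
have d4 : is_derive x (1 : R) (fun y => (Num.sqrt y)^-1) (- (Num.sqrt x) ^- 2 * ((2 * Num.sqrt x)^-1 * 1)).
  by apply: dinv => //; rewrite gt_eqF.
have d5 : is_derive x (1 : R) (fun y => fsum rest (fun w => atank (p + `|w|) y))
    (fsum rest (fun w => 1 / (Num.sqrt x * (1 + (p + `|w|) * x)))).
  by apply: fsum_derive => w; apply: atank_derive => //; rewrite ltr_wpDr.
have d6 : is_derive x (1 : R) (fun y => ln y) (x^-1 * 1) by apply: dln.
rewrite /maj /maj'; apply: is_derive_eq; rewrite /GRing.scale/=.
move: (fsum _ _) (gauss p x) (reson_prim ls x) (reson ls x) => F G V W.
by clear -sx sx2; move: (Num.sqrt x) sx sx2 => s s0 <-; field; rewrite gt_eqF.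
Qed.

(** [sqrt x * resg'] contains the product [reson] itself, which is under control only in mean. It is
    absorbed as a part of the derivative of the first term of [maj]; all other terms involve the
    primitive, which is bounded through the frequencies of [rest]. *)
Lemma maj_ge S p q ls rest x : 0 < p -> 0 < x -> 0 <= S ->
  reson_prim ls x <= 2 * reson_prim rest x ->
  S * Num.sqrt x * `|resg' p q ls x| <= maj' S p ls rest 0 x.
Proof.
move=> p0 x0 S0 Vle.
have sx : 0 < Num.sqrt x by rewrite sqrtr_gt0.
have sx2 : Num.sqrt x ^+ 2 = x by rewrite sqr_sqrtr// ltW.
rewrite /maj' mul0r addr0 -mulrA ler_wpM2l//.
apply: (le_trans (ler_wpM2l (ltW sx) (resg'_le p q ls x0))).
have Vr : reson_prim rest x <= fsum rest (fun w => 2 * x / (1 + `|w| * x)).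
  by apply: fsum_le => w; apply: (le_trans (ler_norm _)); apply: sin_prim_bound; exact: ltW.
have v0 := reson_prim_ge0 ls (ltW x0).
have px0 : 0 < 1 + p * x by rewrite ltr_wpDr// mulr_ge0// ltW.
have e0 := gauss_ge0 p x.
have E8 : gauss p x * (1 + (p * x) ^+ 2) <= 8 / (1 + p * x).
  have y0 : 0 <= (p * x) ^+ 2 by exact: sqr_ge0.
  have := expN_le_inv2 y0; rewrite exprMn -/(gauss p x) -exprMn => h.
  have h1 : 0 < 1 + (p * x) ^+ 2 by clear -y0; lra.
  apply: (le_trans (ler_wpM2r (ltW h1) h)).
  have -> : 4 / (1 + (p * x) ^+ 2) ^+ 2 * (1 + (p * x) ^+ 2) = 4 / (1 + (p * x) ^+ 2).
    by field; rewrite gt_eqF.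
  rewrite ler_pdivrMr// mulrAC ler_pdivlMr//.
  by move: (p * x) px0 => y; clear; nra.
(* 320 = 10 * 8 * 2 * 2: a numerical coefficient, the 8 of [E8], the discarded frequency, and
   [sin_prim_bound]. The two denominators combine by [(1 + p x) (1 + |w| x) >= 1 + (p + |w|) x]. *)
have K1 : 10 * (gauss p x * (1 + (p * x) ^+ 2)) * reson_prim ls x / (x * Num.sqrt x) <=
    320 * fsum rest (fun w => 1 / (Num.sqrt x * (1 + (p + `|w|) * x))).
  apply: (@le_trans _ _ (10 * (8 / (1 + p * x)) * (2 * fsum rest (fun w => 2 * x / (1 + `|w| * x))) / (x * Num.sqrt x))).
    rewrite ler_wpM2r ?invr_ge0 ?mulr_ge0 ?(ltW x0) ?(ltW sx)//.
    apply: ler_pM => //.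
    - by rewrite mulr_ge0// mulr_ge0// addr_ge0// sqr_ge0.
    - by rewrite ler_wpM2l.
    - by apply: (le_trans Vle); rewrite ler_wpM2l.
  rewrite -!fsumZ; set c1 := 10 * _; set c2 := (x * Num.sqrt x)^-1.
  rewrite [leLHS]mulrC -fsumZ; apply: fsum_le => w.
  have wx : 0 <= `|w| * x by rewrite mulr_ge0// ltW.
  have wx1 : 0 < 1 + `|w| * x by clear -wx; lra.
  have -> : c2 * (c1 * (2 * (2 * x / (1 + `|w| * x)))) =
     320 * (1 / (Num.sqrt x * ((1 + p * x) * (1 + `|w| * x)))).
    by rewrite /c1 /c2; field; rewrite !gt_eqF.
  rewrite (ler_wpM2l (ler0n R 320))// !div1r lef_pV2 ?posrE ?mulr_gt0//.
    rewrite ler_wpM2l ?(ltW sx)//.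
    have : 0 <= (p * x) * (`|w| * x) by rewrite mulr_ge0// mulr_ge0 ?ltW.
    by clear; lra.
  by rewrite ltr_wpDr// (mulr_ge0 _ (ltW x0))// addr_ge0// ltW.
move: K1; set F := fsum _ _; move: F => F K1.
move: (gauss p x) (reson_prim ls x) (reson ls x) e0 v0 K1 => G V W G0 V0 K1.
move: (Num.sqrt x) sx sx2 K1 => s s0 <- K1.
have K2 : 0 <= 1 / 2 * G * V / (s ^+ 2 * s) + 6 * p ^+ 2 * s ^+ 4 * G * V / (s ^+ 2 * s).
  have GV := mulr_ge0 G0 V0.
  have i0 : 0 <= (s ^+ 2 * s)^-1 by rewrite invr_ge0 (mulr_ge0 (sqr_ge0 s))// ltW.
  have h := mulr_ge0 (sqr_ge0 (p * s ^+ 2)) GV.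
  have -> : 1 / 2 * G * V / (s ^+ 2 * s) + 6 * p ^+ 2 * s ^+ 4 * G * V / (s ^+ 2 * s) =
    (1 / 2 * (G * V) + 6 * ((p * s ^+ 2) ^+ 2 * (G * V))) / (s ^+ 2 * s) by ring.
  by apply: mulr_ge0 i0; clear -GV h; lra.
rewrite -subr_ge0.
have -> : (G * W - 2 * p ^+ 2 * s ^+ 2 * G * V) / s - G * V / (2 * s ^+ 2 * s) + 320 * F -
    s * (G * (W / s ^+ 2 + (2 * (p * s ^+ 2) ^+ 2 + 9) * V / (s ^+ 2) ^+ 2)) =
    (320 * F - 10 * (G * (1 + (p * s ^+ 2) ^+ 2)) * V / (s ^+ 2 * s)) +
    (1 / 2 * G * V / (s ^+ 2 * s) + 6 * p ^+ 2 * s ^+ 4 * G * V / (s ^+ 2 * s)).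
  by field; rewrite gt_eqF.
by apply: addr_ge0 K2; rewrite subr_ge0.
Qed.
End remainder_majorant.

(** * Lattice points and the dual sum *)
Section lattice_counts.
Implicit Types (v : int * int) (m n K : nat).

Definition nsq v : nat := absz (v.1 ^+ 2 + v.2 ^+ 2)%R.

Lemma nsqE v : (nsq v)%:Z = v.1 ^+ 2 + v.2 ^+ 2.
Proof. by rewrite /nsq gez0_abs// addr_ge0// sqr_ge0. Qed.

Lemma mem_zs2 n v : (v \in zs2 n) = (`|v.1| <= n%:Z) && (`|v.2| <= n%:Z).
Proof.
rewrite -!mem_zs; apply/allpairsP/andP => [[[a b] /= [ha hb ->]]|[h1 h2]]; first by [].
by exists v; split => //; case: v {h1 h2}.
Qed.

Lemma uniq_zs2 n : uniq (zs2 n).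
Proof. by apply: allpairs_uniq; rewrite ?uniq_zs// => -[a b] [c d]. Qed.

Lemma nsq_zs2 n v : (nsq v <= n)%N -> v \in zs2 n.
Proof.
move=> vn; have := nsqE v; rewrite mem_zs2.
have h1 := sqr_ge0 v.1; have h2 := sqr_ge0 v.2 => E.
by move: v vn h1 h2 E => [a b] /= vn h1 h2 E; apply/andP; split; nia.
Qed.

Lemma nsq_eq0 v : (nsq v == 0)%N = (v == 0).
Proof.
case: v => a b; rewrite /nsq absz_eq0 /=.
have := sqr_ge0 a; have := sqr_ge0 b => h1 h2.
by rewrite paddr_eq0// !expf_eq0.
Qed.

Lemma r2_count n m : (m <= n)%N -> r2 m = size [seq v <- zs2 n | nsq v == m].
Proof.
move=> mn; rewrite /r2.
have -> : [set p : int * int | (p.1 ^+ 2 + p.2 ^+ 2 = m%:Z)%R] =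
    [set` [fset v in [seq v <- zs2 n | nsq v == m]]%fset].
  apply/seteqP; split => v /=; rewrite in_fset mem_filter.
    move=> vm; have vE : nsq v = m by apply/eqP; rewrite -eqz_nat nsqE vm.
    by rewrite vE eqxx/= nsq_zs2// vE.
  by move=> /andP[/eqP <- _]; rewrite nsqE.
by rewrite set_fsetK card_fseq undup_id// filter_uniq// uniq_zs2.
Qed.

Lemma sum_r2 (R : pzSemiRingType) (F : nat -> R) n K : (K <= n)%N ->
  \sum_(1 <= m < K.+1) (r2 m)%:R * F m = \sum_(v <- zs2 n | (0 < nsq v <= K)%N) F (nsq v).
Proof.
move=> Kn; rewrite [RHS]big_mkcond/=.
transitivity (\sum_(v <- zs2 n) \sum_(1 <= m < K.+1) (if nsq v == m then F m else 0)).
  rewrite exchange_big/= [LHS]big_nat [RHS]big_nat; apply: eq_bigr => m /andP[m1 mK].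
  rewrite -big_mkcond/= -big_filter big_const_seq count_predT (@r2_count n) ?(leq_trans _ Kn)//.
  by rewrite iter_addr_0 mulr_natl.
apply: eq_bigr => v _; case: ifP => [/andP[v0 vK]|].
  rewrite (big_rem (nsq v)) ?mem_index_iota ?v0 ?ltnS//= eqxx big1_seq ?addr0// => m /andP[_ mr].
  case: eqP => // E; move: mr; rewrite -E mem_rem_uniq ?iota_uniq// !inE eqxx//.
move=> vK; rewrite big_nat big1// => m mK; case: eqP => // E.
by move: vK; rewrite E -[(m <= K)%N]ltnS mK.
Qed.
End lattice_counts.

(** * Lattice sums: crude counting, Poisson summation, Gaussian tails *)

Section lattice_reals.
Context {R : realType}.
Implicit Types (p : R) (v : int * int) (ls : seq R).

Lemma vnrmE v : vnrm v = Num.sqrt (nsq v)%:R :> R.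
Proof.
by rewrite /vnrm -!rmorphXn -rmorphD/= -nsqE.
Qed.

(** The points lie in a square of [(2 s + 1)^2] points, [s] being the integer part of [sqrt K], and
    [2 s + 1 <= 3 s]. *)
Lemma sum_r2_le K : \sum_(1 <= m < K.+1) (r2 m)%:R <= 9 * K%:R :> R.
Proof.
have [->|K0] := posnP K; first by rewrite big_geq// mulr0.
pose s := Num.truncn (Num.sqrt K%:R : R).
have s0 : 0 <= Num.sqrt K%:R :> R by rewrite sqrtr_ge0.
have sK : Num.sqrt K%:R ^+ 2 = K%:R :> R by rewrite sqr_sqrtr// ler0n.
have /andP[s1 s2] := truncn_itv s0; rewrite -/s in s1 s2.
have sK' : (s * s <= K)%N.
  by rewrite -(ler_nat R) natrM -sK expr2 ler_pM// ler0n.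
have Ks : (K < s.+1 * s.+1)%N.
  by rewrite -(ltr_nat R) natrM -sK expr2 ltr_pM.
under eq_bigr => m _ do rewrite -[(r2 m)%:R]mulr1.
rewrite (@sum_r2 R (fun=> 1) K K)//.
rewrite -big_filter big_const_seq count_predT iter_addr_0 -[9]/(9%:R) -natrM ler_nat.
have : (size [seq v <- zs2 K | (0 < nsq v <= K)%N] <= size (zs2 s))%N.
  apply: uniq_leq_size; first by rewrite filter_uniq// uniq_zs2.
  move=> v; rewrite mem_filter => /andP[/andP[_ vK] _]; rewrite mem_zs2.
  have := nsqE v; have := sqr_ge0 v.1; have := sqr_ge0 v.2.
  by move: v vK => [a b] /= vK h1 h2 E; apply/andP; split; nia.
move=> /leq_trans; apply.
have sz m : size (zs m) = (2 * m).+1.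
  by elim: m => //= m ->; lia.
rewrite size_allpairs sz; nia.
Qed.

Lemma fsum_near ls (a : R -> nat -> R) :
  (forall w e, 0 < e -> \forall n \near \oo, `|a w n| <= e) ->
  forall e, 0 < e -> \forall n \near \oo, `|fsum ls (a ^~ n)| <= e.
Proof.
elim: ls a => [|l ls IH] a H e e0 /=; first exact: H.
apply: (IH (fun w n => a w n + (a (w + l) n + a (w - l) n) / 2)) => // w e' e'0.
have e2 : 0 < e' / 2 by rewrite divr_gt0.
near=> n.
have h0 : `|a w n| <= e' / 2 by near: n; exact: H.
have h1 : `|a (w + l) n| <= e' / 2 by near: n; exact: H.
have h2 : `|a (w - l) n| <= e' / 2 by near: n; exact: H.
move: h0 h1 h2; rewrite !ler_norml => /andP[? ?] /andP[? ?] /andP[? ?].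
by apply/andP; split; lra.
Unshelve. all: by end_near.
Qed.

Lemma fsum_poisson ls p (e : R) : 0 < p -> 0 < e -> \forall n \near \oo,
  `|\sum_(v <- zs2 n) fsum ls (fun w => gauss p (vnrm v) * sinc (2 * pi * `|w| * vnrm v))
    - \sum_(k <- zs2 n) fsum ls (fun w => ek p `|w| k)| <= e.
Proof.
move=> p0 e0.
have H := @fsum_near ls (fun w n =>
  \sum_(v <- zs2 n) (gauss p (vnrm v) * sinc (2 * pi * `|w| * vnrm v)) - \sum_(k <- zs2 n) ek p `|w| k).
have {}H := H (fun w e e0 => avg_poisson p0 (normr_ge0 w) e0) e e0.
by apply: filterS H => n; rewrite fsumD fsumN !fsum_sum.
Qed.

(** Half of the exponent gives the exponential factor, the other half is bounded by a product of two
    Cauchy kernels; 100 = 4 * 5^2 by [sum_zs_cauchy]. *)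
Lemma gauss_tail p K n : 0 < p <= 1 ->
  \sum_(v <- zs2 n | (K < nsq v)%N) gauss p (vnrm v) <= 100 / p ^+ 4 * expR (- (p ^+ 2 * K%:R / 2)).
Proof.
move=> /andP[p0 p1].
have p2 : 0 < p ^+ 2 by rewrite exprn_gt0.
have p21 : p ^+ 2 <= 1 by rewrite expr_le1// ltW.
have p4 : 0 <= 4 / p ^+ 4 by rewrite divr_ge0// exprn_ge0// ltW.
pose f (j : int) : R := 1 / (1 + j%:~R ^+ 2).
have f0 j : 0 <= f j by rewrite divr_ge0// addr_ge0// sqr_ge0.
have E (j : int) : expR (- (p ^+ 2 * j%:~R ^+ 2 / 2)) <= 2 / p ^+ 2 * f j.
  have j0 := sqr_ge0 (j%:~R : R).
  have y0 : 0 <= p ^+ 2 * j%:~R ^+ 2 / 2 by rewrite divr_ge0// mulr_ge0// ltW.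
  apply: (le_trans (expN_le_inv y0)).
  have j1 : 0 < 1 + (j%:~R : R) ^+ 2 by rewrite ltr_wpDr.
  have -> : 2 / p ^+ 2 * f j = 1 / (p ^+ 2 / 2 * (1 + j%:~R ^+ 2)).
    by rewrite /f; field; rewrite !gt_eqF.
  rewrite !div1r lef_pV2 ?posrE ?mulr_gt0 ?invr_gt0//; first by clear -p21 j0; lra.
  by rewrite ltr_wpDr.
apply: (@le_trans _ _ (\sum_(v <- zs2 n) 4 / p ^+ 4 * expR (- (p ^+ 2 * K%:R / 2)) * (f v.1 * f v.2))).
  rewrite big_mkcond/= ler_sum// => v _; case: ifP => [Kv|_]; last first.
    exact: (mulr_ge0 (mulr_ge0 p4 (expR_ge0 _)) (mulr_ge0 (f0 _) (f0 _))).
  rewrite /gauss.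
  have vn : (vnrm v : R) ^+ 2 = v.1%:~R ^+ 2 + v.2%:~R ^+ 2.
    by rewrite sqr_sqrtr// addr_ge0// sqr_ge0.
  have vK : K%:R <= (vnrm v : R) ^+ 2 by rewrite vnrmE sqr_sqrtr ?ler0n// ler_nat ltnW.
  apply: (@le_trans _ _ (expR (- (p ^+ 2 * K%:R / 2)) *
     (expR (- (p ^+ 2 * v.1%:~R ^+ 2 / 2)) * expR (- (p ^+ 2 * v.2%:~R ^+ 2 / 2))))).
    rewrite -!expRD ler_expR.
    have := ler_wpM2l (ltW p2) vK; rewrite vn => h; clear -h; lra.
  have -> : 4 / p ^+ 4 * expR (- (p ^+ 2 * K%:R / 2)) * (f v.1 * f v.2) =
    expR (- (p ^+ 2 * K%:R / 2)) * ((2 / p ^+ 2 * f v.1) * (2 / p ^+ 2 * f v.2)).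
    by field; rewrite gt_eqF.
  by rewrite ler_wpM2l ?expR_ge0// ler_pM ?expR_ge0.
rewrite -mulr_sumr sum_zs2 /=.
have -> : \sum_(i <- zs n) \sum_(j <- zs n) f i * f j = (\sum_(i <- zs n) f i) ^+ 2.
  by rewrite expr2 mulr_suml; apply: eq_bigr => i _; rewrite mulr_sumr.
have s0 : 0 <= \sum_(i <- zs n) f i by apply: sumr_ge0.
have s5 : \sum_(i <- zs n) f i <= 5.
  by apply: (le_trans (sum_zs_cauchy n)); rewrite gerBl divr_ge0.
have -> : 100 / p ^+ 4 * expR (- (p ^+ 2 * K%:R / 2)) = 4 / p ^+ 4 * expR (- (p ^+ 2 * K%:R / 2)) * 25 by ring.
rewrite ler_wpM2l//; first exact: (mulr_ge0 p4 (expR_ge0 _)).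
by clear -s0 s5; nra.
Qed.
End lattice_reals.

(** * The dual sum from below and from above *)

Section dual_lattice_sum.
Context {R : realType}.
Notation mu := (@lebesgue_measure R).
Implicit Types (p q : R) (k v : int * int) (ls rest : seq R) (M : seq nat).

(** Half of the constant of [ek_lower]: of two opposite frequencies only one is used in
    [fsum_ek_lower]. *)
Definition radial_const : R := expR (- (2 * pi ^+ 2)) / 64.

Lemma radial_const_gt0 : 0 < radial_const.
Proof. by rewrite divr_gt0// expR_gt0. Qed.

(** The frequencies of the full product are those of [rest] shifted by 0 and by plus or minus [|k|],
    so that frequencies near [|k|] correspond to frequencies of [rest] near 0. Those of modulus
    above 1 are given up, at a total cost of at most [2^size rest]. *)
Lemma fsum_ek_lower p ls rest k : 0 < p <= 1 -> k != 0 -> perm_eq ls (vnrm k :: rest) ->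
  radial_const / (vnrm k * Num.sqrt (vnrm k)) * (density p rest - 2 ^+ size rest)
    <= fsum ls (fun w => ek p `|w| k).
Proof.
move=> p01 k0 pls; rewrite (fsum_perm _ pls) /=.
have /andP[p0 p1] := p01.
set l := vnrm k; have l1 : 1 <= l by exact: vnrm_ge1.
have l0 : 0 < l by exact: lt_le_trans l1.
have sl0 : 0 < Num.sqrt l by rewrite sqrtr_gt0.
set C := radial_const / (l * Num.sqrt l).
have C0 : 0 <= C by rewrite divr_ge0 ?(ltW radial_const_gt0)// mulr_ge0 ?ltW.
(* [ek_lower] requires a sphere of radius at least [|k|], that is [0 <= w]; the symmetry [w -> - w]
   recovers the other sign. *)
pose u (w : R) := if 0 <= w <= 1 then 1 / Num.sqrt (p + w) else 0.
have E1 : fsum rest (fun w => 2 * C * u w) <= fsum rest (fun w => ek p `|w + l| k).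
  apply: fsum_le => w; rewrite /u; case: ifP => [w01|_]; last by rewrite mulr0 ek_ge0.
  have /andP[w0 w1] := w01.
  rewrite ger0_norm ?addr_ge0 ?(ltW l0)// (addrC w l).
  apply: le_trans (ek_lower p01 l1 (erefl _) w01).
  have so0 : 0 < Num.sqrt (p + w) by rewrite sqrtr_gt0 ltr_wpDr.
  rewrite /C /radial_const -/l; move: (expR _) => e.
  by rewrite le_eqVlt; apply/orP; left; apply/eqP; field; rewrite !gt_eqF.
have E2 : fsum rest (fun w => ek p `|w - l| k) = fsum rest (fun w => ek p `|w + l| k).
  by rewrite -fsum_sym; apply: eq_fsum => w; rewrite -opprD normrN.
have E3 : fsum rest (fun w => ek p `|w + l| k) <=
    fsum rest (fun w => ek p `|w| k + (ek p `|w + l| k + ek p `|w - l| k) / 2).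
  have -> : fsum rest (fun w => ek p `|w| k + (ek p `|w + l| k + ek p `|w - l| k) / 2) =
    fsum rest (fun w => ek p `|w| k) + 2^-1 * (fsum rest (fun w => ek p `|w + l| k) + fsum rest (fun w => ek p `|w - l| k)).
    by rewrite -fsumD -fsumZ -fsumD; apply: eq_fsum => w; rewrite (mulrC _ 2^-1).
  have h : 0 <= fsum rest (fun w => ek p `|w| k) by apply: fsum_ge0 => w; exact: ek_ge0.
  rewrite E2; move: h; move: (fsum rest (fun w => ek p `|w| k)) (fsum rest (fun w => ek p `|w + l| k)) => a b.
  by clear; lra.
apply: le_trans E3; apply: le_trans E1.
have -> : 2 ^+ size rest = fsum rest (fun=> 1) :> R by rewrite fsum_cst mulr1.
have -> : fsum rest (fun w => 2 * C * u w) = C * (fsum rest u + fsum rest (fun w => u (- w))).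
  by rewrite fsum_sym fsumZ; ring.
rewrite ler_wpM2l// -fsumN -!fsumD; apply: fsum_le => w.
have H (y : R) : 0 <= y <= 1 -> u y = 1 / Num.sqrt (p + y) by rewrite /u => ->.
have u0 y : 0 <= u y by rewrite /u; case: ifP => // _; rewrite divr_ge0// sqrtr_ge0.
have [w1|w1] := leP `|w| 1.
  have [w0|w0] := leP 0 w.
    rewrite -(H `|w|) ?normr_ge0// ger0_norm//.
    by have := u0 (- w); clear; lra.
  rewrite -(H `|w|) ?normr_ge0// ltr0_norm//.
  by have := u0 w; clear; lra.
have h : 1 / Num.sqrt (p + `|w|) <= 1.
  rewrite ler_pdivrMr ?sqrtr_gt0 ?mul1r; last by rewrite ltr_wpDr.
  by rewrite -[leLHS]sqrtr1 ler_wsqrtr// ler_wpDl ?ltW.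
by have := u0 w; have := u0 (- w); clear -h; lra.
Qed.

Definition freqs M : seq R := [seq Num.sqrt m%:R | m <- M].

Lemma dual_sum_lower p M n : 0 < p <= 1 -> uniq M -> all (fun m => 0 < m <= n)%N M ->
  \sum_(m <- M) (r2 m)%:R * (radial_const / (Num.sqrt m%:R * Num.sqrt (Num.sqrt m%:R))
      * (density p (freqs (rem m M)) - 2 ^+ size M))
  <= \sum_(k <- zs2 n | k != 0) fsum (freqs M) (fun w => ek p `|w| k).
Proof.
move=> p01 uM aM.
pose F k := fsum (freqs M) (fun w => ek p `|w| k).
have F0 k : 0 <= F k by apply: fsum_ge0 => w; exact: ek_ge0.
apply: (@le_trans _ _ (\sum_(m <- M) \sum_(k <- zs2 n) (if nsq k == m then F k else 0))).
  rewrite big_seq [leRHS]big_seq; apply: ler_sum => m mM.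
  have /andP[m0 mn] := allP aM _ mM.
  rewrite -big_mkcond/= -big_filter mulr_natl (r2_count mn).
  set c := radial_const / _ * _.
  have -> : c *+ size [seq v <- zs2 n | nsq v == m] = \sum_(v <- [seq v <- zs2 n | nsq v == m]) c.
    by rewrite big_const_seq count_predT iter_addr_0.
  rewrite big_seq [leRHS]big_seq; apply: ler_sum => k; rewrite mem_filter => /andP[/eqP km _].
  have kn : k != 0 by rewrite -nsq_eq0 km -lt0n.
  have kE : vnrm k = Num.sqrt m%:R :> R by rewrite vnrmE km.
  have pe : perm_eq (freqs M) (vnrm k :: freqs (rem m M)).
    by rewrite kE; exact: (perm_map (fun m : nat => Num.sqrt m%:R) (perm_to_rem mM)).
  apply: le_trans (fsum_ek_lower p01 kn pe); rewrite kE /c.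
  rewrite ler_wpM2l ?divr_ge0 ?(ltW radial_const_gt0) ?mulr_ge0 ?sqrtr_ge0//.
  rewrite lerD2l lerN2 ler_eXn2l ?ltr1n// size_map size_rem//; exact: leq_pred.
rewrite exchange_big/= [leRHS]big_mkcond/=; apply: ler_sum => k _.
have [kM|kM] := boolP (nsq k \in M).
  rewrite (big_rem _ kM)/= eqxx big1_seq ?addr0 => [|m /andP[_ mr]].
    by rewrite -nsq_eq0 -lt0n; have /andP[-> _] := allP aM _ kM.
  by case: eqP => // E; move: mr; rewrite -E mem_rem_uniq// !inE eqxx.
rewrite big1_seq => [|m /andP[_ mM]]; first by rewrite -/(F k); case: ifP.
by case: eqP => // E; move: kM; rewrite E mM.
Qed.

Definition radial_int p T w : R := \int[mu]_(r in `[0, T]) (2 * pi * (gauss p r * sin_prim w r)).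

Lemma radial_int_ek0 p T w : 0 < p -> 0 <= T ->
  `|radial_int p T w - ek p `|w| 0| <= pi / p ^+ 2 * gauss p T.
Proof.
move=> p0 T0; have := radial_ek0 p0 (normr_ge0 w) T0.
suff -> : radial_int p T w = \int[mu]_(r in `[0, T]) (2 * pi * r * expR (- (p ^+ 2 * r ^+ 2)) * sinc (2 * pi * `|w| * r)) by [].
apply: eq_Rintegral => r _; rewrite -sin_prim_sinc /gauss; ring.
Qed.

Lemma radial_int_integrable p a b w :
  mu.-integrable `[a, b] (EFin \o (fun r => 2 * pi * (gauss p r * sin_prim w r))).
Proof.
apply: cont_derivable_itv => r; have d1 := gauss_derive p r; have d2 := sin_prim_derive w r.
exact: ex_derive.
Qed.

(** The radial integral cancels the dual term at the origin up to the truncation at [T]; the summand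
    1 is the error left in Poisson summation for large [n]. *)
Lemma poisson_no_origin ls p T : 0 < p -> 0 <= T -> \forall n \near \oo,
  `|(\sum_(v <- zs2 n) fsum ls (fun w => gauss p (vnrm v) * sinc (2 * pi * `|w| * vnrm v))
     - fsum ls (radial_int p T))
    - \sum_(k <- zs2 n | k != 0) fsum ls (fun w => ek p `|w| k)|
  <= 2 ^+ size ls * (pi / p ^+ 2 * gauss p T) + 1.
Proof.
move=> p0 T0; have := fsum_poisson ls p0 (@ltr01 R); apply: filterS => n.
set A := \sum_(v <- _) _; rewrite (bigD1_seq (0 : int * int)) ?uniq_zs2 ?mem_zs2//=.
set B := \sum_(k <- zs2 n | _) _ => H.
have H2 : `|fsum ls (radial_int p T) - fsum ls (fun w => ek p `|w| 0)| <= 2 ^+ size ls * (pi / p ^+ 2 * gauss p T).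
  rewrite -fsumN -fsumD -fsum_cst; apply: (le_trans (fsum_norm _ _)).
  by apply: fsum_le => w; exact: radial_int_ek0.
move: (fsum ls (radial_int p T)) (fsum ls (fun w => ek p `|w| 0)) (2 ^+ size ls * _) H H2 => I E Z.
by rewrite !ler_norml => /andP[a1 a2] /andP[b1 b2]; apply/andP; split; lra.
Qed.

Lemma dual_sum_upper ls p n L : 0 < p <= 1 -> all (>= 0) ls -> \sum_(l <- ls) l <= L ->
  0 <= \sum_(k <- zs2 n | k != 0) fsum ls (fun w => ek p `|w| k)
  <= 2 ^+ size ls * (25 * 10 ^+ 5 * (1 + L ^+ 2) ^+ 2 / Num.sqrt p).
Proof.
move=> p01 ls0 lsL; have /andP[p0 _] := p01; apply/andP; split.
  by apply: sumr_ge0 => k _; apply: fsum_ge0 => w; exact: ek_ge0.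
rewrite -fsum_sum -fsum_cst; apply: fsum_le_supp => // w wl.
apply: (le_trans (ek_upper_sum n p01 (normr_ge0 w))).
have wL : `|w| ^+ 2 <= L ^+ 2 by rewrite lerXn2r ?nnegrE ?(le_trans _ (le_trans wl lsL))// (le_trans wl).
rewrite ler_wpM2r ?invr_ge0 ?sqrtr_ge0// ler_wpM2l//.
by rewrite lerXn2r ?nnegrE ?lerD2l// addr_ge0// sqr_ge0.
Qed.
End dual_lattice_sum.

(** * The resonance inequality *)
Section circle_lower_bound.
Context {R : realType}.
Notation mu := (@lebesgue_measure R).
Implicit Types (p q x T L : R) (ls : seq R) (M : seq nat).

Lemma integral0_derive (f : R -> R) x : (forall y, derivable f y 1) -> 0 < x ->
  is_derive x (1 : R) (fun y => \int[mu]_(t in `[0, y]) f t) (f x).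
Proof.
move=> df x0; have x1 : x < x + 1 by rewrite ltrDl.
have fi := @cont_derivable_itv R f 0 (x + 1) df.
have [d1 d2] := @continuous_FTC1_closed R f 0 x (x + 1) x1 fi x0 (derivable_continuous_at (df x)).
by apply: DeriveDef; [exact: d1|rewrite -derive1E; exact: d2].
Qed.

Definition radial_total p q ls T : R := \int[mu]_(r in `[0, T]) (2 * pi * (damp p q r * reson_prim ls r)).

Lemma radial_total_derive p q ls x : 0 < x ->
  is_derive x (1 : R) (radial_total p q ls) (2 * pi * x * resg p q ls x).
Proof.
move=> x0.
have -> : 2 * pi * x * resg p q ls x = 2 * pi * (damp p q x * reson_prim ls x).
  by rewrite /resg; field; rewrite gt_eqF.
have D y : derivable (fun r => 2 * pi * (damp p q r * reson_prim ls r)) y 1.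
  have d1 := damp_derive p q y; have d2 := reson_prim_derive ls y.
  exact: ex_derive.
exact: integral0_derive D x0.
Qed.

Lemma radial_total_ge0 p q ls T : 0 <= radial_total p q ls T.
Proof.
have [T0|T0] := leP 0 T; last by rewrite /radial_total set_itv_ge ?Rintegral_set0// bnd_simp -ltNge.
apply: Rintegral_ge0 => r; rewrite /= in_itv/= => /andP[r0 _].
exact: (mulr_ge0 (mulr_ge0 (ler0n _ 2) (pi_ge0 _)) (mulr_ge0 (damp_ge0 p q r) (reson_prim_ge0 ls r0))).
Qed.

(** The product of [gauss p] and the [j]-th power of [gauss q] is again a Gaussian, of this
    parameter. Expanding the fourth power in [damp] thus gives a signed sum of Gaussians, to each of
    which Poisson summation applies. *)
Definition mixed p q (j : nat) : R := Num.sqrt (p ^+ 2 + j%:R * q ^+ 2).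

Lemma gauss_mixed p q j x : gauss (mixed p q j) x = gauss p x * gauss q x ^+ j.
Proof.
rewrite /gauss /mixed sqr_sqrtr; last exact: (addr_ge0 (sqr_ge0 _) (mulr_ge0 (ler0n _ _) (sqr_ge0 _))).
by rewrite -expRM_natl -expRD; congr expR; rewrite -mulr_natl; ring.
Qed.

Lemma mixed_bounds p q j : 0 < p -> 0 < q -> p ^+ 2 + 4 * q ^+ 2 <= 1 -> (0 < j <= 4)%N ->
  [/\ 0 < mixed p q j <= 1, p <= mixed p q j & q <= mixed p q j].
Proof.
move=> p0 q0 pq /andP[j0 j4].
have p2 := exprn_gt0 2 p0; have q2 := exprn_gt0 2 q0.
have j1 : 1 <= j%:R :> R by rewrite ler1n.
have j4' : j%:R <= 4 :> R by rewrite ler_nat.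
have jq : q ^+ 2 <= j%:R * q ^+ 2 by rewrite ler_peMl// ltW.
have jq4 : j%:R * q ^+ 2 <= 4 * q ^+ 2 by rewrite ler_wpM2r// ltW.
have h (x : R) : 0 < x -> x ^+ 2 <= p ^+ 2 + j%:R * q ^+ 2 -> x <= mixed p q j.
  by move=> x0 xx; rewrite -(ger0_norm (ltW x0)) -sqrtr_sqr /mixed ler_wsqrtr.
have hp : p <= mixed p q j by apply: h => //; clear -jq q2; lra.
split => //; last by apply: h => //; clear -jq p2; lra.
rewrite (lt_le_trans p0 hp)/= -[leRHS]sqrtr1 ler_wsqrtr//; clear -jq4 pq; lra.
Qed.

Definition mixture p q (s1 s2 s3 s4 : R) := forall x,
  damp p q x = gauss p x - 4 * gauss s1 x + 6 * gauss s2 x - 4 * gauss s3 x + gauss s4 x.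

Lemma damp_mixture p q : 0 < p -> 0 < q -> p ^+ 2 + 4 * q ^+ 2 <= 1 ->
  exists s1 s2 s3 s4, mixture p q s1 s2 s3 s4 /\
    forall s, s \in [:: s1; s2; s3; s4] -> [/\ 0 < s <= 1, p <= s & q <= s].
Proof.
move=> p0 q0 pq; exists (mixed p q 1), (mixed p q 2), (mixed p q 3), (mixed p q 4).
split=> [x|s]; first by rewrite /damp !gauss_mixed; ring.
by rewrite !inE => /or4P[] /eqP ->; exact: mixed_bounds.
Qed.

Lemma resg_mixture p q s1 s2 s3 s4 ls x : mixture p q s1 s2 s3 s4 -> 0 <= x -> resg p q ls x =
  let A s := fsum ls (fun w => gauss s x * sinc (2 * pi * `|w| * x)) in
  A p - 4 * A s1 + 6 * A s2 - 4 * A s3 + A s4.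
Proof.
move=> mix x0 /=.
have -> : resg p q ls x = damp p q x * fsum ls (fun w => sinc (2 * pi * `|w| * x)).
  move: x0; rewrite le_eqVlt => /predU1P[<-|x0].
    by rewrite /resg invr0 mulr0 /damp /gauss expr0n/= !mulr0 oppr0 expR0 subrr expr0n/= mulr0 mul0r.
  rewrite /resg /reson_prim -mulrA; congr (_ * _).
  rewrite mulrC -fsumZ; apply: eq_fsum => w.
  by rewrite -sin_prim_sinc mulKf// gt_eqF.
rewrite !fsumZ mix; ring.
Qed.

Lemma radial_total_mixture p q s1 s2 s3 s4 ls T : mixture p q s1 s2 s3 s4 -> radial_total p q ls T =
  let J s := fsum ls (radial_int s T) in
  J p - 4 * J s1 + 6 * J s2 - 4 * J s3 + J s4.
Proof.
have R5 (a b c d e : R) : a + (- 4 * b + (6 * c + (- 4 * d + 1 * e))) = a - 4 * b + 6 * c - 4 * d + e.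
  by ring.
move=> mix; pose f s r : R := fsum ls (fun w => 2 * pi * (gauss s r * sin_prim w r)).
have fE s r : f s r = 2 * pi * (gauss s r * reson_prim ls r) by rewrite /f !fsumZ.
have H s := fsum_integrable ls (radial_int_integrable s 0 T).
have If s : mu.-integrable `[0, T] (EFin \o f s) by have [] := H s.
have E s : \int[mu]_(r in `[0, T]) f s r = fsum ls (radial_int s T) by have [] := H s.
have IZ c s : mu.-integrable `[0, T] (EFin \o (fun r => c * f s r)).
  apply: cont_derivable_itv => r.
  have -> : (fun r => c * f s r) = (fun r => c * (2 * pi * (gauss s r * reson_prim ls r))).
    by apply/funext => r'; rewrite fE.
  have d1 := gauss_derive s r; have d2 := reson_prim_derive ls r.
  exact: ex_derive.
rewrite /= /radial_total.
have -> : \int[mu]_(r in `[0, T]) (2 * pi * (damp p q r * reson_prim ls r)) =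
  \int[mu]_(r in `[0, T]) (f p r + ((- 4) * f s1 r + (6 * f s2 r
    + ((- 4) * f s3 r + 1 * f s4 r)))).
  by apply: eq_Rintegral => r _; rewrite !fE mix; ring.
have iD (g h : R -> R) : mu.-integrable `[0, T] (EFin \o g) -> mu.-integrable `[0, T] (EFin \o h) ->
    mu.-integrable `[0, T] (EFin \o (fun x => g x + h x)).
  have mI : measurable (`[0, T] : set (measurableTypeR R)) by [].
  by move=> ig ih; have := integrableD mI ig ih.
have i3 := iD _ _ (IZ (- 4) s3) (IZ 1 s4).
have i2 := iD _ _ (IZ 6 s2) i3.
have i1 := iD _ _ (IZ (- 4) s1) i2.
rewrite (Rint_add (If p) i1) (Rint_add (IZ _ _) i2) (Rint_add (IZ _ _) i3) (Rint_add (IZ _ _) (IZ _ _)).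
rewrite !(Rint_scale _ (If _)) !E.
exact: R5.
Qed.

(** With the coefficients 1, -4, 6, -4, 1 the two negative ones cost at most [8 B], the dual sums
    with coefficients 6 and 1 only help, and the Poisson errors add up to [16 b]. *)
Lemma mixture_combine (Main b B u v w z A0 A1 A2 A3 A4 J0 J1 J2 J3 J4 D0 D1 D2 D3 D4 : R) :
  v = A0 - 4 * A1 + 6 * A2 - 4 * A3 + A4 -> v <= u + w -> w <= z -> Main <= D0 ->
  `|A0 - J0 - D0| <= b -> `|A1 - J1 - D1| <= b -> `|A2 - J2 - D2| <= b ->
  `|A3 - J3 - D3| <= b -> `|A4 - J4 - D4| <= b ->
  0 <= D1 <= B -> 0 <= D2 <= B -> 0 <= D3 <= B -> 0 <= D4 <= B ->
  Main - (8 * B + 16 * b + z) <= u - (J0 - 4 * J1 + 6 * J2 - 4 * J3 + J4).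
Proof.
move=> -> h1 h2 h3; rewrite !ler_norml.
move=> /andP[? ?] /andP[? ?] /andP[? ?] /andP[? ?] /andP[? ?] /andP[? ?] /andP[? ?] /andP[? ?] /andP[? ?].
lra.
Qed.

(** The three subtracted errors: the dual sums of the narrower Gaussians, the truncation of the
    radial integrals together with the Poisson errors, and the Gaussian tail beyond [K]. *)
Lemma circle_lower p q M K L : 0 < p -> 0 < q -> p ^+ 2 + 4 * q ^+ 2 <= 1 ->
  uniq M -> all (fun m => 0 < m)%N M -> \sum_(l <- freqs M) l <= L ->
  \sum_(m <- M) (r2 m)%:R * (radial_const / (Num.sqrt m%:R * Num.sqrt (Num.sqrt m%:R))
      * (density p (freqs (rem m M)) - 2 ^+ size M))
  - (8 * (2 ^+ size M * (25 * 10 ^+ 5 * (1 + L ^+ 2) ^+ 2 / Num.sqrt q))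
     + 16 * (2 ^+ size M * (pi / p ^+ 2 * gauss p (Num.sqrt K%:R)) + 1)
     + 2 ^+ size M * (100 / p ^+ 4 * expR (- (p ^+ 2 * K%:R / 2))))
  <= \sum_(1 <= m < K.+1) (r2 m)%:R * resg p q (freqs M) (Num.sqrt m%:R)
     - radial_total p q (freqs M) (Num.sqrt K%:R).
Proof.
move=> p0 q0 pq uM aM lsL.
set ls := freqs M in lsL *; set T := Num.sqrt K%:R; have T0 : 0 <= T by exact: sqrtr_ge0.
have sz : size ls = size M by rewrite size_map.
have ls0 : all (>= 0) ls by apply/allP => l /mapP[m _ ->]; exact: sqrtr_ge0.
have p1 : p <= 1.
  have := exprn_gt0 2 q0; rewrite -(@ler_pXn2r _ 2)// ?nnegrE ?(ltW p0)// expr1n; clear -pq; lra.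
have p01 : 0 < p <= 1 by rewrite p0.
have g0 : 0 <= 2 ^+ size M :> R by rewrite exprn_ge0.
pose A s n := \sum_(v <- zs2 n) fsum ls (fun w => gauss s (vnrm v) * sinc (2 * pi * `|w| * vnrm v)).
pose J s := fsum ls (radial_int s T).
pose D s n := \sum_(k <- zs2 n | k != 0) fsum ls (fun w => ek s `|w| k).
set b := 2 ^+ size M * (pi / p ^+ 2 * gauss p T) + 1.
set B := 2 ^+ size M * (25 * 10 ^+ 5 * (1 + L ^+ 2) ^+ 2 / Num.sqrt q).
have P s : p <= s -> \forall n \near \oo, `|A s n - J s - D s n| <= b.
  move=> ps; have s0 := lt_le_trans p0 ps.
  have := poisson_no_origin ls s0 T0; apply: filterS => n H; apply: (le_trans H).
  rewrite sz lerD2r ler_wpM2l//.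
  have p2 : p ^+ 2 <= s ^+ 2 by rewrite lerXn2r ?nnegrE ?(ltW p0) ?(ltW s0).
  apply: ler_pM; rewrite ?gauss_ge0 ?divr_ge0 ?pi_ge0 ?sqr_ge0//.
    by rewrite ler_wpM2l ?pi_ge0// lef_pV2 ?posrE ?exprn_gt0.
  by rewrite ler_expR lerN2 ler_wpM2r ?sqr_ge0.
have [s1 [s2 [s3 [s4 [mix sb]]]]] := damp_mixture p0 q0 pq.
have U s n : s \in [:: s1; s2; s3; s4] -> 0 <= D s n <= B.
  move=> /sb[s01 ps qs].
  have /andP[h1 h2] := dual_sum_upper n s01 ls0 lsL.
  rewrite h1 /= /B; apply: (le_trans h2); rewrite sz ler_wpM2l//.
  have sq0 : 0 < Num.sqrt q by rewrite sqrtr_gt0.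
  have sqm : Num.sqrt q <= Num.sqrt s by rewrite ler_wsqrtr.
  by rewrite ler_wpM2l ?(mulr_ge0 _ (sqr_ge0 _))// lef_pV2 ?posrE// (lt_le_trans sq0).
have m1 : s1 \in [:: s1; s2; s3; s4] by rewrite !inE eqxx.
have m2 : s2 \in [:: s1; s2; s3; s4] by rewrite !inE eqxx !orbT.
have m3 : s3 \in [:: s1; s2; s3; s4] by rewrite !inE eqxx !orbT.
have m4 : s4 \in [:: s1; s2; s3; s4] by rewrite !inE eqxx !orbT.
have [_ ps1 _] := sb _ m1; have [_ ps2 _] := sb _ m2.
have [_ ps3 _] := sb _ m3; have [_ ps4 _] := sb _ m4.
have [N MN] : exists N, forall m, m \in M -> (m <= N)%N.
  exists (\sum_(m <- M) m)%N => m mM; rewrite (big_rem _ mM)/=; exact: leq_addr.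
have [n0 _ PP] := filterI (P p (lexx p)) (filterI (P s1 ps1) (filterI (P s2 ps2) (filterI (P s3 ps3) (P s4 ps4)))).
have [n [Kn Nn nn]] : exists n, [/\ K <= n, N <= n & n0 <= n]%N.
  by exists (K + N + n0)%N; rewrite -addnA leq_addr; split => //; [rewrite addnCA leq_addr|rewrite addnA leq_addl].
have /= [P0 [P1 [P2 [P3 P4]]]] := PP n nn.
have U1 := U s1 n m1; have U2 := U s2 n m2; have U3 := U s3 n m3; have U4 := U s4 n m4.
have ML := @dual_sum_lower R p M n p01 uM.
have aMn : all (fun m => 0 < m <= n)%N M.
  by apply/allP => m mM; rewrite (allP aM _ mM)/= (leq_trans (MN _ mM)).
have {}ML := ML aMn; rewrite -/ls -/(D p n) in ML.
set Main := \sum_(m <- M) _ in ML *.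
have S1 : \sum_(v <- zs2 n) resg p q ls (vnrm v) =
   A p n - 4 * A s1 n + 6 * A s2 n - 4 * A s3 n + A s4 n.
  rewrite /A !mulr_sumr -!sumrN -!big_split/=; apply: eq_bigr => v _.
  by rewrite (resg_mixture _ mix)// sqrtr_ge0.
have S2 : \sum_(1 <= m < K.+1) (r2 m)%:R * resg p q ls (Num.sqrt m%:R) =
    \sum_(v <- zs2 n | (0 < nsq v <= K)%N) resg p q ls (vnrm v).
  rewrite (@sum_r2 R (fun m => resg p q ls (Num.sqrt m%:R)) n K Kn).
  by apply: eq_bigr => v _; rewrite vnrmE.
have S3 : \sum_(v <- zs2 n) resg p q ls (vnrm v) <=
    \sum_(v <- zs2 n | (0 < nsq v <= K)%N) resg p q ls (vnrm v)
    + 2 ^+ size M * \sum_(v <- zs2 n | (K < nsq v)%N) gauss p (vnrm v).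
  rewrite mulr_sumr [in X in _ <= X + _]big_mkcond [in X in _ <= _ + X]big_mkcond -big_split/=.
  apply: ler_sum => v _; have [Kv|vK] := ltnP K (nsq v).
    rewrite andbF add0r -sz.
    have v0 : 0 < vnrm v :> R by rewrite vnrmE sqrtr_gt0 ltr0n (leq_ltn_trans _ Kv).
    by apply: (le_trans (resg_le p q ls v0)); rewrite ler_wpM2l ?damp_le// sz.
  rewrite addr0 andbT; case: ltnP => //.
  by rewrite leqn0 => /eqP v0; rewrite vnrmE v0 sqrtr0 /resg invr0 mulr0.
have S4 := gauss_tail K n p01.
have {}S4 := ler_wpM2l g0 S4.
have S5 : radial_total p q ls T = J p - 4 * J s1 + 6 * J s2
   - 4 * J s3 + J s4 by rewrite (radial_total_mixture _ _ mix).
by rewrite S2 S5; exact: (mixture_combine S1 S3 S4 ML P0 P1 P2 P3 P4 U1 U2 U3 U4).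
Qed.
End circle_lower_bound.

(** * The discrepancy from above *)

Section circle_upper_bound.
Context {R : realType}.
Implicit Types (p q x S X L Y : R) (ls rest : seq R) (M : seq nat).

Lemma fsum_ge_f0 ls (f : R -> R) : (forall w, 0 <= f w) -> f 0 <= fsum ls f.
Proof.
elim: ls f => //= l ls IH f f0.
apply: le_trans (IH _ _); rewrite /= ?add0r; last by move=> w; rewrite addr_ge0// divr_ge0// addr_ge0.
by rewrite lerDl divr_ge0// addr_ge0.
Qed.

Lemma density_ge p rest : 0 < p -> (Num.sqrt p)^-1 <= density p rest.
Proof.
move=> p0; have -> : (Num.sqrt p)^-1 = (fun w : R => 1 / Num.sqrt (p + `|w|)) 0.
  by rewrite /= normr0 addr0 div1r.
by apply: fsum_ge_f0 => w; rewrite divr_ge0// sqrtr_ge0.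
Qed.

Lemma circle_error_sqr m x : Num.sqrt m%:R < x < Num.sqrt m.+1%:R ->
  circle_error (x ^+ 2) = \sum_(1 <= i < m.+1) (r2 i)%:R - pi * x ^+ 2.
Proof.
move=> /andP[mx xm]; rewrite /circle_error.
suff -> : Num.truncn (x ^+ 2) = m by [].
have x0 : 0 <= x by apply: le_trans (ltW mx); exact: sqrtr_ge0.
apply: truncn_def; apply/andP; split.
  by rewrite -[leLHS]sqr_sqrtr ?ler0n// lerXn2r ?nnegrE ?sqrtr_ge0// ltW.
by rewrite -[ltRHS]sqr_sqrtr ?ler0n// ltrXn2r ?nnegrE ?sqrtr_ge0.
Qed.

Lemma circle_error_crude m x : Num.sqrt m%:R < x ->
  `|\sum_(1 <= i < m.+1) (r2 i)%:R - pi * x ^+ 2| <= 9 * x ^+ 2.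
Proof.
move=> mx; have x0 : 0 <= x by apply: le_trans (ltW mx); exact: sqrtr_ge0.
have pi4 : pi <= 4 :> R by have := pihalf_lt2 R; clear; lra.
have x2 := sqr_ge0 x.
have mx2 : m%:R <= x ^+ 2.
  by rewrite -[leLHS]sqr_sqrtr ?ler0n// lerXn2r ?nnegrE ?sqrtr_ge0// ltW.
have N9 := sum_r2_le m (R := R).
have N0 : 0 <= \sum_(1 <= i < m.+1) (r2 i)%:R :> R by apply: sumr_ge0 => i _; exact: ler0n.
have h := ler_wpM2r x2 pi4; have h0 := mulr_ge0 (pi_ge0 R) x2.
by rewrite ler_norml; apply/andP; split; clear -h h0 N0 N9 mx2; lra.
Qed.

(** Above [X / 2] the hypothesis on the circle error meets [maj_ge]; below, the trivial bound meets
    [resg'_le_pow]. The free choice of [m0] is used in [resonance_inequality]. *)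
Lemma circle_upper p q M m0 K X S : 0 < p -> 0 <= q -> m0 \in M -> (0 < K)%N -> 0 <= S ->
  0 <= X ->
  (forall x, X / 2 < x <= Num.sqrt K%:R -> `|circle_error (x ^+ 2)| <= S * Num.sqrt x) ->
  \sum_(1 <= m < K.+1) (r2 m)%:R * resg p q (freqs M) (Num.sqrt m%:R)
     - radial_total p q (freqs M) (Num.sqrt K%:R)
  <= S * (2 ^+ size M * Num.sqrt (Num.sqrt K%:R) * gauss p (Num.sqrt K%:R)
          + 1280 * density p (freqs (rem m0 M)))
     + 108 * 2 ^+ size M * q ^+ 8 * X ^+ 10 * ln (Num.sqrt K%:R)
     + 9 * K%:R * (2 ^+ size M * gauss p (Num.sqrt K%:R)) + 4 * (2 ^+ size M * damp p q 1).
Proof.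
move=> p0 q0 mM K0 S0 X0 HS.
set ls := freqs M; set rest := freqs (rem m0 M); set T := Num.sqrt K%:R.
have sz : size ls = size M by rewrite size_map.
have T1 : 1 <= T by rewrite -[leLHS]sqrtr1 ler_wsqrtr// ler1n.
have T0 : 0 < T by exact: lt_le_trans T1.
have pls : perm_eq ls (Num.sqrt m0%:R :: rest).
  exact: (perm_map (fun m : nat => Num.sqrt m%:R) (perm_to_rem mM)).
have Vle x : 0 <= x -> reson_prim ls x <= 2 * reson_prim rest x.
  by move=> x0; rewrite /reson_prim (fsum_perm _ pls); exact: reson_prim_cons_le.
(* 108 = 9 * 12, from [circle_error_crude] and [resg'_le_pow]; the exponent of [X] is 2 + 7 and one
   more for the division by [x] in the derivative of [A ln x]. *)
set A := 108 * 2 ^+ size M * q ^+ 8 * X ^+ 10.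
have A0 : 0 <= A by rewrite /A !mulr_ge0// exprn_ge0.
have Mge x : 0 < x -> S * Num.sqrt x * `|resg' p q ls x| <= maj' S p ls rest 0 x.
  by move=> x0; apply: maj_ge => //; apply: Vle; exact: ltW.
have ME x : maj' S p ls rest A x = maj' S p ls rest 0 x + A / x by rewrite /maj' mul0r addr0.
pose N m : R := \sum_(1 <= i < m.+1) (r2 i)%:R.
have x1 x : x \in `[1, T] -> 0 < x by rewrite in_itv/= => /andP[h _]; exact: lt_le_trans h.
have H := @abel_sqrt R (fun m => (r2 m)%:R) N (resg p q ls) (resg' p q ls) (radial_total p q ls)
  (maj S p ls rest A) (maj' S p ls rest A) K K0 (fun m => erefl)
  (fun x xT => resg_derive p q ls (x1 x xT)) (fun x xT => radial_total_derive p q ls (x1 x xT))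
  (fun x xT => maj_derive S ls rest A p0 (x1 x xT)).
have {}H := H _.
have HB m x : (0 < m < K)%N -> Num.sqrt m%:R < x < Num.sqrt m.+1%:R ->
    `|N m - pi * x ^+ 2| * `|resg' p q ls x| <= maj' S p ls rest A x.
  move=> /andP[m1 mK] xm; have /andP[mx mx'] := xm.
  have x0 : 0 < x by apply: le_lt_trans mx; exact: sqrtr_ge0.
  have d0 := normr_ge0 (resg' p q ls x).
  rewrite ME; have [xX|xX] := ltP (X / 2) x.
    apply: (@le_trans _ _ (maj' S p ls rest 0 x)); last by rewrite lerDl divr_ge0// ltW.
    apply: le_trans (Mge x x0); rewrite ler_wpM2r// /N -circle_error_sqr//.
    by apply: HS; rewrite xX/= (le_trans (ltW mx'))// ler_wsqrtr// ler_nat.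
  apply: (@le_trans _ _ (A / x)); last first.
    by rewrite lerDr; apply: le_trans (Mge x x0); rewrite !mulr_ge0// sqrtr_ge0.
  have h1 := circle_error_crude mx; have h2 := resg'_le_pow p q ls x0.
  apply: (le_trans (ler_pM (normr_ge0 _) d0 h1 h2)); rewrite ler_pdivlMr// sz.
  have -> : 9 * x ^+ 2 * (12 * 2 ^+ size M * q ^+ 8 * x ^+ 7) * x = 108 * 2 ^+ size M * q ^+ 8 * x ^+ 10 by ring.
  rewrite /A ler_wpM2l//; first by rewrite !mulr_ge0// exprn_ge0.
  by rewrite lerXn2r ?nnegrE ?(ltW x0)// (le_trans xX)// ler_pdivrMr// ler_peMr// ler1n.
have {}H := H HB; rewrite -/T in H.
have PT : maj S p ls rest A T <= S * (2 ^+ size M * Num.sqrt T * gauss p T + 1280 * density p rest) + A * ln T.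
  rewrite /maj lerD2r ler_wpM2l// lerD//.
    have sT : 0 < Num.sqrt T by rewrite sqrtr_gt0.
    rewrite ler_pdivrMr// mulrC.
    have -> : 2 ^+ size M * Num.sqrt T * gauss p T * Num.sqrt T = 2 ^+ size M * T * gauss p T.
      transitivity (2 ^+ size M * Num.sqrt T ^+ 2 * gauss p T); first by ring.
      by rewrite sqr_sqrtr ?(ltW T0).
    by rewrite ler_wpM2r ?gauss_ge0// -sz reson_prim_le// ltW.
  have -> : 1280 * density p rest = 320 * fsum rest (fun w => 4 / Num.sqrt (p + `|w|)).
    have -> : 1280 = 320 * 4 :> R by ring.
    rewrite -mulrA /density -fsumZ; congr (_ * _); apply: eq_fsum => w.
    by rewrite mulrA mulr1.
  apply: (ler_wpM2l (ler0n R 320)); apply: fsum_le => w.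
  by have /andP[] := @atank_bound R (p + `|w|) T (ltr_wpDr (normr_ge0 w) p0).
have P1 : 0 <= maj S p ls rest A 1.
  rewrite /maj ln1 mulr0 addr0; apply: (mulr_ge0 S0); apply: addr_ge0.
    by rewrite divr_ge0 ?sqrtr_ge0// (mulr_ge0 (gauss_ge0 p 1))// reson_prim_ge0.
  apply: (mulr_ge0 (ler0n R 320)); apply: fsum_ge0 => w.
  by have /andP[] := @atank_bound R (p + `|w|) 1 (ltr_wpDr (normr_ge0 w) p0).
have U1 := radial_total_ge0 p q ls 1.
have gT0 := resg_ge0 p q ls (ltW T0).
have g10 := resg_ge0 p q ls (@ler01 R).
have gT : resg p q ls T <= 2 ^+ size M * gauss p T.
  by apply: (le_trans (resg_le p q ls T0)); rewrite sz ler_wpM2l ?damp_le.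
have g1 : resg p q ls 1 <= 2 ^+ size M * damp p q 1.
  by have := resg_le p q ls (@ltr01 R); rewrite sz.
have pi4 : pi <= 4 :> R by have := pihalf_lt2 R; clear; lra.
have b1 : (N K - pi * K%:R) * resg p q ls T <= 9 * K%:R * (2 ^+ size M * gauss p T).
  apply: (@le_trans _ _ (9 * K%:R * resg p q ls T)); last first.
    by rewrite ler_wpM2l// mulr_ge0.
  by rewrite ler_wpM2r// (le_trans _ (sum_r2_le K))// gerBl mulr_ge0// pi_ge0.
have b2 : pi * resg p q ls 1 <= 4 * (2 ^+ size M * damp p q 1).
  by apply: ler_pM => //; exact: pi_ge0.
move: H; rewrite ler_norml => /andP[_].
by clear -PT P1 U1 b1 b2; lra.
Qed.
End circle_upper_bound.

(** * Choice of the scales and comparison of the two bounds *)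

Section resonance.
Context {R : realType}.
Implicit Types (S Y : R) (M : seq nat).

Lemma seq_argmin (T : eqType) (s : seq T) (f : T -> R) : s != [::] ->
  exists2 x, x \in s & forall y, y \in s -> f x <= f y.
Proof.
elim: s => [//|a [|b s] IH] _.
  by exists a; rewrite ?mem_head// => y; rewrite inE => /eqP ->.
have [x xs H] := IH isT; have [ax|xa] := leP (f a) (f x).
  exists a; rewrite ?mem_head// => y; rewrite inE => /predU1P[->//|/H]; exact: le_trans.
exists x; first by rewrite inE xs orbT.
by move=> y; rewrite inE => /predU1P[->|/H//]; exact: ltW.
Qed.

(** All errors together stay below [Y^7 = 1 / sqrt p], hence below the density. The powers are
    abstracted as [pw k], so that only their products, monotonicity and positivity enter the
    estimates. *)
Lemma resonance_error (Y n W c G H lnT K d : R) (pw : nat -> R) : (forall k, pw k = Y ^+ k) ->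
  1 <= n -> 400 * c * W <= Y -> 1000 * (1000 * n) <= Y ->
  0 <= G <= (pw 60%N)^-1 -> 0 <= H <= (pw 60%N)^-1 -> 0 <= lnT <= 15 * Y -> 0 <= K <= pw 30%N -> d <= 1 ->
  (8 * (c * W * pw 6%N) + 16 * (n * (pi * pw 28%N * G) + 1) + n * (100 * pw 56%N * H))
   + (108 * n * pw 4%N * lnT + 9 * K * (n * G) + 4 * (n * d)) <= pw 7%N.
Proof.
move=> pwE n1 WY nY /andP[G0 G1] /andP[H0 H1] /andP[l0 l1] /andP[K0 K1] d1.
have pi4 : pi <= 4 :> R by have := pihalf_lt2 R; clear; lra.
have pi0 := @pi_ge0 R.
have n0 : 0 <= n by exact: le_trans n1.
have Y6 : 1000 * 1000 <= Y by apply: le_trans nY; clear -n1; lra.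
have Y1 : 1 <= Y by clear -Y6; lra.
have Y0 : 0 < Y by exact: lt_le_trans Y1.
have nY1 : n <= Y by clear -n0 nY; lra.
have P0 k : 0 < pw k by rewrite pwE exprn_gt0.
have P k := ltW (P0 k).
have up k l : (k <= l)%N -> pw k <= pw l by move=> kl; rewrite !pwE; exact: ler_weXn2l.
have pS k : Y * pw k = pw k.+1 by rewrite !pwE exprS.
have pD k l : pw k * pw l = pw (k + l)%N by rewrite !pwE exprD.
have inv k : (k <= 60)%N -> pw k * (pw 60%N)^-1 <= 1.
  by move=> k60; rewrite ler_pdivrMr// mul1r up.
have a1 : 8 * (c * W * pw 6%N) <= pw 7%N / 50.
  have := ler_wpM2r (P 6%N) WY; rewrite pS; clear; lra.
have a2 : n * (pi * pw 28%N * G) <= 4.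
  apply: (@le_trans _ _ (Y * (4 * pw 28%N * (pw 60%N)^-1))).
    apply: ler_pM => //; first exact: (mulr_ge0 (mulr_ge0 pi0 (P 28%N)) G0).
    apply: ler_pM => //; first exact: (mulr_ge0 pi0 (P 28%N)).
    by rewrite ler_wpM2r.
  have -> : Y * (4 * pw 28%N * (pw 60%N)^-1) = 4 * (Y * pw 28%N * (pw 60%N)^-1) by ring.
  by rewrite pS ger_pMr// inv.
have a3 : n * (100 * pw 56%N * H) <= 100.
  apply: (@le_trans _ _ (Y * (100 * pw 56%N * (pw 60%N)^-1))).
    apply: ler_pM => //; first exact: (mulr_ge0 (mulr_ge0 (ler0n _ 100) (P 56%N)) H0).
    by rewrite ler_wpM2l// (mulr_ge0 (ler0n _ 100) (P 56%N)).
  have -> : Y * (100 * pw 56%N * (pw 60%N)^-1) = 100 * (Y * pw 56%N * (pw 60%N)^-1) by ring.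
  by rewrite pS ger_pMr// inv.
have a4 : 108 * n * pw 4%N * lnT <= pw 7%N / 100.
  apply: (@le_trans _ _ (108 * n * pw 4%N * (15 * Y))).
    by rewrite ler_wpM2l// (mulr_ge0 (mulr_ge0 (ler0n _ 108) n0) (P 4%N)).
  have -> : 108 * n * pw 4%N * (15 * Y) = (1620 * n) * (Y * pw 4%N) by ring.
  rewrite pS; apply: (@le_trans _ _ (Y / 100 * pw 5%N)).
    by rewrite ler_wpM2r//; clear -nY n0; lra.
  have -> : Y / 100 * pw 5%N = (Y * pw 5%N) / 100 by ring.
  by rewrite pS ler_wpM2r ?invr_ge0// up.
have a5 : 9 * K * (n * G) <= 9.
  apply: (@le_trans _ _ (9 * pw 30%N * (Y * (pw 60%N)^-1))).
    apply: ler_pM; [exact: (mulr_ge0 (ler0n _ 9) K0)|exact: (mulr_ge0 n0 G0)|by rewrite ler_wpM2l|exact: ler_pM].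
  have -> : 9 * pw 30%N * (Y * (pw 60%N)^-1) = 9 * (Y * pw 30%N * (pw 60%N)^-1) by ring.
  by rewrite pS ger_pMr// inv.
have a6 : 4 * (n * d) <= 4 * Y.
  by rewrite ler_wpM2l// (le_trans _ nY1)// ler_piMr.
have Y7 : pw 2%N <= pw 7%N by rewrite up.
have Y2 : 1000 * 1000 * Y <= pw 2%N by rewrite pwE expr2 ler_wpM2r// ltW.
clear -a1 a2 a3 a4 a5 a6 Y7 Y2 Y6; lra.
Qed.

(** With [Y = X^(1/10)] the choice is [p = Y^-14], [q = Y^-12] and [K] about [Y^30]. Then [1 / q]
    exceeds [X]; [1 / sqrt q = Y^6] is below [1 / sqrt p = Y^7]; [p sqrt K] is about [Y], which
    makes the Gaussian negligible at [X^(3/2)]; and [q^8 X^10 = Y^4]. An exponent [k] in place of 4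
    in [damp] would lead to [Y^(20 - 4 k)], and 4 is the first to get below [Y^7]. *)
Lemma resonance_params Y (pw : nat -> R) : (forall k, pw k = Y ^+ k) -> 1000 <= Y ->
  exists (p q : R) (K : nat), [/\ [/\ 0 < p, 0 < q & p ^+ 2 + 4 * q ^+ 2 <= 1],
    [/\ Num.sqrt p = (pw 7%N)^-1, Num.sqrt q = (pw 6%N)^-1, p ^+ 2 = (pw 28%N)^-1, p ^+ 4 = (pw 56%N)^-1
      & q ^+ 8 * pw 10%N ^+ 10 = pw 4%N],
    [/\ (0 < K)%N, 0 <= (K%:R : R) <= pw 30%N, Num.sqrt (K%:R : R) <= pw 15%N, 0 <= ln (Num.sqrt (K%:R : R)) <= 15 * Y
       & Y ^+ 2 - 1 <= p ^+ 2 * K%:R] & q <= 1].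
Proof.
move=> pwE Y3.
have Y1 : 1 <= Y by clear -Y3; lra.
have Y0 : 0 < Y by exact: lt_le_trans Y1.
have P0 k : 0 < pw k by rewrite pwE exprn_gt0.
have up k l : (k <= l)%N -> pw k <= pw l by move=> kl; rewrite !pwE; exact: ler_weXn2l.
have pX k l : pw k ^+ l = pw (k * l)%N by rewrite !pwE exprM.
have pD k l : pw k * pw l = pw (k + l)%N by rewrite !pwE exprD.
have pw1 : pw 1%N = Y by rewrite pwE.
pose K := Num.truncn (pw 30%N).
have small k : (0 < k)%N -> 0 < (pw k)^-1 <= 1 / 10.
  move=> k0; rewrite invr_gt0 P0/= div1r lef_pV2 ?posrE//.
  by apply: (le_trans _ (up 1%N k k0)); rewrite pw1; clear -Y3; lra.
have sqi k : Num.sqrt (pw (k * 2)%N)^-1 = (pw k)^-1.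
  by rewrite -pX -exprVn sqrtr_sqr ger0_norm// invr_ge0 ltW.
have K30 : K%:R <= pw 30%N by have /andP[] := truncn_itv (ltW (P0 30%N)).
have K30' : pw 30%N < K%:R + 1 by rewrite natr1 truncnS_gt.
have Kge : 1 <= K%:R :> R.
  by have := up 1%N 30%N isT; rewrite pw1; clear -K30' Y3; lra.
have K1 : (0 < K)%N by rewrite -(ltr_nat R); exact: lt_le_trans Kge.
have T1 : 1 <= Num.sqrt K%:R :> R by rewrite -[leLHS]sqrtr1 ler_wsqrtr.
have T15 : Num.sqrt K%:R <= pw 15%N.
  by rewrite -[leRHS]ger0_norm ?(ltW (P0 _))// -sqrtr_sqr ler_wsqrtr// pX.
exists (pw 14%N)^-1, (pw 12%N)^-1, K; split; last by have /andP[_ h] := small 12%N isT; clear -h; lra.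
- rewrite !invr_gt0 !P0; split => //.
  have /andP[h1 h2] := small 14%N isT; have /andP[h3 h4] := small 12%N isT.
  move: ((pw 14%N)^-1) ((pw 12%N)^-1) h1 h2 h3 h4 => a b; clear; nra.
- rewrite (sqi 7%N) (sqi 6%N) !exprVn !pX; split => //.
  have -> : pw (10 * 10)%N = pw (12 * 8)%N * pw 4%N by rewrite pD.
  by rewrite mulKf// gt_eqF.
- split => //; first by rewrite ler0n.
    rewrite ln_ge0//=; apply: (@le_trans _ _ (ln (pw 15%N))).
      by rewrite ler_ln ?posrE// (lt_le_trans ltr01).
    rewrite pwE lnXn// -[leLHS]mulr_natl ler_wpM2l//.
    have h : -1 < Y - 1 by clear -Y0; lra.
    by have := le_ln1Dx h; rewrite addrC subrK; clear; lra.
  rewrite exprVn pX -[leLHS](mulKf (lt0r_neq0 (P0 28%N))) (_ : 14 * 2 = 28)%N// ler_wpM2l ?invr_ge0 ?(ltW (P0 _))//.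
  have -> : pw 28%N * (Y ^+ 2 - 1) = pw 30%N - pw 28%N by rewrite mulrBr mulr1 -[Y ^+ 2]pwE pD.
  have := up 1%N 28%N isT; rewrite pw1; clear -K30' Y3; lra.
Qed.

Lemma combine_bounds (a1 a2 a3 a4 a5 a6 a7 s S D w : R) :
  a1 - (a2 + a3 + a4) <= s + a5 + a6 + a7 -> a2 + a3 + a4 + (a5 + a6 + a7) <= w ->
  s <= S * (D + 1280 * D) -> w <= D -> a1 <= (1281 * S + 1) * D.
Proof. lra. Qed.

Lemma resonance_inequality M Y S : uniq M -> all (fun m => 0 < m)%N M -> 0 <= S ->
  1000 * (1000 * (1000 * (2 ^+ size M * (1 + (\sum_(l <- freqs M) l) ^+ 2) ^+ 2))) <= Y ->
  Y ^+ 60 <= expR ((Y ^+ 2 - 1) / 2) ->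
  (forall x, Y ^+ 10 / 2 < x <= Y ^+ 15 -> `|circle_error (x ^+ 2)| <= S * Num.sqrt x) ->
  radial_const / 2 * \sum_(m <- M) (r2 m)%:R / (Num.sqrt m%:R * Num.sqrt (Num.sqrt m%:R)) <= 1281 * S + 1.
Proof.
move=> uM aM S0; set L := \sum_(l <- freqs M) l; set W := 2 ^+ size M * _ => WY.
have [pw pwE] : exists pw : nat -> R, forall k, pw k = Y ^+ k by exists (fun k => Y ^+ k).
rewrite -!pwE => Y60 HS.
have [->|Mn] := eqVneq M [::].
  by rewrite big_nil mulr0; exact: (addr_ge0 (mulr_ge0 (ler0n _ 1281) S0) ler01).
have L2 : 1 <= 1 + L ^+ 2 by rewrite lerDl sqr_ge0.
have n1 : 1 <= 2 ^+ size M :> R by rewrite exprn_ege1// ler1n.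
have nW : 2 ^+ size M <= W by rewrite /W ler_peMr ?exprn_ege1// (le_trans ler01).
have Y3 : 1000 <= Y by clear -WY n1 nW; lra.
have Y0 : 0 < Y by clear -Y3; lra.
have P0 k : 0 < pw k by rewrite pwE exprn_gt0.
have [p [q [K [[p0 q0 pq] [sp sq p2 p4 q8] [K1 K30 T15 lT pK] q1]]]] := resonance_params pwE Y3.
have Y60' : expR (- ((pw 2%N - 1) / 2)) <= (pw 60%N)^-1.
  by rewrite expRN lef_pV2 ?posrE ?expR_gt0.
rewrite -pwE in pK.
have Y2 : 1 <= pw 2%N by rewrite pwE exprn_ege1//; clear -Y3; lra.
have T2 : Num.sqrt K%:R ^+ 2 = K%:R :> R by rewrite sqr_sqrtr ?ler0n.
have G1 : 0 <= gauss p (Num.sqrt K%:R) <= (pw 60%N)^-1.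
  by rewrite gauss_ge0/= (le_trans _ Y60')// ler_expR lerN2 T2; clear -pK Y2; lra.
have H1 : 0 <= expR (- (p ^+ 2 * K%:R / 2)) <= (pw 60%N)^-1.
  by rewrite expR_ge0/= (le_trans _ Y60')// ler_expR lerN2; clear -pK; lra.
(* The density [D0] that the upper bound produces is at most each density in the lower bound. *)
have [m0 mM Dmin] := seq_argmin (fun m => density p (freqs (rem m M))) Mn.
set D0 := density _ _ in Dmin.
have D7 : pw 7%N <= D0 by have := density_ge (freqs (rem m0 M)) p0; rewrite sp invrK.
have D0p : 0 < D0 by exact: lt_le_trans (P0 7%N) D7.
have Lo := circle_lower K p0 q0 pq uM aM (lexx L).
have HS' x : pw 10%N / 2 < x <= Num.sqrt K%:R -> `|circle_error (x ^+ 2)| <= S * Num.sqrt x.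
  by move=> /andP[h1 h2]; apply: HS; rewrite h1/= (le_trans h2).
have Up := circle_upper p0 (ltW q0) mM K1 S0 (ltW (P0 10%N)) HS'.
have d1 : damp p q 1 <= 1 by apply: le_trans (gauss_le1 p 1); exact: damp_le.
have e5 : 10 ^+ 5 = 100 * 1000 :> R by ring.
pose c : R := 25 * 10 ^+ 5.
have cW : 400 * c * W <= Y by apply: le_trans WY; rewrite /c e5; clear -nW n1; lra.
have nY : 1000 * (1000 * 2 ^+ size M) <= Y by clear -WY n1 nW; lra.
have Err := resonance_error pwE n1 cW nY G1 H1 lT K30 d1.
have /andP[G0 G60] := G1.
have ST : 2 ^+ size M * Num.sqrt (Num.sqrt K%:R) * gauss p (Num.sqrt K%:R) <= D0.
  apply: le_trans D7.
  apply: (@le_trans _ _ (Y * pw 15%N * (pw 60%N)^-1)).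
    apply: (ler_pM (mulr_ge0 (le_trans ler01 n1) (sqrtr_ge0 _)) G0 _ G60).
    apply: ler_pM; rewrite ?sqrtr_ge0//; first by clear -nY n1; lra.
    apply: le_trans T15; rewrite -[leLHS]mulr1.
    have T1 : 1 <= Num.sqrt K%:R :> R by rewrite -[leLHS]sqrtr1 ler_wsqrtr// ler1n.
    have T1' : 1 <= Num.sqrt (Num.sqrt K%:R) :> R by rewrite -[leLHS]sqrtr1 ler_wsqrtr.
    rewrite -[leRHS](sqr_sqrtr (sqrtr_ge0 K%:R)) expr2 ler_wpM2l// sqrtr_ge0.
  rewrite !pwE -exprS ler_pdivrMr ?exprn_gt0// -exprD; apply: ler_weXn2l => //.
  by clear -Y3; lra.
(* So the subtraction of [2^size M] in the lower bound costs at most half of the density. *)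
have n7 : 2 * 2 ^+ size M <= D0.
  apply: le_trans D7; apply: (@le_trans _ _ Y); first by clear -nY n1; lra.
  by rewrite pwE exprS ler_peMr ?(ltW Y0)// exprn_ege1//; clear -Y3; lra.
pose Sg := \sum_(m <- M) (r2 m)%:R / (Num.sqrt m%:R * Num.sqrt (Num.sqrt m%:R)) : R.
have Lo' : radial_const / 2 * D0 * Sg <= \sum_(m <- M) (r2 m)%:R * (radial_const / (Num.sqrt m%:R * Num.sqrt (Num.sqrt m%:R))
      * (density p (freqs (rem m M)) - 2 ^+ size M)).
  rewrite mulr_sumr big_seq [leRHS]big_seq; apply: ler_sum => m mMm.
  have Dm := Dmin m mMm.
  have i0 : 0 <= (Num.sqrt m%:R * Num.sqrt (Num.sqrt m%:R))^-1 :> R by rewrite invr_ge0 mulr_ge0// sqrtr_ge0.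
  have rc := ltW (@radial_const_gt0 R).
  move: (_^-1) i0 => i i0.
  have -> : radial_const / 2 * D0 * ((r2 m)%:R * i) = (r2 m)%:R * (radial_const * i * (D0 / 2)) by ring.
  rewrite ler_wpM2l ?ler0n// ler_wpM2l ?(mulr_ge0 rc i0)//.
  by clear -Dm n7; lra.
have -> : radial_const / 2 * Sg = (radial_const / 2 * D0 * Sg) / D0 by field; rewrite gt_eqF.
rewrite ler_pdivrMr//; apply: (le_trans Lo').
have E1 : 25 * 10 ^+ 5 * (1 + L ^+ 2) ^+ 2 / Num.sqrt q = 25 * 10 ^+ 5 * (1 + L ^+ 2) ^+ 2 * pw 6%N by rewrite sq invrK.
rewrite E1 p2 p4 !invrK -/D0 in Lo Up.
have E2 : 8 * (2 ^+ size M * (25 * 10 ^+ 5 * (1 + L ^+ 2) ^+ 2 * pw 6%N)) = 8 * (c * W * pw 6%N).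
  by rewrite /W /c; ring.
have E3 : 108 * 2 ^+ size M * q ^+ 8 * pw 10%N ^+ 10 = 108 * 2 ^+ size M * pw 4%N by rewrite -q8 !mulrA.
rewrite E2 in Lo; rewrite E3 in Up.
have S1 := ler_wpM2l S0 (lerD ST (lexx (1280 * D0))).
have F := le_trans Lo Up.
by rewrite p2 in Err; exact: (combine_bounds F Err S1 D7).
Qed.
End resonance.

(** * Sums of two squares *)
Section two_squares.
Implicit Types (p m : nat) (v : int * int).

(** From Wilson's theorem: with [p = 2 h + 1] and [h] even, [(h + j)! (h - j)!] is congruent to
    [(-1)^j (h!)^2] modulo [p]; at [j = h] the left side is [(p - 1)!], so [h!] is a square root of
    -1. *)
Lemma sqrt_neg1 p : prime p -> (p %% 4 = 1)%N -> exists x : nat, (p %| x ^ 2 + 1)%N.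
Proof.
move=> pp p1; have p0 := prime_gt0 pp.
have [h [pE hev]] : exists h, p = (h.*2).+1 /\ ~~ odd h.
  by exists (p.-1)./2; move: p1 p0; clear; lia.
exists h`!.
have W : (p %| ((p.-1)`!).+1)%N by rewrite -Wilson// prime_gt1.
have H j : (j <= h)%N -> (p%:Z %| ((h + j)`! * (h - j)`!)%N%:Z - (-1) ^+ j * (h`! * h`!)%N%:Z)%Z.
  elim: j => [_|j IH jh]; first by rewrite addn0 subn0 expr0 mul1r subrr dvdz0.
  have {}IH := IH (ltnW jh).
  have hj : (0 < h - j)%N by rewrite subn_gt0.
  have cop : coprimez p%:Z (h - j)%N%:Z.
    rewrite /coprimez /gcdz/= -[(_ == _)]/(coprime p (h - j)) prime_coprime// gtnNdvd//.
    by rewrite pE; move: jh; clear; lia.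
  rewrite -(Gauss_dvdzr _ cop).
  have e1 : (h + j.+1)`! = ((h + j).+1 * (h + j)`!)%N by rewrite addnS factS.
  have e2 : (h - j)`! = ((h - j) * (h - j.+1)`!)%N by rewrite subnS -{1}(prednK hj) factS prednK.
  have e3 : p%:Z = (h + j).+1%:Z + (h - j)%N%:Z by rewrite pE; move: jh; clear; lia.
  have -> : (h - j)%N%:Z * (((h + j.+1)`! * (h - j.+1)`!)%N%:Z - (-1) ^+ j.+1 * (h`! * h`!)%N%:Z) =
      p%:Z * ((h + j)`! * (h - j)`!)%N%:Z - (h - j)%N%:Z * (((h + j)`! * (h - j)`!)%N%:Z - (-1) ^+ j * (h`! * h`!)%N%:Z).
    by rewrite e1 e2 e3 exprS !PoszM; ring.
  by apply: rpredB; [exact: dvdz_mulr|exact: dvdz_mull].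
have := H h (leqnn h); rewrite subnn fact0 muln1 addnn -signr_odd (negbTE hev) expr0 mul1r => E.
have pd : (h.*2 = p.-1)%N by rewrite pE.
rewrite pd in E.
have {}W : (p%:Z %| ((p.-1)`!)%:Z + 1)%Z by rewrite -(PoszD _ 1) addn1.
have : (p%:Z %| (h`! * h`!)%N%:Z + 1)%Z.
  have -> : (h`! * h`!)%N%:Z + 1 = ((p.-1)`!)%:Z + 1 - (((p.-1)`!)%:Z - (h`! * h`!)%N%:Z) by ring.
  by apply: rpredB.
by rewrite -(PoszD _ 1) mulnn.
Qed.

Lemma nat_sqrt n : exists s, (s ^ 2 <= n < s.+1 ^ 2)%N.
Proof.
elim: n => [|n [s /andP[s1 s2]]]; first by exists 0%N.
have [h|h] := leqP (s.+1 ^ 2) n.+1.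
  by exists s.+1; rewrite h /=; move: s1 s2; rewrite -!mulnn; clear; nia.
by exists s; rewrite h (leq_trans s1).
Qed.

(** Pigeonhole on the [(s + 1)^2 > p] pairs with entries up to [s], the integer part of [sqrt p];
    primality makes [s^2 < p] strict. *)
Lemma thue p (x : nat) : prime p -> exists a b : int,
  [/\ (a, b) != 0, a ^+ 2 < p%:Z, b ^+ 2 < p%:Z & (p%:Z %| a + x%:Z * b)%Z].
Proof.
move=> pp; have p0 := prime_gt0 pp; have p2 := prime_gt1 pp.
have [s /andP[s1 s2]] := nat_sqrt p.
have s3 : (s ^ 2 < p)%N.
  rewrite ltn_neqAle s1 andbT; apply/eqP => E.
  have sp : (s %| p)%N by rewrite -E -mulnn dvdn_mulr.
  have [_ /(_ _ sp)] := primeP pp; move=> /orP[]/eqP sE; move: E; rewrite sE -mulnn; move: p2; clear; nia.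
case: p pp p0 p2 s1 s2 s3 => // p pp _ p2 s1 s2 s3.
pose f (u : 'I_s.+1 * 'I_s.+1) : 'I_p.+1 := inord ((u.1 + x * u.2) %% p.+1).
have /injectivePn[u [v uv fuv]] : ~~ injectiveb f.
  apply/negP => /injectiveP /leq_card; rewrite card_prod !card_ord mulnn leqNgt s2//.
have {}fuv : ((u.1 + x * u.2) = (v.1 + x * v.2) %[mod p.+1])%N.
  move/(congr1 val): fuv; rewrite /f /= !inordK ?ltn_pmod//.
exists ((u.1 : nat)%:Z - (v.1 : nat)%:Z), ((u.2 : nat)%:Z - (v.2 : nat)%:Z).
have b1 (i j : 'I_s.+1) : (((i : nat)%:Z - (j : nat)%:Z) ^+ 2 < p.+1%:Z)%R.
  have := ltn_ord i; have := ltn_ord j; move: s3; rewrite -mulnn => s3 h1 h2; nia.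
split => //.
  apply: contra uv => /eqP[e1 e2]; apply/eqP; case: u v e1 e2 {fuv} => [a b] [c d] /= e1 e2.
  by congr pair; apply/val_inj; move: e1 e2; clear => /=; lia.
have E : ((u.1 + x * u.2)%N%:Z = (v.1 + x * v.2)%N%:Z %[mod p.+1%:Z])%Z by rewrite !modz_nat fuv.
move/eqP: E; rewrite eqz_mod_dvd => E.
by apply: etrans E; congr dvdz; rewrite !PoszD !PoszM; ring.
Qed.

(** With the pair of [thue], [a^2 + b^2] is a multiple of [p] strictly between 0 and [2 p]. *)
Lemma two_squares p : prime p -> (p %% 4 = 1)%N -> exists c d : int, c ^+ 2 + d ^+ 2 = p%:Z.
Proof.
move=> pp p1; have [x px] := sqrt_neg1 pp p1; have [a [b [ab a2 b2 pab]]] := thue x pp.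
exists a, b.
have px' : (p%:Z %| x%:Z ^+ 2 + 1)%Z.
  by rewrite -[(_ %| _)%Z]/(p %| _)%N; move: px; congr (dvdn _ _); rewrite -PoszM -(PoszD _ 1).
have d : (p%:Z %| a ^+ 2 + b ^+ 2)%Z.
  have -> : a ^+ 2 + b ^+ 2 = (a + x%:Z * b) * (a - x%:Z * b) + b ^+ 2 * (x%:Z ^+ 2 + 1) by ring.
  by apply: rpredD; [exact: dvdz_mulr|exact: dvdz_mull].
have ps : 0 < a ^+ 2 + b ^+ 2.
  rewrite lt_def addr_ge0 ?sqr_ge0// andbT paddr_eq0 ?sqr_ge0// !expf_eq0/=.
  by apply: contra ab => /andP[/eqP -> /eqP ->].
move/dvdzP: d => [k kE]; have k1 : k = 1.
  have p0 : (0 < p%:Z)%R by rewrite ltz_nat prime_gt0.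
  have H (z : int) : 0 < z -> z < 2 -> z = 1 by lia.
  apply: H; first by rewrite -(pmulr_lgt0 _ p0) -kE.
  by rewrite -(ltr_pM2r p0) -kE (mulr_natl p%:Z 2) mulr2n ltrD.
by rewrite kE k1 mul1r.
Qed.

(** In the Gaussian integers, multiplication by [c + d i] and by [c - d i], both of norm [p], gives
    two injections of the points of norm [m] into those of norm [p m]. *)
Lemma r2_mul_prime p m : prime p -> (p %% 4 = 1)%N -> (0 < m)%N -> ~~ (p %| m)%N -> (2 * r2 m <= r2 (p * m))%N.
Proof.
move=> pp p1 m0 pm; have [c [d cd]] := two_squares pp p1.
rewrite (@r2_count m m)// (@r2_count (p * m) (p * m))//.
set s := [seq v <- zs2 m | nsq v == m].
pose f (v : int * int) := (v.1 * c - v.2 * d, v.1 * d + v.2 * c).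
pose g (v : int * int) := (v.1 * c + v.2 * d, v.2 * c - v.1 * d).
have p0 : (p%:Z != 0)%R by rewrite eqz_nat -lt0n prime_gt0.
have sE v : v \in s -> v.1 ^+ 2 + v.2 ^+ 2 = m%:Z.
  by rewrite mem_filter => /andP[/eqP <- _]; rewrite nsqE.
have inj_f : injective f.
  move=> [a b] [a' b'] [e1 e2].
  have h1 : (a - a') * p%:Z = 0.
    transitivity ((a * c - b * d) * c + (a * d + b * c) * d - ((a' * c - b' * d) * c + (a' * d + b' * c) * d)).
      by rewrite -cd; ring.
    by rewrite e1 e2 subrr.
  have h2 : (b - b') * p%:Z = 0.
    transitivity ((a * d + b * c) * c - (a * c - b * d) * d - ((a' * d + b' * c) * c - (a' * c - b' * d) * d)).
      by rewrite -cd; ring.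
    by rewrite e1 e2 subrr.
  move/eqP: h1; rewrite mulf_eq0 (negbTE p0) orbF subr_eq0 => /eqP ->.
  by move/eqP: h2; rewrite mulf_eq0 (negbTE p0) orbF subr_eq0 => /eqP ->.
have inj_g : injective g.
  move=> [a b] [a' b'] [e1 e2].
  have h1 : (a - a') * p%:Z = 0.
    transitivity ((a * c + b * d) * c - (b * c - a * d) * d - ((a' * c + b' * d) * c - (b' * c - a' * d) * d)).
      by rewrite -cd; ring.
    by rewrite e1 e2 subrr.
  have h2 : (b - b') * p%:Z = 0.
    transitivity ((b * c - a * d) * c + (a * c + b * d) * d - ((b' * c - a' * d) * c + (a' * c + b' * d) * d)).
      by rewrite -cd; ring.
    by rewrite e1 e2 subrr.
  move/eqP: h1; rewrite mulf_eq0 (negbTE p0) orbF subr_eq0 => /eqP ->.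
  by move/eqP: h2; rewrite mulf_eq0 (negbTE p0) orbF subr_eq0 => /eqP ->.
have pz (z : int) : (p%:Z %| z ^+ 2)%Z -> (p%:Z %| z)%Z.
  by rewrite -[(_ %| z ^+ 2)%Z]/(p %| _)%N abszX Euclid_dvdX// => /andP[].
(* A common value would be divisible by [c + d i] and by its conjugate, hence by [p]; comparing
   norms, [p] would divide [m]. *)
have disj v w : v \in s -> w \in s -> f v != g w.
  move=> /sE vm /sE wm; apply/eqP; move: v w vm wm => [a b] [a' b'] /= vm wm [e1 e2].
  have k1 : a * p%:Z = a' * p%:Z - 2 * d * (a' * d - b' * c).
    transitivity ((a * c - b * d) * c + (a * d + b * c) * d); first by rewrite -cd; ring.
    by rewrite e1 e2 -cd; ring.
  have k2 : (p%:Z %| 2 * d * (a' * d - b' * c))%Z.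
    apply/dvdzP; exists (a' - a); rewrite mulrBl k1; ring.
  have pd : ~~ (p%:Z %| d)%Z.
    apply/negP => pd; have pc : (p%:Z %| c)%Z.
      apply: pz; have -> : c ^+ 2 = p%:Z - d * d by rewrite -cd; ring.
      by apply: rpredB; [exact: dvdzz|exact: dvdz_mulr].
    have /dvdzP[u uE] := pc; have /dvdzP[v vE] := pd.
    have : (p%:Z * (u ^+ 2 + v ^+ 2) - 1) * p%:Z = 0 by rewrite mulrBl mul1r -{3}cd uE vE; ring.
    move/eqP; rewrite mulf_eq0 (negbTE p0) orbF => /eqP h.
    have : (p%:Z %| 1)%Z.
      by apply/dvdzP; exists (u ^+ 2 + v ^+ 2); move/eqP: h; rewrite subr_eq0 mulrC => /eqP.
    by rewrite dvdz1 /= => /eqP pE; move: pp; rewrite pE.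
  have p2 : ~~ (p %| 2)%N.
    by rewrite gtnNdvd//; move: p1 (prime_gt1 pp); clear; case: p => [|[|[|]]].
  have k3 : (p%:Z %| a' * d - b' * c)%Z.
    move: k2 pd; rewrite -![(_ %| _)%Z]/(p %| _)%N !abszM Euclid_dvdM// Euclid_dvdM// => /orP[/orP[]|]//.
    - by rewrite (negbTE p2).
    - by move=> ->.
  have k4 : (a' * c + b' * d) ^+ 2 = m%:Z * p%:Z - (a' * d - b' * c) ^+ 2.
    by rewrite -wm -cd; ring.
  have k5 : (p%:Z %| a' * c + b' * d)%Z.
    by apply: pz; rewrite k4 expr2; apply: rpredB; [exact: dvdz_mull|exact: dvdz_mulr].
  move: k4; have /dvdzP[u ->] := k5; have /dvdzP[v ->] := k3 => k4.
  have : (m%:Z - (u ^+ 2 + v ^+ 2) * p%:Z) * p%:Z = 0.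
    rewrite mulrBl -[m%:Z * _](subrK ((v * p%:Z) ^+ 2)) -k4; ring.
  move/eqP; rewrite mulf_eq0 (negbTE p0) orbF subr_eq0 => /eqP h.
  move: pm; rewrite -[(_ %| _)%N]/(p%:Z %| m%:Z)%Z h dvdz_mull//.
rewrite mul2n -addnn.
have -> : (size s + size s)%N = size ([seq f v | v <- s] ++ [seq g v | v <- s]).
  by rewrite size_cat !size_map.
apply: uniq_leq_size.
  have us : uniq s by rewrite filter_uniq// uniq_zs2.
  rewrite cat_uniq !map_inj_uniq// us/= andbT; apply/hasPn => z /mapP[w ws ->].
  by apply/mapP => -[v vs /esym/eqP]; rewrite (negbTE (disj _ _ vs ws)).
have nf v : v \in s -> nsq (f v) = (p * m)%N /\ nsq (g v) = (p * m)%N.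
  move=> /sE vm; split; apply/eqP; rewrite -eqz_nat nsqE PoszM -vm -cd /=; apply/eqP; ring.
move=> z; rewrite mem_cat => /orP[]/mapP[v vs ->]; have [h1 h2] := nf v vs.
  by rewrite mem_filter h1 eqxx nsq_zs2// h1.
by rewrite mem_filter h2 eqxx nsq_zs2// h2.
Qed.
End two_squares.

(** * Mertens' estimates for the primes 1 modulo 4 *)
Section chebyshev.
Context {R : realType}.
Implicit Types (n N p : nat).

Notation lnn n := (ln (n%:R : R)).

Lemma lnn_ge0 n : 0 <= lnn n.
Proof. by case: n => [|n]; [rewrite ln0|rewrite ln_ge0// ler1n]. Qed.

Lemma lnn_le n : lnn n <= n%:R.
Proof.
case: n => [|n]; first by rewrite ln0.
have h : -1 < n%:R :> R by rewrite (lt_le_trans _ (ler0n R n)).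
apply: (@le_trans _ _ n%:R); last by rewrite ler_nat.
by have := le_ln1Dx h; rewrite addrC natr1.
Qed.

Lemma lnnM m n : (0 < m)%N -> (0 < n)%N -> lnn (m * n) = lnn m + lnn n.
Proof. by move=> m0 n0; rewrite natrM lnM ?posrE ?ltr0n. Qed.

Lemma le_lnn m n : (0 < m)%N -> (m <= n)%N -> lnn m <= lnn n.
Proof. by move=> m0 mn; rewrite ler_ln ?posrE ?ltr0n ?ler_nat// (leq_trans m0). Qed.

Lemma ln_logn_sum n N : (0 < n <= N)%N ->
  lnn n = \sum_(1 <= p < N.+1 | prime p) (logn p n)%:R * lnn p.
Proof.
elim/ltn_ind: n N => n IH N /andP[n0 nN].
have [n1|n1] := leqP n 1.
  have -> : n = 1%N by apply/eqP; rewrite eqn_leq n1.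
  by rewrite ln1 big1// => p _; rewrite logn1 mul0r.
set q := pdiv n; have qp : prime q := pdiv_prime n1.
have qn : (q %| n)%N := pdiv_dvd n.
pose m := (n %/ q)%N; have nE : n = (q * m)%N by rewrite /m mulnC divnK.
have q1 := prime_gt1 qp.
have m0 : (0 < m)%N by move: n0; rewrite nE muln_gt0 => /andP[].
have mn : (m < n)%N by rewrite nE -{1}(mul1n m) ltn_pmul2r.
have q0 := prime_gt0 qp.
have qN : (q <= N)%N by apply: leq_trans nN; apply: dvdn_leq.
rewrite nE lnnM// (IH m mn N) ?m0 ?(leq_trans (ltnW mn))//.
have -> : lnn q = \sum_(1 <= p < N.+1 | prime p) (p == q)%:R * lnn p.
  rewrite (big_rem q) ?mem_index_iota ?q0//= qp eqxx mul1r big1_seq ?addr0// => p /andP[_].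
  by rewrite mem_rem_uniq ?iota_uniq// inE => /andP[/negbTE -> _]; rewrite mul0r.
rewrite -big_split/=; apply: eq_bigr => p pp.
by rewrite lognM// natrD mulrDl lognE; rewrite (logn_prime _ qp).
Qed.

(** Chebyshev's function, not a theta series. *)
Definition theta N : R := \sum_(1 <= p < N.+1 | prime p) lnn p.

Lemma prime_ndvd_fact p n : prime p -> (n < p)%N -> ~~ (p %| n`!)%N.
Proof.
move=> pp; elim: n => [|n IH] np; first by rewrite fact0 dvdn1 gtn_eqF ?prime_gt1.
by rewrite factS Euclid_dvdM// negb_or IH ?(ltnW np)// andbT gtnNdvd.
Qed.

Lemma bin2n_le n : ('C(n.*2, n) <= 2 ^ n.*2)%N.
Proof.
have := expnDn 1 1 n.*2; rewrite addn1 => ->.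
under eq_bigr do rewrite !exp1n !muln1.
have nn : (n < n.*2.+1)%N by rewrite ltnS -addnn leq_addr.
by rewrite (bigD1 (Ordinal nn))//= leq_addr.
Qed.

(** Every prime between [n + 1] and [2 n] divides the central binomial coefficient, which is at most
    [2^(2 n)]; and [ln 2 <= 1]. *)
Lemma theta_double n : theta n.*2 <= theta n + n.*2%:R.
Proof.
have [->|n0] := posnP n; first by rewrite addr0.
pose C := 'C(n.*2, n); have C0 : (0 < C)%N by rewrite bin_gt0 -addnn leq_addr.
have lC : lnn C <= n.*2%:R.
  apply: (@le_trans _ _ (lnn (2 ^ n.*2))); first by apply: le_lnn => //; exact: bin2n_le.
  rewrite natrX lnXn// -[X in _ <= X]mulr1 mulr_natl ler_wMn2r//.
  by have := @le_ln1Dx R 1 _; rewrite -[1 + 1]/(2%:R); apply; rewrite (lt_le_trans _ ler01).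
apply: le_trans (lerD (lexx _) lC); rewrite -lerBlDl.
have -> : theta n.*2 - theta n = \sum_(n.+1 <= p < n.*2.+1 | prime p) lnn p.
  have nn : (n.+1 <= n.*2.+1)%N by rewrite ltnS -addnn leq_addr.
  by rewrite /theta (big_cat_nat (n := n.+1) (isT : 1 <= n.+1)%N nn)/= addrAC subrr add0r.
rewrite (@ln_logn_sum C (maxn C n.*2)) ?C0 ?leq_maxl//.
set K := maxn C n.*2.
have nK : (n.*2.+1 <= K.+1)%N by rewrite ltnS leq_maxr.
have nn2 : (n.+1 <= n.*2.+1)%N by rewrite ltnS -addnn leq_addr.
rewrite (big_cat_nat (n := n.+1) (isT : 1 <= n.+1)%N (leq_trans nn2 nK))/=.
rewrite (big_cat_nat (n := n.*2.+1) nn2 nK)/=.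
clearbody K.
have pos a b : 0 <= \sum_(a <= p < b | prime p) (logn p C)%:R * lnn p.
  by apply: sumr_ge0 => p _; rewrite mulr_ge0 ?lnn_ge0.
apply: (@le_trans _ _ (\sum_(n.+1 <= p < n.*2.+1 | prime p) (logn p C)%:R * lnn p)); last first.
  by rewrite addrCA lerDl addr_ge0.
rewrite big_nat_cond [leRHS]big_nat_cond; apply: ler_sum => p /andP[/andP[np pn] pp].
rewrite -[leLHS]mul1r ler_wpM2r ?lnn_ge0// ler1n logn_gt0 mem_primes pp C0/=.
have : (p %| (n.*2)`!)%N by rewrite dvdn_fact// prime_gt0//= -ltnS.
have nn : (n <= n.*2)%N by rewrite -addnn leq_addr.
rewrite -(bin_fact nn) Euclid_dvdM// => /orP[//|].
by rewrite -addnn addnK Euclid_dvdM// (negbTE (prime_ndvd_fact pp np)).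
Qed.

Lemma theta_le n : theta n <= 4 * n%:R.
Proof.
elim/ltn_ind: n => n IH.
have mono a b : (a <= b)%N -> theta a <= theta b.
  move=> ab; rewrite /theta (big_cat_nat (n := a.+1) (isT : 1 <= a.+1)%N (ab : a.+1 <= b.+1)%N)/= lerDl.
  by apply: sumr_ge0 => p _; exact: lnn_ge0.
have [n1|n1] := leqP n 1.
  rewrite /theta big_nat_cond big1 ?mulr_ge0// => p /andP[/andP[p1 pn] pp].
  by have := leq_trans (leq_trans (prime_gt1 pp) pn) n1.
pose h := uphalf n.
have hn : (h < n)%N by rewrite /h; lia.
have nh : (n <= h.*2)%N by rewrite /h; lia.
have hh : (h.*2 <= n.+1)%N by rewrite /h; lia.
apply: (le_trans (mono _ _ nh)); apply: (le_trans (theta_double h)).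
apply: (le_trans (lerD (IH h hn) (lexx _))).
rewrite -[4]/(4%:R) -!natrM -natrD ler_nat; move: hh n1 hn; clear; lia.
Qed.
End chebyshev.

(** * Sums weighted by logarithms *)

Section log_sums.
Context {R : realType}.
Implicit Types (n N p : nat).
Notation lnn n := (ln (n%:R : R)).

Lemma sum_multiples (F : nat -> R) d N : (0 < d)%N ->
  \sum_(1 <= n < N.+1 | (d %| n)%N) F n = \sum_(1 <= i < (N %/ d).+1) F (d * i)%N.
Proof.
move=> d0; elim: N => [|N IH]; first by rewrite div0n !big_geq.
rewrite big_mkcond big_nat_recr//= -big_mkcond/= IH divnS//.
case: (boolP (d %| N.+1)%N) => dN; last by rewrite addr0.
by rewrite add1n [RHS]big_nat_recr//=; congr (_ + F _); have := divnK dN; rewrite divnS// dN add1n mulnC => ->.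
Qed.

Lemma logn_count p n N : prime p -> (0 < n <= N)%N ->
  logn p n = (\sum_(1 <= j < N.+1) (p ^ j %| n))%N.
Proof.
move=> pp /andP[n0 nN]; rewrite logn_count_dvd//.
rewrite [RHS](@big_cat_nat _ _ _ n)//=; last exact: leqW.
rewrite [X in (_ + X)%N]big_nat_cond [X in (_ + X)%N]big1 ?addn0// => j /andP[/andP[nj _] _].
apply/eqP; rewrite eqb0 gtnNdvd//; apply: leq_trans (ltn_expl j (prime_gt1 pp)); exact: leq_ltn_trans nj _.
Qed.

(** [ln n] is the sum of [ln p] over the prime powers [p^j] with [j >= 1] dividing [n]. Used with
    [F = 1] for all primes and with [F n = chi n / n] for the character. *)
Lemma sum_mul_ln (F : nat -> R) N :
  \sum_(1 <= n < N.+1) F n * lnn n = \sum_(1 <= p < N.+1 | prime p) lnn p *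
    \sum_(1 <= j < N.+1) \sum_(1 <= i < (N %/ p ^ j).+1) F (p ^ j * i)%N.
Proof.
transitivity (\sum_(1 <= n < N.+1) \sum_(1 <= p < N.+1 | prime p) F n * ((logn p n)%:R * lnn p)).
  rewrite big_nat [RHS]big_nat; apply: eq_bigr => n nN.
  by rewrite (@ln_logn_sum R n N) ?mulr_sumr// -ltnS.
rewrite exchange_big/=; apply: eq_bigr => p pp; rewrite mulr_sumr.
transitivity (\sum_(1 <= n < N.+1) \sum_(1 <= j < N.+1) lnn p * (if (p ^ j %| n)%N then F n else 0)).
  rewrite big_nat [RHS]big_nat; apply: eq_bigr => n nN.
  rewrite (@logn_count p n N)// natr_sum -mulr_sumr mulrA mulrC; congr (_ * _).
  rewrite mulr_sumr; apply: eq_bigr => j _; by case: (_ %| _)%N; rewrite ?mulr1 ?mulr0.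
rewrite exchange_big/=; apply: eq_bigr => j _; rewrite -mulr_sumr -big_mkcond/=.
by rewrite sum_multiples// expn_gt0 prime_gt0.
Qed.

Lemma pow_tail (x : R) M : 0 <= x <= 1 / 2 -> \sum_(2 <= j < M.+1) x ^+ j <= 2 * x ^+ 2.
Proof.
move=> /andP[x0 x1].
have [M1|M1] := leqP M 1; first by rewrite big_geq// mulr_ge0 ?sqr_ge0.
have E : (1 - x) * \sum_(2 <= j < M.+1) x ^+ j = x ^+ 2 - x ^+ M.+1.
  elim: M M1 => [//|M IH]; rewrite ltnS leq_eqVlt => /predU1P[<-|M1].
    by rewrite big_nat1; ring.
  by rewrite big_nat_recr ?leqW//= mulrDr IH// !exprS; ring.
have x2 := exprn_ge0 M.+1 x0; have s0 : 0 <= \sum_(2 <= j < M.+1) x ^+ j.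
  by apply: sumr_ge0 => j _; exact: exprn_ge0.
by move: E x2 s0; move: (\sum_(2 <= j < M.+1) _) (x ^+ M.+1) => s y; clear -x1; nra.
Qed.

Lemma sum_ln_sqr N : \sum_(2 <= n < N.+1) lnn n / n%:R ^+ 2 <= 2.
Proof.
have [N0|N0] := posnP N; first by rewrite N0 big_geq.
(* The subtracted term makes the induction close: its decrease from [N] to [N + 1] pays for the new
   summand. *)
suff H : \sum_(2 <= n < N.+1) lnn n / n%:R ^+ 2 <= 2 - (lnn N + 2) / N%:R.
  by apply: (le_trans H); rewrite gerBl divr_ge0// addr_ge0// lnn_ge0.
elim: N N0 => [//|N IH _]; have [->|N0] := posnP N.
  by rewrite big_geq// ln1; lra.
rewrite big_nat_recr//=; apply: (le_trans (lerD (IH N0) (lexx _))).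
have n1 : 1 <= N%:R :> R by rewrite ler1n.
have L : lnn N.+1 - lnn N <= N%:R^-1.
  rewrite -lnV ?posrE ?ltr0n// -lnM ?posrE ?invr_gt0 ?ltr0n//.
  rewrite -natr1 mulrDl mul1r divff ?gt_eqF ?ltr0n//.
  by apply: le_ln1Dx; rewrite (lt_le_trans _ (_ : 0 <= _))// invr_ge0.
rewrite -natr1 in L *; have l0 := lnn_ge0 (R := R) N.
have l1 : 0 <= ln (N%:R + 1 : R) by rewrite natr1; exact: lnn_ge0.
move: (N%:R : R) (ln _) (ln _) n1 L l0 l1 => x a b x1 L a0 b0.
have x0 : 0 < x by lra.
have xL : x * (b - a) <= 1 by rewrite mulrC -ler_pdivlMr ?mul1r ?div1r.
have xi : x^-1 <= 1 by rewrite invf_le1.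
rewrite -subr_ge0.
have -> : 2 - (b + 2) / (x + 1) - (2 - (a + 2) / x + b / (x + 1) ^+ 2) =
  (1 - x * (b - a)) / (x * (x + 1)) + ((a + 1 - b) * x + (a + 1)) / (x * (x + 1) ^+ 2).
  by field; rewrite !gt_eqF//; lra.
apply: addr_ge0; apply: divr_ge0; rewrite ?subr_ge0//.
- by rewrite mulr_ge0//; lra.
- by rewrite addr_ge0 ?mulr_ge0//; lra.
- by rewrite mulr_ge0 ?sqr_ge0//; lra.
Qed.
End log_sums.

(** * Mertens' first theorem for all primes *)

Section mertens.
Context {R : realType}.
Implicit Types (n N p : nat).
Notation lnn n := (ln (n%:R : R)).

Definition log_prime_sum N : R := \sum_(1 <= p < N.+1 | prime p) lnn p / p%:R.

Lemma sum_ln_lower N : N%:R * lnn N - N%:R <= \sum_(1 <= n < N.+1) lnn n.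
Proof.
elim: N => [|N IH]; first by rewrite mul0r subr0 big_geq.
rewrite big_nat_recr//=; apply: le_trans (lerD IH (lexx _)).
have [->|N0] := posnP N; first by rewrite ln1; lra.
have n1 : 1 <= N%:R :> R by rewrite ler1n.
have L : lnn N.+1 - lnn N <= N%:R^-1.
  rewrite -lnV ?posrE ?ltr0n// -lnM ?posrE ?invr_gt0 ?ltr0n//.
  rewrite -natr1 mulrDl mul1r divff ?gt_eqF ?ltr0n//.
  by apply: le_ln1Dx; rewrite (lt_le_trans _ (_ : 0 <= _))// invr_ge0.
rewrite -natr1 in L *.
move: (N%:R : R) (ln _) (ln _) n1 L => x a b x1 L.
have xL : x * (b - a) <= 1 by rewrite mulrC -ler_pdivlMr ?mul1r ?div1r//; lra.
by lra.
Qed.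

Lemma sum_ln_upper N : \sum_(1 <= n < N.+1) lnn n <= N%:R * lnn N.
Proof.
have -> : N%:R * lnn N = \sum_(1 <= n < N.+1) lnn N by rewrite sumr_const_nat subn1 mulr_natl.
by rewrite big_nat [leRHS]big_nat; apply: ler_sum => n /andP[n1 nN]; rewrite le_lnn.
Qed.

Lemma prime_inv_half p : prime p -> 0 <= (p%:R^-1 : R) <= 1 / 2.
Proof.
move=> pp; rewrite invr_ge0 ler0n div1r/= lef_pV2 ?posrE ?ltr0n ?prime_gt0//.
by rewrite ler_nat prime_gt1.
Qed.

Lemma prime_power_tail N : \sum_(1 <= p < N.+1 | prime p) lnn p *
  \sum_(2 <= j < N.+1) (p%:R^-1) ^+ j <= 4 :> R.
Proof.
apply: (@le_trans _ _ (\sum_(1 <= p < N.+1 | prime p) 2 * (lnn p / p%:R ^+ 2))).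
  apply: ler_sum => p pp; rewrite mulrCA ler_wpM2l ?lnn_ge0//.
  by have := pow_tail N (prime_inv_half pp); rewrite exprVn.
rewrite -mulr_sumr (_ : 4 = 2 * 2 :> R) ?ler_wpM2l//; last by ring.
apply: le_trans (sum_ln_sqr N).
have [->|N0] := posnP N; first by rewrite !big_geq.
rewrite big_mkcond big_ltn//= add0r; apply: ler_sum => n _.
by case: ifP => // _; rewrite divr_ge0 ?lnn_ge0// exprn_ge0.
Qed.

(** [ln (N!) >= N ln N - N] is compared with the factorisation of [N!]: first powers contribute at
    most [N / p] each, higher powers at most [4 N] in all. *)
Lemma log_prime_sum_lower N : (0 < N)%N -> lnn N - 5 <= log_prime_sum N.
Proof.
move=> N0; have n0 : 0 < N%:R :> R by rewrite ltr0n.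
have S := sum_mul_ln (fun=> 1 : R) N.
have -> : lnn N - 5 = (N%:R * lnn N - N%:R) / N%:R - 4 by field; rewrite gt_eqF.
rewrite lerBlDr ler_pdivrMr//; apply: (le_trans (sum_ln_lower N)).
have -> : \sum_(1 <= n < N.+1) lnn n = \sum_(1 <= n < N.+1) 1 * lnn n.
  by apply: eq_bigr => n _; rewrite mul1r.
rewrite S mulrDl mulr_suml.
apply: le_trans (lerD (lexx _) (ler_wpM2r (ltW n0) (prime_power_tail N))).
rewrite mulr_suml -big_split/=; apply: ler_sum => p pp.
have p0 : 0 < p%:R :> R by rewrite ltr0n prime_gt0.
rewrite -mulrA -[X in _ <= _ + X]mulrA -mulrDr ler_wpM2l ?lnn_ge0//.
have -> : p%:R^-1 * N%:R + (\sum_(2 <= j < N.+1) p%:R^-1 ^+ j) * N%:R = \sum_(1 <= j < N.+1) p%:R^-1 ^+ j * N%:R :> R.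
  by rewrite [RHS]big_ltn//= expr1 mulr_suml.
apply: ler_sum => j _; rewrite sumr_const_nat subn1/= exprVn mulrC ler_pdivlMr ?exprn_gt0//.
by rewrite -natrX -natrM ler_nat leq_trunc_div.
Qed.

(** A prime [p] occurs at least [N / p - 1] times in [N!]; the defects add up to Chebyshev's
    [theta N <= 4 N]. *)
Lemma log_prime_sum_upper N : (0 < N)%N -> log_prime_sum N <= lnn N + 4.
Proof.
move=> N0; have n0 : 0 < N%:R :> R by rewrite ltr0n.
have S := sum_mul_ln (fun=> 1 : R) N.
rewrite -(ler_pM2r n0) mulrDl.
apply: (@le_trans _ _ (\sum_(1 <= n < N.+1) lnn n + theta N)); last first.
  by rewrite lerD ?theta_le// mulrC sum_ln_upper.
have -> : \sum_(1 <= n < N.+1) lnn n = \sum_(1 <= n < N.+1) 1 * lnn n.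
  by apply: eq_bigr => n _; rewrite mul1r.
rewrite S /log_prime_sum /theta mulr_suml -big_split/=; apply: ler_sum => p pp.
have p0 : 0 < p%:R :> R by rewrite ltr0n prime_gt0.
rewrite -mulrA -[X in _ <= _ + X]mulr1 -mulrDr ler_wpM2l ?lnn_ge0//.
rewrite big_ltn//= expn1.
apply: (@le_trans _ _ ((N %/ p)%:R + 1)).
  rewrite mulrC ler_pdivrMr// natr1 -natrM ler_nat ltnW// mulnC.
  by rewrite mulnC ltn_ceil// prime_gt0.
rewrite lerD2r sumr_const_nat subn1/= lerDl; apply: sumr_ge0 => j _.
by apply: sumr_ge0.
Qed.
End mertens.

(** * The nontrivial character modulo 4 *)

Section quadratic_character.
Context {R : realType}.
Implicit Types (n N p a b : nat).
Notation lnn n := (ln (n%:R : R)).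

Definition chi n : R := if odd n then (if (n %% 4 == 1)%N then 1 else - 1) else 0.

Lemma chi_mod n : chi n = chi (n %% 4).
Proof. by rewrite /chi modn_mod; have -> : odd (n %% 4) = odd n by lia. Qed.

Lemma chiM m n : chi (m * n) = chi m * chi n.
Proof.
rewrite chi_mod -modnMm (chi_mod m) (chi_mod n).
have := ltn_pmod m (isT : 0 < 4)%N; have := ltn_pmod n (isT : 0 < 4)%N.
by move: (m %% 4)%N (n %% 4)%N => [|[|[|[|?]]]] [|[|[|[|?]]]] // _ _; rewrite /chi/=; ring.
Qed.

Lemma chiX m j : chi (m ^ j) = chi m ^+ j.
Proof. by elim: j => [|j IH]; rewrite ?expr0 ?expnS ?chiM ?IH ?exprS//. Qed.

Lemma chi_norm n : `|chi n| <= 1.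
Proof. by rewrite /chi; case: ifP => _; [case: ifP => _|]; rewrite ?normrN ?normr1 ?normr0. Qed.

Definition csum N : R := \sum_(1 <= n < N.+1) chi n.

Lemma csum_itv N : 0 <= csum N <= 1.
Proof.
suff -> : csum N = if ((N %% 4 == 1) || (N %% 4 == 2))%N then 1 else 0 by case: ifP; rewrite ?lexx ?ler01.
rewrite /csum; elim: N => [|N IH]; first by rewrite big_geq.
rewrite big_nat_recr//= IH chi_mod.
have -> : (N.+1 %% 4 = (N %% 4).+1 %% 4)%N by rewrite -[in RHS]addn1 modnDml addn1.
by have := ltn_pmod N (isT : 0 < 4)%N; case: (N %% 4)%N => [|[|[|[|//]]]] _; rewrite /chi/=; ring.
Qed.

(** The partial sums of [chi] are 0 or 1, so any two differ by at most 1, and summation by parts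
    against a decreasing [f] leaves only its first value. *)
Lemma chi_sum_bound (f : nat -> R) a b : (a <= b)%N ->
  (forall n, (a < n)%N -> 0 <= f n.+1 <= f n) -> 0 <= f a.+1 ->
  `|\sum_(a.+1 <= n < b.+1) chi n * f n| <= f a.+1.
Proof.
rewrite leq_eqVlt => /predU1P[<- _ fa|ab fm fa]; first by rewrite big_geq// normr0.
have H k : `|\sum_(a.+1 <= n < (a.+1 + k).+1) chi n * f n - (csum (a.+1 + k) - csum a) * f (a.+1 + k)%N|
    <= f a.+1 - f (a.+1 + k)%N.
  elim: k => [|k IH].
    rewrite addn0 big_nat1 /csum big_nat_recr//= addrAC subrr add0r subrr normr0 subrr//.
  rewrite addnS big_nat_recr/=; last by rewrite -addnS leq_addr.
  set m := (a.+1 + k)%N in IH *.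
  have cs : csum m.+1 = csum m + chi m.+1 by rewrite /csum big_nat_recr.
  have /andP[f1 f2] : 0 <= f m.+1 <= f m by apply: fm; rewrite /m addSn ltnS leq_addr.
  have /andP[c0 c1] := csum_itv m; have /andP[d0 d1] := csum_itv a.
  have D : `|(csum m - csum a) * (f m - f m.+1)| <= f m - f m.+1.
    rewrite normrM (@ger0_norm _ (f m - f m.+1)) ?subr_ge0// ler_piMl ?subr_ge0//.
    by rewrite ler_norml; apply/andP; split; lra.
  have -> : \sum_(a.+1 <= n < m.+1) chi n * f n + chi m.+1 * f m.+1 - (csum m.+1 - csum a) * f m.+1 =
    (\sum_(a.+1 <= n < m.+1) chi n * f n - (csum m - csum a) * f m) + (csum m - csum a) * (f m - f m.+1).
    by rewrite cs; ring.
  by apply: (le_trans (ler_normD _ _)); lra.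
have := H (b - a.+1)%N; rewrite subnKC//; set s := \sum_(_ <= _ < _) _ => {}H.
have fb : 0 <= f b.
  have := fm b.-1; case: b ab {H s} => // b; rewrite ltnS leq_eqVlt => /predU1P[<-//|ab] /(_ ab).
  by rewrite prednK ?(leq_trans _ ab)// => /andP[]; case: b ab.
have /andP[c0 c1] := csum_itv b; have /andP[d0 d1] := csum_itv a.
have D : `|(csum b - csum a) * f b| <= f b.
  rewrite normrM (ger0_norm fb) ler_piMl//.
  by rewrite ler_norml; apply/andP; split; lra.
have -> : s = (s - (csum b - csum a) * f b) + (csum b - csum a) * f b by rewrite subrK.
by apply: (le_trans (ler_normD _ _)); lra.
Qed.

Definition chi_inv N : R := \sum_(1 <= n < N.+1) chi n * n%:R^-1.

Lemma chi_inv_dist a b : (a <= b)%N -> `|chi_inv b - chi_inv a| <= a.+1%:R^-1.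
Proof.
move=> ab; have aS : (a.+1 <= b.+1)%N by [].
rewrite /chi_inv (big_cat_nat (n := a.+1) (isT : 1 <= a.+1)%N aS)/= addrAC subrr add0r.
apply: (chi_sum_bound (f := fun n => n%:R^-1)) => // n an.
rewrite invr_ge0 ler0n/= lef_pV2 ?posrE ?ltr0n ?ler_nat//; exact: leq_ltn_trans an.
Qed.

Lemma chi_inv_norm N : `|chi_inv N| <= 1.
Proof.
have := chi_inv_dist (leq0n N); rewrite [chi_inv 0]/chi_inv big_geq// subr0 invr1//.
Qed.

(** The non-vanishing of [L(1, chi)], visible on an alternating series: the first terms give 2/3 and
    the rest is at most 1/4. *)
Lemma chi_inv_lower N : (3 <= N)%N -> 1 / 3 <= chi_inv N.
Proof.
move=> N3; have := chi_inv_dist N3.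
have -> : chi_inv 3 = 2 / 3.
  by rewrite /chi_inv big_ltn// big_ltn// big_ltn// big_geq// /chi/= invr1; field.
rewrite ler_norml => /andP[h _].
have e : 4^-1 = 1 / 4 :> R by rewrite div1r.
by move: h; rewrite e; lra.
Qed.

Lemma chi_log_bound N : `|\sum_(1 <= n < N.+1) chi n * (lnn n / n%:R)| <= 9.
Proof.
have t1 n : `|chi n * (lnn n / n%:R)| <= 1.
  rewrite normrM -[leRHS]mulr1 ler_pM ?chi_norm//.
  case: n => [|n]; first by rewrite ln0 ?mul0r ?normr0.
  by rewrite ger0_norm ?divr_ge0 ?lnn_ge0// ler_pdivrMr ?ltr0n// mul1r lnn_le.
have H K : `|\sum_(1 <= n < K.+1) chi n * (lnn n / n%:R)| <= K%:R.
  apply: (le_trans (ler_norm_sum _ _ _)).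
  apply: (@le_trans _ _ (\sum_(1 <= n < K.+1) 1)); first exact: ler_sum.
  by rewrite sumr_const_nat subn1.
(* [ln n / n] decreases once [ln n >= 1]; the cut at 8 = 2^3 lets this follow from [ln 2 >= 1/2]. *)
have [N8|N8] := leqP N 7; first by apply: (le_trans (H N)); rewrite -[9]/(9%:R) ler_nat (leq_trans N8).
have N8' : (8 <= N.+1)%N by exact: leqW.
rewrite (big_cat_nat (n := 8%N) (isT : 1 <= 8)%N N8')/=.
apply: (le_trans (ler_normD _ _)).
have ln8 : 1 <= lnn 8.
  have h2 : 1 / 2 <= lnn 2.
    have h : -1 < - (1 / 2) :> R by lra.
    have := le_ln1Dx h.
    have -> : 1 + - (1 / 2) = 2^-1 :> R by lra.
    by rewrite lnV ?posrE//; lra.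
  have -> : (8%N%:R : R) = 2%:R ^+ 3 by rewrite -natrX.
  by rewrite lnXn// -[leRHS]mulr_natl; lra.
have B2 : `|\sum_(8 <= n < N.+1) chi n * (lnn n / n%:R)| <= lnn 8 / 8%:R.
  apply: (chi_sum_bound (f := fun n => lnn n / n%:R) (a := 7)) => [|n n7|].
  - exact: ltnW.
  - rewrite divr_ge0 ?lnn_ge0//=.
    have n0 : (0 < n)%N by exact: leq_trans n7.
    have n1 : 1 <= n%:R :> R by rewrite ler1n.
    have L : lnn n.+1 - lnn n <= n%:R^-1.
      rewrite -lnV ?posrE ?ltr0n// -lnM ?posrE ?invr_gt0 ?ltr0n//.
      rewrite -natr1 mulrDl mul1r divff ?gt_eqF ?ltr0n//.
      by apply: le_ln1Dx; rewrite (lt_le_trans _ (_ : 0 <= _))// invr_ge0.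
    have l1 : 1 <= lnn n by apply: (le_trans ln8); rewrite le_lnn.
    rewrite ler_pdivrMr ?ltr0n// mulrAC ler_pdivlMr ?ltr0n//.
    rewrite -natr1 in L *.
    move: (n%:R : R) (ln _) (ln _) n1 L l1 => x a b x1 L l1.
    have xL : x * (b - a) <= 1 by rewrite mulrC -ler_pdivlMr ?mul1r ?div1r//; lra.
    lra.
  - by rewrite divr_ge0 ?lnn_ge0.
have B3 : lnn 8 / 8%:R <= 1 by rewrite ler_pdivrMr ?mul1r ?lnn_le// ltr0n.
have := H 7%N; move: B2 B3; set s := `|_|; set s' := `|_|; move=> h1 h2 h3.
by apply: (le_trans (lerD h3 (le_trans h1 h2))); rewrite -[1]/(1%:R) -natrD -[9]/(9%:R) ler_nat.
Qed.

(** [sum_mul_ln] with [F n = chi n / n] produces the terms [chi p ln p / p] multiplied by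
    [chi_inv (N / p)]. Replacing these factors by [chi_inv N] costs at most [theta N / N <= 4],
    higher prime powers cost 4, and the total is bounded by 9. Division by [chi_inv N >= 1/3] gives
    51 = 3 * 17. *)
Lemma chi_prime_sum N : (3 <= N)%N ->
  `|\sum_(1 <= p < N.+1 | prime p) chi p * (lnn p / p%:R)| <= 51.
Proof.
move=> N3; have N0 : (0 < N)%N by exact: leq_trans N3.
have n0 : 0 < N%:R :> R by rewrite ltr0n.
set D := \sum_(1 <= p < N.+1 | prime p) _.
have X3 := chi_inv_lower N3.
suff H : `|chi_inv N * D| <= 17.
  have h0 := normr_ge0 D.
  by move: H; rewrite normrM ger0_norm; [nra|lra].
have S := sum_mul_ln (fun n => chi n / n%:R) N.
have E : \sum_(1 <= n < N.+1) chi n / n%:R * lnn n = \sum_(1 <= p < N.+1 | prime p)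
   (chi p * (lnn p / p%:R) * chi_inv (N %/ p) + lnn p * \sum_(2 <= j < N.+1) (chi p / p%:R) ^+ j * chi_inv (N %/ p ^ j)).
  rewrite S; apply: eq_bigr => p pp.
  have -> : \sum_(1 <= j < N.+1) \sum_(1 <= i < (N %/ p ^ j).+1) chi (p ^ j * i) / (p ^ j * i)%:R =
     \sum_(1 <= j < N.+1) (chi p / p%:R) ^+ j * chi_inv (N %/ p ^ j) :> R.
    apply: eq_bigr => j _; rewrite /chi_inv mulr_sumr; apply: eq_bigr => i _.
    by rewrite chiM chiX natrM natrX invfM exprMn exprVn; ring.
  by rewrite big_ltn//= mulrDr expr1 expn1; congr (_ + _); ring.
rewrite big_split/= in E.
set T2 := \sum_(1 <= p < N.+1 | prime p) lnn p * _ in E.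
set T1 := \sum_(1 <= p < N.+1 | prime p) _ in E.
have B2 : `|T2| <= 4.
  apply: (le_trans (ler_norm_sum _ _ _)); apply: le_trans (prime_power_tail N).
  apply: ler_sum => p pp; rewrite normrM ger0_norm ?lnn_ge0// ler_wpM2l ?lnn_ge0//.
  apply: (le_trans (ler_norm_sum _ _ _)); apply: ler_sum => j _.
  rewrite normrM -[leRHS]mulr1 ler_pM ?chi_inv_norm// normrX lerXn2r ?nnegrE ?invr_ge0 ?ler0n//.
  by rewrite normrM (@ger0_norm _ p%:R^-1) ?invr_ge0// ler_piMl ?invr_ge0 ?chi_norm.
have B0 : `|T1 + T2| <= 9.
  rewrite -E; have := chi_log_bound N; congr (`|_| <= _).
  by apply: eq_bigr => n _; ring.
have B3 : `|chi_inv N * D - T1| <= 4.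
  rewrite /D mulr_sumr -sumrB; apply: (le_trans (ler_norm_sum _ _ _)).
  apply: (@le_trans _ _ (\sum_(1 <= p < N.+1 | prime p) lnn p * N%:R^-1)); last first.
    by rewrite -mulr_suml ler_pdivrMr// theta_le.
  apply: ler_sum => p pp; have p0 : 0 < p%:R :> R by rewrite ltr0n prime_gt0.
  have -> : chi_inv N * (chi p * (lnn p / p%:R)) - chi p * (lnn p / p%:R) * chi_inv (N %/ p) =
     lnn p * (chi p / p%:R * (chi_inv N - chi_inv (N %/ p))) by ring.
  rewrite normrM ger0_norm ?lnn_ge0// ler_wpM2l ?lnn_ge0// normrM.
  apply: (@le_trans _ _ (p%:R^-1 * (N %/ p).+1%:R^-1)).
    apply: ler_pM => //; last exact/chi_inv_dist/leq_div.
    by rewrite normrM (@ger0_norm _ p%:R^-1) ?invr_ge0// ler_piMl ?invr_ge0 ?chi_norm.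
  have h : N%:R <= p%:R * (N %/ p).+1%:R :> R.
    by rewrite -natrM ler_nat mulnC ltnW// ltn_ceil// prime_gt0.
  rewrite -invfM lef_pV2 ?posrE//; exact: lt_le_trans h.
have -> : chi_inv N * D = (chi_inv N * D - T1) + (T1 + T2) - T2 by ring.
move: B0 B2 B3; rewrite !ler_norml => /andP[? ?] /andP[? ?] /andP[? ?].
by apply/andP; split; lra.
Qed.
End quadratic_character.

(** * Reciprocal sums and counting for the primes 1 modulo 4 *)

Definition prime1 p := prime p && (p %% 4 == 1)%N.

Section primes_one_mod_four.
Context {R : realType}.
Implicit Types (n N p : nat).
Notation lnn n := (ln (n%:R : R)).

Definition log_prime1_sum N : R := \sum_(1 <= p < N.+1 | prime1 p) lnn p / p%:R.

Lemma prime1_ind p : prime p ->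
  (p %% 4 == 1)%N%:R = (1 + chi p - (p == 2)%:R) / 2 :> R.
Proof.
move=> pp; rewrite /chi; have [->|p2] := eqVneq p 2; first by rewrite /=; field.
have -> : odd p by case/even_prime: pp p2 => // ->; rewrite eqxx.
by case: (_ == _)%N => /=; field.
Qed.

Lemma log_prime1_sumE N : log_prime1_sum N =
  (log_prime_sum N + \sum_(1 <= p < N.+1 | prime p) chi p * (lnn p / p%:R) -
   \sum_(1 <= p < N.+1 | prime p) (p == 2)%:R * (lnn p / p%:R)) / 2.
Proof.
rewrite /log_prime1_sum /log_prime_sum -big_split -sumrB mulr_suml big_mkcondr.
apply: eq_bigr => p pp /=.
transitivity ((p %% 4 == 1)%N%:R * (lnn p / p%:R)).
  by case: (_ == _)%N => /=; rewrite ?mul1r ?mul0r.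
by rewrite prime1_ind//; ring.
Qed.

Lemma log_prime_two_sum N :
  0 <= \sum_(1 <= p < N.+1 | prime p) (p == 2)%:R * (lnn p / p%:R) <= 1.
Proof.
apply/andP; split.
  by apply: sumr_ge0 => p _; rewrite mulr_ge0// divr_ge0 ?lnn_ge0.
apply: (@le_trans _ _ (\sum_(1 <= p < N.+1 | p == 2) lnn p / p%:R)).
  rewrite big_mkcond [leRHS]big_mkcond; apply: ler_sum => p _.
  case: (p == 2)%N => /=; rewrite ?mul0r ?mul1r; case: ifP => // _.
  by rewrite divr_ge0 ?lnn_ge0.
have [h|h] := leqP 2 N.
  rewrite big_nat1_eq /= ltnS h.
  by rewrite ler_pdivrMr// mul1r lnn_le.
rewrite big_nat_cond big_pred0// => p; apply/negbTE/negP => /andP[/andP[_ p1]] /eqP p2.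
by move: p1; rewrite p2 ltnS leqNgt h.
Qed.

(** 29 rounds up [(5 + 51 + 1) / 2]: the errors for all primes and for [chi], and the prime 2. *)
Lemma log_prime1_sum_lower N : (3 <= N)%N -> lnn N / 2 - 29 <= log_prime1_sum N.
Proof.
move=> N3; have N0 : (0 < N)%N by exact: leq_trans N3.
have := @log_prime_sum_lower R _ N0; have := @chi_prime_sum R _ N3.
have := log_prime_two_sum N; rewrite log_prime1_sumE ler_norml.
by move=> /andP[h1 h2] /andP[h3 h4] h5; lra.
Qed.

Lemma log_prime1_sum_upper N : (3 <= N)%N -> log_prime1_sum N <= lnn N / 2 + 29.
Proof.
move=> N3; have N0 : (0 < N)%N by exact: leq_trans N3.
have := @log_prime_sum_upper R _ N0; have := @chi_prime_sum R _ N3.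
have := log_prime_two_sum N; rewrite log_prime1_sumE ler_norml.
by move=> /andP[h1 h2] /andP[h3 h4] h5; lra.
Qed.

Definition inv_prime1_sum N : R := \sum_(1 <= p < N.+1 | prime1 p) p%:R^-1.

Lemma lnn_gt0 n : (2 <= n)%N -> 0 < lnn n.
Proof. by move=> n2; rewrite ln_gt0// ltr1n. Qed.

Lemma ln_diff_le (x y : R) : 0 < x -> 0 < y -> ln y - ln x <= (y - x) / x.
Proof.
move=> x0 y0; rewrite -ln_div ?posrE//.
have -> : (y - x) / x = y / x - 1 by field; rewrite gt_eqF.
have := @le_ln1Dx R (y / x - 1); rewrite [1 + _]addrC subrK; apply.
by rewrite ltrBrDr addNr divr_gt0.
Qed.

Lemma lnn_step n : (0 < n)%N -> lnn n.+2 - lnn n.+1 <= lnn n.+1 - lnn n.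
Proof.
move=> n0; have h : 0 < n%:R :> R by rewrite ltr0n.
rewrite lerBlDr addrAC lerBrDr -!lnM ?posrE ?ltr0n// ler_ln ?posrE ?mulr_gt0 ?ltr0n//.
by rewrite -!natrM ler_nat; lia.
Qed.

(* Partial summation without integrals: the increment of the left-hand side is
   controlled through [log_prime1_sum_lower] and concavity of [ln]. *)
Lemma inv_prime1_sum_ind N : (3 <= N)%N ->
  (log_prime1_sum N - lnn N / 2 + 29) / lnn N + ln (lnn N.+1) / 2 -
  ((log_prime1_sum 3 - lnn 3 / 2 + 29) / lnn 3 + ln (lnn 4) / 2) <= inv_prime1_sum N.
Proof.
move=> N3; rewrite -(subnKC N3); elim: (N - 3)%N => [|m IH].
  rewrite addn0 subrr; apply: sumr_ge0 => p _; by rewrite invr_ge0.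
rewrite addnS; move: IH; have n3 : (3 <= 3 + m)%N by rewrite leq_addr.
move: (3 + m)%N n3 => n n3; set c := (_ + ln (lnn 4) / 2).
have h := log_prime1_sum_lower n3.
have n2 : (2 <= n)%N by exact: ltnW.
have n1 : (0 < n)%N by exact: ltnW.
have ln0 : 0 < lnn n by rewrite lnn_gt0.
have ln1 : 0 < lnn n.+1 by rewrite lnn_gt0// ltnS.
have ln2 : 0 < lnn n.+2 by rewrite lnn_gt0.
have lln : lnn n <= lnn n.+1 by rewrite le_lnn.
have st : lnn n.+2 - lnn n.+1 <= lnn n.+1 - lnn n by rewrite lnn_step.
have dl := ln_diff_le ln1 ln2.
set t := if prime1 n.+1 then lnn n.+1 / n.+1%:R else 0.
have EA : log_prime1_sum n.+1 = log_prime1_sum n + t.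
  by rewrite /log_prime1_sum big_mkcond big_nat_recr//= -big_mkcond.
have ES : inv_prime1_sum n.+1 = inv_prime1_sum n + t / lnn n.+1.
  rewrite /inv_prime1_sum big_mkcond big_nat_recr//= -big_mkcond; congr (_ + _).
  rewrite /t; case: ifP => _; last by rewrite mul0r.
  by rewrite mulrAC divff ?mul1r// gt_eqF.
rewrite EA ES => IH.
have -> : (log_prime1_sum n + t - lnn n.+1 / 2 + 29) / lnn n.+1 =
   (log_prime1_sum n - lnn n / 2 + 29) / lnn n.+1 + t / lnn n.+1 - ((lnn n.+1 - lnn n) / lnn n.+1) / 2.
  by field; rewrite gt_eqF.
have k1 : (log_prime1_sum n - lnn n / 2 + 29) / lnn n.+1 <= (log_prime1_sum n - lnn n / 2 + 29) / lnn n.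
  by rewrite ler_wpM2l ?lef_pV2 ?posrE//; lra.
have k2 : (lnn n.+2 - lnn n.+1) / lnn n.+1 <= (lnn n.+1 - lnn n) / lnn n.+1.
  by rewrite ler_wpM2r// invr_ge0 ltW.
by lra.
Qed.

Lemma inv_prime1_sum_lower : exists2 C : R, 0 <= C & forall N, (3 <= N)%N ->
  ln (lnn N) / 2 - C <= inv_prime1_sum N.
Proof.
exists (`|(log_prime1_sum 3 - lnn 3 / 2 + 29) / lnn 3 + ln (lnn 4) / 2|) => // N N3.
apply: le_trans (inv_prime1_sum_ind N3).
have N0 : (0 < N)%N by exact: leq_trans N3.
have h := log_prime1_sum_lower N3.
have l0 : 0 < lnn N by rewrite lnn_gt0// (ltn_trans _ N3).
have k1 : 0 <= (log_prime1_sum N - lnn N / 2 + 29) / lnn N by rewrite divr_ge0 ?(ltW l0)//; lra.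
have k2 : ln (lnn N) <= ln (lnn N.+1).
  by rewrite ler_ln ?posrE ?le_lnn// lnn_gt0// ltnS.
have := ler_norm ((log_prime1_sum 3 - lnn 3 / 2 + 29) / lnn 3 + ln (lnn 4) / 2).
by lra.
Qed.

(** The sum of [ln p / p] between [x / K] and [x] is at least 1, because [118 / 2] exceeds twice the
    error 29 by 1; each of its terms is at most [K ln x / x]. *)
Lemma count_prime1_lower : exists2 K : nat, (0 < K)%N & forall x, (3 * K <= x)%N ->
  x%:R / (K%:R * lnn x) <= (count prime1 (index_iota (x %/ K).+1 x.+1))%:R.
Proof.
have [K K0 KE] : exists2 K : nat, (0 < K)%N & expR 118 <= K%:R :> R.
  exists (Num.truncn (expR 118 : R)).+1 => //.
  by apply: ltW; apply: truncnS_gt.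
exists K => // x xK; set z := (x %/ K)%N.
have z3 : (3 <= z)%N by rewrite leq_divRL.
have zx : (z <= x)%N by exact: leq_div.
have x3 : (3 <= x)%N by exact: leq_trans zx.
have x0 : 0 < x%:R :> R by rewrite ltr0n (leq_trans _ x3).
have z0 : 0 < z%:R :> R by rewrite ltr0n (leq_trans _ z3).
have k0 : 0 < K%:R :> R by rewrite ltr0n.
have lx : 0 < lnn x by rewrite lnn_gt0// (ltn_trans _ x3).
have hl : 118 <= lnn x - lnn z.
  rewrite -ln_div ?posrE// -[118]expRK ler_ln ?posrE ?expR_gt0 ?divr_gt0//.
  rewrite (le_trans KE)// ler_pdivlMr// -natrM ler_nat mulnC; exact: leq_divM.
have h1 := log_prime1_sum_lower x3; have h2 := log_prime1_sum_upper z3.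
have EA : log_prime1_sum x = log_prime1_sum z + \sum_(z.+1 <= p < x.+1 | prime1 p) lnn p / p%:R.
  by rewrite /log_prime1_sum -big_cat_nat.
have T1 : 1 <= \sum_(z.+1 <= p < x.+1 | prime1 p) lnn p / p%:R by lra.
rewrite ler_pdivrMr ?mulr_gt0//.
have -> : (count prime1 (index_iota z.+1 x.+1))%:R = \sum_(z.+1 <= p < x.+1 | prime1 p) 1 :> R.
  by rewrite -sum1_count natr_sum.
rewrite -[leLHS]mul1r; have := ler_wpM2r (ltW x0) T1; move/le_trans; apply.
rewrite !mulr_suml big_nat_cond [leRHS]big_nat_cond; apply: ler_sum => p /andP[/andP[zp px] _].
have p0 : 0 < p%:R :> R by rewrite ltr0n (leq_trans _ zp).
rewrite mul1r mulrAC ler_pdivrMr// [leRHS]mulrAC mulrC.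
apply: ler_pM => //; [exact: lnn_ge0| | by rewrite le_lnn// -(ltr0n R)].
by rewrite -natrM ler_nat mulnC ltnW// -ltn_divLR.
Qed.

(** The first such prime is 5, and [1 / n^2 <= 1 / (n - 1) - 1 / n] telescopes from there. *)
Lemma inv_prime1_sqr_sum N : \sum_(1 <= p < N.+1 | prime1 p) (p%:R^-1) ^+ 2 <= 1 / 4 :> R.
Proof.
have H n : \sum_(1 <= p < (n + 4).+1 | prime1 p) (p%:R^-1) ^+ 2 <= 1 / 4 - (n + 4)%:R^-1 :> R.
  elim: n => [|n IH].
    rewrite add0n big_nat_cond big_pred0 => [|p]; first by rewrite mul1r subrr.
    by do 6 (case: p => [|p]; first by rewrite ?andbF).
  rewrite addSn big_mkcond big_nat_recr//= -big_mkcond.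
  set m := (n + 4)%N in IH *; have m0 : (0 < m)%N by rewrite /m addnS.
  have m0' : 0 < m%:R :> R by rewrite ltr0n.
  have : (if prime1 m.+1 then (m.+1%:R^-1) ^+ 2 else 0) <= m%:R^-1 - m.+1%:R^-1 :> R.
    apply: (@le_trans _ _ ((m.+1%:R^-1) ^+ 2)).
      by case: ifP => // _; rewrite exprn_ge0// invr_ge0.
    have -> : m%:R^-1 - m.+1%:R^-1 = m%:R^-1 * m.+1%:R^-1 :> R.
      by rewrite -natr1; field; rewrite !gt_eqF// addr_gt0.
    by rewrite expr2 ler_pM ?invr_ge0// lef_pV2 ?posrE ?ltr0n// ler_nat.
  by move=> h; apply: (le_trans (lerD IH h)); rewrite addrA subrK.
apply: (@le_trans _ _ (\sum_(1 <= p < (N + 4).+1 | prime1 p) (p%:R^-1) ^+ 2)).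
  rewrite (@big_cat_nat _ _ _ N.+1 1 (N + 4).+1)//= ?ltnS ?leq_addr// lerDl.
  by apply: sumr_ge0 => p _; rewrite exprn_ge0// invr_ge0.
by apply: (le_trans (H N)); rewrite lerBlDr lerDl invr_ge0.
Qed.
End primes_one_mod_four.

(** * Products of primes 1 modulo 4 *)
(** For distinct primes: the squarefree integers with exactly [k] prime factors, all taken from [s],
    without repetition. *)
Fixpoint prods (s : seq nat) k {struct s} : seq nat :=
  match s, k with
  | _, 0 => [:: 1]
  | [::], _.+1 => [::]
  | p :: s', k'.+1 => prods s' k ++ [seq (p * a)%N | a <- prods s' k']
  end.

Lemma prods0 s : prods s 0 = [:: 1%N]. Proof. by case: s. Qed.

Lemma prods_gt0 s k a : all prime s -> a \in prods s k -> (0 < a)%N.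
Proof.
elim: s k a => [|p s IH] [|k] a //=; rewrite ?inE => //; try by move=> _ /eqP->.
move=> /andP[pp sp]; rewrite mem_cat => /orP[/IH->//|/mapP[b bs ->]].
by rewrite muln_gt0 prime_gt0//= (IH k).
Qed.

Lemma prods_prime_dvd s k a q : all prime s -> a \in prods s k -> prime q -> (q %| a)%N -> q \in s.
Proof.
elim: s k a => [|p s IH] [|k] a //=; try by rewrite ?inE => _ /eqP-> /prime_gt1; rewrite dvdn1 => /gtn_eqF->.
move=> /andP[pp sp]; rewrite mem_cat inE => /orP[h|/mapP[b bs ->]] qp.
  by move=> qa; rewrite (IH k.+1 a) ?orbT.
rewrite Euclid_dvdM// => /orP[|qb]; last by rewrite (IH k b) ?orbT.
by rewrite dvdn_prime2// => ->.
Qed.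

Lemma uniq_prods s k : all prime s -> uniq s -> uniq (prods s k).
Proof.
elim: s k => [|p s IH] [|k] //= /andP[pp sp] /andP[ps us].
rewrite cat_uniq IH// map_inj_uniq ?IH//; last first.
  by move=> a b /eqP; rewrite eqn_pmul2l ?prime_gt0// => /eqP.
rewrite andbT; apply/hasPn => _ /mapP[b bs ->]; apply/negP => h.
by move: ps; rewrite (prods_prime_dvd sp h)// dvdn_mulr.
Qed.

Lemma r2_1_gt0 : (0 < r2 1)%N.
Proof.
by rewrite (@r2_count 1 1).
Qed.

Lemma r2_prods s k a : all prime1 s -> uniq s -> a \in prods s k -> (2 ^ k <= r2 a)%N.
Proof.
have P1 t : all prime1 t -> all prime t by apply: sub_all => p /andP[].
elim: s k a => [|p s IH] [|k] a //=; try by rewrite ?inE => *; rewrite (eqP (_ : a == 1%N)) ?r2_1_gt0.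
move=> /andP[/andP[pp /eqP p1] sp] /andP[ps us]; rewrite mem_cat => /orP[/IH->//|/mapP[b bs ->]].
apply: leq_trans (r2_mul_prime pp p1 _ _); first by rewrite expnS leq_mul2l IH.
- exact: prods_gt0 (P1 _ sp) bs.
- by apply: contra ps; exact: prods_prime_dvd (P1 _ sp) bs pp.
Qed.

(** * Elementary symmetric sums of reciprocals *)

Section elementary_symmetric.
Context {R : realType}.
Implicit Types (s : seq nat) (k : nat).
Notation lnn n := (ln (n%:R : R)).

Definition esym s k : R := \sum_(a <- prods s k) a%:R^-1.

Lemma esym0 s : esym s 0 = 1.
Proof. by rewrite /esym prods0 big_seq1 invr1. Qed.

Lemma esym_cons p s k : esym (p :: s) k.+1 = esym s k.+1 + p%:R^-1 * esym s k.
Proof.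
rewrite /esym /= big_cat big_map/= mulr_sumr; congr (_ + _).
by apply: eq_bigr => a _; rewrite natrM invfM.
Qed.

Lemma esym_ge0 s k : 0 <= esym s k.
Proof. by apply: sumr_ge0 => a _; rewrite invr_ge0. Qed.

Lemma esym1 s : esym s 1 = \sum_(p <- s) p%:R^-1.
Proof.
elim: s => [|p s IH]; first by rewrite /esym /= !big_nil.
by rewrite esym_cons big_cons IH esym0 mulr1 addrC.
Qed.

(** Newton's identity [(k+2) e_(k+2) = p_1 e_(k+1) - p_2 e_k + p_3 e_(k-1) - ...], truncated after a
    negative term. *)
Lemma esym_newton s k : (\sum_(p <- s) p%:R^-1) * esym s k.+1 -
  (\sum_(p <- s) (p%:R^-1) ^+ 2) * esym s k <= k.+2%:R * esym s k.+2.
Proof.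
elim: s k => [|p s IH] k.
  by rewrite !big_nil !mul0r subrr mulr_ge0// esym_ge0.
rewrite !big_cons !esym_cons; have x0 : 0 <= p%:R^-1 :> R by rewrite invr_ge0.
have IHk := IH k; have := esym1 s; move: IHk; set S := \sum_(q <- s) q%:R^-1.
set S2 := \sum_(q <- s) _ ^+ 2.
case: k => [|k] IHk e1.
  rewrite e1 !esym0 in IHk *; move: IHk; move: (esym s 2) => E2.
  by move: x0; move: (p%:R^-1) => x x0 IHk; clear IH e1; nra.
have IHm := ler_wpM2l x0 (IH k); rewrite -/S -/S2 in IHm.
have E3 : 0 <= (p%:R^-1) ^+ 3 * esym s k by rewrite mulr_ge0 ?exprn_ge0 ?esym_ge0.
have K3 : k.+3%:R = k.+2%:R + 1 :> R by rewrite natr1.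
rewrite !esym_cons K3; rewrite K3 in IHk; move: IHk IHm E3; clear e1 IH K3 x0.
move: (p%:R^-1) (esym s k.+3) (esym s k.+2) (esym s k.+1) (esym s k) => x a b c d.
move: (k.+2%:R : R) => K h1 h2 h3.
have -> : (K + 1) * (a + x * b) = (K + 1) * a + x * (K * b) + x * b by ring.
have -> : (x + S) * (b + x * c) - (x ^+ 2 + S2) * (c + x * d) =
  (S * b - S2 * c) + x * (S * c - S2 * d) + x * b - x ^+ 3 * d by ring.
by lra.
Qed.

Section lower.
Variables (s : seq nat) (sg : R).
Hypothesis (sg0 : 0 < sg) (sgS : sg <= \sum_(p <- s) p%:R^-1 - 1).
Hypothesis S2s : \sum_(p <- s) (p%:R^-1) ^+ 2 <= 1 / 4 :> R.

(** The previous case and [k <= 3 sg] give [e_(k-1) <= 3 e_k]; the quadratic term of [esym_newton]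
    is then at most [3/4 e_k], less than the unit that [sg] keeps in reserve. *)
Lemma esym_ratio k : k.+1%:R <= 3 * sg -> sg * esym s k <= k.+1%:R * esym s k.+1.
Proof.
elim: k => [|k IH] ks; first by rewrite esym0 esym1 mulr1 mul1r (le_trans sgS)// lerBlDr lerDl.
have ks' : k.+1%:R <= 3 * sg by apply: le_trans ks; rewrite ler_nat.
apply: le_trans (esym_newton s k); have E1 := esym_ge0 s k.+1; have E0 := esym_ge0 s k.
have h : esym s k <= 3 * esym s k.+1.
  rewrite -(ler_pM2l sg0); apply: (le_trans (IH ks')).
  by rewrite mulrA [sg * 3]mulrC ler_wpM2r.
have h1 : (\sum_(p <- s) (p%:R^-1) ^+ 2) * esym s k <= 1 / 4 * (3 * esym s k.+1).
  by apply: ler_pM => //; apply: sumr_ge0 => p _; rewrite exprn_ge0// invr_ge0.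
have h2 : (sg + 1) * esym s k.+1 <= (\sum_(p <- s) p%:R^-1) * esym s k.+1.
  by rewrite ler_wpM2r// -lerBrDr.
by apply: le_trans (lerB h2 h1); clear -E1; lra.
Qed.

(** Lowering [sg] by a bounded amount changes [sg^k] by a bounded factor only while [k] is of order
    [sg]. Nothing larger may be lost here, as the powers of the iterated logarithms depend on it. *)
Lemma esym_lower k : k%:R <= 3 * sg -> sg ^+ k / (k`!)%:R <= esym s k.
Proof.
elim: k => [|k IH] ks; first by rewrite esym0 expr0 divr1.
have ks' : k%:R <= 3 * sg by apply: le_trans ks; rewrite ler_nat.
rewrite factS natrM invfM exprS -(@ler_pM2l _ k.+1%:R) ?ltr0n//.
apply: le_trans (esym_ratio ks).
have -> : k.+1%:R * (sg * sg ^+ k * (k.+1%:R^-1 / k`!%:R)) = sg * (sg ^+ k / k`!%:R).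
  transitivity ((k.+1%:R * k.+1%:R^-1) * (sg * (sg ^+ k / k`!%:R))); first by ring.
  by rewrite divff ?mul1r// pnatr_eq0.
exact: ler_wpM2l (ltW sg0) _ _ (IH ks').
Qed.

Hypothesis sprime : all prime s.

(** [ln a] marks one prime factor of [a]; forgetting that the cofactor is coprime to it leaves the
    product on the right. *)
Lemma esym_log t k : all prime t -> \sum_(a <- prods t k.+1) lnn a / a%:R <=
  (\sum_(p <- t) lnn p / p%:R) * esym t k.
Proof.
elim: t k => [|p t IH] k; first by rewrite /= !big_nil mul0r.
move=> /= /andP[pp tp]; rewrite big_cat big_map/= big_cons.
have p0 := prime_gt0 pp; have x0 : 0 <= p%:R^-1 :> R by rewrite invr_ge0.
have l0 : 0 <= lnn p by rewrite lnn_ge0.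
have T0 : 0 <= \sum_(q <- t) lnn q / q%:R.
  by apply: sumr_ge0 => q _; rewrite divr_ge0 ?lnn_ge0.
have -> : \sum_(a <- prods t k) lnn (p * a) / (p * a)%:R =
   lnn p / p%:R * esym t k + p%:R^-1 * \sum_(a <- prods t k) lnn a / a%:R.
  rewrite /esym !mulr_sumr -big_split/= big_seq [RHS]big_seq; apply: eq_bigr => a /(prods_gt0 tp) a0.
  by rewrite lnnM// natrM invfM; ring.
have h1 := IH k tp.
have h2 : \sum_(a <- prods t k) lnn a / a%:R <=
   (\sum_(q <- t) lnn q / q%:R) * (esym (p :: t) k - esym t k) * p%:R.
  case: k {h1} => [|k]; first by rewrite prods0 big_seq1 !esym0 subrr mulr0 mul0r ln1 mul0r.
  apply: (le_trans (IH k tp)); rewrite esym_cons addrC addKr mulrCA mulrAC mulrA.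
  by rewrite mulVf ?mul1r// pnatr_eq0 -lt0n.
have h3 := ler_wpM2l x0 h2.
have h4 : 0 <= lnn p / p%:R * (esym (p :: t) k - esym t k).
  rewrite mulr_ge0 ?divr_ge0//; case: k {h1 h2 h3} => [|k]; first by rewrite !esym0 subrr.
  by rewrite esym_cons addrC addKr mulr_ge0// esym_ge0.
move: h3; have -> : p%:R^-1 * ((\sum_(q <- t) lnn q / q%:R) * (esym (p :: t) k - esym t k) * p%:R) =
  (\sum_(q <- t) lnn q / q%:R) * (esym (p :: t) k - esym t k).
  by field; rewrite pnatr_eq0 -lt0n.
move: h1 h4; rewrite !mulrBr mulrDl; clear -R; move: (\sum_(q <- t) _) => T.
by move=> h1 h2 h3; lra.
Qed.

(** Markov's inequality: with weights [1 / a] the mean of [ln a] is at most [6 ln y], so at least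
    half of the weight has [ln a <= 12 ln y]. *)
Lemma esym_trunc y k : 4 <= lnn y -> k%:R <= 3 * sg -> \sum_(p <- s) lnn p / p%:R <= lnn y + 4 ->
  esym s k / 2 <= \sum_(a <- prods s k | (a <= y ^ 12)%N) a%:R^-1.
Proof.
move=> ly ks sT; have y0 : (0 < y)%N.
  by case: y ly {sT} => //; rewrite ln0// leNgt ltr0n.
have E0 := esym_ge0 s k.
have L : \sum_(a <- prods s k) lnn a / a%:R <= 6 * lnn y * esym s k.
  case: k ks E0 => [|k] ks E0; first by rewrite prods0 big_seq1 ln1 mul0r mulr_ge0// mulr_ge0//; lra.
  apply: (le_trans (esym_log k sprime)).
  have h := esym_ratio ks.
  have h' : esym s k <= 3 * esym s k.+1.
    by rewrite -(ler_pM2l sg0); apply: (le_trans h); rewrite mulrA [sg * 3]mulrC ler_wpM2r.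
  have -> : 6 * lnn y * esym s k.+1 = (2 * lnn y) * (3 * esym s k.+1) by ring.
  apply: ler_pM => //; [|exact: esym_ge0|by lra].
  by apply: sumr_ge0 => q _; rewrite divr_ge0 ?lnn_ge0.
have H : 12 * lnn y * \sum_(a <- prods s k | ~~ (a <= y ^ 12)%N) a%:R^-1 <= \sum_(a <- prods s k) lnn a / a%:R.
  rewrite [leRHS](bigID (fun a => (a <= y ^ 12)%N))/= ler_wpDl//.
    by apply: sumr_ge0 => a _; rewrite divr_ge0 ?lnn_ge0.
  rewrite mulr_sumr; apply: ler_sum => a; rewrite -ltnNge => ya.
  rewrite ler_wpM2r ?invr_ge0//; have -> : 12 * lnn y = lnn (y ^ 12).
    by rewrite natrX lnXn ?ltr0n// mulr_natl.
  by rewrite le_lnn ?expn_gt0 ?y0// ltnW.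
move: E0 L; rewrite /esym (bigID (fun a => (a <= y ^ 12)%N))/=.
move: H; move: (\sum_(a <- prods s k) lnn a / a%:R) => W; set u := \sum_(a <- _ | ~~ _) _; set v := \sum_(a <- _ | _) a%:R^-1.
move=> h1 h2 h3; have l0 : 0 < lnn y by lra.
have : 12 * u <= 6 * (v + u).
  by rewrite -(ler_pM2l l0); clear -h1 h3; nra.
by lra.
Qed.
End lower.
End elementary_symmetric.

(** * The integers that resonate *)

Section products_of_primes.
Context {R : realType}.
Notation lnn n := (ln (n%:R : R)).

Definition prime1s y : seq nat := [seq p <- index_iota 1 y.+1 | prime1 p].

Lemma prime1s_all y : all prime1 (prime1s y). Proof. exact: filter_all. Qed.

Lemma prime1s_uniq y : uniq (prime1s y). Proof. by rewrite filter_uniq// iota_uniq. Qed.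

Lemma all_prime_prime1s y : all prime (prime1s y).
Proof. by apply: sub_all (prime1s_all y) => p /andP[]. Qed.

Lemma mem_prime1s_le y p : p \in prime1s y -> (p <= y)%N.
Proof. by rewrite mem_filter mem_index_iota ltnS => /and3P[]. Qed.

Section construction.
Variables (K y j : nat).
Let A := [seq a <- prods (prime1s y) j | (a <= y ^ 12)%N].
Let Q a := [seq p <- index_iota ((y ^ 24 %/ a) %/ K).+1 (y ^ 24 %/ a).+1 | prime1 p].

(** With [a <= y^12] the window for [p], just below [y^24 / a], lies above [y]. So [p] divides no
    cofactor: the products are distinct, and the representations of [a] carry over to [p a]. *)
Definition smooth_times_prime : seq nat := [seq (p * a)%N | a <- A, p <- Q a].

Hypotheses (K0 : (0 < K)%N) (y3K : (3 * K <= y)%N).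

Let y0 : (0 < y)%N. Proof. by apply: leq_trans y3K; rewrite muln_gt0. Qed.

Let A_gt0 a : a \in A -> (0 < a)%N.
Proof. by rewrite mem_filter => /andP[_ /(prods_gt0 (all_prime_prime1s y))]. Qed.

Let A_quot a : a \in A -> (y ^ 12 <= y ^ 24 %/ a)%N.
Proof.
move=> aA; rewrite leq_divRL ?A_gt0//; move: aA; rewrite mem_filter => /andP[ay _].
by apply: (@leq_trans (y ^ 12 * y ^ 12)); rewrite ?leq_mul2l ?ay ?orbT// -expnD.
Qed.

Let y12 : (y * y <= y ^ 12)%N.
Proof. by rewrite mulnn leq_pexp2l. Qed.

Let Q_gt a p : a \in A -> p \in Q a -> (y < p)%N.
Proof.
move=> aA; rewrite mem_filter mem_index_iota => /andP[_ /andP[h _]]; apply: leq_trans h.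
rewrite ltnS leq_divRL//; apply: leq_trans (A_quot aA); apply: leq_trans y12.
by rewrite leq_mul2l; apply/orP; right; apply: leq_trans y3K; rewrite leq_pmull.
Qed.

Let Q_ndvd a b p : a \in A -> b \in A -> p \in Q a -> ~~ (p %| b)%N.
Proof.
move=> aA bA pQ; apply/negP => pb; have := Q_gt aA pQ; rewrite ltnNge => /negP; apply.
apply: mem_prime1s_le; move: bA; rewrite mem_filter => /andP[_ bA].
apply: (prods_prime_dvd (all_prime_prime1s y) bA) => //.
by move: pQ; rewrite mem_filter => /andP[/andP[]].
Qed.

Lemma smooth_times_prime_uniq : uniq smooth_times_prime.
Proof.
apply: allpairs_uniq_dep.
- by rewrite filter_uniq// uniq_prods ?prime1s_uniq ?all_prime_prime1s.
- by move=> a _; rewrite filter_uniq// iota_uniq.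
move=> [a p] [b q] /allpairsPdep[a' [p' [aA pQ [ea ep]]]] /allpairsPdep[b' [q' [bA qQ [eb eq]]]] /= e.
subst a' p' b' q'; have pp : prime p by move: pQ; rewrite mem_filter => /andP[/andP[]].
have qp : prime q by move: qQ; rewrite mem_filter => /andP[/andP[]].
have pq : p = q.
  have : (p %| q * b)%N by rewrite -e dvdn_mulr.
  by rewrite Euclid_dvdM// (negPf (Q_ndvd aA bA pQ)) orbF dvdn_prime2// => /eqP.
subst q; congr existT; apply/eqP; rewrite -(@eqn_pmul2l p) ?e//; exact: prime_gt0.
Qed.

Lemma smooth_times_prime_le : all (fun m => 0 < m <= y ^ 24)%N smooth_times_prime.
Proof.
apply/allP => _ /allpairsPdep[a [p [aA pQ ->]]]; have a0 := A_gt0 aA.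
move: pQ; rewrite mem_filter mem_index_iota => /andP[/andP[pp _] /andP[_ h]].
by rewrite muln_gt0 a0 prime_gt0//= -leq_divRL.
Qed.

Lemma smooth_times_prime_r2 : all (fun m => 2 ^ j <= r2 m)%N smooth_times_prime.
Proof.
apply/allP => _ /allpairsPdep[a [p [aA pQ ->]]]; have pa := Q_ndvd aA aA pQ.
have a0 := A_gt0 aA; move: pQ aA; rewrite !mem_filter => /andP[/andP[pp /eqP p1] _] /andP[_ ap].
apply: leq_trans (r2_mul_prime pp p1 a0 pa); apply: (@leq_trans (r2 a)); last by rewrite leq_pmull.
exact: r2_prods (prime1s_all y) (prime1s_uniq y) ap.
Qed.

Hypothesis QK : forall x, (3 * K <= x)%N ->
  x%:R / (K%:R * lnn x) <= (count prime1 (index_iota (x %/ K).+1 x.+1))%:R.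

Lemma smooth_times_prime_size (s : R) : 4 <= lnn y -> 0 < s -> s <= inv_prime1_sum y - 1 ->
  j%:R <= 3 * s -> 1 / (96 * K%:R) * (y%:R ^+ 24 / lnn y) * (s ^+ j / (j`!)%:R) <= (size smooth_times_prime)%:R.
Proof.
move=> ly s0 sS js; have l0 : 0 < lnn y by lra.
have yr0 : 0 < y%:R :> R by rewrite ltr0n.
have k0 : 0 < K%:R :> R by rewrite ltr0n.
have eS (F : nat -> R) : \sum_(p <- prime1s y) F p = \sum_(1 <= p < y.+1 | prime1 p) F p.
  by rewrite big_filter.
have S1 : s <= \sum_(p <- prime1s y) p%:R^-1 - 1 by rewrite eS.
have S2 : \sum_(p <- prime1s y) (p%:R^-1) ^+ 2 <= 1 / 4 :> R by rewrite eS inv_prime1_sqr_sum.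
have T : \sum_(p <- prime1s y) lnn p / p%:R <= lnn y + 4.
  rewrite eS; apply: le_trans (log_prime_sum_upper y0); rewrite /log_prime_sum.
  rewrite big_mkcond [leRHS]big_mkcond; apply: ler_sum => p _; rewrite /prime1.
  by case: (prime p) => //=; case: ifP => // _; rewrite divr_ge0 ?lnn_ge0.
have E1 := esym_lower s0 S1 S2 js.
have E2 := esym_trunc s0 S1 S2 (all_prime_prime1s y) ly js T.
have c0 : 0 <= y%:R ^+ 24 / (48 * K%:R * lnn y) :> R.
  by rewrite divr_ge0 ?exprn_ge0 ?mulr_ge0// ltW.
(* 96 = 2 * 2 * 24: the truncation of [esym_trunc], then [y^24 / a <= 2 x] and [ln x <= 24 ln y]. *)
have -> : 1 / (96 * K%:R) * (y%:R ^+ 24 / lnn y) * (s ^+ j / (j`!)%:R) =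
  y%:R ^+ 24 / (48 * K%:R * lnn y) * (s ^+ j / (j`!)%:R / 2).
  move: (y%:R ^+ 24 : R) (s ^+ j / _) (K%:R : R) (lnn y : R) k0 l0 => u v K' l k0 l0.
  by field; rewrite !gt_eqF.
apply: (@le_trans _ _ (y%:R ^+ 24 / (48 * K%:R * lnn y) * \sum_(a <- A) a%:R^-1)).
  rewrite ler_wpM2l// big_filter; apply: le_trans E2; by rewrite ler_wpM2r.
rewrite size_allpairs_dep sumnE big_map natr_sum mulr_sumr big_seq [leRHS]big_seq.
apply: ler_sum => a aA; have a0 := A_gt0 aA; have ar0 : 0 < a%:R :> R by rewrite ltr0n.
rewrite size_filter; set x := (y ^ 24 %/ a)%N.
have x12 : (y ^ 12 <= x)%N by exact: A_quot.
have yy : (y <= y ^ 12)%N by apply: leq_trans y12; rewrite leq_pmull.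
have yx : (y <= x)%N by apply: leq_trans x12.
have x0 : (0 < x)%N by apply: leq_trans yx.
apply: le_trans (QK _); last by apply: leq_trans y3K _.
have lx : lnn x <= 24 * lnn y.
  have -> : 24 * lnn y = lnn (y ^ 24) by rewrite natrX lnXn ?ltr0n// mulr_natl.
  by rewrite le_lnn// leq_div.
have lx0 : lnn y <= lnn x by rewrite le_lnn.
have h : y%:R ^+ 24 / a%:R <= 2 * x%:R :> R.
  rewrite ler_pdivrMr// -natrX -!natrM ler_nat; have := ltn_ceil (y ^ 24) a0; rewrite -/x.
  by move=> h; apply: (leq_trans (ltnW h)); rewrite leq_mul2r; apply/orP; right; rewrite mul2n -addnn -addn1 leq_add2l.
have lxp : 0 < lnn x by exact: lt_le_trans lx0.
rewrite ler_pdivlMr ?mulr_gt0//; rewrite [y%:R ^+ 24 / _ / _]mulrAC.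
have v0 : 0 <= 2 * x%:R :> R by rewrite mulr_ge0.
move: h lx lx0 v0; move: (y%:R ^+ 24 / a%:R) (x%:R : R) (lnn x) (lnn y) (K%:R : R) k0 l0.
move=> u v lx l k k0 l0 h1 h2 h3 v0.
have kl0 : 0 < 48 * k * l by rewrite !mulr_gt0.
rewrite [u / _ * _]mulrAC ler_pdivrMr//; have -> : v * (48 * k * l) = (2 * v) * (k * (24 * l)) by ring.
apply: (@le_trans _ _ (2 * v * (k * lx))).
  by rewrite ler_wpM2r ?mulr_ge0 ?(ltW k0)//; apply: ltW; apply: lt_le_trans h3.
by rewrite ler_wpM2l// ler_wpM2l ?(ltW k0).
Qed.
End construction.

Lemma many_prime_factors : exists (c C : R) (y0 : nat), [/\ 0 < c, 0 <= C &
  forall y j s, (y0 <= y)%N -> 0 < s -> s <= ln (lnn y) / 2 - C -> j%:R <= 3 * s ->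
  exists M : seq nat, [/\ uniq M, all (fun m => 0 < m <= y ^ 24)%N M,
    all (fun m => 2 ^ j <= r2 m)%N M &
    c * (y%:R ^+ 24 / lnn y) * (s ^+ j / (j`!)%:R) <= (size M)%:R]].
Proof.
have [K K0 QK] := @count_prime1_lower R; have [C C0 HC] := @inv_prime1_sum_lower R.
exists (1 / (96 * K%:R)), (C + 1), (3 * K + (Num.truncn (expR 4 : R)).+1)%N; split.
- by rewrite divr_gt0// mulr_gt0// ltr0n.
- by rewrite addr_ge0.
move=> y j s yy s0 sS js; have yK : (3 * K <= y)%N by apply: leq_trans yy; exact: leq_addr.
have y3 : (3 <= y)%N by apply: leq_trans yK; rewrite leq_pmulr.
have y1 : (0 < y)%N by apply: leq_trans y3.
have ly : 4 <= lnn y.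
  rewrite -[4]expRK ler_ln ?posrE ?expR_gt0 ?ltr0n//; apply: (le_trans (ltW (truncnS_gt _))).
  by rewrite ler_nat; apply: leq_trans yy; exact: leq_addl.
exists (smooth_times_prime K y j); split.
- exact: smooth_times_prime_uniq.
- exact: smooth_times_prime_le.
- exact: smooth_times_prime_r2.
- by apply: smooth_times_prime_size => //; have := HC _ y3; lra.
Qed.
End products_of_primes.

(** * Choice of the parameters *)
Section poisson_weight.
Context {R : realType}.
Implicit Types (x mu : R).

(** The first diagonal Pade approximant. At [x = 2 / (2 j + 1)] it equals [(j + 1) / j], exactly
    what [expR2_le] requires. *)
Lemma expR_pade x : 0 <= x -> expR x * (2 - x) <= 2 + x.
Proof.
move=> x0; rewrite -subr_ge0.
have -> : 0 = 2 + 0 - expR 0 * (2 - 0) :> R by rewrite expR0 mul1r addr0 subr0 subrr.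
apply: (@derive_ge0_le R (fun y => 2 + y - expR y * (2 - y)) (fun y => 1 - expR y * (1 - y)) 0 x) => // y _.
  by apply: is_derive_eq; rewrite /GRing.scale/=; ring.
rewrite subr_ge0 -(expRK y) expRK -ler_pdivlMl ?expR_gt0// mulr1 -expRN.
exact: expR_ge1Dx.
Qed.

(* [(1 + 1/j) ^ (j + 1/2) >= e], squared to avoid the square root. *)
Lemma expR2_le j : (0 < j)%N -> expR 2 * j%:R ^+ j.*2.+1 <= j.+1%:R ^+ j.*2.+1 :> R.
Proof.
move=> j0; have jr : 0 < j%:R :> R by rewrite ltr0n.
have -> : 2 = (2 / (j.*2.+1)%:R) * (j.*2.+1)%:R :> R by rewrite divfK// pnatr_eq0.
rewrite expRM_natr -exprMn lerXn2r ?nnegrE ?mulr_ge0 ?expR_ge0//.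
have := @expR_pade (2 / (j.*2.+1)%:R); rewrite divr_ge0// => /(_ isT).
have e : (j.*2.+1)%:R = 2 * j%:R + 1 :> R by rewrite -addn1 natrD -muln2 natrM mulrC.
have e1 : j.+1%:R = j%:R + 1 :> R by rewrite natr1.
rewrite e e1 {e e1}; move: (expR _) => u; move: (j%:R : R) jr => z z0.
have d0 : 0 < 2 * z + 1 by rewrite addr_gt0// mulr_gt0.
have -> : 2 - 2 / (2 * z + 1) = 4 * z / (2 * z + 1) by field; rewrite gt_eqF.
have -> : 2 + 2 / (2 * z + 1) = 4 * (z + 1) / (2 * z + 1) by field; rewrite gt_eqF.
by rewrite mulrA ler_pdivrMr// divfK ?gt_eqF//; lra.
Qed.

(** Stirling's bound with the right power of [j]: the quotient of neighbouring right-hand sides is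
    handled by [expR2_le]. *)
Lemma fact_upper j : (0 < j)%N ->
  (j`!)%:R * expR j%:R <= expR 1 * Num.sqrt j%:R * j%:R ^+ j :> R.
Proof.
elim: j => // -[_ _|j IH _]; first by rewrite sqrtr1 expr1 !mulr1 mul1r.
have {IH} := IH isT; set n := j.+1 => IH; have n0 : 0 < n%:R :> R by rewrite ltr0n.
have ee : expR n.+1%:R = expR n%:R * expR 1 :> R by rewrite -expRD natr1.
rewrite factS natrM ee.
have -> : n.+1%:R * n`!%:R * (expR n%:R * expR 1) = n.+1%:R * expR 1 * (n`!%:R * expR n%:R) :> R by ring.
apply: (le_trans (ler_wpM2l _ IH)); first by rewrite mulr_ge0 ?expR_ge0.
have K : expR 1 * (Num.sqrt n%:R * n%:R ^+ n) <= Num.sqrt n.+1%:R * n.+1%:R ^+ n :> R.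
  rewrite -(@ler_pXn2r _ 2) ?nnegrE ?mulr_ge0 ?expR_ge0 ?sqrtr_ge0 ?exprn_ge0//.
  rewrite !exprMn !sqr_sqrtr// -expRM_natr mul1r -!exprM !muln2 -!exprS.
  exact: expR2_le.
have := ler_wpM2l (mulr_ge0 (ler0n R n.+1) (expR_ge0 1)) K.
rewrite [n.+1%:R ^+ n.+1]exprS; move: (n.+1%:R ^+ n) => u; by congr (_ <= _); ring.
Qed.

(** Of the two units lost, one is the constant of [fact_upper] and the other comes from replacing
    [mu] by its integer part. *)
Lemma poisson_mode mu : 1 <= mu ->
  expR (mu - 2 - ln mu / 2) <= mu ^+ Num.truncn mu / ((Num.truncn mu)`!)%:R.
Proof.
move=> mu1; have mu0 : 0 < mu by lra.
have /andP[jm mj] : (Num.truncn mu)%:R <= mu < (Num.truncn mu).+1%:R by rewrite truncn_itv// ltW.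
have j0 : (0 < Num.truncn mu)%N by rewrite truncn_gt0.
move: (Num.truncn mu) jm mj j0 => j jm mj j0; have jr : 0 < j%:R :> R by rewrite ltr0n.
have f0 : 0 < (j`!)%:R :> R by rewrite ltr0n fact_gt0.
rewrite ler_pdivlMr// !expRD expRN.
have e2 : expR (ln mu / 2) = Num.sqrt mu.
  apply/eqP; rewrite -(@eqrXn2 _ 2)// ?expR_ge0 ?sqrtr_ge0//.
  by rewrite sqr_sqrtr ?ltW// -expRM_natr divfK// lnK.
rewrite e2; have s0 : 0 < Num.sqrt mu by rewrite sqrtr_gt0.
have F := fact_upper j0.
have e3 : expR mu <= expR j%:R * expR 1 by rewrite -expRD ler_expR natr1 ltW.
have e1 := expR_gt0 (1 : R).
have e22 : expR 2 = expR 1 * expR 1 :> R by rewrite -expRD.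
rewrite expRN e22 mulrAC ler_pdivrMr// [_ / _ * _]mulrAC ler_pdivrMr ?mulr_gt0//.
apply: (@le_trans _ _ (expR j%:R * expR 1 * j`!%:R)); first by rewrite ler_wpM2r// ltW.
have -> : expR j%:R * expR 1 * j`!%:R = expR 1 * (j`!%:R * expR j%:R) :> R by ring.
apply: (@le_trans _ _ (expR 1 * (expR 1 * Num.sqrt j%:R * j%:R ^+ j))); first by rewrite ler_wpM2l// ltW.
have -> : mu ^+ j * Num.sqrt mu * (expR 1 * expR 1) = expR 1 * (expR 1 * Num.sqrt mu * mu ^+ j) by ring.
rewrite ler_wpM2l ?(ltW e1)// ler_pM ?mulr_ge0 ?sqrtr_ge0 ?exprn_ge0 ?(ltW e1)//.
  by rewrite (ler_wpM2l (ltW e1))// ler_wsqrtr.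
by rewrite lerXn2r ?nnegrE// ltW.
Qed.

Lemma expR_dominates (A eps : R) n : 0 < eps ->
  exists x0, forall x, x0 <= x -> A * x ^+ n <= expR (eps * x).
Proof.
move=> e0; exists (1 + `|A| * (n.+1%:R / eps) ^+ n.+1) => x xx.
have c0 : 0 <= `|A| * (n.+1%:R / eps) ^+ n.+1.
  by rewrite mulr_ge0// exprn_ge0// divr_ge0// ltW.
have x0 : 0 < x by lra.
have d0 : 0 < n.+1%:R / eps by rewrite divr_gt0.
apply: (@le_trans _ _ ((eps * x / n.+1%:R) ^+ n.+1)); last first.
  have {2}-> : eps * x = (eps * x / n.+1%:R) * n.+1%:R by rewrite divfK// pnatr_eq0.
  rewrite expRM_natr lerXn2r ?nnegrE ?expR_ge0//; first by rewrite divr_ge0// mulr_ge0// ltW.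
  by apply: le_trans (expR_ge1Dx _); rewrite lerDr.
have -> : eps * x / n.+1%:R = x / (n.+1%:R / eps) by field; rewrite gt_eqF// addrC natr1 pnatr_eq0.
rewrite expr_div_n ler_pdivlMr ?exprn_gt0// [x ^+ n.+1]exprS mulrAC ler_wpM2r ?exprn_ge0 ?(ltW x0)//.
apply: (@le_trans _ _ (`|A| * (n.+1%:R / eps) ^+ n.+1)); last by lra.
by rewrite ler_wpM2r ?ler_norm// exprn_ge0// ltW.
Qed.
End poisson_weight.

(** * Optimising the number of prime factors *)

Section parameters.
Context {R : realType}.
Implicit Types (l C : R).

Definition cbrt2 : R := 2 `^ (1 / 3).

Lemma cbrt2_itv : 1 <= cbrt2 <= 3 / 2.
Proof.
have h : cbrt2 ^+ 3 = 2 by rewrite /cbrt2 -powR_mulrn ?powR_ge0// -powRrM divfK// powRr1.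
have c0 : 0 <= cbrt2 by exact: powR_ge0.
by apply/andP; split; rewrite -(@ler_pXn2r _ 3) ?nnegrE// h; lra.
Qed.

(** Origin of [2^(4/3)]: about [L = ln X] integers up to [y^24], each with at least [2^j]
    representations, give [L 2^j y^-18], and [y^24] is about [L ln y j! / s^j]. The result is
    [(L^(1/3) (2^(4/3) s)^j / (j! ln y))^(3/4)]. *)
Lemma two_cbrt2 : 2 * cbrt2 = expR (4 / 3 * ln 2).
Proof.
rewrite /cbrt2 /powR pnatr_eq0/= -[2 in LHS](@lnK R) ?posrE// -expRD.
by rewrite lnK ?posrE//; congr expR; field.
Qed.

(* [j] is the mode of the Poisson distribution of mean [2 cbrt2 s]. *)
Lemma mode_parameters_mean s : 1 <= s -> exists (j : nat) (al : R),
  [/\ j%:R <= 3 * s, s ^+ j / (j`!)%:R = expR al, - (5 * s) <= al <= s &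
      2 * cbrt2 * s - ln (3 * s) / 2 - 2 <= al + j%:R * (4 / 3 * ln 2)].
Proof.
move=> s1; have /andP[k1 k2] := cbrt2_itv; have s0 : 0 < s by lra.
have [mu muE] : exists mu, mu = 2 * cbrt2 * s by eexists.
have mu2 : 2 * s <= mu by rewrite muE ler_wpM2r//; lra.
have mu3 : mu <= 3 * s by rewrite muE ler_wpM2r//; lra.
have mu1 : 1 <= mu by lra.
have mu0 : 0 <= mu by lra.
have P := poisson_mode mu1.
have /andP[jm _] := truncn_itv mu0.
move: (Num.truncn mu) P jm => j P jm.
have f0 : 0 < (j`!)%:R :> R by rewrite ltr0n fact_gt0.
have a0 : 0 < s ^+ j / (j`!)%:R by rewrite divr_gt0 ?exprn_gt0.
have [al alE] : exists al, expR al = s ^+ j / (j`!)%:R.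
  by exists (ln (s ^+ j / (j`!)%:R)); rewrite lnK.
have js : j%:R <= 3 * s by exact: le_trans mu3.
have E : mu ^+ j / (j`!)%:R = expR (al + j%:R * (4 / 3 * ln 2)).
  by rewrite expRD expRM_natl -two_cbrt2 alE muE exprMn; ring.
rewrite E ler_expR in P.
have l2 : 0 <= ln (2 : R) <= 1.
  rewrite ln_ge0 ?ler1n//=; have := @le_ln1Dx R 1; rewrite (_ : 1 + 1 = 2)//; apply; lra.
have lm : ln mu <= ln (3 * s).
  by rewrite ler_ln ?posrE//; lra.
have lm' : ln mu <= mu.
  have := @le_ln1Dx R (mu - 1); rewrite [1 + _]addrC subrK => H.
  by apply: (le_trans (H _)); lra.
exists j, al; split => //; last by clear -P lm muE; lra.
apply/andP; split.
  have h1 : j%:R * (4 / 3 * ln 2) <= 3 * s * (4 / 3).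
    apply: ler_pM => //; clear -l2; [case/andP: l2|case/andP: l2] => *; lra.
  by clear -P h1 mu2 lm' s1; lra.
rewrite -ler_expR alE.
case: (j) => [|i]; first by rewrite expr0 divr1 -expR0 ler_expR; lra.
apply: le_trans (expR_ge1Dxn i (ltW s0)); by rewrite lerDr.
Qed.

Lemma mode_parameters C : 0 <= C -> exists W l0, forall l, l0 <= l ->
  exists (s : R) (j : nat) (al : R),
  [/\ 1 <= s, s = l / 2 - C, j%:R <= 3 * s, s ^+ j / (j`!)%:R = expR al &
      - (4 * l) <= al <= l /\ cbrt2 * l - ln l / 2 - W <= al + j%:R * (4 / 3 * ln 2)].
Proof.
move=> C0; exists (3 * C + 3), (2 * C + 2) => l ll; have /andP[k1 k2] := cbrt2_itv.
have [s sE] : exists s, s = l / 2 - C by eexists.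
have s1 : 1 <= s by lra.
have [j [al [js ea al12 H]]] := mode_parameters_mean s1.
exists s, j, al; split => //; split.
  by move/andP: al12 => [h1 h2]; apply/andP; split; clear -h1 h2 sE s1 ll C0; lra.
apply: le_trans H; have lm : ln (3 * s) <= 1 + ln l.
  have e2 := expR_ge1Dx (1 : R).
  have -> : 1 + ln l = ln (expR 1 * l) by rewrite lnM ?posrE ?expR_gt0 ?expRK//; lra.
  rewrite ler_ln ?posrE ?mulr_gt0 ?expR_gt0//; try lra.
  apply: (@le_trans _ _ (2 * l)); first by rewrite sE; lra.
  by rewrite ler_wpM2r//; lra.
have h : cbrt2 * l - 3 * C <= 2 * cbrt2 * s.
  have -> : 2 * cbrt2 * s = cbrt2 * l - 2 * cbrt2 * C by rewrite sE; field.
  by rewrite lerD2l lerN2 ler_wpM2r//; lra.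
by clear -h lm; lra.
Qed.

(** Here [l] stands for log_3 X, so [expR (expR l)] is [ln X], up to a constant the number of
    integers wanted. The last conclusion is the size of the resonating sum. *)
Lemma parameters (c C : R) (y0 : nat) : 0 < c -> 0 <= C -> exists W l0, forall l, l0 <= l ->
  exists (y j : nat) (s : R),
  [/\ [/\ (y0 <= y)%N, 0 < s, s <= ln (ln y%:R : R) / 2 - C & j%:R <= 3 * s],
      1 <= (y%:R : R) <= expR (expR l),
      expR (expR l) <= c * (y%:R ^+ 24 / ln y%:R) * (s ^+ j / (j`!)%:R) &
      expR (expR l / 4 + 3 / 4 * (cbrt2 - 1) * l - 3 / 8 * ln l - W) <=
        expR (expR l) * 2 ^+ j / y%:R ^+ 18].
Proof.
move=> c0 C0; have [W1 [l1 H]] := @mode_parameters (C + 12) ltac:(lra).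
have [b bE] : exists b, b = `|ln c| by eexists.
have b0 : 0 <= b by rewrite bE.
exists (3 / 4 * W1 + 3 / 4 * b + 18), (1 + `|l1| + b + 24 + 24 * y0%:R) => l ll.
have y00 : 0 <= y0%:R :> R by [].
have ll1 : l1 <= l by have := ler_norm l1; lra.
have l24 : 24 + 24 * y0%:R + b <= l by have := normr_ge0 l1; lra.
have {H} [s [j [al [s1 sE js ea [/andP[al1 al2] W1h]]]]] := H _ ll1.
have La : 1 + l <= expR l by exact: expR_ge1Dx.
(* Solves [c y^24 / ln y * expR al = expR (expR l)] for [e = ln y], with [ln (ln y)] replaced by its
   bound [l] and [- ln c] by [b]. *)
have [e eE] : exists e : R, e = (b + expR l + l - al) / 24 by eexists.
have e0 : expR l / 24 <= e by rewrite eE; lra.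
have e1 : e + 1 <= expR l by rewrite eE; lra.
have [g gE] : exists g : R, g = expR e by eexists.
have g1 : 1 <= g by rewrite gE -expR0 ler_expR; lra.
have g0 : 0 <= g by lra.
exists (Num.truncn g).+1, j, s.
have /andP[tg1 tg2] := truncn_itv g0.
have yg : g <= (Num.truncn g).+1%:R by exact: ltW.
have y2g : (Num.truncn g).+1%:R <= expR (e + 1).
  rewrite -natr1 expRD -gE; apply: (@le_trans _ _ (g * 2)); first by lra.
  by rewrite ler_wpM2l//; have := expR_ge1Dx (1 : R); lra.
move: yg y2g; move: (Num.truncn g).+1 => y yg y2g.
have yr0 : 0 < y%:R :> R by lra.
have ly1 : e <= ln (y%:R : R).
  by rewrite -[e]expRK ler_ln ?posrE ?expR_gt0// -gE.
have ly2 : ln (y%:R : R) <= expR l.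
  by apply: le_trans e1; rewrite -[e + 1]expRK ler_ln ?posrE ?expR_gt0//.
have ly0 : 0 < ln (y%:R : R) by lra.
split.
- split => //; try by lra.
    rewrite -(ler_nat R); apply: le_trans yg; rewrite gE; apply: le_trans (expR_ge1Dx _); lra.
  have : l - 24 <= ln (ln (y%:R : R)).
    have l24' := @lnn_le R 24.
    rewrite -[leLHS]expRK ler_ln ?posrE ?expR_gt0//; apply: le_trans ly1; apply: le_trans e0.
    rewrite expRD ler_wpM2l ?expR_ge0// expRN lef_pV2 ?posrE ?expR_gt0//.
    by have := expR_ge1Dx (24 : R); lra.
  by rewrite sE; lra.
- apply/andP; split; first by lra.
  by apply: (le_trans y2g); rewrite ler_expR (le_trans e1)// -[leLHS]addr0 (le_trans _ (expR_ge1Dx _))// addrC lerD2r.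
- rewrite ea.
  have h1 : expR (b + expR l + l - al) / expR l <= y%:R ^+ 24 / ln y%:R.
    apply: ler_pM; rewrite ?expR_ge0 ?invr_ge0 ?expR_ge0//; last by rewrite lef_pV2 ?posrE ?expR_gt0.
    have -> : b + expR l + l - al = e * 24%:R by rewrite eE divfK// pnatr_eq0.
    rewrite expRM_natr lerXn2r ?nnegrE ?expR_ge0 ?(ltW yr0)//.
    by rewrite -gE.
  have h2 : 1 <= c * expR b.
    have -> : 1 = c * c^-1 by rewrite divff// gt_eqF.
    rewrite ler_wpM2l ?(ltW c0)// -[c^-1]lnK ?posrE ?invr_gt0// ler_expR lnV ?posrE//.
    by have := ler_norm (- ln c); rewrite normrN bE.
  apply: (@le_trans _ _ (c * (expR (b + expR l + l - al) / expR l) * expR al)).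
    have -> : c * (expR (b + expR l + l - al) / expR l) * expR al = (c * expR b) * expR (expR l).
      rewrite -expRN -mulrA -!expRD -mulrA -expRD; congr (_ * expR _); ring.
    by rewrite ler_peMl ?expR_ge0.
  by rewrite ler_wpM2r ?expR_ge0// ler_wpM2l// ltW.
have -> : 2 ^+ j = expR (j%:R * ln 2) :> R by rewrite expRM_natl lnK ?posrE.
rewrite ler_pdivlMr ?exprn_gt0//.
apply: (@le_trans _ _ (expR (expR l / 4 + 3 / 4 * (cbrt2 - 1) * l - 3 / 8 * ln l -
  (3 / 4 * W1 + 3 / 4 * b + 18)) * expR ((e + 1) * 18%:R))).
  by rewrite ler_wpM2l ?expR_ge0// expRM_natr lerXn2r ?nnegrE ?expR_ge0// ltW.
rewrite -!expRD ler_expR eE; clear -W1h.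
by move: W1h; move: (expR l) (ln l) (ln 2) => La' lnl l2; nra.
Qed.
End parameters.

(** * Assembly of the lower bound *)

Section omega.
Context {R : realType}.

(** The logarithm of the claimed bound without its constant, in terms of [l] = log_3 X. *)
Definition log_target (l : R) := expR l / 4 + 3 / 4 * (cbrt2 - 1) * l - 3 / 8 * ln l.

(** [y <= ln X] gives [sqrt m <= (ln X)^12], hence the exponent 13 for a sum of at most [ln X]
    roots; and [m^(3/4) <= y^18] as 18 = 24 * 3/4. *)
Lemma many_representations : exists W l0 : R, forall l, l0 <= l ->
  exists M : seq nat, [/\ uniq M, all (fun m => 0 < m)%N M,
    (size M)%:R <= expR (expR l) / 20, \sum_(x <- freqs M) x <= expR (expR l) ^+ 13 &
    expR (log_target l - W) <=
      \sum_(m <- M) (r2 m)%:R / (Num.sqrt m%:R * Num.sqrt (Num.sqrt m%:R))].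
Proof.
have [c [C [y0 [c0 C0 H]]]] := @many_prime_factors R.
have [W [l1 HP]] := parameters y0 c0 C0.
exists (W + 40), (1 + `|l1| + 40) => l ll; have ll1 : l1 <= l by have := ler_norm l1; lra.
have l40 : 40 <= l by have := normr_ge0 l1; lra.
have {HP} [y [j [s [[yy s0 sl js] /andP[y1 yL] sz fin]]]] := HP _ ll1.
have [M0 [uM aM rM cM]] := H _ _ _ yy s0 sl js.
have L40 : 40 <= expR (expR l).
  by have := expR_ge1Dx (expR l); have := expR_ge1Dx l; lra.
move: yL sz fin L40; rewrite /log_target; set T := expR l / 4 + _ - _.
move: (expR (expR l)) => L yL sz fin L40.
have L20 : 0 <= L / 20 by lra.
(* Only [L / 20] of the integers are kept, so that [2^|M|] is at most [X^(1/20)], the square root of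
   [Y = X^(1/10)]. *)
have /andP[n1 n2] := truncn_itv L20; move: (Num.truncn (L / 20)) n1 n2 => n n1 n2.
have nM : (n <= size M0)%N by rewrite -(ler_nat R); apply: le_trans cM; apply: le_trans sz; lra.
have sM : size (take n M0) = n by rewrite size_takel.
have sub : {subset take n M0 <= M0} by move=> m; exact: mem_take.
have yr0 : 0 <= y%:R :> R by lra.
have M12 m : m \in take n M0 -> Num.sqrt m%:R <= y%:R ^+ 12 :> R.
  move=> /sub/(allP aM)/andP[m0 my]; rewrite -(@ler_pXn2r _ 2) ?nnegrE ?sqrtr_ge0 ?exprn_ge0//.
  by rewrite sqr_sqrtr// -exprM -natrX ler_nat.
exists (take n M0); split.
- exact: take_uniq.
- by apply/allP => m /sub/(allP aM)/andP[].
- by rewrite sM.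
- rewrite /freqs big_map; apply: (@le_trans _ _ (\sum_(m <- take n M0) L ^+ 12)).
    rewrite big_seq [leRHS]big_seq; apply: ler_sum => m mM; apply: (le_trans (M12 _ mM)).
    by rewrite lerXn2r ?nnegrE//; lra.
  rewrite big_const_seq count_predT sM iter_addr addr0 -[leLHS]mulr_natl (exprS L 12).
  by rewrite ler_wpM2r ?exprn_ge0//; lra.
apply: (@le_trans _ _ (\sum_(m <- take n M0) 2 ^+ j / y%:R ^+ 18)).
  rewrite big_const_seq count_predT sM iter_addr addr0 -[leRHS]mulr_natl.
  have p0 : 0 <= 2 ^+ j / y%:R ^+ 18 :> R by rewrite divr_ge0 ?exprn_ge0.
  have e : n.+1%:R = n%:R + 1 :> R by rewrite -natr1.
  have nL : L / 40 <= n%:R by clear -n2 e L40; lra.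
  apply: le_trans (ler_wpM2r p0 nL).
  have -> : L / 40 * (2 ^+ j / y%:R ^+ 18) = L * 2 ^+ j / y%:R ^+ 18 / 40 by ring.
  rewrite opprD addrA expRD; apply: ler_pM; rewrite ?expR_ge0// expRN lef_pV2 ?posrE ?expR_gt0//.
  by have := expR_ge1Dx (40 : R); lra.
rewrite big_seq [leRHS]big_seq; apply: ler_sum => m mM.
have m0 : 0 < m%:R :> R by rewrite ltr0n; have /andP[] := allP aM _ (sub _ mM).
have q0 : 0 < Num.sqrt (m%:R : R) by rewrite sqrtr_gt0.
apply: ler_pM; rewrite ?exprn_ge0 ?invr_ge0 ?exprn_ge0//.
  by rewrite -natrX ler_nat (allP rM)// sub.
have y0' : 0 < y%:R :> R by lra.
rewrite lef_pV2 ?posrE ?mulr_gt0 ?exprn_gt0 ?sqrtr_gt0//.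
rewrite (_ : 18 = 12 + 6)%N// exprD; apply: ler_pM; rewrite ?sqrtr_ge0 ?M12//.
rewrite -(@ler_pXn2r _ 2) ?nnegrE ?sqrtr_ge0 ?exprn_ge0//.
by rewrite sqr_sqrtr ?sqrtr_ge0// -exprM M12.
Qed.

Lemma log_target_ge l : 4 <= l -> l / 8 <= log_target l.
Proof.
move=> l4; rewrite /log_target; have /andP[k1 k2] := @cbrt2_itv R.
have h := @expR_ge1Dxn R l 1 ltac:(lra).
have h2 : 2 * l <= expR l by apply: le_trans h; rewrite (_ : 2`! = 2)%N//; nra.
have h3 : ln l <= l by have := @le_ln1Dx R (l - 1); rewrite [1 + _]addrC subrK => H; apply: (le_trans (H _)); lra.
have h4 : 0 <= 3 / 4 * (cbrt2 - 1) * l by rewrite mulr_ge0// ?mulr_ge0//; lra.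
by clear -h2 h3 h4 l4; lra.
Qed.

(** The hypotheses of [resonance_inequality] for [Y = X^(1/10)], with [L = ln X]. Half of the
    exponent of [Y] pays for [2^n], the other half for the powers of [L]. *)
Lemma resonator_conditions : exists L0 : R, forall L, L0 <= L -> forall (n : nat) (D : R),
  n%:R <= L / 20 -> 0 <= D <= L ^+ 13 ->
  1000 * (1000 * (1000 * (2 ^+ n * (1 + D ^+ 2) ^+ 2))) <= expR (L / 10) /\
  expR (L / 10) ^+ 60 <= expR ((expR (L / 10) ^+ 2 - 1) / 2).
Proof.
have [L1 H1] := @expR_dominates R (1000 * (1000 * (1000 * 4))) 20^-1 52 ltac:(by rewrite invr_gt0).
have [L2 H2] := @expR_dominates R 13 5^-1 1 ltac:(by rewrite invr_gt0).
exists (1 + `|L1| + `|L2|) => L LL n D nL /andP[D0 DL].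
have n1 := normr_ge0 L1; have n2 := normr_ge0 L2.
have h1 : L1 <= L by have := ler_norm L1; lra.
have h2 : L2 <= L by have := ler_norm L2; lra.
have L1' : 1 <= L by lra.
have {}H1 := H1 _ h1; have {}H2 := H2 _ h2; split; last first.
  rewrite -!expRM_natr ler_expR.
  have -> : L / 10 * 60 = 6 * L by field.
  have -> : L / 10 * 2 = 5^-1 * L by field.
  by move: H2; rewrite expr1; lra.
have e2 : 2 ^+ n <= expR (20^-1 * L).
  apply: (@le_trans _ _ (expR n%:R)).
    rewrite -[n%:R]mul1r expRM_natr lerXn2r ?nnegrE ?expR_ge0//.
    by have := expR_ge1Dx (1 : R); lra.
  by rewrite ler_expR mulrC.
have hD : (1 + D ^+ 2) ^+ 2 <= 4 * L ^+ 52.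
  have -> : 4 * L ^+ 52 = (2 * (L ^+ 13) ^+ 2) ^+ 2 by rewrite exprMn -!exprM; congr (_ * _); ring.
  have L13 : 1 <= L ^+ 13 by rewrite exprn_ege1.
  have L26 : 1 <= (L ^+ 13) ^+ 2 by rewrite exprn_ege1.
  have d1 : D ^+ 2 <= (L ^+ 13) ^+ 2 by rewrite lerXn2r ?nnegrE//; lra.
  have d0 : 0 <= D ^+ 2 by rewrite sqr_ge0.
  by rewrite lerXn2r ?nnegrE//; clear -L26 d1 d0; lra.
have -> : expR (L / 10) = expR (20^-1 * L) * expR (20^-1 * L) :> R by rewrite -expRD; congr expR; field.
apply: le_trans (ler_wpM2l (expR_ge0 _) H1).
have -> : expR (20^-1 * L) * (1000 * (1000 * (1000 * 4)) * L ^+ 52) =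
  1000 * (1000 * (1000 * (expR (20^-1 * L) * (4 * L ^+ 52)))) by ring.
do 3 (apply: (ler_wpM2l (ler0n R 1000))).
by apply: ler_pM => //; first [exact: exprn_ge0|exact: sqr_ge0].
Qed.
End omega.

Theorem theorem2 (R : realType) :
  exists c X0 : R, 0 < c /\
    forall X : R, X0 <= X ->
      ((c * ln X `^ (1 / 4) * ln (ln X) `^ (3 / 4 * (2 `^ (1 / 3) - 1))
          * ln (ln (ln X)) `^ (- (3 / 8)))%:E
       <= ereal_sup [set (`|circle_error (x ^+ 2) / Num.sqrt x|%R)%:E
            | x in [set x : R | (X / 2 < x <= 5 * X `^ (3 / 2) * ln X ^+ 2)%R]])%E.
Proof.
have [W [l1 HM]] := @many_representations R; have [L1 HL] := @resonator_conditions R.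
have r0 := @radial_const_gt0 R; move: (@radial_const R) r0 (@resonance_inequality R) => r r0 RI.
have eW : 0 < expR (- W) by exact: expR_gt0.
have K0 : 0 < 1281 :> R by rewrite (ltr0n R 1281).
have [K KE] : exists K : R, K = 1281 by eexists.
rewrite -KE in RI K0.
have c0 : 0 < r * expR (- W) / (4 * K) by rewrite divr_gt0 ?mulr_gt0.
exists (r * expR (- W) / (4 * K)).
(* The last condition makes the additive 1 of the resonance inequality smaller than half of its main
   term, since [log_target l >= l / 8]. *)
have [l0 [l01 l04 l0L l0b]] : exists l0 : R, [/\ l1 <= l0, 4 <= l0, L1 <= l0 & 8 * (4 / (r * expR (- W))) <= l0].
  exists (`|l1| + 4 + `|L1| + 8 * (4 / (r * expR (- W)))).
  have h : 0 <= 8 * (4 / (r * expR (- W))) by rewrite mulr_ge0// divr_ge0// ltW// mulr_gt0.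
  by move: h; have := ler_norm l1; have := ler_norm L1; have := normr_ge0 l1; have := normr_ge0 L1; clear; split; lra.
exists (expR (expR (expR l0))); split => // X XX.
have X0 : 0 < X by apply: lt_le_trans XX; exact: expR_gt0.
have LL : expR (expR l0) <= ln X by rewrite -[leLHS]expRK ler_ln ?posrE ?expR_gt0.
have L0 : 0 < ln X by apply: lt_le_trans LL; exact: expR_gt0.
have LaL : expR l0 <= ln (ln X) by rewrite -[leLHS]expRK ler_ln ?posrE ?expR_gt0.
have La0 : 0 < ln (ln X) by apply: lt_le_trans LaL; exact: expR_gt0.
have ll : l0 <= ln (ln (ln X)) by rewrite -[leLHS]expRK ler_ln ?posrE ?expR_gt0.
have eL : expR (expR (ln (ln (ln X)))) = ln X by rewrite !lnK ?posrE.
have eX : expR (ln X) = X by rewrite lnK ?posrE.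
set l := ln (ln (ln X)) in ll eL *.
have lpos : 0 < l by clear -l04 ll; lra.
have -> : r * expR (- W) / (4 * K) * ln X `^ (1 / 4) * ln (ln X) `^ (3 / 4 * (2 `^ (1 / 3) - 1)) * l `^ (- (3 / 8)) =
   r * expR (- W) / (4 * K) * expR (log_target l).
  have powE a b : 0 < a -> a `^ b = expR (b * ln a) :> R by move=> a0; rewrite /powR gt_eqF.
  rewrite -/cbrt2 !powE// -!mulrA -!expRD -/l; do 3 congr (_ * _).
  by congr expR; rewrite /log_target lnK ?posrE//; ring.
have [M [uM aM sM fM big]] := HM _ (le_trans l01 ll).
rewrite eL in sM fM.
have lL : l <= ln X.
  by have := expR_ge1Dx (expR l); have := expR_ge1Dx l; rewrite eL; clear; lra.
have f0 : 0 <= \sum_(x <- freqs M) x :> R.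
  by rewrite /freqs big_map; apply: sumr_ge0 => m _; exact: sqrtr_ge0.
have LX : L1 <= ln X by exact: le_trans l0L (le_trans ll lL).
have f1 : 0 <= (\sum_(x <- freqs M) x : R) <= ln X ^+ 13 by rewrite f0 fM.
have [C1 C2] := HL (ln X) LX (size M) _ sM f1.
have T1 : 1 < r / 4 * (expR (- W) * expR (log_target l)).
  have : 4 / (r * expR (- W)) < expR (log_target l).
    apply: lt_le_trans (expR_ge1Dx _); have := log_target_ge (le_trans l04 ll); clear -l0b ll; lra.
  rewrite ltr_pdivrMr ?mulr_gt0//; set u := expR (log_target l); set w := expR (- W).
  move=> h; have -> : r / 4 * (w * u) = (u * (r * w)) / 4 :> R by ring.
  by rewrite ltr_pdivlMr// mul1r.
(* Otherwise [S sqrt x] bounds the circle error on the whole range and the main term is at most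
   [K S + 1]; but [1 < K S], and [2 K S] is a lower bound for the main term. *)
rewrite leNgt; apply/negP => sup.
set S := r * expR (- W) / (4 * K) * expR (log_target l) in sup.
have S0 : 0 <= S by rewrite /S mulr_ge0 ?expR_ge0 ?(ltW c0).
have := RI M (expR (ln X / 10)) S uM aM S0 C1 C2.
have e10 : expR (ln X / 10) ^+ 10 = X by rewrite -expRM_natr divfK ?pnatr_eq0.
have e15 : expR (ln X / 10) ^+ 15 = X `^ (3 / 2).
  by rewrite /powR gt_eqF// -expRM_natr; congr expR; field.
have L4 : 4 <= ln X by apply: le_trans lL; apply: le_trans ll.
rewrite e10 e15 => RIX; suff HX : forall x : R, X / 2 < x <= X `^ (3 / 2) ->
    `|circle_error (x ^+ 2)| <= S * Num.sqrt x.
  have := RIX HX; apply/negP; rewrite -ltNge.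
  apply: (@lt_le_trans _ _ (r / 2 * (expR (- W) * expR (log_target l)))); last first.
    by rewrite ler_wpM2l ?divr_ge0 ?(ltW r0)// -expRD addrC.
  have -> : K * S = r / 4 * (expR (- W) * expR (log_target l)).
    by rewrite /S; field; rewrite gt_eqF.
  have -> : r / 2 * (expR (- W) * expR (log_target l)) = r / 4 * (expR (- W) * expR (log_target l)) +
     r / 4 * (expR (- W) * expR (log_target l)) by field.
  by rewrite ltrD2l.
move=> x /andP[x1 x2]; have x0 : 0 < x by apply: lt_trans x1; rewrite divr_gt0.
have q0 : 0 < Num.sqrt x by rewrite sqrtr_gt0.
rewrite -ler_pdivrMr// -lee_fin ltW//; apply: le_lt_trans sup; apply: ereal_sup_ubound.
exists x => /=; last by rewrite normrM normfV (ger0_norm (ltW q0)).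
(* The range up to [X^(3/2)] is contained in that of the theorem, because [ln X >= 1]. *)
rewrite x1/= (le_trans x2)// mulrAC ler_peMl ?powR_ge0//.
have : 1 <= ln X ^+ 2 by rewrite exprn_ege1//; clear -L4; lra.
by clear; lra.
Qed.
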